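(* Let $j:\mathfrak{B}^1(H)\to\mathfrak{B}^1(G)$ be a map constructed as described in the context (an injective, affine, $H$-equivariant CLF-map whose image is the set of self-dual $o_E$-$o_D$-lattice functions in $V$). Let $\phi:\mathfrak{B}^1(H)\to\mathfrak{B}^1(G)$ be an affine CLF-map which is equivariant under the centre of the group $\prod_{i\in I_0\cup I_+}\mathbf{H}_i^0((E_i)_0)$. Then $j^{-1}\circ\phi$ (is defined and) is a translation of $\mathfrak{B}^1(H)$. In terms of lattice functions, the image of $\phi$ is the set of self-dual $o_E$-$o_D$-lattice functions in $V$, and $\phi$ is $\prod_{i\in I_0\cup I_+}\mathbf{H}_i^0((E_i)_0)$-equivariant.
   Context: **Basic setting.** $k$ is a non-Archimedean local field of odd residue characteristic; $D$ is a division algebra with centre $k$ and finite index $d$; $\nu$ is the valuation on $k$ with $\nu(k^\times)=\mathbb{Z}$, extended uniquely to $D$ and to every finite-dimensional division algebra over $k$; $\rho$ is an involution on $D$ (a ring isomorphism $D\to D^{op}$ of order one or two); $k_0$ is the fixed field of $\rho$ in $k$; $\bar k$ is an algebraic closure of $k$. For a division algebra $D'$ with discrete valuation, $o_{D'}$ and $\mathfrak{p}_{D'}$ are its valuation ring and maximal ideal. $V$ is an $m$-dimensional right $D$-vector space, $\epsilon\in\{1,-1\}$, $h:V\times V\to D$ is a non-degenerate $\epsilon$-hermitian form (biadditive, $h(v_1\lambda_1,v_2\lambda_2)=\epsilon\rho(\lambda_1)\rho(h(v_2,v_1))\lambda_2$), and $\sigma$ is its adjoint involution on $\mathrm{End}_D(V)$.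 $\mathbf{G}=\mathbf{U}(h)=\mathbf{U}(\sigma)$ is the unitary group over $k_0$, $G=\mathbf{G}(k_0)=\{g\in \mathrm{End}_D(V): \sigma(g)g=1\}$, $\mathfrak{g}=\mathrm{Lie}(\mathbf{G})(k_0)=\{a\in\mathrm{End}_D(V):\sigma(a)=-a\}$. A superscript $0$ denotes the identity component. **Lattice functions.** An $o_D$-lattice function in $V$ is a family $(\Lambda(r))_{r\in\mathbb{R}}$ of (full) $o_D$-lattices in $V$ with $\Lambda(r)\supseteq\Lambda(s)$ for $r<s$, $\Lambda(r)=\bigcap_{t<r}\Lambda(t)$, $\Lambda(r)\mathfrak{p}_D=\Lambda(r+\frac1d)$. $\mathrm{Latt}^1_{o_D}(V)$ is the set of these. $\Lambda$ corresponds to the norm $\alpha_\Lambda(v)=\sup\{t: v\in\Lambda(t)\}$. $\Lambda$ is split by a direct sum decomposition of $V$ into $D$-subspaces $W$ if each $\Lambda(t)$ is the direct sum of the $\Lambda(t)\cap W$. Any two lattice functions are split by a common decomposition into lines $v_iD$; the convex combination $\lambda\Lambda+(1-\lambda)\Lambda'$ ($\lambda\in[0,1]$) is the lattice function split by this decomposition whose norm takes the value $\lambda\alpha_\Lambda(v_i)+(1-\lambda)\alpha_{\Lambda'}(v_i)$ at $v_i$ (independent of choices); this is the affine structure. For $s\in\mathbb{R}$, $(\Lambda+s)(t)=\Lambda(t-s)$. The dual of $\Lambda$ is $\Lambda^{\#}(t)=\{v\in V: h(v,\Lambda(s))\subseteq\mathfrak{p}_D\text{ for all }s>-t\}$; $\mathrm{Latt}^1_h(V)$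 is the set of self-dual ones. $G$ acts by $(g.\Lambda)(t)=g(\Lambda(t))$. The extended Bruhat–Tits building $\mathfrak{B}^1(G)=\mathfrak{B}^1(\mathbf{G},k_0)$ is identified, by the unique affine $G$-equivariant bijection, with $\mathrm{Latt}^1_h(V)$. The square lattice function of $\Lambda$ is $\tilde{\mathfrak{g}}_\Lambda(t)=\{a\in\mathrm{End}_D(V): a\Lambda(s)\subseteq\Lambda(s+t)\ \forall s\in\mathbb{R}\}$; the Lie algebra filtration of $\Lambda\in\mathfrak{B}^1(G)$ is $\mathfrak{g}_\Lambda(t)=\tilde{\mathfrak{g}}_\Lambda(t)\cap\mathfrak{g}$. **Centralizer.** $\beta\in\mathfrak{g}$ is such that $E:=k[\beta]\subseteq\mathrm{End}_D(V)$ is a product of fields $E_i$ ($i\in I$) with identity elements $1_i$; $V_i=1_iV$. $\sigma$ acts on $I$ by $\sigma(1_i)=1_{\sigma(i)}$; write $-i=\sigma(i)$; $I_0$ is the fixed point set, and $I\setminus I_0=I_+\sqcup I_-$ with $\sigma(I_+)=I_-$. For $i\in I_0$, $(E_i)_0$ is the set of $\sigma$-fixed points in $E_i$; for $i\in I_+$, $(E_i)_0=E_i$. $H$ is the centralizer of $\beta$ in $G$. For each $i$, fix an $E_i$-algebra isomorphism of $\mathrm{End}_{E_i\otimes_kD}(V_i)$ (the centralizer of $E_i$ in $\mathrm{End}_D(V_i)$) with $\mathrm{End}_{D'_i}(V'_i)$, where $D'_i$ is a division algebra of finite index central over $E_i$ and $V_i'$ a finite-dimensional right $D_i'$-vector space.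 Put $\mathbf{H}_i=\mathbf{U}(\sigma|_{\mathrm{End}_{D'_i}(V'_i)})$ for $i\in I_0$, $\mathbf{H}_i=\mathbf{GL}_{D'_i}(V'_i)$ for $i\in I_+$, $H_i=\mathbf{H}_i((E_i)_0)$. Canonically $H\cong\prod_{i\in I_0\cup I_+}H_i$ (through which subgroups of $\prod_i H_i$ act on $\mathfrak{B}^1(G)$), and $\mathfrak{B}^1(H):=\prod_{i\in I_0\cup I_+}\mathfrak{B}^1(\mathbf{H}_i,(E_i)_0)$. Here $\mathfrak{B}^1(\mathbf{H}_i,(E_i)_0)$ is identified (affinely and $H_i$-equivariantly) with $\mathrm{Latt}^1_{o_{D'_i}}(V'_i)$ for $i\in I_+$ and with the self-dual elements $\mathrm{Latt}^1_{h_i}(V'_i)$ for $i\in I_0$, where $h_i$ is a fixed signed hermitian form on $V'_i$ with adjoint involution $\sigma|_{\mathrm{End}_{D'_i}(V'_i)}$; lattice functions over $D'_i$ are normalized via the extension of $\nu$, i.e. $\Lambda(r)\pi=\Lambda(r+\nu(\pi))$ for a uniformizer $\pi$ of $D'_i$. The Lie algebra of $H$ is $\mathfrak{h}=\bigoplus_{i\in I_0\cup I_+}\mathfrak{h}_i$, with $\mathfrak{h}_i=\{a\in\mathrm{End}_{E_i\otimes_kD}(V_i):\sigma(a)=-a\}$ for $i\in I_0$ and $\mathfrak{h}_i=\mathrm{End}_{E_i\otimes_kD}(V_i)$ for $i\in I_+$; it embeds in $\mathfrak{g}$ by $(a_i)\mapsto\sum_{i\in I_0}a_i+\sum_{i\in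 I_+}(a_i-\sigma(a_i))$. For $x=(x_i)\in\mathfrak{B}^1(H)$, $\mathfrak{h}_x(t)=\bigoplus_i\mathfrak{h}_{x_i}(t)$, where $\mathfrak{h}_{x_i}$ is the square lattice function of $x_i$ for $i\in I_+$ and its intersection with $\mathfrak{h}_i$ for $i\in I_0$. **CLF.** A map $f:\mathfrak{B}^1(H)\to\mathfrak{B}^1(G)$ is a CLF-map if $\mathfrak{h}_x(t)=\mathfrak{h}\cap\mathfrak{g}_{f(x)}(t)$ (inside $\mathfrak{g}$) for all $x\in\mathfrak{B}^1(H)$, $t\in\mathbb{R}$. **$o_E$-$o_D$-lattice functions.** An $o_E$-$o_D$-lattice function in $V$ is an $o_D$-lattice function $\Lambda$ in $V$ split by $(V_i)_{i\in I}$ such that for every $i$ the function $t\mapsto\Lambda(t)\cap V_i$ is an $o_{E_i}$-lattice function in $V_i$ (with normalization by $\nu$: $\mathfrak{p}_{E_i}$ shifts by $1/e(E_i|k)$). **Construction of $j$.** By results of Broussous–Lemaire, for each $i$ there is an affine, $\mathrm{Aut}_{D'_i}(V'_i)$-equivariant bijection $\tilde j^{E_i}$ from $\mathrm{Latt}^1_{o_{D'_i}}(V'_i)$ onto the set of $o_D$-lattice functions in $V_i$ that are also $o_{E_i}$-lattice functions, such that the square lattice function of $\tilde j^{E_i}(\Lambda)$ intersected with $\mathrm{End}_{E_i\otimes_k D}(V_i)$ is the square lattice function of $\Lambda$; it is unique up to a translation $\Lambda\mapsto\Lambda+s$. Fix such maps. For $i\in I_0$ and $\Lambda\in\mathrm{Latt}^1_{h_i}(V'_i)$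 let $j_i(\Lambda)$ be the unique self-dual (with respect to $h|_{V_i\times V_i}$) lattice function of the form $\tilde j^{E_i}(\Lambda)+s$, $s\in\mathbb{R}$. For $i\in I_+$ let $j_i(\Lambda)=\Lambda_1\oplus\Lambda_1^{\#_{-i}}$ with $\Lambda_1=\tilde j^{E_i}(\Lambda)$ and $\Lambda_1^{\#_{-i}}(t)=\{v\in V_{-i}: h(v,\Lambda_1(s))\subseteq\mathfrak{p}_D\ \forall s>-t\}$. Then $j((x_i)_i)=\bigoplus_{i\in I_0\cup I_+}j_i(x_i)$. **Translations.** $\mathbf{O}_2^{is}$ is the algebraic group $\left\{\begin{pmatrix}\lambda&0\\0&\lambda^{-1}\end{pmatrix},\begin{pmatrix}0&\lambda\\\lambda^{-1}&0\end{pmatrix}:\lambda\in\bar k^\times\right\}$. A translation of a set $\mathrm{Latt}^1_{o_{D'}}(V')$ is a map $\Lambda\mapsto\Lambda+s$ with $s\in\mathbb{R}$. A translation of the building $\mathrm{Latt}^1_{h'}(V')$ of a unitary group is the identity if the group is not isomorphic (over its field of definition) to $\mathbf{O}_2^{is}$; if it is isomorphic to $\mathbf{O}_2^{is}$, then $V'$ is the direct sum of its two isotropic lines $L_1,L_2$, every self-dual lattice function is split by $(L_1,L_2)$ and is determined by its restriction to $L_1$ (so the building is identified with $\mathrm{Latt}^1$ of a line, an affine real line), and a translation is a map changing the restriction to $L_1$ by $+s$ (and that to $L_2$ by $-s$) for a fixed $s\in\mathbb{R}$. A translation of $\mathfrak{B}^1(H)$ is a product of translations of the factors $\mathfrak{B}^1(\mathbf{H}_i,(E_i)_0)$.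 *)

(* Defs.v *)
From HB Require Import structures.
From mathcomp Require Import all_boot all_order all_algebra all_field.
From mathcomp Require Import all_classical all_reals ereal.
From mathcomp Require mpoly.

Set Implicit Arguments.
Unset Strict Implicit.
Unset Printing Implicit Defensive.

Import Order.TTheory GRing.Theory Num.Theory.

Local Open Scope classical_set_scope.
Local Open Scope ring_scope.

(* A right module over a ring A is an lmodType over the converse ring A^c, so  *)
(* that ract a v is the vector v.a and End_A(V) is [set f | linear f].         *)
Definition ract (A : nzRingType) (V : lmodType A^c) (a : A) (v : V) : V :=
  (a : A^c) *: v.

Definition End (A : nzRingType) (V : lmodType A^c) : set (V -> V) :=
  [set f | linear f].

Section Valuations.
Variable R : realType.
Local Open Scope ereal_scope.

Record valuation (A : nzRingType) (w : A -> \bar R) : Prop := {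
  valuation_eqy : forall x, w x = +oo <-> x = 0%R;
  valuation_neqNy : forall x, w x != -oo;
  valuationM : forall x y, w (x * y)%R = w x + w y;
  valuationD : forall x y, Order.min (w x) (w y) <= w (x + y)%R }.

Definition valring (A : Type) (w : A -> \bar R) : set A := [set a | 0 <= w a].
Definition maxideal (A : Type) (w : A -> \bar R) : set A := [set a | 0 < w a].
Definition uniformizer (A : Type) (w : A -> \bar R) : set A :=
  [set a | [/\ 0 < w a, w a < +oo & forall b, 0 < w b -> w a <= w b]].

Record local_field (k : fieldType) (nu : k -> \bar R) : Prop := {
  local_field_valuation : valuation nu;
  local_field_normalized :
    nu @` [set x | x != 0%R] = [set (n%:~R)%:E | n in [set: int]];
  local_field_complete : forall u : nat -> k,
    (forall M : R, exists N, forall m n, (N <= m)%N -> (N <= n)%N ->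
      M%:E <= nu (u m - u n)%R) ->
    exists l, forall M : R, exists N, forall n, (N <= n)%N ->
      M%:E <= nu (u n - l)%R;
  local_field_finite_residue : exists s : seq k, forall x, valring nu x ->
    exists2 y, y \in s & maxideal nu (x - y)%R }.

Definition odd_residue_char (k : fieldType) (nu : k -> \bar R) : Prop :=
  exists p : nat, [/\ prime p, odd p & maxideal nu p%:R%R].

Record central_division_algebra (k : fieldType) (A : falgType k) : Prop := {
  cda_division : forall x : A, x != 0%R -> x \is a GRing.unit;
  cda_central : forall x : A,
    (forall y, (x * y = y * x)%R) <-> exists c : k, x = c%:A%R }.

Definition extends_valuation (k : fieldType) (A : falgType k)
    (nu : k -> \bar R) (w : A -> \bar R) : Prop :=
  valuation w /\ forall c : k, w c%:A%R = nu c.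

End Valuations.

Section LatticeFunctions.
(* Lattices in an additive subgroup W of V on which a valued division ring A   *)
(* acts by act: right D-spaces via ract, but also E_i-spaces inside V.         *)
Variables (R : realType) (A : Type) (w : A -> \bar R).
Variables (V : zmodType) (act : A -> V -> V) (W : set V).
Implicit Types (L : R -> set V).

Definition act_basis n (b : 'I_n -> V) : Prop :=
  (forall l, W (b l)) /\
  forall v, W v -> exists! a : 'I_n -> A, v = \sum_l act (a l) (b l).

Definition lattice (M : set V) : Prop := exists n (g : 'I_n -> V),
  W = [set \sum_l act (a l) (g l) | a in [set: 'I_n -> A]] /\
  M = [set \sum_l act (a l) (g l) | a in
        [set a : 'I_n -> A | forall l, valring w (a l)]].

(* If pi is a uniformizer and M is a lattice, then M pi is the product of M    *)
(* with the maximal ideal.                                                     *)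
Definition lattice_function (step : A -> R) L : Prop :=
  [/\ forall r, lattice (L r),
      forall r s, r < s -> L s `<=` L r,
      forall r, L r = \bigcap_(t in [set t | t < r]) L t
    & forall pi, uniformizer w pi -> forall r,
        act pi @` L r = L (r + step pi)].

Definition lf_translate L (s : R) : R -> set V := fun t => L (t - s).

Definition lf_norm L (v : V) : \bar R := ereal_sup [set t%:E | t in [set t | L t v]].

Definition split_by (I : finType) (U : I -> set V) L : Prop :=
  forall t, L t = [set \sum_i v i | v in
                    [set v : I -> V | forall i, U i (v i) /\ L t (v i)]].

(* L3 is the convex combination c L1 + (1 - c) L2. *)
Definition convex_comb (c : R) L1 L2 L3 : Prop :=
  exists n (b : 'I_n -> V),
    let line l := range (act^~ (b l)) in
    [/\ act_basis b, split_by line L1, split_by line L2, split_by line L3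
      & forall l, lf_norm L3 (b l) =
          (c%:E * lf_norm L1 (b l) + (1 - c)%:E * lf_norm L2 (b l))%E].

End LatticeFunctions.

(* The normalization Lambda(r) pi = Lambda(r + nu(pi)). *)
Definition nu_step (R : realType) (A : Type) (w : A -> \bar R) : A -> R :=
  fun pi => fine (w pi).

(* The normalization Lambda(r) p_D = Lambda(r + 1/d). *)
Definition index_step (R : realType) (A : Type) (d : nat) : A -> R :=
  fun _ => d%:R^-1.

Definition lf_act (R : realType) (V : Type) (g : V -> V) (L : R -> set V) :
  R -> set V := fun t => g @` L t.

Definition in_square (R : realType) (V : Type) (L : R -> set V) (t : R) :
  set (V -> V) := [set a | forall s, a @` L s `<=` L (s + t)].

Section Hermitian.
Variables (A : nzRingType) (V : lmodType A^c).

Record involution (rho : A -> A) : Prop := {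
  involutionD : {morph rho : x y / x + y};
  involutionM : forall x y, rho (x * y) = rho y * rho x;
  involution1 : rho 1 = 1;
  involutionK : involutive rho }.

Record hermitian_form (rho : A -> A) (eps : A) (h : V -> V -> A) : Prop := {
  hermitian_involution : involution rho;
  hermitian_sign : eps = 1 \/ eps = -1;
  hermitianDl : forall v1 v2 v, h (v1 + v2) v = h v1 v + h v2 v;
  hermitianDr : forall v v1 v2, h v (v1 + v2) = h v v1 + h v v2;
  hermitianZ : forall v1 v2 a1 a2,
    h (ract a1 v1) (ract a2 v2) = eps * rho a1 * rho (h v2 v1) * a2;
  hermitian_nondegenerate : forall v, (forall u, h v u = 0) -> v = 0 }.

Variable h : V -> V -> A.

Definition adjoint (f : V -> V) : V -> V :=
  xget f [set g | End g /\ forall u v, h (f u) v = h u (g v)].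

Definition unitary_group : set (V -> V) :=
  [set g | End g /\ adjoint g \o g = id].

Definition unitary_lie : set (V -> V) :=
  [set a | End a /\ forall v, adjoint a v = - a v].

Definition general_linear : set (V -> V) := [set g | End g /\ bijective g].

Variables (R : realType) (w : A -> \bar R) (step : A -> R).

Definition Latt (L : R -> set V) : Prop :=
  lattice_function w (@ract A V) setT step L.

(* For W = V_i this is the dual with respect to the restriction of h to V_i    *)
(* and, when L lives in V_i and W = V_{-i}, it is the dual in V_{-i}.          *)
Definition lf_dual (W : set V) (L : R -> set V) : R -> set V := fun t =>
  [set v | W v /\ forall s, - t < s -> forall u, L s u -> maxideal w (h v u)].

Definition Latt_h (L : R -> set V) : Prop := Latt L /\ lf_dual setT L = L.

End Hermitian.

Section Zariski.
Variable K : fieldType.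

Definition zariski_closed n (Z : set ('I_n -> K)) : Prop :=
  exists P : set (mpoly.mpoly n K),
    Z = [set x | forall p, P p -> mpoly.meval x p = 0].

Definition zariski_connected n (S : set ('I_n -> K)) : Prop :=
  forall Z1 Z2, zariski_closed Z1 -> zariski_closed Z2 ->
    S `<=` Z1 `|` Z2 -> S `&` (Z1 `&` Z2) = set0 ->
    S `<=` Z1 \/ S `<=` Z2.

Definition zariski_component n (G : set ('I_n -> K)) (e : 'I_n -> K) :
    set ('I_n -> K) :=
  [set x | exists S, [/\ S `<=` G, zariski_connected S, S e & S x]].

Definition O2is : set 'M[K]_2 := [set M | exists2 c : K, c != 0 &
  M = \matrix_(i, j) (if i == j then (if i == 0 then c else c^-1) else 0) \/
  M = \matrix_(i, j) (if i == j then 0 else (if i == 0 then c else c^-1))].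

End Zariski.

Section AlgebraicGroups.
(* End_D(V), for D central over E, is an algebra over the subfield F of E; K   *)
(* is an algebraic closure of E via tau.  After a choice of an F-basis b of    *)
(* End_D(V), the K-points of an algebraic group over F inside End_D(V) are the *)
(* points of a subset of K^n, and this does not depend on b up to a linear     *)
(* change of coordinates over F.                                               *)
Variables (E : fieldType) (F : set E) (D : falgType E) (V : lmodType D^c).
Variables (K : fieldType) (tau : E -> K) (h : V -> V -> D).

Definition Fcomb n (c : 'I_n -> E) (b : 'I_n -> V -> V) : V -> V :=
  fun v => \sum_l ract (c l)%:A (b l v).

Definition Fbasis n (b : 'I_n -> V -> V) : Prop :=
  (forall l, End (b l)) /\
  forall a, End a -> exists! c : 'I_n -> E, (forall l, F (c l)) /\ a = Fcomb c b.

Definition Fcoord n (b : 'I_n -> V -> V) (a : V -> V) : 'I_n -> E :=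
  xget (fun=> 0) [set c | (forall l, F (c l)) /\ a = Fcomb c b].

Section Points.
Variables (n : nat) (b : 'I_n -> V -> V).

(* a |-> a (x) 1 from End_D(V) to its scalar extension to K. *)
Definition bar (a : V -> V) : 'I_n -> K := fun l => tau (Fcoord b a l).

Definition bar_mul (x y : 'I_n -> K) : 'I_n -> K := fun p =>
  \sum_l \sum_m x l * y m * bar (b l \o b m) p.

Definition bar_adjoint (x : 'I_n -> K) : 'I_n -> K := fun p =>
  \sum_l x l * bar (adjoint h (b l)) p.

Definition bar_unitary : set ('I_n -> K) :=
  [set x | bar_mul (bar_adjoint x) x = bar id].

Definition bar_gl : set ('I_n -> K) :=
  [set x | exists y, bar_mul x y = bar id /\ bar_mul y x = bar id].

Definition coefs_in_F m (p : mpoly.mpoly m K) : Prop :=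
  forall mon, (tau @` F) (mpoly.mcoeff mon p).

(* Mutually inverse polynomial maps over F, compatible with multiplication;    *)
(* both groups are closed in their ambient affine space, so that regular       *)
(* functions on them are restrictions of polynomials.                          *)
Definition unitary_iso_O2is : Prop :=
  exists (P : 'I_2 -> 'I_2 -> mpoly.mpoly n K)
         (Q : 'I_n -> mpoly.mpoly (2 * 2) K),
    let f x : 'M[K]_2 := \matrix_(i, j) mpoly.meval x (P i j) in
    let g (M : 'M[K]_2) l := mpoly.meval (fun q => mxvec M 0 q) (Q l) in
    [/\ forall i j, coefs_in_F (P i j),
        forall l, coefs_in_F (Q l),
        forall x, bar_unitary x -> O2is (f x) /\ g (f x) = x,
        forall M, O2is M -> bar_unitary (g M) /\ f (g M) = M
      & forall x y, bar_unitary x -> bar_unitary y ->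
          f (bar_mul x y) = f x *m f y].

End Points.

(* F-points of the identity component of U(h), resp. of GL_D(V). *)
Definition unitary_neutral : set (V -> V) := [set g | unitary_group h g /\
  exists n (b : 'I_n -> V -> V),
    Fbasis b /\ zariski_component (bar_unitary b) (bar b id) (bar b g)].

Definition gl_neutral : set (V -> V) := [set g | general_linear g /\
  exists n (b : 'I_n -> V -> V),
    Fbasis b /\ zariski_component (bar_gl b) (bar b id) (bar b g)].

Definition is_O2is : Prop :=
  exists n (b : 'I_n -> V -> V), Fbasis b /\ unitary_iso_O2is b.

Variables (R : realType) (w : D -> \bar R).

Definition unitary_translation (f : (R -> set V) -> (R -> set V)) : Prop :=
  (~ is_O2is -> forall L, Latt_h h w (nu_step w) L -> f L = L) /\
  (is_O2is -> exists v1 v2 : V,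
    let line v := range ((@ract D V)^~ v) in
    [/\ h v1 v1 = 0, h v2 v2 = 0,
        act_basis (@ract D V) setT (fun l : 'I_2 => if l == 0 then v1 else v2)
      & exists s : R, forall L, Latt_h h w (nu_step w) L -> forall t,
          f L t = [set u1 + u2 | u1 in L (t - s) `&` line v1
                               & u2 in L (t + s) `&` line v2]]).

Definition gl_translation (f : (R -> set V) -> (R -> set V)) : Prop :=
  exists s : R, forall L, Latt w (nu_step w) L -> f L = lf_translate L s.

End AlgebraicGroups.

Section Centralizer.
Variables (R : realType) (k : fieldType) (D : falgType k) (d : nat).
Variables (nuD : D -> \bar R) (V : lmodType D^c) (h : V -> V -> D).
Variable (beta : V -> V).

Definition poly_end (p : {poly k}) : V -> V :=
  fun v => \sum_(n < size p) ract (p`_n)%:A (iter n beta v).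

(* i : E_i -> End_D(V) is written iota i; its value at 1 is the idempotent 1_i. *)
Variables (I : finType) (E : I -> fieldExtType k).
Variables (nuE : forall i, E i -> \bar R) (iota : forall i, E i -> V -> V).

(* k[beta] is the direct product of the (images under iota of the) fields E_i. *)
Record product_of_fields : Prop := {
  pf_end : forall i (x : E i), End (iota x);
  pf_add : forall i (x y : E i) v, iota (x + y) v = iota x v + iota y v;
  pf_mul : forall i (x y : E i), iota (x * y) = iota x \o iota y;
  pf_scal : forall i (c : k) v, iota (c%:A : E i) v = ract c%:A (iota (1 : E i) v);
  pf_inj : forall i, injective (@iota i);
  pf_orth : forall i i', i != i' -> forall (x : E i) (x' : E i') v,
    iota x (iota x' v) = 0;
  pf_sum : range poly_end =
    [set (fun v => \sum_i iota (x i) v) | x in [set: forall i, E i]] }.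

Definition idem (i : I) : V -> V := iota (1 : E i).
Definition Vcomp (i : I) : set V := range (idem i).

(* End_{E_i (x) D}(V_i), as endomorphisms of V vanishing on V_{i'}, i' <> i. *)
Definition Cent (i : I) : set (V -> V) :=
  [set a | [/\ End a, idem i \o a \o idem i = a
             & forall x : E i, a \o iota x = iota x \o a]].

Definition lattice_function_D (W : set V) (L : R -> set V) : Prop :=
  lattice_function nuD (@ract D V) W (index_step R d) L.
Definition lattice_function_E (i : I) (L : R -> set V) : Prop :=
  lattice_function (@nuE i) (@iota i) (Vcomp i) (nu_step (@nuE i)) L.

(* The extended building of G. *)
Definition B1G (L : R -> set V) : Prop := Latt_h h nuD (index_step R d) L.

Definition oE_oD_lattice_function (L : R -> set V) : Prop :=
  [/\ lattice_function_D setT L, split_by Vcomp L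
    & forall i, lattice_function_E i (fun t => L t `&` Vcomp i)].

Definition centralizer : set (V -> V) :=
  [set g | unitary_group h g /\ g \o beta = beta \o g].

Definition lie_filtration (L : R -> set V) (t : R) : set (V -> V) :=
  in_square L t `&` unitary_lie h.

Variables (D' : forall i, falgType (E i)) (nuD' : forall i, D' i -> \bar R).
Variables (V' : forall i, lmodType (D' i)^c).
Variables (psi : forall i, (V -> V) -> (V' i -> V' i)).

Record centralizer_iso (i : I) : Prop := {
  ci_bij : set_bij (Cent i) (@End (D' i) (V' i)) (@psi i);
  ci_add : forall a b, Cent i a -> Cent i b -> forall v,
    @psi i (fun u => a u + b u) v = @psi i a v + @psi i b v;
  ci_mul : forall a b, Cent i a -> Cent i b ->
    @psi i (a \o b) = @psi i a \o @psi i b;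
  ci_scal : forall (x : E i) v, @psi i (iota x) v = ract (x%:A : D' i) v }.

Notation Latt' i := (@Latt (D' i) (V' i) R (@nuD' i) (nu_step (@nuD' i))).

Record BL_map (i : I) (f : (R -> set (V' i)) -> (R -> set V)) : Prop := {
  BL_bij : set_bij [set L | Latt' i L]
    [set L | lattice_function_D (Vcomp i) L /\ lattice_function_E i L] f;
  BL_affine : forall c, 0 <= c <= 1 -> forall L1 L2 L3,
    Latt' i L1 -> Latt' i L2 -> Latt' i L3 ->
    convex_comb (@ract (D' i) (V' i)) setT c L1 L2 L3 ->
    convex_comb (@ract D V) (Vcomp i) c (f L1) (f L2) (f L3);
  BL_equivariant : forall a, Cent i a -> general_linear (@psi i a) ->
    forall L, Latt' i L -> f (lf_act (@psi i a) L) = lf_act a (f L);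
  BL_square : forall a, Cent i a -> forall L, Latt' i L -> forall t,
    in_square (f L) t a <-> in_square L t (@psi i a) }.

Variables (s : I -> I) (Iplus : {set I}).

Definition sigma_on_index : Prop := forall i, adjoint h (idem i) = idem (s i).

Definition half_system : Prop :=
  (forall i, i \in Iplus -> s i != i) /\
  (forall i, s i != i -> (s i \in Iplus) = (i \notin Iplus)).

(* The union of I_0 and I_+. *)
Definition halfI : finType := {i : I | (s i == i) || (i \in Iplus)}.

Variable (h' : forall i, V' i -> V' i -> D' i).

Definition form_compatible (i : I) : Prop :=
  forall a, Cent i a -> @psi i (adjoint h a) = adjoint (@h' i) (@psi i a).

Definition E0 (i : I) : set (E i) :=
  [set x | s i = i -> adjoint h (iota x) = iota x].

Definition pointH := forall j : halfI, R -> set (V' (sval j)).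

(* The extended building of H. *)
Definition B1H (x : pointH) : Prop := forall j : halfI,
  if s (sval j) == sval j
  then Latt_h (@h' (sval j)) (@nuD' (sval j)) (nu_step (@nuD' (sval j))) (x j)
  else Latt' (sval j) (x j).

Definition convex_combH (c : R) (x y z : pointH) : Prop := forall j : halfI,
  convex_comb (@ract (D' (sval j)) (V' (sval j))) setT c (x j) (y j) (z j).

Definition affine_map (f : pointH -> R -> set V) : Prop :=
  forall c, 0 <= c <= 1 -> forall x y z, B1H x -> B1H y -> B1H z ->
    convex_combH c x y z -> convex_comb (@ract D V) setT c (f x) (f y) (f z).

Definition lieH_factor (j : halfI) : set (V -> V) :=
  [set a | Cent (sval j) a /\
    (s (sval j) = sval j -> forall v, adjoint h a v = - a v)].

Definition lieH_embed (j : halfI) (a : V -> V) : V -> V :=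
  if s (sval j) == sval j then a else fun v => a v - adjoint h a v.

Definition lieH : set (V -> V) :=
  [set (fun v => \sum_j lieH_embed j (a j) v) | a in
    [set a : halfI -> V -> V | forall j, lieH_factor j (a j)]].

Definition lieH_filtration (x : pointH) (t : R) : set (V -> V) :=
  [set (fun v => \sum_j lieH_embed j (a j) v) | a in
    [set a : halfI -> V -> V | forall j,
      lieH_factor j (a j) /\ in_square (x j) t (@psi (sval j) (a j))]].

Definition CLF_map (f : pointH -> R -> set V) : Prop :=
  forall x t, B1H x -> lieH_filtration x t = lieH `&` lie_filtration (f x) t.

Variables (K : fieldType) (tau : forall i, E i -> K).

(* The group of all (g_j) with g_j in H_j^0((E_j)_0). *)
Definition neutralH : set (forall j : halfI, V' (sval j) -> V' (sval j)) :=
  [set g | forall j,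
    if s (sval j) == sval j
    then unitary_neutral (E0 (i := sval j)) (@tau (sval j)) (@h' (sval j)) (g j)
    else gl_neutral (E0 (i := sval j)) (@tau (sval j)) (g j)].

Definition centre_neutralH : set (forall j : halfI, V' (sval j) -> V' (sval j)) :=
  [set z | neutralH z /\ forall g, neutralH g -> forall j, z j \o g j = g j \o z j].

(* The canonical isomorphism of H with the product of the H_j sends g to the   *)
(* family of the psi_j(g 1_j).                                                 *)
Definition equivariant (S : set (forall j : halfI, V' (sval j) -> V' (sval j)))
    (f : pointH -> R -> set V) : Prop :=
  forall g, centralizer g ->
    S (fun j => @psi (sval j) (g \o idem (sval j))) ->
    forall x, B1H x ->
      f (fun j => lf_act (@psi (sval j) (g \o idem (sval j))) (x j)) = lf_act g (f x).

Definition translationH (f : pointH -> pointH) : Prop :=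
  exists fj : forall j : halfI, (R -> set (V' (sval j))) -> (R -> set (V' (sval j))),
    (forall j,
      if s (sval j) == sval j
      then unitary_translation (E0 (i := sval j)) (@tau (sval j)) (@h' (sval j))
             (@nuD' (sval j)) (fj j)
      else gl_translation (@nuD' (sval j)) (fj j)) /\
    (forall x, B1H x -> f x = fun j => fj j (x j)).

Variable jt : forall i, (R -> set (V' i)) -> (R -> set V).

Definition j_factor (j : halfI) (L : R -> set (V' (sval j))) : R -> set V :=
  let i := sval j in
  let L1 := jt L in
  if s i == i
  then xget L1 [set L2 | (exists r, L2 = lf_translate L1 r) /\
                         lf_dual h nuD (Vcomp i) L2 = L2]
  else fun t => [set u + v | u in L1 t & v in lf_dual h nuD (Vcomp (s i)) L1 t].

Definition j_map (x : pointH) : R -> set V := fun t =>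
  [set \sum_j v j | v in [set v : halfI -> V | forall j, j_factor (x j) t (v j)]].

End Centralizer.

(* Main.v *)
(* A CLF-map [phi] makes the square lattice function of [phi x] contain the       *)
(* scalars and the skew scalars of the [E_i] with the right valuations.  Since 2  *)
(* is a unit this forces [phi x] to be split by the [V_i] and to be an            *)
(* [o_E]-lattice function, so that [phi x = j y] for a unique [y].  Comparing     *)
(* square lattice functions again, [y_i = x_i + s_i(x)] for general linear        *)
(* factors, and [y_i = x_i] for unitary factors unless [h'_i] is a hyperbolic     *)
(* quadratic plane, where self-dual lattice functions form a line and             *)
(* [y_i = x_i + s_i(x)] makes sense; this is the case of [O_2^is].  The real      *)
(* functions [s_i] are affine on the building of [H], and they are constant:      *)
(* moving one coordinate of [x] at a time, the centre acts on a general linear    *)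
(* or [O_2^is] factor by translations and a periodic affine function on the line  *)
(* is constant, while the building of any other unitary group is covered by       *)
(* lines that branch, on which an affine function cannot vary.                    *)
(*                                                                                *)
(* To recognize [O_2^is]: its diagonal torus is a one-parameter group that is     *)
(* Laurent polynomial in the parameter, an extreme coefficient of which has       *)
(* isotropic values; and two elements of [O_2^is] whose squares are not 1         *)
(* commute, which leaves no room for unipotent isometries.                        *)
Require Import Defs.
From HB Require Import structures.
From mathcomp Require Import all_boot all_order all_algebra all_field.
From mathcomp Require Import all_classical all_reals ereal.
From mathcomp Require Import ring lra.
From mathcomp Require mpoly.
Import (canonicals) mpoly.

Set Implicit Arguments.
Unset Strict Implicit.
Unset Printing Implicit Defensive.

Import Order.TTheory GRing.Theory Num.Theory.

Local Open Scope classical_set_scope.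
Local Open Scope ring_scope.

(** * Valuations of division rings *)

(** Let [Y x] be the family of coordinates of [phi x] under the inverse of [j]. One shows that [Y]
    exists, that [Y x] differs from [x] in each factor by a real shift, and that the shift does not
    depend on [x].

    Existence. The CLF condition places the skew parts of the scalars of E_i into the filtration of
    [phi x] at their own valuation. Since 2 is a unit, sums and products of skew scalars recover
    every scalar with the right valuation ([iota_plus], [iota_fix]); at most one index of I_0
    carries no nonzero skew scalar, and its idempotent is 1 minus the others ([good_of_CLF]). Hence
    [phi x] is a self-dual o_E-o_D-lattice function, and [j] is a bijection onto these
    ([jmap_ycoord], [jmap_inv]).

    Comparison. A norm is determined up to translation by its square lattice function
    ([square_translate]); this settles the general linear factors ([Y_plus]). In a unitary factor
    only skew endomorphisms are at hand. They still determine a self-dual norm ([skew_square_eq],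
    [Y_fix]) unless V'_i is a hyperbolic quadratic plane over a commutative field, called split
    ([splane]). On a split plane the self-dual norms form one real line ([SD_pl]), so that [Y x] and
    [x] again differ by a real shift.

    Constancy. The shifts are affine functions on the building of H, and [const_G] changes one
    coordinate of [x] at a time. A uniformizer acting as a scalar, or the diagonal torus of a split
    plane, is central, so a shift is periodic along the corresponding lines and therefore constant
    on them ([periodic_affine]). In all other directions three lines are glued pairwise along half
    lines, which forces an affine function to be constant on them ([three_fold]). The gluing comes
    from elementary matrices ([F_swap]), transvections ([fold_skew]) and Eichler transformations
    ([fold_orth]). Two self-dual norms are joined by finitely many such lines, because a hyperbolic
    plane splitting both can be removed as long as they differ ([hyperbolic_step], which rests on
    the Hensel argument [isotropic_lift]).

    Finally, a unitary group is O_2^is exactly when its space is a split plane ([splane_is_O2is],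
    [is_O2is_splane]), so the maps found are translations in the sense required. They are onto and
    commute with the neutral components ([factor]); this yields the image and the equivariance of
    [phi]. *)

Definition vge (R : realType) (A : Type) (w : A -> \bar R) (r : R) (a : A) : Prop :=
  (r%:E <= w a)%E.

(** The common setting for D, the E_i and the D'_i: a discretely valued division ring. All of them
    satisfy it by [ext_dvaluation]. *)
Record dvaluation (R : realType) (A : unitRingType) (w : A -> \bar R) : Prop := {
  dv_val : valuation w;
  dv_div : forall x : A, x != 0 -> x \is a GRing.unit;
  dv_unif : exists p, uniformizer w p }.

Section Valuation.
Variables (R : realType) (A : unitRingType) (w : A -> \bar R).
Hypothesis Hw : valuation w.
Notation nu := (nu_step w).
Implicit Types (a b c p : A) (r s : R).

Lemma val0 : w 0 = +oo%E.
Proof. by apply/(valuation_eqy Hw). Qed.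

Lemma w_nu a : a != 0 -> w a = (nu a)%:E.
Proof.
move=> a0; rewrite /nu_step fineK // fin_numE (valuation_neqNy Hw) /=.
by apply/eqP => /(valuation_eqy Hw) /eqP; rewrite (negbTE a0).
Qed.

Lemma vge0 r : vge w r 0.
Proof. by rewrite /vge val0 leey. Qed.

Lemma vgeE r a : a != 0 -> vge w r a <-> r <= nu a.
Proof. by move=> a0; rewrite /vge (w_nu a0) lee_fin. Qed.

Lemma vge_nu a : vge w (nu a) a.
Proof. by have [->|a0] := eqVneq a 0; [exact: vge0 | apply/vgeE]. Qed.

Lemma vgeW s r a : r <= s -> vge w s a -> vge w r a.
Proof. by move=> rs; apply: le_trans; rewrite lee_fin. Qed.

Lemma vge_inf a : (forall r, vge w r a) -> a = 0.
Proof.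
move=> H; have [//|a0] := eqVneq a 0.
by have /vgeE := H (nu a + 1) => /(_ a0); rewrite gerDl ler10.
Qed.

Lemma vgeD r a b : vge w r a -> vge w r b -> vge w r (a + b).
Proof.
by move=> ra rb; apply: le_trans (valuationD Hw a b); rewrite le_min ra rb.
Qed.

Lemma vge_sum (J : Type) (l : seq J) (P : pred J) (F : J -> A) r :
  (forall i, P i -> vge w r (F i)) -> vge w r (\sum_(i <- l | P i) F i).
Proof. by move=> H; elim/big_ind: _ => //; [exact: vge0 | move=> *; exact: vgeD]. Qed.

Lemma vgeM r s a b : vge w r a -> vge w s b -> vge w (r + s) (a * b).
Proof. by move=> ra rb; rewrite /vge (valuationM Hw) EFinD leeD. Qed.

Lemma nu_one_aux : nu 1 = 0.
Proof.
have := valuationM Hw 1 1; rewrite mulr1 (w_nu (oner_neq0 A)) -EFinD => -[].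
by move/eqP; rewrite -subr_eq0 opprD addNKr oppr_eq0 => /eqP.
Qed.

Lemma vgeN r a : vge w r (- a) <-> vge w r a.
Proof.
have H b : vge w r b -> vge w r (- b).
  have n1 : nu (-1) = 0.
    have /eqP := valuationM Hw (-1) (-1).
    have N0 : -1 != 0 :> A by rewrite oppr_eq0 oner_eq0.
    rewrite mulrNN mulr1 (w_nu (oner_neq0 A)) (w_nu N0) nu_one_aux.
    by rewrite -EFinD eqe => /eqP; lra.
  move=> rb; rewrite -mulN1r -[r]add0r; apply: vgeM => //.
  by rewrite -n1; exact: vge_nu.
by split => /H //; rewrite opprK.
Qed.

Lemma vgeB r a b : vge w r a -> vge w r b -> vge w r (a - b).
Proof. by move=> ra rb; apply: vgeD => //; apply/vgeN. Qed.

Lemma nuN a : nu (- a) = nu a.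
Proof.
have [->|a0] := eqVneq a 0; first by rewrite oppr0.
have Na0 : - a != 0 by rewrite oppr_eq0.
apply/eqP; rewrite eq_le; apply/andP; split.
  by apply/(vgeE _ a0)/vgeN/vge_nu.
by apply/(vgeE _ Na0)/vgeN/vge_nu.
Qed.

Lemma mul_neq0 a b : a != 0 -> b != 0 -> a * b != 0.
Proof.
move=> a0 b0; apply/eqP => ab; have := valuationM Hw a b.
by rewrite ab val0 !w_nu.
Qed.

Lemma nuM a b : a != 0 -> b != 0 -> nu (a * b) = nu a + nu b.
Proof.
move=> a0 b0; have := valuationM Hw a b.
by rewrite !w_nu // ?mul_neq0 // -EFinD => -[].
Qed.

Lemma exp_neq0 a n : a != 0 -> a ^+ n != 0.
Proof.
by move=> a0; elim: n => [|n IH]; rewrite ?expr0 ?oner_neq0 // exprS mul_neq0.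
Qed.

Lemma nuX a n : a != 0 -> nu (a ^+ n) = nu a *+ n.
Proof.
move=> a0; elim: n => [|n IH]; first by rewrite expr0 nu_one_aux mulr0n.
by rewrite exprS mulrS nuM ?exp_neq0 // IH.
Qed.

End Valuation.

Section DValuation.
Variables (R : realType) (A : unitRingType) (w : A -> \bar R).
Hypothesis Hw : dvaluation w.
Notation nu := (nu_step w).
Implicit Types (a b c p : A) (r s : R).
Let V := dv_val Hw.

Lemma divU a : a != 0 -> a \is a GRing.unit. Proof. exact: dv_div Hw a. Qed.

Lemma inv_neq0 a : a != 0 -> a^-1 != 0.
Proof.
move=> a0; apply/eqP => E; have := mulrV (divU a0).
by rewrite E mulr0 => /eqP; rewrite eq_sym oner_eq0.
Qed.

Lemma nuV a : a != 0 -> nu a^-1 = - nu a.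
Proof.
move=> a0; have := nuM V a0 (inv_neq0 a0).
rewrite mulrV ?divU // (nu_one_aux V); lra.
Qed.

Lemma vge_mull c r a : c != 0 -> vge w r (c * a) <-> vge w (r - nu c) a.
Proof.
move=> c0; split => H.
  rewrite -(mulKr (divU c0) a) addrC -nuV //; apply: vgeM => //; exact: vge_nu.
rewrite -[r](subrK (nu c)) addrC; apply: vgeM => //; exact: vge_nu.
Qed.

Lemma vge_mulr c r a : c != 0 -> vge w r (a * c) <-> vge w (r - nu c) a.
Proof.
move=> c0; split => H.
  rewrite -(mulrK (divU c0) a) -nuV //; apply: vgeM => //; exact: vge_nu.
rewrite -[r](subrK (nu c)); apply: vgeM => //; exact: vge_nu.
Qed.

Lemma uniformizer_nu p : uniformizer w p ->
  [/\ p != 0, 0 < nu p & forall b, b != 0 -> 0 < nu b -> nu p <= nu b].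
Proof.
move=> [p0 py pm].
have pn0 : p != 0 by apply/eqP => E; move: py; rewrite E (val0 V).
split => //; first by move: p0; rewrite w_nu.
by move=> b b0; have := pm b; rewrite (w_nu V b0) (w_nu V pn0) lte_fin lee_fin.
Qed.

Lemma expz_neq0 p (z : int) : p != 0 -> p ^ z != 0.
Proof.
move=> p0; case: z => n; first exact: exp_neq0 V _ n p0.
rewrite NegzE -exprz_inv -exprnP; exact: exp_neq0 V _ _ (inv_neq0 p0).
Qed.

Lemma nuXz p (z : int) : p != 0 -> nu (p ^ z) = z%:~R * nu p.
Proof.
move=> p0; case: z => n; first by rewrite -exprnP nuX // mulrzl.
rewrite NegzE -exprz_inv -exprnP (nuX V) ?inv_neq0 // nuV // mulrNz mulNr.
by rewrite mulrzl mulNrn.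
Qed.

(** Dividing by the power of p with exponent floor(nu a / nu p) leaves a value in [0, nu p), and
    minimality of nu p makes it 0. *)
Lemma nu_discr p : uniformizer w p ->
  forall a, a != 0 -> exists z : int, nu a = z%:~R * nu p.
Proof.
move=> /uniformizer_nu [p0 pp pm] a a0.
pose z := Num.floor (nu a / nu p); exists z.
have b0 : a * p ^ (- z) != 0 by rewrite (mul_neq0 V) ?expz_neq0.
have nb : nu (a * p ^ (- z)) = nu a - z%:~R * nu p.
  by rewrite (nuM V) ?expz_neq0 // nuXz // mulrNz mulNr.
have h1 : z%:~R <= nu a / nu p by exact: floor_le.
have h2 : nu a / nu p < (z + 1)%:~R by by case/andP: (floor_itv (nu a / nu p)).
rewrite ler_pdivlMr // in h1; rewrite ltr_pdivrMr // intrD in h2.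
have [H|H] := leP (nu a) (z%:~R * nu p); first by lra.
have := pm _ b0; rewrite nb; lra.
Qed.

Lemma uniformizer_eq p q : uniformizer w p -> uniformizer w q -> nu p = nu q.
Proof.
move=> /uniformizer_nu [p0 pp pm] /uniformizer_nu [q0 qp qm].
by apply/eqP; rewrite eq_le pm // qm.
Qed.

End DValuation.

(** * Linear algebra over division rings *)

(** Covers D acting by [ract] as well as E_i acting by [iota]. Under [iota] the unit acts as the
    idempotent of V_i, which is why [act1] is restricted to W while the other identities hold on all
    of V. *)
Record right_space (A : nzRingType) (V : zmodType) (act : A -> V -> V)
    (W : set V) : Prop := {
  rs0 : W 0;
  rsD : forall u v, W u -> W v -> W (u + v);
  rsZ : forall a u, W u -> W (act a u);
  actDr : forall a u v, act a (u + v) = act a u + act a v;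
  actDl : forall a b u, act (a + b) u = act a u + act b u;
  actM : forall a b u, act (a * b) u = act b (act a u);
  act1 : forall u, W u -> act 1 u = u }.

Definition consf (T : Type) n (x : T) (f : 'I_n -> T) : 'I_n.+1 -> T :=
  fun l => if unlift ord0 l is Some l' then f l' else x.

Lemma consf0 T n (x : T) (f : 'I_n -> T) : consf x f ord0 = x.
Proof. by rewrite /consf unlift_none. Qed.

Lemma consfS T n (x : T) (f : 'I_n -> T) l : consf x f (lift ord0 l) = f l.
Proof. by rewrite /consf liftK. Qed.

Lemma consf_eta T n (f : 'I_n.+1 -> T) : consf (f ord0) (fun l => f (lift ord0 l)) = f.
Proof. by apply/funext => l; rewrite /consf; case: unliftP => [l'|] ->. Qed.

Lemma consf_eta2 T n (f : 'I_n.+2 -> T) :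
  f = consf (f ord0) (consf (f (lift ord0 ord0)) (fun l => f (lift ord0 (lift ord0 l)))).
Proof. by rewrite -[LHS]consf_eta -[X in consf _ X = _]consf_eta. Qed.

Lemma forall_ord_recl n (P : 'I_n.+1 -> Prop) :
  (forall l, P l) <-> P ord0 /\ forall l, P (lift ord0 l).
Proof.
split=> [H|[H0 HS] l]; first by split.
by case: (unliftP ord0 l) => [l'|] ->.
Qed.

Lemma forall_ord_recl2 n (P : 'I_n.+2 -> Prop) : (forall l, P l) <->
  [/\ P ord0, P (lift ord0 ord0) & forall l, P (lift ord0 (lift ord0 l))].
Proof.
split=> [H|[H0 H1 HS]]; first by split.
by apply/forall_ord_recl; split=> //; apply/forall_ord_recl.
Qed.

Section RightSpace.
Variables (A : nzRingType) (V : zmodType) (act : A -> V -> V).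

Definition comb n (b : 'I_n -> V) (x : 'I_n -> A) : V := \sum_l act (x l) (b l).

Lemma comb_cons n (b : 'I_n -> V) v x y :
  comb (consf v b) (consf x y) = act x v + comb b y.
Proof.
rewrite /comb big_ord_recl !consf0; congr (_ + _).
by apply: eq_bigr => l _; rewrite !consfS.
Qed.

Lemma comb_recl n (b : 'I_n.+1 -> V) x :
  comb b x = act (x ord0) (b ord0) +
             comb (fun l => b (lift ord0 l)) (fun l => x (lift ord0 l)).
Proof. by rewrite /comb big_ord_recl. Qed.

Variable (W : set V).
Hypothesis HW : right_space act W.
Implicit Types (a : A) (u v : V).

Lemma actr0 a : act a 0 = 0.
Proof. by apply: (@addrI _ (act a 0)); rewrite -(actDr HW) !addr0. Qed.

Lemma act0r u : act 0 u = 0.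
Proof. by apply: (@addrI _ (act 0 u)); rewrite -(actDl HW) !addr0. Qed.

Lemma actrN a u : act a (- u) = - act a u.
Proof. by apply: (@addrI _ (act a u)); rewrite -(actDr HW) !subrr actr0. Qed.

Lemma actNr a u : act (- a) u = - act a u.
Proof. by apply: (@addrI _ (act a u)); rewrite -(actDl HW) !subrr act0r. Qed.

Lemma act_sumr (J : Type) (s : seq J) (P : pred J) a (F : J -> V) :
  act a (\sum_(i <- s | P i) F i) = \sum_(i <- s | P i) act a (F i).
Proof. by elim/big_rec2: _ => [|i x y _ <-]; rewrite ?actr0 ?(actDr HW). Qed.

Lemma act_suml (J : Type) (s : seq J) (P : pred J) (F : J -> A) u :
  act (\sum_(i <- s | P i) F i) u = \sum_(i <- s | P i) act (F i) u.
Proof. by elim/big_rec2: _ => [|i x y _ <-]; rewrite ?act0r ?(actDl HW). Qed.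

Lemma rs_sum (J : Type) (s : seq J) (P : pred J) (F : J -> V) :
  (forall i, P i -> W (F i)) -> W (\sum_(i <- s | P i) F i).
Proof.
move=> H; elim/big_ind: _ => //; first exact: rs0 HW.
by move=> x y; exact: rsD HW x y.
Qed.

Lemma rsN u : W u -> W (- u).
Proof.
move=> Wu; have <- : act (-1) u = - u by rewrite actNr (act1 HW).
exact: (rsZ HW).
Qed.

Lemma rsB u v : W u -> W v -> W (u - v).
Proof. by move=> Wu Wv; apply: (rsD HW) => //; exact: rsN. Qed.

Lemma combD n (b : 'I_n -> V) x y :
  comb b (fun l => x l + y l) = comb b x + comb b y.
Proof. by rewrite /comb -big_split; apply: eq_bigr => l _; rewrite (actDl HW). Qed.

Lemma combN n (b : 'I_n -> V) x : comb b (fun l => - x l) = - comb b x.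
Proof. by rewrite /comb -sumrN; apply: eq_bigr => l _; rewrite actNr. Qed.

Lemma combZ n (b : 'I_n -> V) x a : comb b (fun l => x l * a) = act a (comb b x).
Proof. by rewrite /comb act_sumr; apply: eq_bigr => l _; rewrite (actM HW). Qed.

Lemma comb0 n (b : 'I_n -> V) : comb b (fun=> 0) = 0.
Proof. by rewrite /comb big1 // => l _; rewrite act0r. Qed.

Lemma comb_delta n (b : 'I_n -> V) l : (forall l, W (b l)) ->
  comb b (fun m => (m == l)%:R) = b l.
Proof.
move=> Wb; rewrite /comb (bigD1 l) //= eqxx (act1 HW) //.
by rewrite big1 ?addr0 // => m /negbTE ->; rewrite act0r.
Qed.

Lemma comb_W n (b : 'I_n -> V) x : (forall l, W (b l)) -> W (comb b x).
Proof. by move=> Wb; apply: rs_sum => l _; apply: (rsZ HW). Qed.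

Notation basis := (act_basis act W).

Lemma basisP n (b : 'I_n -> V) : basis b <->
  [/\ forall l, W (b l), forall v, W v -> exists x, v = comb b x
    & forall x, comb b x = 0 -> forall l, x l = 0].
Proof.
split=> [[Wb Hb]|[Wb Hb Ib]].
  split=> // [v /Hb [x [-> _]]|x x0 l]; first by exists x.
  have [y [_ Hy]] := Hb 0 (rs0 HW).
  have yx : y = x by apply: Hy; exact: esym x0.
  have y0 : y = fun=> 0.
    by apply: Hy; rewrite big1 // => m _; rewrite act0r.
  by rewrite -yx y0.
split=> // v /Hb [x vx]; exists x; split=> // y vy; apply/funext => l.
apply/eqP; rewrite -subr_eq0; apply/eqP; apply: (Ib (fun l => x l - y l)).
by rewrite combD combN -vx /comb -vy subrr.
Qed.

Definition crd n (b : 'I_n -> V) (v : V) : 'I_n -> A :=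
  xget (fun=> 0) [set x | v = comb b x].

Section Coord.
Variables (n : nat) (b : 'I_n -> V).
Hypothesis Hb : basis b.

Lemma basisW l : W (b l). Proof. by case: Hb. Qed.

Lemma comb_inj x y : comb b x = comb b y -> x = y.
Proof.
have [_ _ Ib] := iffLR (basisP b) Hb => E; apply/funext => l; apply/eqP.
rewrite -subr_eq0; apply/eqP; apply: (Ib (fun l => x l - y l)).
by rewrite combD combN E subrr.
Qed.

Lemma crdP v : W v -> comb b (crd b v) = v.
Proof.
have [_ Sb _] := iffLR (basisP b) Hb; move=> /Sb [x vx].
by rewrite /crd; case: xgetP => [y _ /= <- //|/(_ x) /=].
Qed.

Lemma crd_comb x : crd b (comb b x) = x.
Proof. by apply: comb_inj; rewrite crdP //; apply: comb_W; exact: basisW. Qed.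

Lemma crdD u v : W u -> W v -> crd b (u + v) = fun l => crd b u l + crd b v l.
Proof. by move=> Wu Wv; apply: comb_inj; rewrite combD !crdP //; apply: (rsD HW). Qed.

Lemma crdZ a u : W u -> crd b (act a u) = fun l => crd b u l * a.
Proof. by move=> Wu; apply: comb_inj; rewrite combZ !crdP //; apply: (rsZ HW). Qed.

Lemma crd_b l : crd b (b l) = fun m => (m == l)%:R.
Proof. by rewrite -{1}(comb_delta l basisW) crd_comb. Qed.

Lemma basis_neq0 l : b l != 0.
Proof.
apply/eqP => b0; have := congr1 (@^~ l) (crd_b l); rewrite b0 /= eqxx.
by rewrite -(comb0 b) crd_comb => /eqP; rewrite eq_sym oner_eq0.
Qed.
End Coord.

Definition lform (lam : V -> A) : Prop :=
  (forall u v, W u -> W v -> lam (u + v) = lam u + lam v) /\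
  (forall a u, W u -> lam (act a u) = lam u * a).

Section Lform.
Variable lam : V -> A.
Hypothesis Hl : lform lam.

Lemma lformD u v : W u -> W v -> lam (u + v) = lam u + lam v.
Proof. by case: Hl => H _; exact: H. Qed.

Lemma lformZ a u : W u -> lam (act a u) = lam u * a.
Proof. by case: Hl => _; apply. Qed.

Lemma lform0 : lam 0 = 0.
Proof. by rewrite -(actr0 0) lformZ ?mulr0 //; exact: rs0 HW. Qed.

Lemma lformN u : W u -> lam (- u) = - lam u.
Proof.
move=> Wu; apply: (@addrI _ (lam u)).
by rewrite -lformD ?subrr ?lform0 //; exact: rsN.
Qed.

Lemma lformB u v : W u -> W v -> lam (u - v) = lam u - lam v.
Proof. by move=> Wu Wv; rewrite lformD ?lformN //; exact: rsN. Qed.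

Lemma lform_sum (J : Type) (s : seq J) (P : pred J) (F : J -> V) :
  (forall i, W (F i)) ->
  lam (\sum_(i <- s | P i) F i) = \sum_(i <- s | P i) lam (F i).
Proof.
move=> WF; elim: s => [|i s IH]; first by rewrite !big_nil lform0.
rewrite !big_cons; case: (P i) => //; rewrite lformD ?IH //; exact: rs_sum.
Qed.

Lemma lform_comb n (b : 'I_n -> V) x : (forall l, W (b l)) ->
  lam (comb b x) = \sum_l lam (b l) * x l.
Proof.
move=> Wb; rewrite /comb lform_sum => [|l]; last exact: (rsZ HW).
by apply: eq_bigr => l _; rewrite lformZ.
Qed.

Lemma ker_right_space : right_space act [set u | W u /\ lam u = 0].
Proof.
split=> /=.
- by split; [exact: rs0 HW | exact: lform0].
- move=> u v [Wu u0] [Wv v0]; split; first exact: rsD HW _ _ Wu Wv.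
  by rewrite lformD // u0 v0 addr0.
- move=> a u [Wu u0]; split; first exact: (rsZ HW).
  by rewrite lformZ // u0 mul0r.
- exact: actDr HW.
- exact: actDl HW.
- exact: actM HW.
- by move=> u [Wu _]; exact: act1 HW _ Wu.
Qed.
End Lform.

Lemma crd_lform n (b : 'I_n -> V) l : basis b -> lform (fun v => crd b v l).
Proof. by move=> Hb; split=> [u v Wu Wv|a u Wu]; rewrite ?crdD ?crdZ. Qed.

End RightSpace.

Section DivisionSpace.
Variables (A : unitRingType) (V : zmodType) (act : A -> V -> V) (W : set V).
Hypothesis HW : right_space act W.
Hypothesis Adiv : forall x : A, x != 0 -> x \is a GRing.unit.
Implicit Types (a : A) (u v : V).
Notation basis W := (act_basis act W).

Lemma actK a u : a != 0 -> W u -> act a^-1 (act a u) = u.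
Proof. by move=> a0 Wu; rewrite -(actM HW) divrr ?Adiv // (act1 HW). Qed.

Lemma actVK a u : a != 0 -> W u -> act a (act a^-1 u) = u.
Proof. by move=> a0 Wu; rewrite -(actM HW) mulVr ?Adiv // (act1 HW). Qed.

Lemma act_neq0 a u : a != 0 -> W u -> u != 0 -> act a u != 0.
Proof.
move=> a0 Wu u0; apply/eqP => E; move: u0.
by rewrite -(actK a0 Wu) E (actr0 HW) eqxx.
Qed.

(** Pick a basis vector on which lam does not vanish and clear lam from the others with it. This is
    the engine of the inductions on dimension. *)
Lemma ker_basis n (b : 'I_n.+1 -> V) lam v : basis W b -> lform act W lam ->
  W v -> lam v != 0 -> exists b1 : 'I_n -> V, basis [set u | W u /\ lam u = 0] b1.
Proof.
move=> Hb Hl Wv lv; have Wb := basisW Hb.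
have [l0 l0P] : exists l0, lam (b l0) != 0.
  apply: contrapT => H; move: lv; rewrite -(crdP HW Hb Wv) (lform_comb HW Hl) //.
  rewrite big1 ?eqxx // => l _; have [->|H'] := eqVneq (lam (b l)) 0.
    by rewrite mul0r.
  by case: H; exists l.
pose c l := (lam (b l0))^-1 * lam (b (lift l0 l)).
pose b1 l := b (lift l0 l) - act (c l) (b l0).
pose ext (x : 'I_n -> A) m :=
  if unlift l0 m is Some l then x l else - \sum_l c l * x l.
have ext0 x : ext x l0 = - \sum_l c l * x l by rewrite /ext unlift_none.
have extS x l : ext x (lift l0 l) = x l by rewrite /ext liftK.
have E x : comb act b1 x = comb act b (ext x).
  rewrite /comb (bigD1_ord l0) //= ext0 (actNr HW) (act_suml HW) -sumrN -big_split /=.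
  apply: eq_bigr => l _; rewrite extS /b1 (actDr HW) (actrN HW).
  by rewrite addrC (actM HW (c l)).
have Wb1 l : W (b1 l) by apply: (rsB HW) => //; exact: (rsZ HW).
exists b1; apply/(basisP (ker_right_space HW Hl)); split.
- move=> l; split=> //; rewrite (lformB HW Hl) ?(lformZ Hl) //.
    by rewrite mulrA divrr ?Adiv // mul1r subrr.
  exact: (rsZ HW).
- move=> u [Wu lu]; have uE := crdP HW Hb Wu; set y := crd act b u in uE.
  exists (fun l => y (lift l0 l)); rewrite E -uE; congr comb.
  apply/funext => m; case: (unliftP l0 m) => [l|] ->; first by rewrite extS.
  rewrite ext0; move: lu; rewrite -uE (lform_comb HW Hl) // (bigD1_ord l0) //=.
  move/(congr1 (fun z => (lam (b l0))^-1 * z)); rewrite mulrDr mulr0 mulKr ?Adiv //.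
  rewrite mulr_sumr => /eqP; rewrite addr_eq0 => /eqP ->; congr (- _).
  by apply: eq_bigr => l _; rewrite mulrA.
- move=> x x0 l; have [_ _ Ib] := iffLR (basisP HW b) Hb.
  by have := Ib (ext x); rewrite -E => /(_ x0 (lift l0 l)); rewrite extS.
Qed.

Lemma basis0 (b : 'I_0 -> V) u : basis W b -> W u -> u = 0.
Proof. by move=> Hb Wu; rewrite -(crdP HW Hb Wu) /comb big_ord0. Qed.

Lemma spanning_basis n (g : 'I_n -> V) :
  (forall l, W (g l)) -> (forall v, W v -> exists x, v = comb act g x) ->
  exists m (b : 'I_m -> V), basis W b.
Proof.
elim: n g => [|n IH] g Wg Sg.
  by exists 0%N, g; apply/(basisP HW); split=> // x _ [].
have [Ig|/existsNP [x /not_implyP [x0 /existsNP [l0 /eqP xl0]]]] :=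
  pselect (forall x, comb act g x = 0 -> forall l, x l = 0).
  by exists n.+1, g; apply/(basisP HW).
apply: (IH (fun l => g (lift l0 l))) => // v /Sg [y ->].
exists (fun l => y (lift l0 l) - x (lift l0 l) * ((x l0)^-1 * y l0)).
rewrite (combD HW) (combN HW) (combZ HW).
have xE : act (x l0) (g l0) = - comb act (fun l => g (lift l0 l)) (fun l => x (lift l0 l)).
  by apply/eqP; rewrite -addr_eq0; move: x0; rewrite {1}/comb (bigD1_ord l0) //= => ->.
rewrite {1}/comb (bigD1_ord l0) //= addrC; congr (_ + _).
by rewrite -(actrN HW) -xE (actM HW (x l0)^-1) actK.
Qed.

End DivisionSpace.

Section Dependence.
Variables (A : unitRingType) (V : zmodType) (act : A -> V -> V).
Hypothesis Adiv : forall x : A, x != 0 -> x \is a GRing.unit.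
Notation basis W := (act_basis act W).

(** Induction on n: a coordinate form that is nonzero on the first vector projects the remaining
    ones into its kernel, which has one basis vector less. *)
Lemma dependent n (W : set V) (b : 'I_n -> V) (u : 'I_n.+1 -> V) :
  right_space act W -> basis W b -> (forall m, W (u m)) ->
  exists x, comb act u x = 0 /\ exists m, x m != 0.
Proof.
have one : (1 : A) != 0 by exact: oner_neq0.
elim: n W b u => [|n IH] W b u HW Hb Wu.
  exists (fun=> 1); split; last by exists ord0.
  by rewrite /comb big_ord_recl big_ord0 addr0 (act1 HW) // (basis0 HW Hb (Wu ord0)).
have [u0|u0] := eqVneq (u ord0) 0.
  exists (fun m => (m == ord0)%:R); split; last by exists ord0; rewrite eqxx.
  by rewrite (comb_delta HW) // u0.
have [l xl] : exists l, crd act b (u ord0) l != 0.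
  apply: contrapT => H; move: u0; rewrite -(crdP HW Hb (Wu ord0)) /comb.
  rewrite big1 ?eqxx // => l _; have [->|H'] := eqVneq (crd act b (u ord0) l) 0.
    by rewrite (act0r HW).
  by case: H; exists l.
have Hl := crd_lform HW l Hb; set lam := (fun v => _) in Hl.
have {}xl : lam (u ord0) != 0 by [].
have [b1 Hb1] := ker_basis HW Adiv Hb Hl (Wu ord0) xl.
pose c m := (lam (u ord0))^-1 * lam (u (lift ord0 m)).
have [m|x [x0 [m xm]]] :=
    IH _ b1 (fun m => u (lift ord0 m) - act (c m) (u ord0)) (ker_right_space HW Hl) Hb1.
  split; first by apply: (rsB HW) => //; exact: (rsZ HW).
  rewrite (lformB HW Hl) ?(lformZ Hl) //; last exact: (rsZ HW).
  by rewrite mulrA divrr ?Adiv // mul1r subrr.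
exists (consf (- \sum_m c m * x m) x); split; last first.
  by exists (lift ord0 m); rewrite consfS.
rewrite comb_recl consf0 -[RHS]x0 (actNr HW) (act_suml HW) /comb -sumrN -big_split /=.
apply: eq_bigr => l' _; rewrite consfS (actDr HW) (actrN HW).
by rewrite addrC (actM HW (c l')).
Qed.

Lemma indep_basis n (W : set V) (b u : 'I_n -> V) : right_space act W -> basis W b ->
  (forall m, W (u m)) -> (forall x, comb act u x = 0 -> forall l, x l = 0) ->
  basis W u.
Proof.
move=> HW Hb Wu Iu; apply/(basisP HW); split=> // v Wv.
have [|x [x0 xm]] := dependent (u := consf v u) HW Hb.
  by apply/forall_ord_recl; split=> [|l]; rewrite ?consf0 ?consfS.
move: x0; rewrite -[x]consf_eta comb_cons => x0.
have [x00|x00] := eqVneq (x ord0) 0.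
  exfalso; move: x0; rewrite x00 (act0r HW) add0r => /Iu xl.
  by case: xm => m; case: (unliftP ord0 m) => [l|] ->; rewrite ?x00 ?xl eqxx.
exists (fun l => - x (lift ord0 l) * (x ord0)^-1).
rewrite (combZ HW) (combN HW); move/eqP: x0; rewrite addr_eq0 => /eqP <-.
by rewrite (actK HW).
Qed.

End Dependence.

(** Turns finitely many strict inequalities into a uniform gap; starting the minimum at al + 1
    covers an empty family. *)
Lemma fin_gap (R : realType) (T : finType) (P : pred T) (f : T -> R) (al : R) :
  (forall l, P l -> al < f l) -> exists r, al < r /\ forall l, P l -> r <= f l.
Proof.
move=> H; exists (\big[Num.min/al + 1]_(l | P l) f l); split.
  by apply: lt_bigmin => //; rewrite ltrDl.
by move=> l Pl; exact: bigmin_le_cond.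
Qed.

Lemma fin_lb (R : realType) (T : finType) (f : T -> R) :
  exists r, forall l, r <= f l.
Proof. by exists (\big[Num.min/0]_l f l) => l; exact: bigmin_le_cond. Qed.

Lemma fin_min (R : realType) (T : finType) (P : pred T) (f : T -> R) l0 : P l0 ->
  exists2 l, P l & forall m, P m -> f l <= f m.
Proof. by move=> P0; case: (arg_minP f P0) => l Pl H; exists l. Qed.

(** * Norms and lattice functions *)

Section Norms.
Variables (R : realType) (A : unitRingType) (w : A -> \bar R).
Hypothesis Hw : dvaluation w.
Notation nu := (nu_step w).
Let Hv := dv_val Hw.
Let Adiv := dv_div Hw.
Variables (V : zmodType) (act : A -> V -> V).
Implicit Types (W : set V) (L : R -> set V) (r s t : R) (u v : V) (x : A).

(** The lattice function split by the basis b whose norm at b l is a l. *)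
Definition LB n (b : 'I_n -> V) (a : 'I_n -> R) : R -> set V := fun r =>
  [set comb act b x | x in [set x | forall l, vge w (r - a l) (x l)]].

(** A lattice function viewed as a norm. [nf_val] says that the supremum defining the norm is finite
    and attained, [nf_bd] that linear forms are bounded, which takes the place of finite generation.
    [LF_normfam] and [normfam_LF] give the equivalence with lattice functions; this form restricts
    well to kernels of linear forms. *)
Record normfam W L : Prop := {
  nf_sub : forall r v, L r v -> W v;
  nf0 : forall r, L r 0;
  nfD : forall r u v, L r u -> L r v -> L r (u + v);
  nfZ : forall r t x v, L r v -> vge w t x -> L (r + t) (act x v);
  nf_val : forall v, W v -> v != 0 -> exists al, forall r, L r v <-> r <= al;
  nf_bd : forall lam, lform act W lam ->
    exists C, forall r v, L r v -> vge w (r + C) (lam v) }.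

Definition nrm L v : R := xget 0 [set al | forall r, L r v <-> r <= al].

Section Norm.
Variables (W : set V) (L : R -> set V).
Hypotheses (HW : right_space act W) (HL : normfam W L).

Lemma nrmP v r : W v -> v != 0 -> L r v <-> r <= nrm L v.
Proof.
move=> Wv v0; have [al H] := nf_val HL Wv v0.
by rewrite /nrm; case: xgetP => [y _ /= Hy|/(_ al)/= []//]; exact: Hy.
Qed.

Lemma nrm_mem v : W v -> L (nrm L v) v.
Proof.
move=> Wv; have [->|v0] := eqVneq v 0; first exact: nf0 HL _.
by apply/nrmP.
Qed.

Lemma nrm_eq v al : W v -> v != 0 -> (forall r, L r v <-> r <= al) -> nrm L v = al.
Proof.
move=> Wv v0 H; apply/eqP; rewrite eq_le; apply/andP; split.
  by apply/H/nrm_mem.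
by apply/nrmP => //; apply/H.
Qed.

Lemma nfW s r v : s <= r -> L r v -> L s v.
Proof.
move=> sr Lv; have [->|v0] := eqVneq v 0; first exact: nf0 HL _.
have Wv := nf_sub HL Lv; move: Lv.
by move=> /(nrmP _ Wv v0) H; apply/(nrmP _ Wv v0)/(le_trans sr).
Qed.

Lemma nf_act r v x : x != 0 -> W v -> L r (act x v) <-> L (r - nu x) v.
Proof.
move=> x0 Wv; split=> H.
  rewrite -(actK HW Adiv x0 Wv) -(nuV Hw) //.
  by apply: (nfZ HL) => //; exact: vge_nu.
by rewrite -[r](subrK (nu x)); apply: (nfZ HL) => //; exact: vge_nu.
Qed.

Lemma nrm_act x v : x != 0 -> W v -> v != 0 -> nrm L (act x v) = nrm L v + nu x.
Proof.
move=> x0 Wv v0; apply: nrm_eq; first exact: (rsZ HW).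
  exact: (act_neq0 HW).
move=> r; split; first by move/(nf_act _ x0 Wv)/(nrmP _ Wv v0); rewrite lerBlDr.
by move=> H; apply/(nf_act _ x0 Wv)/(nrmP _ Wv v0); rewrite lerBlDr.
Qed.

Lemma nfN r v : L r v -> L r (- v).
Proof.
move=> Lv; have Wv := nf_sub HL Lv.
rewrite -(act1 HW Wv) -(actNr HW) -[r]addr0; apply: (nfZ HL) => //.
by apply/(vgeN Hv); rewrite -(nu_one_aux Hv); exact: vge_nu.
Qed.

Lemma nfB r u v : L r u -> L r v -> L r (u - v).
Proof. by move=> Lu Lv; apply: (nfD HL) => //; exact: nfN. Qed.

Lemma nf_sum (J : Type) (s : seq J) (P : pred J) (F : J -> V) r :
  (forall i, P i -> L r (F i)) -> L r (\sum_(i <- s | P i) F i).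
Proof.
move=> H; elim/big_ind: _ => //; first exact: nf0 HL _.
by move=> x y; exact: nfD HL _ x y.
Qed.

(** In a vanishing combination the smallest norm of a term occurs at least twice: a single dominant
    term would equal minus a sum lying strictly deeper. The coefficients then account for the
    difference of the two norms. *)
Lemma nf_dominant n (u : 'I_n -> V) (x : 'I_n -> A) : (forall l, W (u l)) ->
  (forall l, u l != 0) -> comb act u x = 0 -> (exists m, x m != 0) ->
  exists l m, l != m /\ exists z, z != 0 /\ nrm L (u l) - nrm L (u m) = nu z.
Proof.
move=> Wu u0 x0 [m0 xm0].
have [m xm mmin] := fin_min (P := fun m => x m != 0) (fun l => nrm L (u l) + nu (x l)) xm0.
apply: contrapT => H.
have [l|r [rm rmin]] := fin_gap (P := fun l => (x l != 0) && (l != m))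
  (f := fun l => nrm L (u l) + nu (x l)) (al := nrm L (u m) + nu (x m)).
  move=> /andP[xl lm]; rewrite lt_neqAle mmin // andbT; apply/eqP => E; apply: H.
  exists l, m; split=> //; exists (x m * (x l)^-1).
  split; first by rewrite (mul_neq0 Hv) // (inv_neq0 Hw).
  by rewrite (nuM Hv) ?(inv_neq0 Hw) // (nuV Hw) //; move: E; lra.
have : L r (act (x m) (u m)).
  move: x0; rewrite /comb (bigD1 m) //= => /eqP; rewrite addr_eq0 => /eqP ->.
  apply: nfN; apply: nf_sum => l lm; have [->|xl] := eqVneq (x l) 0.
    by rewrite (act0r HW); exact: nf0 HL _.
  by apply/nrmP; rewrite ?nrm_act ?rmin ?xl ?lm //; [exact: (rsZ HW)|exact: (act_neq0 HW)].
move/nrmP; rewrite nrm_act // => /(_ (rsZ HW _ (Wu m)) (act_neq0 HW Adiv xm (Wu m) (u0 m))).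
by move: rm; lra.
Qed.

(** If the supremum were not attained, there would be arbitrarily many vectors of S with distinct
    norms within nu p of it. More of them than the dimension are dependent, so by [nf_dominant] two
    of their norms differ by a multiple of nu p, which the window excludes. *)
Lemma nf_max_on n (b : 'I_n -> V) (S : set V) B p : act_basis act W b ->
  uniformizer w p -> S !=set0 -> (forall v, S v -> W v /\ v != 0) ->
  (forall v, S v -> nrm L v <= B) ->
  exists2 v, S v & forall u, S u -> nrm L u <= nrm L v.
Proof.
move=> Hb up [u0 Su0] SW SB; apply: contrapT => H.
have next v : S v -> exists2 u, S u & nrm L v < nrm L u.
  move=> Sv; apply: contrapT => H'; apply: H; exists v => // u Su.
  by rewrite leNgt; apply/negP => uv; apply: H'; exists u.
have [p0 pp _] := uniformizer_nu Hw up.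
have Hs : has_sup [set nrm L v | v in S].
  split; first by exists (nrm L u0), u0.
  by exists B => _ [v Sv <-]; exact: SB.
set sp := sup [set nrm L v | v in S].
have le_sp v : S v -> nrm L v <= sp by move=> Sv; apply: ub_le_sup; [case: Hs | exists v].
have [_ [v0 Sv0 <-] v0s] := sup_adherent pp Hs.
(* The new vector, of larger norm than all the others, is put in front; the window (sp - nu p, sp]
   is preserved. *)
have chain k : exists u : 'I_k.+1 -> V, [/\ forall i, S (u i),
    forall i, sp - nu p < nrm L (u i), forall i, nrm L (u i) <= nrm L (u ord0)
    & forall i j, i != j -> nrm L (u i) != nrm L (u j)].
  elim: k => [|k [u [Su us um ui]]].
    by exists (fun=> v0); split=> // i j; rewrite !ord1 eqxx.
  have [v Sv uv] := next _ (Su ord0).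
  have lt_v i : nrm L (u i) < nrm L v by apply: le_lt_trans (um i) uv.
  exists (consf v u); split.
  - by apply/forall_ord_recl; split=> [|i]; rewrite ?consf0 ?consfS.
  - apply/forall_ord_recl; split=> [|i]; rewrite ?consf0 ?consfS //.
    exact: lt_trans (us ord0) uv.
  - by apply/forall_ord_recl; split=> [|i]; rewrite consf0 ?consfS // ltW.
  - move=> i j; case: (unliftP ord0 i) => [i'|] ->; case: (unliftP ord0 j) => [j'|] ->;
      rewrite ?consf0 ?consfS ?eqxx //.
    + by rewrite (inj_eq lift_inj) => /ui.
    + by move=> _; rewrite lt_eqF.
    + by move=> _; rewrite gt_eqF.
have [u [Su us _ ui]] := chain n.
have Wu l : W (u l) by case: (SW _ (Su l)).
have un0 l : u l != 0 by case: (SW _ (Su l)).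
have [x [x0 xm]] := dependent Adiv HW Hb Wu.
have [l [m [lm [z [z0 E]]]]] := nf_dominant Wu un0 x0 xm.
have [k kE] := nu_discr Hw up z0.
have := ui _ _ lm; move: (us l) (us m) (le_sp _ (Su l)) (le_sp _ (Su m)).
have [k0|k0] := eqVneq k 0; first by move: E; rewrite kE k0 mul0r; lra.
have : 1 <= `|k%:~R : R| by rewrite -intr_norm ler1z -gtz0_ge1 normr_gt0.
have : `|nrm L (u l) - nrm L (u m)| = `|k%:~R : R| * nu p.
  by rewrite E kE normrM [X in _ * X]gtr0_norm.
move=> Ek k1 h1 h2 h3 h4.
have : `|nrm L (u l) - nrm L (u m)| < nu p by rewrite ltr_norml; apply/andP; split; lra.
by rewrite Ek -[X in _ < X]mul1r ltr_pM2r // ltNge k1.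
Qed.

End Norm.
End Norms.

(** * Splitting bases for one norm and for two norms *)

Section LBNorm.
Variables (R : realType) (A : unitRingType) (w : A -> \bar R).
Hypothesis Hw : dvaluation w.
Notation nu := (nu_step w).
Notation LB := (LB w).
Let Hv := dv_val Hw.
Let Adiv := dv_div Hw.
Variables (V : zmodType) (act : A -> V -> V).
Implicit Types (W : set V) (L : R -> set V) (r s t : R) (u v : V) (x : A).

Section Fixed.
Variable W : set V.
Hypothesis HW : right_space act W.

Lemma LBE n (b : 'I_n -> V) a r v : act_basis act W b ->
  LB act b a r v <-> W v /\ forall l, vge w (r - a l) (crd act b v l).
Proof.
move=> Hb; split=> [[x xP <-]|[Wv xP]].
  by rewrite (crd_comb HW) //; split=> //; apply: (comb_W HW) => l; exact: (basisW Hb l).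
by exists (crd act b v) => //; rewrite (crdP HW).
Qed.

Lemma LB_attained n (b : 'I_n -> V) a v : act_basis act W b -> W v -> v != 0 ->
  exists m, crd act b v m != 0 /\
    forall r, LB act b a r v <-> r <= a m + nu (crd act b v m).
Proof.
move=> Hb Wv v0; set x := crd act b v.
have [m0 xm0] : exists m, x m != 0.
  apply: contrapT => H; move: v0; rewrite -(crdP HW Hb Wv) /comb big1 ?eqxx // => l _.
  have [E|E] := eqVneq (x l) 0; first by rewrite -/x E (act0r HW).
  by case: H; exists l.
have [m xm mmin] := fin_min (P := fun m => x m != 0) (fun l => a l + nu (x l)) xm0.
exists m; split=> // r; split=> [/(LBE _ _ _ Hb) [_ /(_ m)/(vgeE Hv _ xm)]|rm]; first lra.
apply/(LBE _ _ _ Hb); split=> // l; rewrite -/x.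
have [->|xl] := eqVneq (x l) 0; first exact: (vge0 Hv _).
by apply/(vgeE Hv _ xl); have := mmin _ xl; lra.
Qed.

Lemma LB_normfam n (b : 'I_n -> V) a : act_basis act W b -> normfam w act W (LB act b a).
Proof.
move=> Hb; split.
- by move=> r v /(LBE _ _ _ Hb) [].
- move=> r; apply/(LBE _ _ _ Hb); split; first exact: (rs0 HW).
  move=> l; rewrite -(comb0 HW b) (crd_comb HW) //; exact: (vge0 Hv _).
- move=> r _ _ [x xP <-] [y yP <-]; rewrite -(combD HW); exists (fun l => x l + y l) => //.
  by move=> l; apply: (vgeD Hv).
- move=> r t c _ [x xP <-] tc; rewrite -(combZ HW); exists (fun l => x l * c) => //.
  by move=> l; rewrite addrAC; apply: (vgeM Hv) => //.
- by move=> v Wv v0; have [m [_ H]] := LB_attained a Hb Wv v0; exists (a m + nu (crd act b v m)).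
- move=> lam Hl; have [C HC] := fin_lb (fun l => nu (lam (b l)) - a l).
  exists C => r _ [x xP <-]; rewrite (lform_comb HW Hl); last by move=> l; exact: (basisW Hb l).
  apply: (vge_sum Hv) => l _.
  by apply: vgeW (vgeM Hv (vge_nu Hv _) (xP l)); have := HC l; lra.
Qed.

Lemma LB_nrm n (b : 'I_n -> V) a v : act_basis act W b -> W v -> v != 0 ->
  exists2 m, crd act b v m != 0 & nrm (LB act b a) v = a m + nu (crd act b v m).
Proof.
move=> Hb Wv v0; have [m [xm H]] := LB_attained a Hb Wv v0; exists m => //.
exact: (nrm_eq (LB_normfam a Hb)).
Qed.

Lemma LB_b n (b : 'I_n -> V) a l r : act_basis act W b ->
  LB act b a r (b l) <-> r <= a l.
Proof.
move=> Hb; split=> [/(LBE _ _ _ Hb) [_ /(_ l)]|H].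
  rewrite (crd_b HW Hb) eqxx => /(vgeE Hv _ (oner_neq0 A)).
  by rewrite (nu_one_aux Hv); lra.
apply/(LBE _ _ _ Hb); split=> [|m]; first exact: (basisW Hb l).
rewrite (crd_b HW Hb); case: eqP => [->|_]; last exact: (vge0 Hv _).
by apply/(vgeE Hv _ (oner_neq0 A)); rewrite (nu_one_aux Hv); lra.
Qed.

Lemma nrm_LB n (b : 'I_n -> V) a l : act_basis act W b -> nrm (LB act b a) (b l) = a l.
Proof.
move=> Hb; apply: (nrm_eq (LB_normfam a Hb)); first exact: (basisW Hb l).
  exact: (basis_neq0 HW Hb).
by move=> r; exact: LB_b.
Qed.

Lemma nf_LB_sub n (b : 'I_n -> V) a L : normfam w act W L -> (forall l, L (a l) (b l)) ->
  forall r v, LB act b a r v -> L r v.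
Proof.
move=> HL Hab r _ [x xP <-]; apply: (nf_sum HL) => l _.
by rewrite -[r](subrKC (a l)); apply: (nfZ HL).
Qed.

(** The coordinate at which the norm of v is attained, rescaled to take the value 1 at v, is a form
    of least possible norm; with it v splits off as a direct factor. *)
Lemma norm_form L n (b : 'I_n -> V) a v : act_basis act W b -> L = LB act b a ->
  W v -> v != 0 -> exists lam, [/\ lform act W lam, lam v = 1 &
    forall r u, L r u -> vge w (r - nrm L v) (lam u)].
Proof.
move=> Hb -> Wv v0; have [m xm E] := LB_nrm a Hb Wv v0.
have Hl := crd_lform HW m Hb; set y := crd act b v m in xm E *.
exists (fun u => y^-1 * crd act b u m); split.
- split=> [u u' Wu Wu'|c u Wu]; first by rewrite (lformD Hl) // mulrDr.
  by rewrite (lformZ Hl) // mulrA.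
- by rewrite mulVr // Adiv.
- move=> r u /(LBE _ _ _ Hb) [Wu /(_ m) H].
  apply/(vge_mull Hw); first exact: (inv_neq0 Hw xm).
  by rewrite E (nuV Hw) //; apply: vgeW H; lra.
Qed.

(** The difference of the two norms is invariant under scaling, and scaling brings the norm of a
    vector under LB b a to one of the finitely many a l. On each of these sets [nf_max_on] maximizes
    the norm of L. *)
Lemma max_ratio L n (b : 'I_n.+1 -> V) a : act_basis act W b -> normfam w act W L ->
  exists v, [/\ W v, v != 0 & forall u, W u -> u != 0 ->
    nrm L u - nrm (LB act b a) u <= nrm L v - nrm (LB act b a) v].
Proof.
move=> Hb HL; set L' := LB act b a; have HL' := LB_normfam a Hb.
have [p up] := dv_unif Hw.
have [C HC] := choice (fun m => nf_bd HL (crd_lform HW m Hb)).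
pose S l := [set u | [/\ W u, u != 0 & nrm L' u = a l]].
have /choice [v vP] : forall l, exists v, S l v /\
    forall u, S l u -> nrm L u <= nrm L v.
  move=> l; have [D HD] := fin_lb (fun m => a m + C m).
  have [||u [Wu u0 Eu]|v Sv vmax] :=
    nf_max_on Hw HW HL (S := S l) (B := a l - D) Hb up; last by exists v.
  - exists (b l); split; [exact: (basisW Hb l) | exact: (basis_neq0 HW Hb) | exact: nrm_LB].
  - by move=> u [].
  have [m xm E] := LB_nrm a Hb Wu u0.
  have /(vgeE Hv _ xm) := HC m _ _ (nrm_mem HL Wu); have := HD m.
  by move: Eu; rewrite E; lra.
have [m _ mmin] := fin_min (P := predT) (fun l => a l - nrm L (v l)) (erefl true : predT ord0).
have [[Wm m0 Em] _] := vP m.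
exists (v m); split=> // u Wu u0.
have [l xl E] := LB_nrm a Hb Wu u0; set y := crd act b u l in xl E.
have y0 := inv_neq0 Hw xl.
have /((vP l).2) : S l (act y^-1 u).
  split; [exact: (rsZ HW) | exact: (act_neq0 HW)|].
  by rewrite (nrm_act Hw HW HL') // (nuV Hw) // E; lra.
by rewrite (nrm_act Hw HW HL) // (nuV Hw) //; have := mmin l isT; rewrite E Em; lra.
Qed.

(** A form that is optimal for L' at v is optimal for L as well, since the ratio is largest at v.
    Hence one and the same form splits v off both norms. *)
Lemma ratio_form L L' n (b : 'I_n -> V) a v : act_basis act W b -> L' = LB act b a ->
  normfam w act W L -> W v -> v != 0 ->
  (forall u, W u -> u != 0 -> nrm L u - nrm L' u <= nrm L v - nrm L' v) ->
  exists lam, [/\ lform act W lam, lam v = 1,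
    forall r u, L r u -> vge w (r - nrm L v) (lam u) &
    forall r u, L' r u -> vge w (r - nrm L' v) (lam u)].
Proof.
move=> Hb E HL Wv v0 H; have HL' : normfam w act W L' by rewrite E; exact: LB_normfam.
have [lam [Hl lv HL'l]] := norm_form Hb E Wv v0; exists lam; split=> // r u Lu.
have Wu := nf_sub HL Lu; have [->|u0] := eqVneq u 0.
  by rewrite (lform0 HW Hl); exact: (vge0 Hv _).
apply: vgeW (HL'l _ _ (nrm_mem HL' Wu)).
by have := H _ Wu u0; move/(nrmP HL _ Wu u0): Lu; lra.
Qed.

Lemma ker_normfam L lam v : normfam w act W L -> lform act W lam -> W v -> lam v = 1 ->
  (forall r u, L r u -> vge w (r - nrm L v) (lam u)) ->
  normfam w act [set u | W u /\ lam u = 0] (fun r => [set u | L r u /\ lam u = 0]).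
Proof.
move=> HL Hl Wv lv Lb; split=> /=.
- by move=> r u [Lu u0]; split=> //; exact: (nf_sub HL Lu).
- by move=> r; split; [exact: (nf0 HL _) | exact: (lform0 HW)].
- move=> r u u' [Lu u0] [Lu' u0']; split; first exact: (nfD HL).
  by rewrite (lformD Hl (nf_sub HL Lu) (nf_sub HL Lu')) u0 u0' addr0.
- move=> r t c u [Lu u0] tc; split; first exact: (nfZ HL).
  by rewrite (lformZ Hl _ (nf_sub HL Lu)) u0 mul0r.
- move=> u [Wu lu] u0; have [al H] := nf_val HL Wu u0; exists al => r.
  by split=> [[/H]|/H].
- move=> mu Hm; pose mu' u := mu (u - act (lam u) v).
  have Wp u : W u -> [set u | W u /\ lam u = 0] (u - act (lam u) v).
    move=> Wu; split; first by apply: (rsB HW) => //; exact: (rsZ HW).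
    rewrite (lformB HW Hl) ?(lformZ Hl) ?lv ?mul1r ?subrr //; exact: (rsZ HW).
  have Hm' : lform act W mu'.
    split=> [u u' Wu Wu'|c u Wu]; rewrite /mu'.
      rewrite -(lformD Hm); [|exact: Wp|exact: Wp]; congr mu.
      by rewrite (lformD Hl) // (actDl HW) opprD addrACA.
    rewrite -(lformZ Hm); last exact: Wp.
    by rewrite (lformZ Hl) // (actDr HW) (actrN HW) (actM HW).
  have [C HC] := nf_bd HL Hm'; exists C => r u [Lu lu].
  by have := HC _ _ Lu; rewrite /mu' lu (act0r HW) subr0.
Qed.

Lemma cons_basis n (b1 : 'I_n -> V) lam v : lform act W lam -> W v -> lam v = 1 ->
  act_basis act [set u | W u /\ lam u = 0] b1 -> act_basis act W (consf v b1).
Proof.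
move=> Hl Wv lv Hb1; have HK := ker_right_space HW Hl.
have [Kb Sb Ib] := iffLR (basisP HK b1) Hb1.
apply/(basisP HW); split.
- by apply/forall_ord_recl; split=> [|l]; rewrite ?consf0 ?consfS //; case: (Kb l).
- move=> u Wu; have [|x ux] := Sb (u - act (lam u) v).
    split; first by apply: (rsB HW) => //; exact: (rsZ HW).
    rewrite (lformB HW Hl) ?(lformZ Hl) ?lv ?mul1r ?subrr //; exact: (rsZ HW).
  by exists (consf (lam u) x); rewrite comb_cons -ux subrKC.
- move=> x; rewrite -[x]consf_eta comb_cons => x0.
  have Wc : W (comb act b1 (fun l => x (lift ord0 l))).
    by apply: (comb_W HW) => l; case: (Kb l).
  have xl0 : x ord0 = 0.
    have := congr1 lam x0; rewrite (lform0 HW Hl) (lformD Hl) ?(lformZ Hl) //; last exact: (rsZ HW).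
    rewrite lv mul1r (lform_comb HW Hl); last by move=> l; case: (Kb l).
    by rewrite big1 ?addr0 // => l _; case: (Kb l) => _ ->; rewrite mul0r.
  move: x0; rewrite xl0 (act0r HW) add0r => /Ib x0.
  by apply/forall_ord_recl; split=> [|l]; rewrite ?consf0 ?consfS.
Qed.

Lemma cons_LB L n (b1 : 'I_n -> V) a1 lam v : normfam w act W L -> lform act W lam ->
  W v -> lam v = 1 -> (forall r u, L r u -> vge w (r - nrm L v) (lam u)) ->
  act_basis act [set u | W u /\ lam u = 0] b1 ->
  (fun r => [set u | L r u /\ lam u = 0]) = LB act b1 a1 ->
  L = LB act (consf v b1) (consf (nrm L v) a1).
Proof.
move=> HL Hl Wv lv Lb Hb1 E; apply/funext => r; apply/seteqP; split=> u.
  move=> Lu; have Wu := nf_sub HL Lu.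
  have : LB act b1 a1 r (u - act (lam u) v).
    rewrite -E; split.
      apply: (nfB Hw HW HL) => //; rewrite -[r](subrKC (nrm L v)).
      by apply: (nfZ HL); [exact: (nrm_mem HL Wv) | exact: Lb].
    rewrite (lformB HW Hl) ?(lformZ Hl) ?lv ?mul1r ?subrr //; exact: (rsZ HW).
  move=> [x xP Ex]; exists (consf (lam u) x).
    by apply/forall_ord_recl; split=> [|l]; rewrite ?consf0 ?consfS //; exact: Lb.
  by rewrite comb_cons Ex subrKC.
apply: (nf_LB_sub HL); apply/forall_ord_recl.
split=> [|l]; rewrite ?consf0 ?consfS; first exact: (nrm_mem HL Wv).
suff : (fun r => [set u | L r u /\ lam u = 0]) (a1 l) (b1 l) by case.
have := congr1 (fun F : R -> set V => F (a1 l) (b1 l)) E => /= ->.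
exists (fun m => (m == l)%:R).
  move=> m; case: eqP => [->|_]; last exact: (vge0 Hv _).
  by apply/(vgeE Hv _ (oner_neq0 A)); rewrite (nu_one_aux Hv) subrr.
rewrite (comb_delta (ker_right_space HW Hl)) //; exact: (basisW Hb1).
Qed.

End Fixed.

Lemma normfam_LB n W (b : 'I_n -> V) L : right_space act W -> act_basis act W b ->
  normfam w act W L ->
  exists (b' : 'I_n -> V) a, act_basis act W b' /\ L = LB act b' a.
Proof.
elim: n W b L => [|n IH] W b L HW Hb HL.
  exists b, (fun=> 0); split=> //; apply/funext => r; apply/seteqP; split=> v.
    move=> /(nf_sub HL) Wv; rewrite (basis0 HW Hb Wv).
    exact: nf0 (LB_normfam HW _ Hb) _.
  move=> /(nf_sub (LB_normfam HW _ Hb)) Wv; rewrite (basis0 HW Hb Wv).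
  exact: (nf0 HL _).
have [v [Wv v0 vmax]] := max_ratio HW (fun=> 0) Hb HL.
have [lam [Hl lv Ll _]] := ratio_form HW Hb erefl HL Wv v0 vmax.
have lv0 : lam v != 0 by rewrite lv oner_neq0.
have [b1 Hb1] := ker_basis HW Adiv Hb Hl Wv lv0.
have [b2 [a2 [Hb2 E]]] := IH _ _ _ (ker_right_space HW Hl) Hb1 (ker_normfam HW HL Hl Wv lv Ll).
exists (consf v b2), (consf (nrm L v) a2); split; first exact: (cons_basis HW Hl Wv lv Hb2).
exact: (cons_LB HW HL Hl Wv lv Ll Hb2 E).
Qed.

(** Two norms have a common splitting basis: the vector of maximal ratio splits off both with the
    same complement, and the induction continues in that complement. *)
Lemma normfam_LB2 n W (b : 'I_n -> V) L L' : right_space act W -> act_basis act W b ->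
  normfam w act W L -> normfam w act W L' ->
  exists (b' : 'I_n -> V) a a',
    [/\ act_basis act W b', L = LB act b' a & L' = LB act b' a'].
Proof.
elim: n W b L L' => [|n IH] W b L L' HW Hb HL HL'.
  have [b1 [a1 [Hb1 E1]]] := normfam_LB HW Hb HL.
  have [b2 [a2 [Hb2 E2]]] := normfam_LB HW Hb HL'.
  exists b1, a1, a2; split=> //; rewrite E2; congr LB.
  by apply/funext => -[].
have [b0 [a0 [Hb0 E0]]] := normfam_LB HW Hb HL'.
have [v [Wv v0]] := max_ratio HW a0 Hb0 HL; rewrite -E0 => vmax.
have [lam [Hl lv Ll Ll']] := ratio_form HW Hb0 E0 HL Wv v0 vmax.
have lv0 : lam v != 0 by rewrite lv oner_neq0.
have [b1 Hb1] := ker_basis HW Adiv Hb Hl Wv lv0.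
have [b2 [a2 [a2' [Hb2 E E']]]] := IH _ _ _ _ (ker_right_space HW Hl) Hb1
  (ker_normfam HW HL Hl Wv lv Ll) (ker_normfam HW HL' Hl Wv lv Ll').
exists (consf v b2), (consf (nrm L v) a2), (consf (nrm L' v) a2').
split; first exact: (cons_basis HW Hl Wv lv Hb2).
  exact: (cons_LB HW HL Hl Wv lv Ll Hb2 E).
exact: (cons_LB HW HL' Hl Wv lv Ll' Hb2 E').
Qed.

End LBNorm.

(** * Lattice functions as norms, and their convex combinations *)

Section LatticeFunction.
Variables (R : realType) (A : unitRingType) (w : A -> \bar R).
Hypothesis Hw : dvaluation w.
Notation nu := (nu_step w).
Notation LB := (LB w).
Let Hv := dv_val Hw.
Let Adiv := dv_div Hw.
Variables (V : zmodType) (act : A -> V -> V) (W : set V).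
Hypothesis HW : right_space act W.
Variable step : A -> R.
Hypothesis Hstep : forall p, uniformizer w p -> step p = nu p.
Implicit Types (L : R -> set V) (M : set V) (r s t : R) (u v : V) (c p : A).

Lemma latticeP M : lattice w act W M -> exists n (g : 'I_n -> V),
  [/\ forall l, W (g l), forall v, W v -> exists x, v = comb act g x &
      forall v, M v <-> exists2 x, v = comb act g x & forall l, vge w 0 (x l)].
Proof.
move=> [n [g0 [EW EM]]]; pose g l := act 1 (g0 l).
have gE x : \sum_l act (x l) (g0 l) = comb act g x.
  by apply: eq_bigr => l _; rewrite /g -(actM HW) mul1r.
exists n, g; split.
- move=> l; rewrite EW; exists (fun m => (m == l)%:R) => //.
  rewrite (bigD1 l) //= eqxx big1 ?addr0 // => m /negbTE ->.
  by rewrite (act0r HW).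
- by move=> v; rewrite {1}EW => -[x _ <-]; exists x.
- move=> v; rewrite EM; split=> [[x xP <-]|[x -> xP]]; first by exists x.
  by exists x.
Qed.

Lemma LF_basis L : lattice_function w act W step L ->
  exists n (b : 'I_n -> V), act_basis act W b.
Proof.
case=> /(_ 0) /latticeP [n [g [Wg Sg _]]] _ _ _.
exact: (spanning_basis HW Adiv Wg Sg).
Qed.

Lemma unif_decomp p c : uniformizer w p -> c != 0 ->
  exists z : int, exists c0, [/\ c = p ^ z * c0, vge w 0 c0 & nu c = z%:~R * nu p].
Proof.
move=> up c0; have [z E] := nu_discr Hw up c0; have [p0 _ _] := uniformizer_nu Hw up.
exists z, ((p ^ z)^-1 * c).
have pz := expz_neq0 Hw z p0; split=> //; first by rewrite mulVKr // Adiv.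
apply/(vge_mull Hw); first exact: (inv_neq0 Hw).
by rewrite (nuV Hw) // (nuXz Hw) // -E; apply: vgeW (vge_nu Hv _); lra.
Qed.

Section Shift.
Variables (L : R -> set V) (p : A).
Hypothesis HL : lattice_function w act W step L.
Hypothesis up : uniformizer w p.
Let p0 : p != 0. Proof. by case: (uniformizer_nu Hw up). Qed.
Let pp : 0 < nu p. Proof. by case: (uniformizer_nu Hw up). Qed.

Lemma LF_sub r v : L r v -> W v.
Proof.
have [/(_ r)/latticeP [n [g [Wg _ H]]] _ _ _] := HL.
by move/H => [x -> _]; exact: (comb_W HW).
Qed.

Lemma LF_shift1 r v : W v -> L r v <-> L (r + nu p) (act p v).
Proof.
have [_ _ _ /(_ _ up r)] := HL; rewrite Hstep // => <- Wv.
split=> [Lv|[v' Lv' E]]; first by exists v.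
by rewrite -(actK HW Adiv p0 Wv) -E (actK HW Adiv p0 (LF_sub Lv')).
Qed.

Lemma LF_shift (z : int) r v : W v -> L r v <-> L (r + z%:~R * nu p) (act (p ^ z) v).
Proof.
have Hn (n : nat) r' v' : W v' -> L r' v' <-> L (r' + n%:R * nu p) (act (p ^+ n) v').
  elim: n r' v' => [|n IH] r' v' Wv'.
    by rewrite expr0 (act1 HW) // mul0r addr0.
  rewrite (IH _ _ Wv') exprSr (actM HW) (LF_shift1 _ (rsZ HW _ Wv')).
  by rewrite -addrA -{2}[nu p]mul1r -mulrDl natr1.
move=> Wv; case: z => n; first by rewrite -exprnP; exact: Hn.
rewrite NegzE -exprz_inv -exprnP.
rewrite [X in _ <-> X](Hn n.+1) -?(actM HW); last exact: (rsZ HW).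
rewrite exprVn mulVr ?(act1 HW) // ?Adiv ?(exp_neq0 Hv) //.
by rewrite mulrNz -addrA mulNr addNr addr0.
Qed.

(** Powers of a uniformizer move every index close to 0, so the finite generation of the single
    lattice L 0 bounds all linear forms; these bounds make the supremum finite, and left continuity
    makes it attained. *)
Lemma LF_normfam : normfam w act W L.
Proof.
have [HLat Hanti Hcont _] := HL.
have anti r s v : s <= r -> L r v -> L s v.
  by rewrite le_eqVlt => /orP[/eqP -> //|sr]; exact: Hanti.
have bd lam : lform act W lam -> exists C, forall r v, L r v -> vge w (r + C) (lam v).
  move=> Hl; have [n [g [Wg Sg H]]] := latticeP (HLat 0).
  have [C HC] := fin_lb (fun l => nu (lam (g l))).
  (* The loss nu p bounds the distance from r to the largest multiple of nu p below it. *)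
  exists (C - nu p) => r v Lv; have Wv := LF_sub Lv.
  pose z := Num.floor (r / nu p).
  have h1 : z%:~R <= r / nu p by exact: floor_le.
  have h2 : r / nu p < (z + 1)%:~R by case/andP: (floor_itv (r / nu p)).
  rewrite ler_pdivlMr // in h1; rewrite ltr_pdivrMr // intrD in h2.
  have := anti _ _ _ h1 Lv.
  move=> /(LF_shift (- z)) -/(_ Wv); rewrite mulrNz mulNr subrr => /H [x xE xP].
  have : vge w C (lam (act (p ^ (- z)) v)).
    rewrite xE (lform_comb HW Hl) //; apply: (vge_sum Hv) => l _.
    by rewrite -[C]addr0; apply: (vgeM Hv) => //; apply: vgeW (vge_nu Hv _).
  rewrite (lformZ Hl) // => /(vge_mulr Hw _ _ (expz_neq0 Hw _ p0)).
  by rewrite (nuXz Hw) // mulrNz; apply: vgeW; lra.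
split=> //.
- exact: LF_sub.
- move=> r; have [n [g [_ _ H]]] := latticeP (HLat r).
  by apply/H; exists (fun=> 0); [rewrite (comb0 HW) | move=> l; exact: (vge0 Hv)].
- move=> r u v; have [n [g [_ _ H]]] := latticeP (HLat r).
  move=> /H [x -> xP] /H [y -> yP]; apply/H; exists (fun l => x l + y l).
    by rewrite (combD HW).
  by move=> l; exact: (vgeD Hv).
- move=> r t c v Lv tc; have Wv := LF_sub Lv.
  have [c0|c0] := eqVneq c 0.
    rewrite c0 (act0r HW); have [n [g [_ _ H]]] := latticeP (HLat (r + t)).
    by apply/H; exists (fun=> 0); [rewrite (comb0 HW) | move=> l; exact: (vge0 Hv)].
  have [z [d [E vd nE]]] := unif_decomp up c0.
  apply: (anti (r + nu c)); first by rewrite lerD2l; apply/(vgeE Hv _ c0).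
  rewrite E (actM HW) -E nE; move: Lv => /(LF_shift z) -/(_ Wv).
  have [n [g [_ _ H]]] := latticeP (HLat (r + z%:~R * nu p)).
  move=> /H [x -> xP]; apply/H; exists (fun l => x l * d); first by rewrite (combZ HW).
  by move=> l; rewrite -[0](addr0 0); exact: (vgeM Hv).
move=> v Wv v0.
have [n [g [_ Sg H]]] := latticeP (HLat 0).
have [x vE] := Sg _ Wv.
have [C HC] := fin_lb (fun l => nu (x l)).
have [m [b Hb]] := LF_basis HL.
have [l xl] : exists l, crd act b v l != 0.
  apply: contrapT => H'; move: v0; rewrite -(crdP HW Hb Wv) /comb big1 ?eqxx // => l _.
  have [E|E] := eqVneq (crd act b v l) 0; first by rewrite E (act0r HW).
  by case: H'; exists l.
have [D HD] := bd _ (crd_lform HW l Hb).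
have ub t : L t v -> t <= nu (crd act b v l) - D.
  by move=> /HD /(vgeE Hv _ xl); lra.
have [t0 Lt0] : exists t, L t v.
  pose z := Num.floor (C / nu p); exists (z%:~R * nu p).
  have h1 : z%:~R <= C / nu p by exact: floor_le.
  rewrite ler_pdivlMr // in h1.
  apply/(LF_shift (- z)) => //; rewrite mulrNz mulNr subrr; apply/H.
  exists (fun l => x l * p ^ (- z)); first by rewrite (combZ HW) -vE.
  move=> l'; apply/(vge_mulr Hw); first exact: (expz_neq0 Hw).
  rewrite (nuXz Hw) // mulrNz; apply: vgeW (vge_nu Hv _); have := HC l'; lra.
have Hs : has_sup [set t | L t v].
  by split; [exists t0 | exists (nu (crd act b v l) - D) => t /ub].
exists (sup [set t | L t v]) => r; split=> [Lr|]; first by apply: ub_le_sup => //; case: Hs.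
move=> rs; apply: (anti _ _ _ rs); rewrite Hcont => t /= ts.
have e0 : 0 < sup [set t | L t v] - t by rewrite subr_gt0.
have [s Ls] := sup_adherent e0 Hs; rewrite subKr => /ltW ts'.
exact: (anti _ _ _ ts' Ls).
Qed.

End Shift.

Lemma nf_continuous L r : normfam w act W L ->
  L r = \bigcap_(t in [set t | t < r]) L t.
Proof.
move=> HL; apply/seteqP; split=> v; first by move=> Lv t /= /ltW tr; exact: (nfW HL tr Lv).
move=> H; have Wv : W v by apply: (nf_sub HL (r := r - 1)); apply: H => /=; lra.
have [->|v0] := eqVneq v 0; first exact: (nf0 HL).
apply/(nrmP HL _ Wv v0); rewrite leNgt; apply/negP => rn.
have /H /(nrmP HL _ Wv v0) : (r + nrm L v) / 2 < r by lra.
lra.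
Qed.

(** The values of w are multiples of nu p, so the bound r - a l may be rounded up to the next
    multiple, and the coordinate condition becomes divisibility by a power of p. *)
Lemma LB_lattice n (b : 'I_n -> V) a r : act_basis act W b -> lattice w act W (LB act b a r).
Proof.
move=> Hb; have [p up] := dv_unif Hw; have [p0 pp pmin] := uniformizer_nu Hw up.
pose c l := p ^ (Num.ceil ((r - a l) / nu p)).
have c0 l : c l != 0 by exact: (expz_neq0 Hw).
have cP l x : vge w (r - a l) x <-> vge w (nu (c l)) x.
  have -> : nu (c l) = (Num.ceil ((r - a l) / nu p))%:~R * nu p by rewrite (nuXz Hw).
  set z := Num.ceil _; have h1 : (r - a l) / nu p <= z%:~R by exact: ceil_ge.
  rewrite ler_pdivrMr // in h1; split; last exact: vgeW.
  have [->|x0] := eqVneq x 0; first by move=> _; exact: (vge0 Hv).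
  have [y E] := nu_discr Hw up x0.
  move=> /(vgeE Hv _ x0); rewrite E => h2; apply/(vgeE Hv _ x0); rewrite E.
  rewrite ler_pM2r // ler_int /z ceil_le_int ?ler_pdivrMr //.
exists n, (fun l => act (c l) (b l)); split; apply/seteqP; split=> v.
- move=> Wv; exists (fun l => (c l)^-1 * crd act b v l) => //.
  rewrite -[RHS](crdP HW Hb Wv); apply: eq_bigr => l _.
  by rewrite -(actM HW) mulVKr // Adiv.
- move=> [x _ <-]; apply: (rs_sum HW) => l _; apply: (rsZ HW); apply: (rsZ HW).
  exact: (basisW Hb).
- move=> [x xP <-]; exists (fun l => (c l)^-1 * x l).
    move=> l; have /cP H := xP l; apply/(vge_mull Hw); first exact: (inv_neq0 Hw).
    by rewrite (nuV Hw) // opprK add0r.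
  by apply: eq_bigr => l _; rewrite -(actM HW) mulVKr // Adiv.
- move=> [x xP <-]; exists (fun l => c l * x l).
    by move=> l; apply/cP/(vge_mull Hw) => //; rewrite subrr; exact: xP.
  by apply: eq_bigr => l _; rewrite -(actM HW).
Qed.

Lemma normfam_LF n (b : 'I_n -> V) L : act_basis act W b -> normfam w act W L ->
  lattice_function w act W step L.
Proof.
move=> Hb HL; have [b' [a [Hb' E]]] := normfam_LB Hw HW Hb HL; split.
- by move=> r; rewrite E; exact: LB_lattice.
- by move=> r s rs v; apply: (nfW HL); exact: ltW.
- by move=> r; exact: nf_continuous.
- move=> p up r; have [p0 _ _] := uniformizer_nu Hw up; rewrite Hstep //.
  apply/seteqP; split=> v.
    by move=> [u Lu <-]; apply: (nfZ HL) => //; exact: (vge_nu Hv).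
  move=> Lv; have Wv := nf_sub HL Lv; exists (act p^-1 v); last by rewrite (actVK HW).
  by apply/(nf_act Hw HW HL _ (inv_neq0 Hw p0) Wv); rewrite (nuV Hw) // opprK.
Qed.

Lemma translate_normfam L s : normfam w act W L -> normfam w act W (lf_translate L s).
Proof.
move=> HL; rewrite /lf_translate; split.
- by move=> r v; exact: (nf_sub HL).
- by move=> r; exact: (nf0 HL).
- by move=> r u v; exact: (nfD HL).
- by move=> r t c v Lv tc; rewrite addrAC; exact: (nfZ HL).
- move=> v Wv v0; exists (nrm L v + s) => r.
  by rewrite (nrmP HL _ Wv v0) lerBlDr.
- move=> lam Hl; have [C HC] := nf_bd HL Hl; exists (C - s) => r v /HC.
  by rewrite addrAC addrA.
Qed.

Lemma nrm_translate L s v : normfam w act W L -> W v -> v != 0 ->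
  nrm (lf_translate L s) v = nrm L v + s.
Proof.
move=> HL Wv v0; apply: (nrm_eq (translate_normfam s HL)) => // r.
by rewrite /lf_translate (nrmP HL _ Wv v0) lerBlDr.
Qed.

Lemma translate_LB n (b : 'I_n -> V) a s :
  lf_translate (LB act b a) s = LB act b (fun l => a l + s).
Proof.
apply/funext => r; rewrite /lf_translate /LB; congr (image _ _).
apply/seteqP; split=> x /= xP l; move: (xP l); apply: vgeW; lra.
Qed.

(* [L3 = c L1 + (1 - c) L2] *)
Definition conv (c : R) L1 L2 L3 : Prop :=
  exists n (b : 'I_n -> V) a1 a2, [/\ act_basis act W b, L1 = LB act b a1,
    L2 = LB act b a2 & L3 = LB act b (fun l => c * a1 l + (1 - c) * a2 l)].

(** An inequality that mentions no basis. Applied to the splitting basis of another combination of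
    the same norms it gives an inclusion, and by symmetry [conv_uniq]. *)
Lemma conv_ge (c : R) L1 L2 L3 r s v : 0 <= c <= 1 -> conv c L1 L2 L3 ->
  L1 r v -> L2 s v -> L3 (c * r + (1 - c) * s) v.
Proof.
move=> /andP[c0 c1] [n [b [a1 [a2 [Hb -> -> ->]]]]].
move=> /(LBE w HW _ _ _ Hb) [Wv H1] /(LBE w HW _ _ _ Hb) [_ H2].
apply/(LBE w HW _ _ _ Hb); split=> // l.
have [->|x0] := eqVneq (crd act b v l) 0; first exact: (vge0 Hv).
have /(vgeE Hv _ x0) h1 := H1 l; have /(vgeE Hv _ x0) h2 := H2 l.
by apply/(vgeE Hv _ x0); nra.
Qed.

Lemma conv_sub (c : R) L1 L2 L3 L3' : 0 <= c <= 1 -> conv c L1 L2 L3 -> conv c L1 L2 L3' ->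
  forall r v, L3' r v -> L3 r v.
Proof.
move=> c01 H [n [b [a1 [a2 [Hb E1 E2 ->]]]]]; apply: nf_LB_sub => [|l].
  by case: H => m [b' [? [? [Hb' _ _ ->]]]]; exact: (LB_normfam Hw HW _ Hb').
by apply: (conv_ge c01 H); rewrite ?E1 ?E2; apply/(LB_b Hw HW).
Qed.

Lemma conv_uniq (c : R) L1 L2 L3 L3' : 0 <= c <= 1 ->
  conv c L1 L2 L3 -> conv c L1 L2 L3' -> L3 = L3'.
Proof.
move=> c01 H H'; apply/funext => r; apply/seteqP; split=> v.
  exact: (conv_sub c01 H' H).
exact: (conv_sub c01 H H').
Qed.

Lemma conv_nf (c : R) L1 L2 L3 : conv c L1 L2 L3 ->
  [/\ normfam w act W L1, normfam w act W L2 & normfam w act W L3].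
Proof.
by move=> [n [b [a1 [a2 [Hb -> -> ->]]]]]; split; exact: (LB_normfam Hw HW _ Hb).
Qed.

Lemma conv_ex n (b : 'I_n -> V) (c : R) L1 L2 : act_basis act W b ->
  normfam w act W L1 -> normfam w act W L2 -> exists L3, conv c L1 L2 L3.
Proof.
move=> Hb H1 H2; have [b' [a1 [a2 [Hb' E1 E2]]]] := normfam_LB2 Hw HW Hb H1 H2.
by exists (LB act b' (fun l => c * a1 l + (1 - c) * a2 l)), n, b', a1, a2.
Qed.

Lemma lf_normE L v : normfam w act W L -> W v -> v != 0 -> lf_norm L v = (nrm L v)%:E.
Proof.
move=> HL Wv v0; rewrite /lf_norm; apply/eqP; rewrite eq_le; apply/andP; split.
  by apply: ge_ereal_sup => _ [t /= /(nrmP HL _ Wv v0) tn <-]; rewrite lee_fin.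
by apply: ereal_sup_ubound; exists (nrm L v) => //; exact: (nrm_mem HL).
Qed.

Lemma split_LB L n (b : 'I_n -> V) : normfam w act W L -> act_basis act W b ->
  split_by (fun l => range (act^~ (b l))) L <-> exists a, L = LB act b a.
Proof.
move=> HL Hb; have Wb := basisW Hb; have b0 := basis_neq0 HW Hb; split.
  move=> H; exists (fun l => nrm L (b l)); apply/funext => r; rewrite H.
  apply/seteqP; split=> v.
    move=> [u uP <-].
    have /choice [x xP] : forall l, exists x, act x (b l) = u l.
      by move=> l; have [[x _ E] _] := uP l; exists x.
    exists x.
      move=> l; have [->|x0] := eqVneq (x l) 0; first exact: (vge0 Hv).
      have := (uP l).2; rewrite -(xP l).
      move=> /(nf_act Hw HW HL _ x0 (Wb l))/(nrmP HL _ (Wb l) (b0 l)) h.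
      by apply/(vgeE Hv _ x0); lra.
    by apply: eq_bigr => l _; exact: xP.
  move=> [x xP <-]; exists (fun l => act (x l) (b l)) => // l; split; first by exists (x l).
  rewrite -[r](subrKC (nrm L (b l))); apply: (nfZ HL) => //; exact: (nrm_mem HL).
move=> [a ->] r; apply/seteqP; split=> v.
  move=> [x xP <-]; exists (fun l => act (x l) (b l)) => // l; split; first by exists (x l).
  rewrite -[r](subrKC (a l)); apply: (nfZ (LB_normfam Hw HW a Hb)) => //.
  exact/(LB_b Hw HW).
move=> [u uP <-]; apply: (nf_sum (LB_normfam Hw HW a Hb)) => l _; exact: (uP l).2.
Qed.

Lemma convex_combP (c : R) L1 L2 L3 : normfam w act W L1 -> normfam w act W L2 ->
  normfam w act W L3 -> convex_comb act W c L1 L2 L3 <-> conv c L1 L2 L3.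
Proof.
move=> H1 H2 H3; split.
  move=> [n [b /= [Hb /(split_LB H1 Hb) [a1 E1] /(split_LB H2 Hb) [a2 E2] ]]].
  move=> /(split_LB H3 Hb) [a3 E3] H; exists n, b, a1, a2; split=> //; rewrite E3.
  congr LB; apply/funext => l; have := H l.
  have Wb := basisW Hb l; have b0 := basis_neq0 HW Hb l.
  rewrite !lf_normE // E1 E2 E3 !(nrm_LB Hw HW) //.
  by rewrite -!EFinM -EFinD => -[].
move=> [n [b [a1 [a2 [Hb E1 E2 E3]]]]]; exists n, b; split=> //.
- by apply/(split_LB H1 Hb); exists a1.
- by apply/(split_LB H2 Hb); exists a2.
- by apply/(split_LB H3 Hb); eexists; exact: E3.
move=> l; have Wb := basisW Hb l; have b0 := basis_neq0 HW Hb l.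
by rewrite !lf_normE // E1 E2 E3 !(nrm_LB Hw HW) // -!EFinM -EFinD.
Qed.

End LatticeFunction.

(** * Complete valuations and their extensions *)

Definition val_complete (R : realType) (A : zmodType) (w : A -> \bar R) : Prop :=
  forall u : nat -> A,
    (forall M : R, exists N, forall m n, (N <= m)%N -> (N <= n)%N -> vge w M (u m - u n)) ->
    exists l, forall M : R, exists N, forall n, (N <= n)%N -> vge w M (u n - l).

Lemma le_mulrn_bound (R : realType) (x y C : R) :
  (forall n : nat, x *+ n + C <= y *+ n) -> x <= y.
Proof.
move=> H; rewrite leNgt; apply/negP => yx.
have d0 : 0 < x - y by rewrite subr_gt0.
have [n Hn] : exists n : nat, - C < (x - y) *+ n.
  exists (Num.truncn (`|C| / (x - y))).+1.
  have := truncnS_gt (`|C| / (x - y)); rewrite ltr_pdivrMr // mulrC mulr_natr => h.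
  by apply: le_lt_trans h; rewrite -normrN ler_norm.
by have := H n; move: Hn; rewrite mulrnBl; lra.
Qed.

Section Compare.
Variables (R : realType) (A : unitRingType) (w : A -> \bar R).
Hypothesis Hw : dvaluation w.
Let Hv := dv_val Hw.
Variables (V : zmodType) (act : A -> V -> V) (W : set V).
Hypothesis HW : right_space act W.

Lemma nf_compare n (b : 'I_n -> V) L1 L2 : act_basis act W b ->
  normfam w act W L1 -> normfam w act W L2 ->
  exists C, forall r v, L1 r v -> L2 (r + C) v.
Proof.
move=> Hb H1 H2; have [C HC] := choice (fun l => nf_bd H1 (crd_lform HW l Hb)).
have [D HD] := fin_lb (fun l => C l + nrm L2 (b l)); exists D => r v L1v.
have Wv := nf_sub H1 L1v; rewrite -(crdP HW Hb Wv); apply: (nf_sum H2) => l _.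
have Wb := basisW Hb l.
apply: (nfW H2 (r := nrm L2 (b l) + (r + C l))); first by have := HD l; lra.
by apply: (nfZ H2); [exact: (nrm_mem H2) | exact: HC].
Qed.

Record prenormfam (L : R -> set V) : Prop := {
  pnf_sub : forall r v, L r v -> W v;
  pnf0 : forall r, L r 0;
  pnfD : forall r u v, L r u -> L r v -> L r (u + v);
  pnfZ : forall r t x v, L r v -> vge w t x -> L (r + t) (act x v);
  pnf_val : forall v, W v -> v != 0 -> exists al, forall r, L r v <-> r <= al }.
End Compare.

Section CompleteBound.
Variables (R : realType) (A : unitRingType) (w : A -> \bar R).
Hypothesis Hw : dvaluation w.
Hypothesis Hc : val_complete w.
Let Hv := dv_val Hw.
Variables (V : zmodType) (act : A -> V -> V).

(** Induction on dimension. If lam were unbounded there would be vectors u m, deeper and deeper in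
    L, with lam (u m) = 1. By induction the coordinates of u m - v in the kernel of lam are Cauchy;
    the limit of u m still has lam equal to 1, yet lies in every L r. *)
Lemma complete_bd n W (b : 'I_n -> V) L : right_space act W -> act_basis act W b ->
  prenormfam w act W L -> forall lam, lform act W lam ->
    exists C, forall r v, L r v -> vge w (r + C) (lam v).
Proof.
elim: n W b L => [|n IH] W b L HW Hb HL lam Hl.
  exists 0 => r v /(pnf_sub HL) Wv; rewrite (basis0 HW Hb Wv) (lform0 HW Hl).
  exact: (vge0 Hv).
apply: contrapT => H.
have mono s r v : s <= r -> L r v -> L s v.
  move=> sr Lv; have [->|v0] := eqVneq v 0; first exact: (pnf0 HL).
  have [al Hal] := pnf_val HL (pnf_sub HL Lv) v0.
  by move/Hal: Lv => ra; apply/Hal/(le_trans sr).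
have LN r v : L r v -> L r (- v).
  move=> Lv; have Wv := pnf_sub HL Lv.
  rewrite -(act1 HW Wv) -(actNr HW) -[r]addr0; apply: (pnfZ HL) => //.
  by apply/(vgeN Hv); rewrite -(nu_one_aux Hv); exact: vge_nu.
have small (C : R) : exists u, [/\ W u, lam u = 1 & L C u].
  apply: contrapT => H'; apply: H; exists (- C) => r v Lv.
  have Wv := pnf_sub HL Lv.
  have [->|l0] := eqVneq (lam v) 0; first exact: (vge0 Hv).
  apply/(vgeE Hv _ l0); rewrite leNgt; apply/negP => h; apply: H'.
  exists (act (lam v)^-1 v); split; first exact: (rsZ HW).
    by rewrite (lformZ Hl) // divrr // (divU Hw).
  apply: (mono _ (r + nu_step w (lam v)^-1)); first by rewrite (nuV Hw) //; lra.
  by apply: (pnfZ HL) => //; exact: (vge_nu Hv).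
have [u uP] := choice (fun m : nat => small m%:R).
have [v [Wv lv _]] := small 0.
have lv0 : lam v != 0 by rewrite lv oner_neq0.
have [b1 Hb1] := ker_basis HW (dv_div Hw) Hb Hl Wv lv0.
have HK := ker_right_space HW Hl; set K := [set u | _] in HK Hb1.
have HLK : prenormfam w act K (fun r => [set u | L r u /\ lam u = 0]).
  split=> /=.
  - by move=> r z [/(pnf_sub HL)].
  - by move=> r; split; [exact: (pnf0 HL) | exact: (lform0 HW)].
  - move=> r z z' [Lz z0] [Lz' z'0]; split; first exact: (pnfD HL).
    by rewrite (lformD Hl (pnf_sub HL Lz) (pnf_sub HL Lz')) z0 z'0 addr0.
  - move=> r t c z [Lz z0] tc; split; first exact: (pnfZ HL).
    by rewrite (lformZ Hl _ (pnf_sub HL Lz)) z0 mul0r.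
  - move=> z [Wz lz] z0; have [al Hal] := pnf_val HL Wz z0; exists al => r.
    by split=> [[/Hal]|/Hal].
have Ku m : K (u m - v).
  have [Wu lu _] := uP m; split; first exact: (rsB HW).
  by rewrite (lformB HW Hl) // lu lv subrr.
have [C HC] := choice (fun l => IH _ _ _ HK Hb1 HLK _ (crd_lform HK l Hb1)).
have /choice [x xP] : forall l, exists x, forall M : R, exists N, forall m, (N <= m)%N ->
    vge w M (crd act b1 (u m - v) l - x).
  move=> l; apply: Hc => M; exists (Num.truncn `|M - C l|).+1 => p q Np Nq.
  have Hp := crd_lform HK l Hb1.
  rewrite -(lformB HK Hp (Ku p) (Ku q)).
  have -> : u p - v - (u q - v) = u p - u q by rewrite opprB addrA subrK.
  have -> : M = (M - C l) + C l by lra.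
  apply: HC; have [Wp lp Lp] := uP p; have [Wq lq Lq] := uP q.
  split; last by rewrite (lformB HW Hl) // lp lq subrr.
  have bnd (j : nat) : ((Num.truncn `|M - C l|%R).+1 <= j)%N -> M - C l <= j%:R.
    move=> Nj; apply: le_trans (ler_norm _) _; apply: ltW.
    by apply: lt_le_trans (truncnS_gt _) _; rewrite ler_nat.
  by apply: (pnfD HL); [apply: mono Lp | apply: LN; apply: mono Lq]; exact: bnd.
pose z := v + comb act b1 x.
have Wc : W (comb act b1 x) by apply: (comb_W HW) => l; have [] := basisW Hb1 l.
have Wz : W z by exact: (rsD HW).
have lz : lam z = 1.
  rewrite /z (lformD Hl) // lv (lform_comb HW Hl); last first.
    by move=> l; have [] := basisW Hb1 l.
  by rewrite big1 ?addr0 // => l _; have [_ ->] := basisW Hb1 l; rewrite mul0r.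
have z0 : z != 0.
  by apply/eqP => z0; move: lz; rewrite z0 (lform0 HW Hl) => /eqP; rewrite eq_sym oner_eq0.
have [al Hal] := pnf_val HL Wz z0.
(* The vector z differs from u M by a kernel vector with small coordinates, so z lies beyond its own
   norm al. *)
suff /Hal : L (al + 1) z by rewrite gerDl ler10.
have Lb l : exists s, L s (b1 l).
  have [Wb _] := basisW Hb1 l; have [be Hbe] := pnf_val HL Wb (basis_neq0 HK Hb1 l).
  by exists be; apply/Hbe.
have [s sP] := choice Lb.
have [N NP] := choice (fun l => xP l (al + 1 - s l)).
pose M := (\max_l N l + (Num.truncn `|al + 1|%R).+1)%N.
have [WM lM LM] := uP M.
have -> : z = u M - (comb act b1 (fun l => crd act b1 (u M - v) l - x l)).
  rewrite (combD HK) (combN HK) (crdP HK Hb1 (Ku M)).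
  by rewrite opprD opprK opprB addrA addrCA subrr addr0.
apply: (pnfD HL).
  apply: mono LM; apply: le_trans (ler_norm _) _; apply: ltW.
  by apply: lt_le_trans (truncnS_gt _) _; rewrite ler_nat leq_addl.
apply: LN; rewrite /comb; elim/big_ind: _ => [|y y'|l _]; first exact: (pnf0 HL).
  exact: (pnfD HL).
rewrite -[al + 1](subrKC (s l)); apply: (pnfZ HL) => //; apply: NP.
by apply: leq_trans (leq_addr _ _); exact: leq_bigmax.
Qed.
End CompleteBound.

Section FiniteExtension.
Variables (R : realType) (F : fieldType) (w0 : F -> \bar R).
Hypotheses (Hw0 : dvaluation w0) (Hc0 : val_complete w0).
Let Hv0 := dv_val Hw0.
Variable A : falgType F.
Let scal (c : F) (x : A) : A := c *: x.

Lemma scal_right_space : right_space scal setT.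
Proof.
split=> //; rewrite /scal.
- by move=> a u v; rewrite scalerDr.
- by move=> a b u; rewrite scalerDl.
- by move=> a b u; rewrite scalerA mulrC.
- by move=> u _; rewrite scale1r.
Qed.
Let HA := scal_right_space.

Lemma scal_basis : exists n (b : 'I_n -> A), act_basis scal setT b.
Proof.
apply: (spanning_basis HA (dv_div Hw0) (g := fun i : 'I_(\dim {:A}) => (vbasis {:A})`_i)) => // v _.
by exists (fun i => vector.coord (vbasis {:A}) i v); apply: coord_vbasis; exact: memvf.
Qed.

Lemma ext_normfam (w : A -> \bar R) : extends_valuation w0 w -> normfam w0 scal setT (fun r => [set x | vge w r x]).
Proof.
move=> [Hv Hext]; have [n [b Hb]] := scal_basis.
have pre : prenormfam w0 scal setT (fun r => [set x | vge w r x]).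
  split=> //=.
  - by move=> r; exact: (vge0 Hv).
  - by move=> r u v; exact: (vgeD Hv).
  - move=> r t c v rv tc; rewrite /scal -mulr_algl addrC; apply: (vgeM Hv) => //.
    by rewrite /vge Hext.
  - by move=> v _ v0; exists (nu_step w v) => r; exact: (vgeE Hv).
split; [exact: (pnf_sub pre)|exact: (pnf0 pre)|exact: (pnfD pre)|exact: (pnfZ pre)|exact: (pnf_val pre)|].
exact: (complete_bd Hw0 Hc0 HA Hb pre).
Qed.

Lemma ext_nrm (w : A -> \bar R) (x : A) : extends_valuation w0 w -> x != 0 ->
  nrm (fun r => [set x | vge w r x]) x = nu_step w x.
Proof.
move=> Hext x0; apply: (nrm_eq (ext_normfam Hext)) => // r.
exact: (vgeE Hext.1).
Qed.

(** With n the dimension of A, the powers 1, x, ..., x^n are dependent, so two of them have values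
    differing by a multiple of nu p0. Hence n! nu x is such a multiple for every x, and a least
    positive value exists. *)
Lemma ext_dvaluation (w : A -> \bar R) : extends_valuation w0 w -> (forall x : A, x != 0 -> x \is a GRing.unit) ->
  dvaluation w.
Proof.
move=> Hext Adiv; have [Hv Hwc] := Hext; split=> //.
have [n [b Hb]] := scal_basis; have HL := ext_normfam Hext.
have [p0 up] := dv_unif Hw0; have [p00 pp pmin] := uniformizer_nu Hw0 up.
have key x : x != 0 -> exists z : int, nu_step w x *+ n`! = z%:~R * nu_step w0 p0.
  move=> x0; have xX i : x ^+ i != 0 by exact: (exp_neq0 Hv).
  have [y [y0 ym]] := dependent (dv_div Hw0) (u := fun i : 'I_n.+1 => x ^+ i) HA Hb (fun=> I).
  have [l [m [lm [z [z0 E]]]]] := nf_dominant Hw0 HA HL (fun=> I) (fun i : 'I_n.+1 => xX i) y0 ym.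
  have [k kE] := nu_discr Hw0 up z0.
  move: E; rewrite kE !ext_nrm // !(nuX Hv) //.
  wlog: l m k lm {kE} / (m < l)%N => [H|ml] E.
    case: (ltngtP m l) => [lm'|lm'|/val_inj E']; [exact: (H l m k) | | by rewrite E' eqxx in lm].
    apply: (H m l (- k)) => //; first by rewrite eq_sym.
    by rewrite mulrNz mulNr -E opprB.
  have ln : (l - m <= n)%N by apply: leq_trans (leq_subr _ _) _; rewrite -ltnS.
  have lm0 : (0 < l - m)%N by rewrite subn_gt0.
  have /dvdnP [q qE] : (l - m %| n`!)%N by rewrite dvdn_fact // lm0 ln.
  exists (k * q%:Z); rewrite qE mulnC mulrnA mulrnBr ?(ltnW ml) // E.
  by rewrite intrM -pmulrn -mulr_natr mulrAC.
have nf0 : (0 < n`!%:R :> R) by rewrite ltr0n fact_gt0.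
pose P (z : nat) := `[< exists x : A, [/\ x != 0, 0 < nu_step w x &
  nu_step w x *+ n`! = z%:R * nu_step w0 p0] >].
have toP x : x != 0 -> 0 < nu_step w x -> exists2 z, P z & nu_step w x *+ n`! = z%:R * nu_step w0 p0.
  move=> x0 xp; have [z E] := key _ x0.
  have z0 : 0 <= z.
    have : 0 < z%:~R * nu_step w0 p0 by rewrite -E -mulr_natr mulr_gt0.
    by rewrite pmulr_lgt0 // ltr0z => /ltW.
  exists `|z|%N; last by rewrite E natr_absz ger0_norm.
  by apply/asboolP; exists x; split=> //; rewrite E natr_absz ger0_norm.
have exP : exists z, P z.
  have p1 : (p0%:A : A) != 0 by rewrite scaler_eq0 oner_eq0 orbF.
  have np : nu_step w (p0%:A : A) = nu_step w0 p0 by rewrite /nu_step Hwc.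
  by have [|z Pz _] := toP _ p1; [rewrite np | exists z].
case: (ex_minnP exP) => z /asboolP [x [x0 xp E]] zmin.
exists x; split; rewrite ?(w_nu Hv x0) ?ltry ?lte_fin // => y yp.
have [->|y0] := eqVneq y 0; first by rewrite (val0 Hv) leey.
move: yp; rewrite (w_nu Hv y0) lte_fin lee_fin => yp.
have [z' Pz' E'] := toP _ y0 yp; have := zmin _ Pz'.
by rewrite -(ler_nat R) -(ler_pM2r pp) -E -E' lerMn2r gtn_eqF ?fact_gt0.
Qed.

Lemma ext_complete (w : A -> \bar R) : extends_valuation w0 w -> val_complete w.
Proof.
move=> Hext u Hu; have [Hv Hwc] := Hext.
have [n [b Hb]] := scal_basis; have HL := ext_normfam Hext.
have [C HC] := choice (fun l => nf_bd HL (crd_lform HA l Hb)).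
have /choice [x xP] : forall l, exists x, forall M : R, exists N, forall m, (N <= m)%N ->
    vge w0 M (crd scal b (u m) l - x).
  move=> l; apply: Hc0 => M; have [N HN] := Hu (M - C l); exists N => p q Np Nq.
  rewrite -(lformB HA (crd_lform HA l Hb)) //.
  by rewrite -[M](subrK (C l)); apply: HC; exact: HN.
exists (comb scal b x) => M.
have [N NP] := choice (fun l => xP l (M - nu_step w (b l))).
exists (\max_l N l)%N => m Nm.
rewrite -[u m](crdP HA Hb (I : setT (u m))) -(combN HA) -(combD HA).
apply: (vge_sum Hv) => l _; rewrite /scal -mulr_algl -[M](subrK (nu_step w (b l))).
apply: (vgeM Hv); last exact: (vge_nu Hv).
by rewrite /vge Hwc; apply: NP; apply: leq_trans Nm; exact: leq_bigmax.
Qed.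

(** The two valuations are norms on a finite-dimensional space and so comparable up to a constant.
    Applying this to all powers of x removes the constant. *)
Lemma ext_unique (w1 w2 : A -> \bar R) : extends_valuation w0 w1 -> extends_valuation w0 w2 -> w1 = w2.
Proof.
move=> H1 H2; have [n [b Hb]] := scal_basis.
suff le v1 v2 (x : A) : extends_valuation w0 v1 -> extends_valuation w0 v2 -> x != 0 ->
    nu_step v1 x <= nu_step v2 x.
  apply/funext => x; have [->|x0] := eqVneq x 0; first by rewrite (val0 H1.1) (val0 H2.1).
  rewrite (w_nu H1.1) // (w_nu H2.1) //; congr (_%:E).
  by apply/eqP; rewrite eq_le !le.
move=> K1 K2 x0; have [C HC] := nf_compare HA Hb (ext_normfam K1) (ext_normfam K2).
apply: (le_mulrn_bound (C := C)) => i; rewrite -(nuX K1.1) // -(nuX K2.1) //.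
have xX := exp_neq0 K1.1 i x0.
by apply/(vgeE K2.1 _ xX); apply: HC; exact: (vge_nu K1.1).
Qed.

End FiniteExtension.

(** * The local field k *)

Section LocalField.
Variables (R : realType) (k : fieldType) (nu : k -> \bar R).
Hypothesis hk : local_field nu.

Lemma local_val1 : exists2 p, p != 0 & nu p = 1%:E.
Proof.
have E := local_field_normalized hk.
have [p p0 pE] : (nu @` [set x | x != 0]) 1%:E by rewrite E; exists 1.
by exists p.
Qed.

Lemma local_valZ x : x != 0 -> exists z : int, nu x = (z%:~R)%:E.
Proof.
move=> x0; have E := local_field_normalized hk.
have : (nu @` [set x | x != 0]) (nu x) by exists x.
by rewrite E => -[z _ <-]; exists z.
Qed.

Lemma local_dvaluation : dvaluation nu.
Proof.
have Hv := local_field_valuation hk; split=> // [x|]; first by rewrite unitfE.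
have [p p0 E] := local_val1.
exists p; rewrite /uniformizer /= E; split; rewrite ?lte01 ?ltry // => b b0.
have [->|bn] := eqVneq b 0; first by rewrite (val0 Hv) leey.
have [z zE] := local_valZ bn.
move: b0; rewrite zE lte_fin ltr0z lee_fin => z0.
by rewrite ler1z -gtz0_ge1.
Qed.

Lemma local_complete : val_complete nu.
Proof. by move=> u Hu; exact: (local_field_complete hk Hu). Qed.

(** An odd p is 2 times an integer plus 1, so p and 2 cannot both lie in the maximal ideal. *)
Lemma local_nu2 : odd_residue_char nu -> nu 2%:R = 0%E.
Proof.
move=> [p [_ po pm]]; have Hv := local_field_valuation hk.
have nat0 (n : nat) : vge nu 0 (n%:R : k).
  elim: n => [|n IH]; first exact: (vge0 Hv).
  rewrite -natr1; apply: (vgeD Hv) => //.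
  by rewrite -(nu_one_aux Hv); exact: (vge_nu Hv).
have pm' : (0 < nu p%:R)%E by [].
apply/eqP; rewrite eq_le (nat0 2) andbT leNgt; apply/negP => h2.
have : (0 < nu (p%:R - 2%:R * p./2%:R))%E.
  apply: lt_le_trans (valuationD Hv _ _); rewrite lt_min pm' /=.
  have wN x : nu (- x) = nu x.
    have [->|x0] := eqVneq x 0; first by rewrite oppr0.
    by rewrite !(w_nu Hv) ?oppr_eq0 // (nuN Hv).
  rewrite wN (valuationM Hv); apply: lt_le_trans h2 _.
  by rewrite leeDl //; exact: nat0.
have -> : p%:R - 2%:R * p./2%:R = 1 :> k.
  by rewrite -[p in p%:R]odd_double_half po natrD -mul2n natrM addrK.
by rewrite (w_nu Hv (oner_neq0 _)) (nu_one_aux Hv) ltxx.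
Qed.
End LocalField.

(** * Endomorphisms and hermitian forms *)

Section Endo.
Variables (A : nzRingType) (V : lmodType A^c).
Implicit Types (a b : A) (u v : V) (f g : V -> V).

Lemma ract_right_space : right_space (@ract A V) setT.
Proof.
split=> //; rewrite /ract.
- by move=> a u v; rewrite scalerDr.
- by move=> a b u; rewrite scalerDl.
- by move=> a b u; rewrite scalerA.
- by move=> u _; rewrite scale1r.
Qed.

Lemma EndP f : End f <-> (forall u v, f (u + v) = f u + f v) /\
  forall a u, f (ract a u) = ract a (f u).
Proof.
split=> [Hf|[fD fZ]]; last by move=> a u v; rewrite fD fZ.
have f0 : f 0 = 0.
  by have := Hf 1 0 0; rewrite !scale1r !addr0 => /(congr1 (fun x => x - f 0)); rewrite subrr addrK.
split=> [u v|a u]; first by have := Hf 1 u v; rewrite !scale1r.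
by have := Hf a u 0; rewrite !addr0 f0 addr0.
Qed.

Lemma EndD f u v : End f -> f (u + v) = f u + f v.
Proof. by move=> /EndP []. Qed.

Lemma EndZ f a u : End f -> f (ract a u) = ract a (f u).
Proof. by move=> /EndP []. Qed.

Lemma End0 f : End f -> f 0 = 0.
Proof. by move=> Hf; rewrite -{1}(scale0r (0 : V)) (EndZ 0 0 Hf) /ract scale0r. Qed.

Lemma EndN f u : End f -> f (- u) = - f u.
Proof.
move=> Hf; apply: (@addrI _ (f u)).
by rewrite -(EndD _ _ Hf) !subrr (End0 Hf).
Qed.

Lemma EndB f u v : End f -> f (u - v) = f u - f v.
Proof. by move=> Hf; rewrite (EndD _ _ Hf) (EndN _ Hf). Qed.

Lemma End_sum f (J : Type) (s : seq J) (P : pred J) (F : J -> V) : End f ->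
  f (\sum_(i <- s | P i) F i) = \sum_(i <- s | P i) f (F i).
Proof.
by move=> Hf; elim/big_rec2: _ => [|i x y _ <-]; rewrite ?(End0 Hf) ?(EndD _ _ Hf).
Qed.

Lemma End_comb f n (b : 'I_n -> V) x : End f ->
  f (comb (@ract A V) b x) = comb (@ract A V) (f \o b) x.
Proof. by move=> Hf; rewrite End_sum //; apply: eq_bigr => l _; rewrite EndZ. Qed.

Lemma End_id : End (@id V).
Proof. by apply/EndP. Qed.

Lemma End_zero : End (fun=> 0 : V).
Proof. by apply/EndP; split=> *; rewrite ?addr0 // /ract scaler0. Qed.

Lemma End_comp f g : End f -> End g -> End (f \o g).
Proof.
by move=> Hf Hg; apply/EndP; split=> * /=; rewrite ?(EndD _ _ Hg) ?(EndD _ _ Hf) ?(EndZ _ _ Hg) ?(EndZ _ _ Hf).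
Qed.

Lemma End_add f g : End f -> End g -> End (fun v => f v + g v).
Proof.
move=> Hf Hg; apply/EndP; split=> [u v|a u].
  by rewrite (EndD _ _ Hg) (EndD _ _ Hf) addrACA.
by rewrite (EndZ _ _ Hg) (EndZ _ _ Hf) /ract scalerDr.
Qed.

Lemma End_opp f : End f -> End (fun v => - f v).
Proof.
move=> Hf; apply/EndP; split=> [u v|a u]; first by rewrite (EndD _ _ Hf) opprD.
by rewrite (EndZ _ _ Hf) /ract scalerN.
Qed.

Lemma End_sub f g : End f -> End g -> End (fun v => f v - g v).
Proof. by move=> Hf Hg; apply: End_add => //; exact: End_opp. Qed.

Lemma End_bigsum (J : Type) (s : seq J) (P : pred J) (F : J -> V -> V) :
  (forall i, P i -> End (F i)) -> End (fun v => \sum_(i <- s | P i) F i v).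
Proof.
move=> H; elim: s => [|i s IH].
  have -> : (fun v : V => \sum_(i <- [::] | P i) F i v) = fun=> 0.
    by apply/funext => v; rewrite big_nil.
  exact: End_zero.
have -> : (fun v : V => \sum_(j <- i :: s | P j) F j v) =
   if P i then (fun v => F i v + \sum_(j <- s | P j) F j v)
   else fun v => \sum_(j <- s | P j) F j v.
  by apply/funext => v; rewrite big_cons; case: (P i).
by case Pi: (P i) => //; apply: End_add => //; exact: H.
Qed.

Lemma End_ract_form v (lam : V -> A) : lform (@ract A V) setT lam ->
  End (fun u => ract (lam u) v).
Proof.
move=> Hl; apply/EndP; split=> [x y|a x].
  by rewrite (lformD Hl) // /ract scalerDl.
by rewrite (lformZ Hl) // (actM ract_right_space).
Qed.
End Endo.

(** * A norm is known from its square lattice function up to translation *)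

Section SquareTranslate.
Variables (R : realType) (A : unitRingType) (w : A -> \bar R).
Hypothesis Hw : dvaluation w.
Let Hv := dv_val Hw.
Variables (V : lmodType A^c).
Notation act := (@ract A V).
Let HW := ract_right_space V.

(* Compare the operator norms of the rank one maps [u |-> v (lam u)], where [lam]
   is a form of minimal norm with [lam v0 = 1]. *)
Lemma square_translate n (b : 'I_n -> V) L L' : act_basis act setT b ->
  normfam w act setT L -> normfam w act setT L' ->
  (forall t a, End a -> in_square L t a -> in_square L' t a) ->
  exists s, L' = lf_translate L s.
Proof.
move=> Hb HL HL' H.
have key v0 v : v0 != 0 -> v != 0 -> nrm L' v0 + nrm L v - nrm L v0 <= nrm L' v.
  move=> v00 v0'; have [b' [a' [Hb' E]]] := normfam_LB Hw HW Hb HL.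
  have [lam [Hl lv Ll]] := norm_form Hw HW Hb' E I v00.
  have Hin : in_square L (nrm L v - nrm L v0) (fun u => act (lam u) v).
    move=> s _ [u Lu <-]; have -> : s + (nrm L v - nrm L v0) = nrm L v + (s - nrm L v0) by lra.
    by apply: (nfZ HL); [exact: (nrm_mem HL) | exact: Ll].
  apply/(nrmP HL' _ I v0'); rewrite -addrA.
  apply: (H _ _ (End_ract_form v Hl) Hin (nrm L' v0) v).
  by exists v0; [exact: (nrm_mem HL')| rewrite lv (act1 HW)].
have [[v0 v00]|V0] := pselect (exists v : V, v != 0); last first.
  exists 0; apply/funext => r; apply/seteqP; split=> v _;
    (have [->|v0] := eqVneq v 0; last by case: V0; exists v).
    exact: (nf0 HL).
  exact: (nf0 HL').
exists (nrm L' v0 - nrm L v0); apply/funext => r; apply/seteqP.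
have eqn v : v != 0 -> nrm L' v = nrm L v + (nrm L' v0 - nrm L v0).
  by move=> v0'; have := key _ _ v00 v0'; have := key _ _ v0' v00; lra.
rewrite /lf_translate; split=> v; have [->|v1] := eqVneq v 0.
- by move=> _; exact: (nf0 HL).
- by move=> /(nrmP HL' _ I v1); rewrite eqn // => h; apply/(nrmP HL _ I v1); lra.
- by move=> _; exact: (nf0 HL').
- by move=> /(nrmP HL _ I v1) h; apply/(nrmP HL' _ I v1); rewrite eqn //; lra.
Qed.

Lemma translate_square (L : R -> set V) s t (a : V -> V) : in_square (lf_translate L s) t a <-> in_square L t a.
Proof.
have E r : r + s + t - s = r + t by lra.
split=> H r; last by have := H (r - s); rewrite /lf_translate addrAC.
by have := H (r + s); rewrite /lf_translate addrK E.
Qed.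
End SquareTranslate.

Section Hermitian.
Variables (A : unitRingType) (V : lmodType A^c).
Notation act := (@ract A V).
Let HW := ract_right_space V.
Variables (rho : A -> A) (eps : A) (h : V -> V -> A).
Hypothesis Hh : hermitian_form rho eps h.
Implicit Types (a c : A) (u v z : V).
Let Hr := hermitian_involution Hh.

Lemma rhoD a c : rho (a + c) = rho a + rho c. Proof. exact: (involutionD Hr). Qed.
Lemma rhoM a c : rho (a * c) = rho c * rho a. Proof. exact: (involutionM Hr). Qed.
Lemma rho1 : rho 1 = 1. Proof. exact: (involution1 Hr). Qed.
Lemma rhoK a : rho (rho a) = a. Proof. exact: (involutionK Hr). Qed.
Lemma rho0 : rho 0 = 0.
Proof. by apply: (@addrI _ (rho 0)); rewrite -rhoD !addr0. Qed.
Lemma rhoN a : rho (- a) = - rho a.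
Proof. by apply: (@addrI _ (rho a)); rewrite -rhoD !subrr rho0. Qed.
Lemma rhoB a c : rho (a - c) = rho a - rho c.
Proof. by rewrite rhoD rhoN. Qed.
Lemma rho_eq0 a : (rho a == 0) = (a == 0).
Proof. by apply/eqP/eqP => [E|->]; [rewrite -[a]rhoK E rho0 | exact: rho0]. Qed.
Lemma rhoV a : a \is a GRing.unit -> rho a^-1 = (rho a)^-1.
Proof.
move=> Ua; have E1 : rho a^-1 * rho a = 1 by rewrite -rhoM divrr // rho1.
have E2 : rho a * rho a^-1 = 1 by rewrite -rhoM mulVr // rho1.
have Ur : rho a \is a GRing.unit by apply/unitrP; exists (rho a^-1).
by apply: (mulrI Ur); rewrite E2 divrr.
Qed.
Lemma eps2 : eps * eps = 1.
Proof. by case: (hermitian_sign Hh) => ->; rewrite ?mulrNN mulr1. Qed.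
Lemma epsC a : eps * a = a * eps.
Proof. by case: (hermitian_sign Hh) => ->; rewrite ?mulNr ?mulrN mulr1 mul1r. Qed.
Lemma rho_eps : rho eps = eps.
Proof. by case: (hermitian_sign Hh) => ->; rewrite ?rhoN rho1. Qed.
Lemma eps_neq0 : eps != 0.
Proof. by case: (hermitian_sign Hh) => ->; rewrite ?oppr_eq0 oner_eq0. Qed.
Lemma epsK a : eps * (eps * a) = a.
Proof. by rewrite mulrA eps2 mul1r. Qed.

Lemma hDl u v z : h (u + v) z = h u z + h v z. Proof. exact: (hermitianDl Hh). Qed.
Lemma hDr u v z : h z (u + v) = h z u + h z v. Proof. exact: (hermitianDr Hh). Qed.
Lemma hsym u v : h u v = eps * rho (h v u).
Proof.
have := hermitianZ Hh u v 1 1; rewrite !(act1 HW) // rho1 !mulr1.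
by [].
Qed.
Lemma hZr a u v : h u (act a v) = h u v * a.
Proof.
have := hermitianZ Hh u v 1 a; rewrite (act1 HW) // rho1 mulr1 => ->.
by rewrite -hsym.
Qed.
Lemma hZl a u v : h (act a u) v = rho a * h u v.
Proof.
have := hermitianZ Hh u v a 1; rewrite (act1 HW) // mulr1 => ->.
by rewrite epsC -mulrA -hsym.
Qed.
Lemma h0r u : h u 0 = 0.
Proof. by apply: (@addrI _ (h u 0)); rewrite -hDr !addr0. Qed.
Lemma h0l u : h 0 u = 0.
Proof. by apply: (@addrI _ (h 0 u)); rewrite -hDl !addr0. Qed.
Lemma hNr u v : h u (- v) = - h u v.
Proof. by apply: (@addrI _ (h u v)); rewrite -hDr !subrr h0r. Qed.
Lemma hNl u v : h (- u) v = - h u v.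
Proof. by apply: (@addrI _ (h u v)); rewrite -hDl !subrr h0l. Qed.
Lemma hBr u v z : h z (u - v) = h z u - h z v. Proof. by rewrite hDr hNr. Qed.
Lemma hBl u v z : h (u - v) z = h u z - h v z. Proof. by rewrite hDl hNl. Qed.
Lemma h_lform u : lform act setT (h u).
Proof. by split=> *; rewrite ?hDr ?hZr. Qed.
Lemma h_combr u n (b : 'I_n -> V) x : h u (comb act b x) = \sum_l h u (b l) * x l.
Proof. by rewrite (lform_comb HW (h_lform u)). Qed.
Lemma h_suml (J : Type) (s : seq J) (P : pred J) (F : J -> V) v :
  h (\sum_(i <- s | P i) F i) v = \sum_(i <- s | P i) h (F i) v.
Proof. by elim/big_rec2: _ => [|i x y _ <-]; rewrite ?h0l ?hDl. Qed.
Lemma h_combl u n (b : 'I_n -> V) x : h (comb act b x) u = \sum_l rho (x l) * h (b l) u.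
Proof. by rewrite h_suml; apply: eq_bigr => l _; rewrite hZl. Qed.
Lemma hsym0 u v : h u v = 0 -> h v u = 0.
Proof. by move=> E; rewrite hsym E rho0 mulr0. Qed.
Lemma h_nondegl v : (forall u, h v u = 0) -> v = 0.
Proof. exact: (hermitian_nondegenerate Hh). Qed.
Lemma h_nondegr v : (forall u, h u v = 0) -> v = 0.
Proof. by move=> H; apply: h_nondegl => u; exact: hsym0. Qed.

Hypothesis Adiv : forall x : A, x != 0 -> x \is a GRing.unit.

(** Non-degeneracy makes the columns of the Gram matrix independent in A^n, hence a basis; expanding
    the standard vectors in it yields the dual basis. *)
Lemma dual_basisr n (b : 'I_n -> V) : act_basis act setT b ->
  exists b' : 'I_n -> V, forall l m, h (b l) (b' m) = (l == m)%:R.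
Proof.
move=> Hb; pose fact (a : A) (f : {ffun 'I_n -> A}) : {ffun 'I_n -> A} := [ffun l => f l * a].
have Hf : right_space fact setT.
  split=> //.
  - by move=> a u v; apply/ffunP => l; rewrite !ffunE mulrDl.
  - by move=> a c u; apply/ffunP => l; rewrite !ffunE mulrDr.
  - by move=> a c u; apply/ffunP => l; rewrite !ffunE mulrA.
  - by move=> u _; apply/ffunP => l; rewrite !ffunE mulr1.
have combE (u : 'I_n -> {ffun 'I_n -> A}) x l : comb fact u x l = \sum_p u p l * x p.
  by rewrite /comb sum_ffunE; apply: eq_bigr => p _; rewrite ffunE.
pose e (m : 'I_n) : {ffun 'I_n -> A} := [ffun l => (l == m)%:R].
have eE x l : comb fact e x l = x l.
  rewrite combE (bigD1 l) //= ffunE eqxx mul1r big1 ?addr0 // => p pl.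
  by rewrite ffunE eq_sym (negbTE pl) mul0r.
have He : act_basis fact setT e.
  apply/(basisP Hf); split=> // [v _|x /ffunP x0 l].
    by exists v; apply/ffunP => l; rewrite eE.
  by have := x0 l; rewrite eE ffunE.
pose u (p : 'I_n) : {ffun 'I_n -> A} := [ffun l => h (b l) (b p)].
have Iu x : comb fact u x = 0 -> forall l, x l = 0.
  move=> /ffunP x0; have [_ Sb Ib] := iffLR (basisP HW b) Hb; apply: Ib.
  apply: h_nondegr => z; have [y ->] := Sb z I.
  rewrite h_combl big1 // => l _; rewrite h_combr.
  have -> : \sum_p h (b l) (b p) * x p = 0; last by rewrite mulr0.
  have -> : \sum_p h (b l) (b p) * x p = comb fact u x l.
    by rewrite combE; apply: eq_bigr => p _; rewrite ffunE.
  by rewrite x0 ffunE.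
have Hu := indep_basis Adiv Hf He (fun=> I) Iu.
have [_ Su _] := iffLR (basisP Hf u) Hu.
have [x xP] := choice (fun m => Su (e m) I).
exists (fun m => comb act b (x m)) => l m; rewrite h_combr.
have := congr1 (fun f : {ffun 'I_n -> A} => f l) (xP m); rewrite combE /e ffunE => ->.
by apply: eq_bigr => p _; rewrite /u ffunE.
Qed.

Lemma dual_basisl n (b : 'I_n -> V) : act_basis act setT b ->
  exists2 b' : 'I_n -> V, act_basis act setT b' & forall l m, h (b' m) (b l) = (l == m)%:R.
Proof.
move=> Hb; have [b' H] := dual_basisr Hb.
have E l m : h (act eps (b' m)) (b l) = (l == m)%:R.
  rewrite hZl hsym H rho_eps epsK; case: (l == m); [exact: rho1 | exact: rho0].
exists (fun m => act eps (b' m)) => //.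
apply: (indep_basis Adiv HW Hb) => // x x0 l; apply/eqP; rewrite -rho_eq0; apply/eqP.
rewrite -(h0l (b l)) -x0 h_combl (bigD1 l) //= E eqxx mulr1 big1 ?addr0 // => m ml.
by rewrite E eq_sym (negbTE ml) mulr0.
Qed.

Section Adjoint.
Variables (n : nat) (b : 'I_n -> V).
Hypothesis Hb : act_basis act setT b.
Implicit Types (f g : V -> V).

Lemma adjoint_ex f : End f -> exists g, End g /\ forall u v, h (f u) v = h u (g v).
Proof.
move=> Hf; have [b' H] := dual_basisr Hb.
exists (fun v => comb act b' (fun m => h (f (b m)) v)); split.
  apply/EndP; split=> [u v|a u].
    by rewrite -(combD HW); congr comb; apply/funext => m; rewrite hDr.
  by rewrite -(combZ HW); congr comb; apply/funext => m; rewrite hZr.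
move=> u v; rewrite -(crdP HW Hb (I : setT u)) (End_comb _ _ Hf) !h_combl.
apply: eq_bigr => l _; congr (_ * _); rewrite h_combr (bigD1 l) //= H eqxx mul1r.
by rewrite big1 ?addr0 // => m /negbTE ml; rewrite H eq_sym ml mul0r.
Qed.

Lemma adjointP f : End f -> End (adjoint h f) /\ forall u v, h (f u) v = h u (adjoint h f v).
Proof.
move=> Hf; rewrite /adjoint; case: xgetP => [g _ [? ?]|H]; first by split.
by have [g Hg] := adjoint_ex Hf; case: (H g).
Qed.

Lemma adjoint_End f : End f -> End (adjoint h f).
Proof. by move=> /adjointP []. Qed.

Lemma adjE f u v : End f -> h (f u) v = h u (adjoint h f v).
Proof. by move=> /adjointP []. Qed.

Lemma adjoint_uniq f g : End f -> (forall u v, h (f u) v = h u (g v)) -> adjoint h f = g.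
Proof.
move=> Hf H; apply/funext => v; apply/eqP; rewrite -subr_eq0; apply/eqP.
by apply: h_nondegr => u; rewrite hBr -H (adjE _ _ Hf) subrr.
Qed.

Lemma adjEl f u v : End f -> h (adjoint h f u) v = h u (f v).
Proof. by move=> Hf; rewrite hsym -(adjE _ _ Hf) -hsym. Qed.

Lemma adjointK f : End f -> adjoint h (adjoint h f) = f.
Proof.
move=> Hf; apply: adjoint_uniq; first exact: adjoint_End.
by move=> u v; exact: adjEl.
Qed.

Lemma adjoint_comp f g : End f -> End g -> adjoint h (f \o g) = adjoint h g \o adjoint h f.
Proof.
move=> Hf Hg; apply: adjoint_uniq; first exact: End_comp.
by move=> u v /=; rewrite (adjE _ _ Hf) (adjE _ _ Hg).
Qed.

Lemma adjoint_add f g : End f -> End g ->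
  adjoint h (fun v => f v + g v) = fun v => adjoint h f v + adjoint h g v.
Proof.
move=> Hf Hg; apply: adjoint_uniq; first exact: End_add.
by move=> u v; rewrite hDl hDr (adjE _ _ Hf) (adjE _ _ Hg).
Qed.

Lemma adjoint_opp f : End f -> adjoint h (fun v => - f v) = fun v => - adjoint h f v.
Proof.
move=> Hf; apply: adjoint_uniq; first exact: End_opp.
by move=> u v; rewrite hNl hNr (adjE _ _ Hf).
Qed.

End Adjoint.
End Hermitian.

(** * Self-dual norms *)

Section SelfDual.
Variables (R : realType) (A : unitRingType) (w : A -> \bar R).
Hypothesis Hw : dvaluation w.
Notation nu := (nu_step w).
Notation LB := (LB w).
Let Hv := dv_val Hw.
Let Adiv := dv_div Hw.
Variables (V : lmodType A^c).
Notation act := (@ract A V).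
Let HW := ract_right_space V.
Variables (rho : A -> A) (eps : A) (h : V -> V -> A).
Implicit Types (L : R -> set V) (a c : A) (u v z : V) (r s t : R).

(** The dual norm in terms of a closed condition on values, with all indices s allowed; [lf_dualE]
    compares it with [lf_dual]. *)
Definition Dual L : R -> set V := fun r =>
  [set z | forall s z', L s z' -> vge w (r + s) (h z z')].

Definition SD L : Prop := normfam w act setT L /\ Dual L = L.

Lemma SD_h L r s z z' : SD L -> L r z -> L s z' -> vge w (r + s) (h z z').
Proof. by move=> [_ {1}<-]; apply. Qed.

Lemma SD_in L r z : SD L -> (forall s z', L s z' -> vge w (r + s) (h z z')) -> L r z.
Proof. by move=> [_ {2}<-]. Qed.

Lemma SD_le L L' : SD L -> SD L' -> (forall r z, L r z -> L' r z) -> L = L'.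
Proof.
move=> SL SL' H; apply/funext => r; apply/seteqP; split=> z; first exact: H.
by move=> L'z; apply: (SD_in SL) => s z' /H; exact: (SD_h SL').
Qed.

Hypothesis Hh : hermitian_form rho eps h.
Variables (n0 : nat) (b0 : 'I_n0 -> V).
Hypothesis Hb0 : act_basis act setT b0.

(** If a pairing h v u had value below t + s, dividing u by it would give an index still larger than
    - t at which the pairing is 1, outside the maximal ideal. *)
Lemma lf_dualE (W : set V) L t v :
  (forall r c u, L r u -> c != 0 -> L (r + nu c) (act c u)) ->
  lf_dual h w W L t v <-> W v /\ Dual L t v.
Proof.
move=> LZ; split=> [[Wv H]|[Wv H]]; split=> // s.
  move=> u Lu; have [->|h0] := eqVneq (h v u) 0; first exact: (vge0 Hv).
  apply/(vgeE Hv _ h0); rewrite leNgt; apply/negP => lt.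
  have st : - t < s + nu (h v u)^-1 by rewrite (nuV Hw) //; lra.
  have := H _ st _ (LZ _ _ _ Lu (inv_neq0 Hw h0)).
  rewrite (hZr Hh) divrr ?Adiv // /maxideal /=.
  by rewrite (w_nu Hv (oner_neq0 A)) (nu_one_aux Hv) ltxx.
move=> ts u /H; rewrite /vge /maxideal /=; apply: lt_le_trans.
by rewrite lte_fin; lra.
Qed.

Section Step.
Variable step : A -> R.
Hypothesis Hstep : forall p, uniformizer w p -> step p = nu p.

Lemma Latt_nf L : Latt w step L <-> normfam w act setT L.
Proof.
have [p up] := dv_unif Hw.
by split=> [H|]; [exact: (LF_normfam Hw HW Hstep H up) | exact: (normfam_LF Hw HW Hstep Hb0)].
Qed.

Lemma Latt_hE L : Latt_h h w step L <-> SD L.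
Proof.
rewrite /Latt_h Latt_nf; split=> -[HL E]; split=> //.
  rewrite -[RHS]E; apply/funext => r; apply/seteqP; split=> z.
    by move=> H; apply/lf_dualE => // *; apply: (nfZ HL) => //; exact: (vge_nu Hv).
  by move=> /lf_dualE [] // *; apply: (nfZ HL) => //; exact: (vge_nu Hv).
rewrite -[RHS]E; apply/funext => r; apply/seteqP; split=> z.
  by move=> /lf_dualE [] // *; apply: (nfZ HL) => //; exact: (vge_nu Hv).
by move=> H; apply/lf_dualE => // *; apply: (nfZ HL) => //; exact: (vge_nu Hv).
Qed.
End Step.

(** Moving a scalar from one argument of h to the other shows that multiplication by a shifts L by
    nu (rho a); as for any norm it shifts by nu a. *)
Lemma SD_rho L v a : SD L -> v != 0 -> w (rho a) = w a.
Proof.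
move=> SL v0; have HL := SL.1.
have [->|a0] := eqVneq a 0; first by rewrite (rho0 Hh).
have ra0 : rho a != 0 by rewrite (rho_eq0 Hh).
rewrite !(w_nu Hv) //; congr (_%:E).
have key r : L r (act a v) <-> L (r - nu (rho a)) v.
  split=> H; apply: (SD_in SL) => s z' Lz'.
    have := SD_h SL H Lz'; rewrite (hZl Hh) => /(vge_mull Hw _ _ ra0).
    by apply: vgeW; lra.
  rewrite (hZl Hh); apply/(vge_mull Hw _ _ ra0).
  by have := SD_h SL H Lz'; apply: vgeW; lra.
have av0 := act_neq0 HW Adiv a0 (I : setT v) v0.
have := nrm_act Hw HW HL a0 (I : setT v) v0.
have := key (nrm L (act a v)); have := key (nrm L v + nu (rho a)).
rewrite !(nrmP HL _ I v0) !(nrmP HL _ I av0) addrK lexx => -[_ /(_ isT) h1] [/(_ (lexx _)) h2 _].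
lra.
Qed.

Hypothesis Hrho : forall a, w (rho a) = w a.

Lemma vge_rho r a : vge w r (rho a) <-> vge w r a.
Proof. by rewrite /vge Hrho. Qed.

Lemma nu_rho a : nu (rho a) = nu a.
Proof. by rewrite /nu_step Hrho. Qed.

Lemma nu_eps : nu eps = 0.
Proof.
by case: (hermitian_sign Hh) => ->; rewrite ?(nuN Hv) (nu_one_aux Hv).
Qed.

Lemma vge_eps r a : vge w r (eps * a) <-> vge w r a.
Proof. by rewrite (vge_mull Hw _ _ (eps_neq0 Hh)) nu_eps subr0. Qed.

Lemma vge_sym r u v : vge w r (h u v) <-> vge w r (h v u).
Proof. by rewrite (hsym Hh) vge_eps vge_rho. Qed.

(** The dual basis splits the dual norm with opposite values. It does not depend on a, so duality is
    affine and convex combinations of self-dual norms are self-dual ([conv_SD]). *)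
Lemma Dual_LB n (b : 'I_n -> V) : act_basis act setT b ->
  exists2 b' : 'I_n -> V, act_basis act setT b' &
    forall a : 'I_n -> R, Dual (LB act b a) = LB act b' (fun l => - a l).
Proof.
move=> Hb; have [b' Hb' H] := dual_basisl Hh Adiv Hb; exists b' => // a.
have hb x l : h (comb act b' x) (b l) = rho (x l).
  rewrite (h_combl Hh) (bigD1 l) //= H eqxx mulr1 big1 ?addr0 // => m ml.
  by rewrite H eq_sym (negbTE ml) mulr0.
apply/funext => r; apply/seteqP; split=> z.
  move=> Dz; rewrite -(crdP HW Hb' (I : setT z)); eexists; last by [].
  move=> l; rewrite opprK; apply/vge_rho; rewrite -hb (crdP HW Hb') //.
  by apply: Dz; apply/(LB_b Hw HW).
move=> [x xP <-] s _ [y yP <-]; rewrite (h_combr Hh); apply: (vge_sum Hv) => l _.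
rewrite hb; have -> : r + s = (r - - a l) + (s - a l) by lra.
by apply: (vgeM Hv) => //; apply/vge_rho.
Qed.

Lemma Dual_nf L : normfam w act setT L -> normfam w act setT (Dual L).
Proof.
move=> HL; have [b [a [Hb E]]] := normfam_LB Hw HW Hb0 HL.
have [b' Hb' H] := Dual_LB Hb; rewrite E H; exact: (LB_normfam Hw HW _ Hb').
Qed.

Lemma Dual_translate L s : Dual (lf_translate L s) = lf_translate (Dual L) (- s).
Proof.
apply/funext => r; apply/seteqP; rewrite /lf_translate; split=> z H t z' Lz'.
  have : L (t + s - s) z' by rewrite addrK.
  by move=> /H; apply: vgeW; lra.
by have := H _ _ Lz'; apply: vgeW; lra.
Qed.

Lemma conv_SD (c : R) L1 L2 L3 : 0 <= c <= 1 -> conv w act setT c L1 L2 L3 ->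
  SD L1 -> SD L2 -> SD L3.
Proof.
move=> c01 H [H1 D1] [H2 D2]; have [_ _ H3] := conv_nf Hw HW H; split=> //.
have [n [b [a1 [a2 [Hb E1 E2 E3]]]]] := H.
have [b' Hb' HD] := Dual_LB Hb; apply: (conv_uniq Hw HW c01 _ H).
exists n, b', (fun l => - a1 l), (fun l => - a2 l).
split=> //; first by rewrite -HD -E1.
  by rewrite -HD -E2.
rewrite E3 HD; congr LB; apply/funext => l; ring.
Qed.

Lemma in_square_Dual L t (a : V -> V) : End a -> in_square L t a ->
  in_square (Dual L) t (adjoint h a).
Proof.
move=> Ha H s _ [z Dz <-] s' z' Lz'; rewrite (adjEl Hh Adiv Hb0) // -addrA.
by apply: Dz; rewrite addrC; apply: H; exists z'.
Qed.

Lemma in_square_adj L t (a : V -> V) : SD L -> End a -> in_square L t a ->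
  in_square L t (adjoint h a).
Proof. by move=> [_ {2}<-]; exact: in_square_Dual. Qed.

Lemma SD_translate L s v : SD L -> SD (lf_translate L s) -> v != 0 -> s = 0.
Proof.
move=> SL SL' v0; have HL := SL.1; have := SL'.2; rewrite Dual_translate SL.2 => E.
have := nrm_translate s HL (I : setT v) v0.
by rewrite -E (nrm_translate _ HL) //; lra.
Qed.

End SelfDual.

(** * Lifting nearly isotropic vectors *)

Section Hensel.
Variables (R : realType) (A : unitRingType) (w : A -> \bar R).
Hypothesis Hw : dvaluation w.
Hypothesis Hc : val_complete w.
Hypothesis H2 : w 2%:R = 0%E.
Notation nu := (nu_step w).
Let Hv := dv_val Hw.
Let Adiv := dv_div Hw.
Variables (V : lmodType A^c).
Notation act := (@ract A V).
Let HW := ract_right_space V.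
Variables (rho : A -> A) (eps : A) (h : V -> V -> A).
Hypothesis Hh : hermitian_form rho eps h.
Hypothesis Hrho : forall a, w (rho a) = w a.

Lemma two_neq0 : 2%:R != 0 :> A.
Proof. by apply/eqP => E; move: H2; rewrite E (val0 Hv). Qed.

Definition ihalf : A := 2%:R^-1.

Lemma halfC a : ihalf * a = a * ihalf.
Proof. by have := commrV (commr_nat a 2) => <-. Qed.

Lemma halfD : ihalf + ihalf = 1.
Proof. by rewrite -mulr2n -mulr_natr mulVr // Adiv // two_neq0. Qed.

Lemma half_add a : ihalf * a + ihalf * a = a.
Proof. by rewrite -mulrDl halfD mul1r. Qed.

Lemma half_neq0 : ihalf != 0. Proof. exact: (inv_neq0 Hw two_neq0). Qed.

Lemma nu_half : nu ihalf = 0.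
Proof. by rewrite (nuV Hw two_neq0) /nu_step H2 oppr0. Qed.

Lemma rho_half : rho ihalf = ihalf.
Proof.
rewrite /ihalf (rhoV Hh) ?Adiv ?two_neq0 //.
by rewrite -[2%:R]/(1 + 1) (rhoD Hh) (rho1 Hh).
Qed.

Lemma vge_half r a : vge w r (ihalf * a) <-> vge w r a.
Proof. by rewrite (vge_mull Hw _ _ half_neq0) nu_half subr0. Qed.

Lemma nu_one_plus d z : 0 < d -> vge w d z -> 1 + z != 0 /\ nu (1 + z) = 0.
Proof.
move=> d0 dz.
have n1 : ~ vge w d 1 by move=> /(vgeE Hv _ (oner_neq0 A)); rewrite (nu_one_aux Hv); lra.
have ne : 1 + z != 0.
  apply/eqP => E; apply: n1; apply/(vgeN Hv).
  by have -> : -1 = z by move/eqP: E; rewrite addrC addr_eq0 => /eqP.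
split=> //; apply/eqP; rewrite eq_le; apply/andP; split.
  rewrite leNgt; apply/negP => lt; apply: n1.
  apply: False_ind; have : vge w (Num.min d (nu (1 + z))) (1 + z - z).
    by apply: (vgeB Hv); [apply: vgeW (vge_nu Hv _) | apply: vgeW dz]; rewrite ge_min lexx ?orbT.
  rewrite addrK => /(vgeE Hv _ (oner_neq0 A)); rewrite (nu_one_aux Hv) ge_min; lra.
apply/(vgeE Hv _ ne)/(vgeD Hv); last by apply: vgeW dz; lra.
by rewrite -{1}(nu_one_aux Hv); exact: (vge_nu Hv).
Qed.

(* Newton iteration for [h (e + f x) (e + f x) = 0], which converges quadratically. *)
Lemma isotropic_lift e f q k : h f e = 1 -> vge w q (h e e) -> vge w k (h f f) ->
  0 < q + k -> exists x, vge w q x /\ h (e + act x f) (e + act x f) = 0.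
Proof.
move=> fe qe kf qk; set K := h f f in kf.
pose v x := e + act x f; pose Q x := h (v x) (v x); pose t x := h f (v x).
have tE x : t x = 1 + K * x by rewrite /t /v (hDr Hh) (hZr Hh) fe.
have vD x y : v (x + y) = v x + act y f by rewrite /v (actDl HW) addrA.
have hexp z y : h (z + act y f) (z + act y f) =
    h z z + eps * rho (h f z) * y + rho y * h f z + rho y * K * y.
  rewrite (hDl Hh) !(hDr Hh) !(hZl Hh) !(hZr Hh) -/K [h z f](hsym Hh).
  by rewrite !mulrA !addrA.
have QD x y : Q (x + y) = Q x + eps * rho (t x) * y + rho y * t x + rho y * K * y.
  by rewrite /Q vD hexp.
(* The Newton correction: each of the two linear terms in [QD] contributes minus half of Q x, so
   only the quadratic term remains. *)
pose y0 x := eps * ((rho (t x))^-1 * (ihalf * Q x)); pose st x := - y0 x.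
have small x : vge w q x -> [/\ t x != 0, nu (t x) = 0 & vge w 0 (t x)].
  move=> qx; have qkx : vge w (q + k) (K * x) by rewrite addrC; apply: (vgeM Hv).
  have [ne n0] := nu_one_plus qk qkx; rewrite -tE in ne n0; split=> //.
  by rewrite -n0; exact: (vge_nu Hv).
have stE x r : vge w q x -> vge w r (Q x) -> vge w r (st x).
  move=> /small [t0 nt _] rQ; have rt0 : rho (t x) != 0 by rewrite (rho_eq0 Hh).
  apply/(vgeN Hv)/(vge_eps Hw Hh)/(vge_mull Hw _ _ (inv_neq0 Hw rt0)).
  by rewrite (nuV Hw) // (nu_rho Hrho) nt !oppr0 addr0; apply/vge_half.
have Qst x : vge w q x -> Q (x + st x) = rho (st x) * K * st x.
  move=> /small [t0 nt _]; have rt0 : rho (t x) != 0 by rewrite (rho_eq0 Hh).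
  have QE : eps * rho (Q x) = Q x by rewrite /Q -(hsym Hh).
  rewrite QD -[RHS]add0r; congr (_ + _).
  have -> : eps * rho (t x) * st x = - (ihalf * Q x).
    rewrite /st mulrN; congr (- _); rewrite /y0 (mulrA _ eps).
    have -> : eps * rho (t x) * eps = rho (t x) by rewrite -mulrA -(epsC Hh) (epsK Hh).
    by rewrite mulVKr // Adiv.
  have -> : rho (st x) * t x = - (ihalf * Q x).
    rewrite /st (rhoN Hh) mulNr; congr (- _); rewrite /y0 (rhoM Hh) (rhoM Hh).
    rewrite (rhoV Hh) ?Adiv // (rhoK Hh) (rho_eps Hh) -(mulrA _ eps) (epsC Hh (t x)).
    rewrite mulrA -(mulrA _ (t x)^-1) mulVr ?Adiv // mulr1 -(epsC Hh) (rhoM Hh) rho_half.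
    by rewrite mulrA QE halfC.
  by rewrite -addrA -opprD half_add subrr.
pose u := fix u n := if n is m.+1 then u m + st (u m) else 0.
(* The remainder rho(st) K st has value at least 2(q + n(q+k)) + k, which exceeds the bound needed
   for n + 1 by n(q+k). *)
have inv n : vge w q (u n) /\ vge w (q + (q + k) *+ n) (Q (u n)).
  elim: n => [|n [IH1 IH2]].
    by rewrite mulr0n addr0 /= /Q /v (act0r HW) addr0; split=> //; exact: (vge0 Hv).
  have qn : 0 <= (q + k) *+ n by rewrite mulrn_wge0 // ltW.
  have sq : vge w (q + (q + k) *+ n) (st (u n)) by exact: stE.
  split=> /=; first by apply: (vgeD Hv) => //; apply: vgeW sq; rewrite lerDl.
  rewrite Qst //; apply: (vgeW (s := q + (q + k) *+ n + k + (q + (q + k) *+ n))).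
    by rewrite mulrS; lra.
  by apply: (vgeM Hv) => //; apply: (vgeM Hv) => //; apply/(vge_rho Hrho).
have qkn (M : R) : exists N : nat, forall n, (N <= n)%N -> M <= q + (q + k) *+ n.
  exists (Num.truncn (`|M - q| / (q + k))).+1 => n Nn.
  have := truncnS_gt (`|M - q| / (q + k)); rewrite ltr_pdivrMr // mulrC mulr_natr => h1.
  have : (q + k) *+ (Num.truncn (`|M - q| / (q + k))).+1 <= (q + k) *+ n by rewrite ler_pMn2l.
  by have := ler_norm (M - q); lra.
have cauchy n m : (n <= m)%N -> vge w (q + (q + k) *+ n) (u m - u n).
  elim: m => [|m IH]; first by rewrite leqn0 => /eqP ->; rewrite subrr; exact: (vge0 Hv).
  rewrite leq_eqVlt => /orP[/eqP ->|]; first by rewrite subrr; exact: (vge0 Hv).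
  rewrite ltnS => nm /=; rewrite addrAC; apply: (vgeD Hv); first exact: IH.
  have [i1 i2] := inv m; apply: vgeW (stE _ _ i1 i2).
  by rewrite lerD2l ler_wpMn2l // ltW.
have [x xP] : exists l, forall M : R, exists N, forall n, (N <= n)%N -> vge w M (u n - l).
  apply: Hc => M; have [N HN] := qkn M; exists N => m n Nm Nn.
  have -> : u m - u n = (u m - u N) - (u n - u N) by rewrite opprB addrA subrK.
  by apply: (vgeB Hv); (apply: vgeW (cauchy _ _ _); [exact: HN | ]).
have qx : vge w q x.
  have [N HN] := xP q; have := HN _ (leqnn N); have [i1 _] := inv N.
  by move=> i2; have := vgeB Hv i1 i2; rewrite opprB addrC subrK.
exists x; split=> //; apply: (vge_inf Hv) => M.
pose M' := `|M| + `|k|; have [N HN] := xP M'; have [N' HN'] := qkn M.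
set n := maxn N N'; have hz := HN n (leq_maxl _ _); have hQ := HN' n (leq_maxr _ _).
have [i1 i2] := inv n; have [t0 nt vt] := small _ i1.
have {hz} zM : vge w M' (x - u n) by apply/(vgeN Hv); rewrite opprB.
have MM : M <= M' by have := ler_norm M; have := normr_ge0 k; rewrite /M'; lra.
rewrite -/(Q x) -[x in Q x](subrKC (u n)) QD.
apply: (vgeD Hv); [apply: (vgeD Hv); [apply: (vgeD Hv)|]|].
- by apply: vgeW i2.
- apply: vgeW (vgeM Hv (_ : vge w 0 _) zM); first by rewrite add0r.
  by apply/(vge_eps Hw Hh)/(vge_rho Hrho).
- apply: vgeW (vgeM Hv (_ : vge w M' _) vt); first by rewrite addr0.
  exact/(vge_rho Hrho).
apply: vgeW (vgeM Hv (vgeM Hv (_ : vge w M' _) kf) zM); last exact/(vge_rho Hrho).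
have := ler_norm M; have := ler_norm (- k); rewrite normrN /M'.
by have := normr_ge0 M; have := normr_ge0 k; lra.
Qed.
End Hensel.

(** * Affine functions on self-dual norms *)

Section Hyperbolic.
Variables (R : realType) (A : unitRingType) (w : A -> \bar R).
Hypothesis Hw : dvaluation w.
Notation nu := (nu_step w).
Notation LB := (LB w).
Let Hv := dv_val Hw.
Let Adiv := dv_div Hw.
Variables (V : lmodType A^c).
Notation act := (@ract A V).
Notation SD := (SD w).
Let HW := ract_right_space V.
Variables (rho : A -> A) (eps : A) (h : V -> V -> A).
Hypothesis Hh : hermitian_form rho eps h.
Hypothesis Hrho : forall a, w (rho a) = w a.
Variables (n0 : nat) (b0 : 'I_n0 -> V).
Hypothesis Hb0 : act_basis act setT b0.
Implicit Types (L : R -> set V) (c : A) (u v z e f : V) (r s t a : R) (pi : V -> V).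

Record self_proj pi : Prop := {
  sp_End : End pi;
  sp_idem : forall z, pi (pi z) = pi z;
  sp_adj : forall z z', h (pi z) z' = h z (pi z') }.

Definition fixed pi : set V := [set z | pi z = z].

Lemma fix_right_space pi : End pi -> right_space act (fixed pi).
Proof.
move=> Hp; split; rewrite /fixed /=.
- by rewrite (End0 Hp).
- by move=> u v pu pv; rewrite (EndD _ _ Hp) pu pv.
- by move=> c u pu; rewrite (EndZ _ _ Hp) pu.
- exact: (actDr HW).
- exact: (actDl HW).
- exact: (actM HW).
- by move=> u _; rewrite (act1 HW).
Qed.

Lemma fix_basis pi : End pi -> (forall z, pi (pi z) = pi z) ->
  exists n (b : 'I_n -> V), act_basis act (fixed pi) b.
Proof.
move=> Hp pp; apply: (spanning_basis (fix_right_space Hp) Adiv (g := pi \o b0)).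
  by move=> l; exact: pp.
move=> v pv; exists (crd act b0 v); rewrite -(End_comb _ _ Hp).
by rewrite (crdP HW Hb0).
Qed.

Lemma fix_normfam pi L : End pi -> (forall z, pi (pi z) = pi z) -> normfam w act setT L ->
  (forall r z, L r z -> L r (pi z)) ->
  normfam w act (fixed pi) (fun r => [set z | L r z /\ fixed pi z]).
Proof.
move=> Hp pp HL Lp; have HF := fix_right_space Hp; split=> /=.
- by move=> r v [].
- by move=> r; split; [exact: (nf0 HL) | exact: (rs0 HF)].
- by move=> r u v [Lu pu] [Lv pv]; split; [exact: (nfD HL) | exact: (rsD HF)].
- by move=> r t c v [Lv pv] tc; split; [exact: (nfZ HL) | exact: (rsZ HF)].
- move=> v pv v0; exists (nrm L v) => r; rewrite (nrmP HL _ I v0).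
  by split=> [[]|].
- move=> lam Hl; have Hl' : lform act setT (lam \o pi).
    split=> [u v _ _|c u _] /=; first by rewrite (EndD _ _ Hp) (lformD Hl) //; exact: pp.
    by rewrite (EndZ _ _ Hp) (lformZ Hl) //; exact: pp.
  have [C HC] := nf_bd HL Hl'; exists C => r v [Lv pv].
  by have := HC _ _ Lv; rewrite /= pv.
Qed.

Lemma fix_nrm pi L v : End pi -> (forall z, pi (pi z) = pi z) -> normfam w act setT L ->
  (forall r z, L r z -> L r (pi z)) -> fixed pi v -> v != 0 ->
  nrm (fun r => [set z | L r z /\ fixed pi z]) v = nrm L v.
Proof.
move=> Hp pp HL Lp pv v0; apply: (nrm_eq (fix_normfam Hp pp HL Lp)) => // r.
by rewrite /= (nrmP HL _ I v0); split=> [[]|].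
Qed.

Definition hpair e f : Prop := [/\ h e e = 0, h f f = 0 & h f e = 1].

Section Step.
Hypothesis Hc : val_complete w.
Hypothesis H2 : w 2%:R = 0%E.
Variables (L L' : R -> set V) (pi : V -> V).
Hypotheses (SL : SD h L) (SL' : SD h L') (Hpi : self_proj pi).
Hypotheses (Lp : forall r z, L r z -> L r (pi z)) (Lp' : forall r z, L' r z -> L' r (pi z)).
Let HL := SL.1.
Let HL' := SL'.1.
Let Hp := sp_End Hpi.
Let pp := sp_idem Hpi.

(** If all nonzero pairings of v with the splitting basis were strictly deeper than its norm
    requires, self-duality of L' would put v strictly deeper in L'. The vector found is the dual
    partner of v. *)
Lemma attained v n (b : 'I_n -> V) (a : 'I_n -> R) : pi v = v -> v != 0 ->
  act_basis act (fixed pi) b ->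
  (fun r => [set z | L' r z /\ fixed pi z]) = LB act b a ->
  exists l, h v (b l) != 0 /\ nu (h v (b l)) <= nrm L' v + a l.
Proof.
move=> pv v0 Hb E; apply: contrapT => H.
have [l hl|r [rv rl]] := fin_gap (P := fun l => h v (b l) != 0)
    (f := fun l => nu (h v (b l)) - a l) (al := nrm L' v).
  rewrite ltNge; apply/negP => le; apply: H; exists l; split=> //; lra.
suff : L' r v by move=> /(nrmP HL' _ I v0); lra.
apply: (SD_in SL') => s z' /Lp' Lz'; rewrite -pv (sp_adj Hpi).
have EE q y : LB act b a q y <-> L' q y /\ fixed pi y by rewrite -E.
have /EE [x xP <-] : L' s (pi z') /\ fixed pi (pi z') by split=> //; exact: pp.
 rewrite (h_combr Hh); apply: (vge_sum Hv) => l _.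
have [->|hl] := eqVneq (h v (b l)) 0; first by rewrite mul0r; exact: (vge0 Hv).
have -> : r + s = (r + a l) + (s - a l) by lra.
by apply: (vgeM Hv) => //; apply/(vgeE Hv _ hl); have := rl _ hl; lra.
Qed.

(** Take v with the largest excess a - a' of its L-norm over its L'-norm on the image of pi. If the
    excess is not positive, L is contained in L' there and duality gives equality. Otherwise v has a
    partner that is optimal for both norms, and Hensel's lemma makes the pair isotropic. *)
Lemma hyperbolic_step n (b : 'I_n -> V) : act_basis act (fixed pi) b ->
  (forall r z, pi z = z -> L r z <-> L' r z) \/
  exists e f a a', [/\ hpair e f, pi e = e, pi f = f, 0 < a - a' &
    [/\ L a e, L (- a) f, L' a' e, L' (- a') f &
      forall u, pi u = u -> u != 0 -> nrm L u - nrm L' u <= a - a']].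
Proof.
case: n b => [|n] b Hb.
  left=> r z pz; rewrite (basis0 (fix_right_space Hp) Hb pz).
  by split=> _; [exact: (nf0 HL') | exact: (nf0 HL)].
have HF := fix_right_space Hp; have HFL := fix_normfam Hp pp HL Lp.
have HFL' := fix_normfam Hp pp HL' Lp'.
have [b' [al [Hb' E]]] := normfam_LB Hw HF Hb HFL'.
have [v [pv v0]] := max_ratio Hw HF al Hb' HFL; rewrite -E fix_nrm // fix_nrm // => vmax0.
have vmax u : pi u = u -> u != 0 -> nrm L u - nrm L' u <= nrm L v - nrm L' v.
  by move=> pu u0; have := vmax0 _ pu u0; rewrite !fix_nrm.
set a := nrm L v in vmax0 vmax *; set a' := nrm L' v in vmax0 vmax *.
have La : L a v by exact: (nrm_mem HL).
have La' : L' a' v by exact: (nrm_mem HL').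
have [d0|d0] := leP (a - a') 0.
  left=> r z pz; have sub s u : pi u = u -> L s u -> L' s u.
    move=> pu; have [->|u0] := eqVneq u 0; first by move=> _; exact: (nf0 HL').
    move=> /(nrmP HL _ I u0) h1; apply/(nrmP HL' _ I u0).
    by have := vmax _ pu u0; lra.
  split; first exact: sub.
  move=> L'z; apply: (SD_in SL) => s z' /Lp /(sub _ _ (pp z')).
  by move=> Lz'; rewrite -pz (sp_adj Hpi); exact: (SD_h SL' L'z Lz').
right; have [l [hl nl]] := attained pv v0 Hb' E.
have L'b : L' (al l) (b' l).
  have EE q y : LB act b' al q y <-> L' q y /\ fixed pi y by rewrite -E.
  suff : L' (al l) (b' l) /\ fixed pi (b' l) by case.
  by apply/EE/(LB_b Hw HF).
have hl' : h (b' l) v != 0 by apply/eqP => /(hsym0 Hh) /eqP; rewrite (negbTE hl).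
have nl' : nu (h (b' l) v) = nu (h v (b' l)).
  have H u1 u2 : h u1 u2 != 0 -> h u2 u1 != 0 -> nu (h u1 u2) <= nu (h u2 u1).
    move=> h1 h2; apply/(vgeE Hv _ h2)/(vge_sym Hw Hh Hrho); exact: (vge_nu Hv).
  by apply/eqP; rewrite eq_le !H.
pose f0 := act (rho (h (b' l) v)^-1) (b' l).
have f0v : h f0 v = 1 by rewrite (hZl Hh) (rhoK Hh) mulVr // Adiv.
have pf0 : pi f0 = f0 by apply: (rsZ HF); exact: (basisW Hb').
have L'f0 : L' (- a') f0.
  apply: (nfW HL' (r := al l + nu (rho (h (b' l) v)^-1))).
    by rewrite (nu_rho Hrho) (nuV Hw) // nl'; move: nl; rewrite -/a'; lra.
  by apply: (nfZ HL') => //; exact: (vge_nu Hv).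
(* Passing from L to L' costs at most a - a' by maximality, so the bound - a' for f0 in L' becomes -
   a in L. *)
have Lf0 : L (- a) f0.
  apply: (SD_in SL) => s z' /Lp Lz; rewrite -pf0 (sp_adj Hpi).
  have [->|u0] := eqVneq (pi z') 0; first by rewrite (h0r Hh); exact: (vge0 Hv).
  apply: vgeW (SD_h SL' L'f0 (nrm_mem HL' (I : setT (pi z')))).
  move: Lz => /(nrmP HL _ I u0); have := vmax _ (pp z') u0; lra.
(* The value of h v v is at least 2a by L, that of h f0 f0 at least - 2a' by L'; their sum is
   positive, as the iteration requires. *)
have [|x [qx e0]] := isotropic_lift Hw Hc H2 Hh Hrho f0v (SD_h SL La La) (SD_h SL' L'f0 L'f0).
  by lra.
set e := v + act x f0 in e0.
have pe : pi e = e by apply: (rsD HF) => //; exact: (rsZ HF).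
have Le : L a e.
  apply: (nfD HL) => //; have -> : a = - a + (a + a) by lra.
  exact: (nfZ HL).
have Le' : L' a' e.
  apply: (nfD HL') => //; apply: (nfW HL' (r := - a' + (a + a))); first lra.
  exact: (nfZ HL').
have tE : h f0 e = 1 + h f0 f0 * x by rewrite /e (hDr Hh) (hZr Hh) f0v.
have [t0 nt] : 1 + h f0 f0 * x != 0 /\ nu (1 + h f0 f0 * x) = 0.
  apply: (nu_one_plus Hw (d := - a' - a' + (a + a))); first lra.
  exact: (vgeM Hv (SD_h SL' L'f0 L'f0) qx).
rewrite -tE in t0 nt.
pose f1 := act (rho (h f0 e)^-1) f0.
have f1e : h f1 e = 1 by rewrite (hZl Hh) (rhoK Hh) mulVr // Adiv.
have nt' : vge w 0 (rho (h f0 e)^-1).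
  by apply/(vge_rho Hrho); rewrite -oppr0 -nt -(nuV Hw) //; exact: (vge_nu Hv).
have Lf1 : L (- a) f1 by rewrite -[- a]addr0; exact: (nfZ HL).
have Lf1' : L' (- a') f1 by rewrite -[- a']addr0; exact: (nfZ HL').
have pf1 : pi f1 = f1 by exact: (rsZ HF).
(* Subtracting half of h f1 f1 times e makes the partner isotropic without changing its pairing with
   e. *)
pose c := ihalf A * h f1 f1; pose f := f1 - act c e.
have vc : vge w (- a' - a') c by apply/(vge_half Hw H2); exact: (SD_h SL' Lf1' Lf1').
have e1f : h e f1 = eps by rewrite (hsym Hh) f1e (rho1 Hh) mulr1.
have fe : h f e = 1 by rewrite /f (hBl Hh) (hZl Hh) e0 mulr0 subr0.
have ff : h f f = 0.
  have hQ : eps * rho (h f1 f1) = h f1 f1 by rewrite -(hsym Hh).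
  have rc : rho c * eps = c.
    by rewrite -(epsC Hh) /c (rhoM Hh) (rho_half Hw H2 Hh) mulrA hQ halfC.
  rewrite {2}/f (hBr Hh) (hZr Hh) fe mul1r /f (hBl Hh) (hZl Hh) e1f rc /c.
  by rewrite -addrA -opprD (half_add Hw H2) subrr.
exists e, f, a, a'; split=> //.
  by rewrite /f (EndB _ _ Hp) pf1 (EndZ _ _ Hp) pe.
split=> //.
- apply: (nfB Hw HW HL) => //; apply: (nfW HL (r := a + (- a' - a'))); first lra.
  exact: (nfZ HL).
- apply: (nfB Hw HW HL') => //; apply: (nfW HL' (r := a' + (- a' - a'))); first lra.
  exact: (nfZ HL').
Qed.
End Step.
End Hyperbolic.

(* Three lines glued pairwise along half lines: a function that is midpoint affine
   on each of them is constant. *)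
Lemma three_fold (R : realType) (F1 F2 F3 : R -> R) (g : R) :
  (forall a a', F1 a + F1 a' = F1 ((a + a') / 2) *+ 2) ->
  (forall a a', F2 a + F2 a' = F2 ((a + a') / 2) *+ 2) ->
  (forall a a', F3 a + F3 a' = F3 ((a + a') / 2) *+ 2) ->
  (forall a, - g <= a *+ 2 -> F2 a = F1 a) ->
  (forall a, a *+ 2 <= - g -> F3 a = F2 a) ->
  (forall a, - g <= a *+ 2 -> F3 a = F1 (- a - g)) ->
  forall a a', F1 a = F1 a'.
Proof.
move=> H1 H2 H3 H21 H32 H31.
suff key t : 0 <= t -> F1 (- g / 2 + t) = F1 (- g / 2) /\ F1 (- g / 2 - t) = F1 (- g / 2).
  have all a : F1 a = F1 (- g / 2).
    have [h|h] := leP (- g / 2) a.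
      have [|+ _] := key (a + g / 2); first lra.
      by have -> : - g / 2 + (a + g / 2) = a by lra.
    have [|_ +] := key (- g / 2 - a); first lra.
    by have -> : - g / 2 - (- g / 2 - a) = a by lra.
  by move=> a a'; rewrite all [RHS]all.
(* The three lines meet at a0. After gluing, only three values at distance t are left, one for each
   half line, and their pairwise sums all equal twice the value at a0. *)
move=> t0; set a0 := - g / 2.
have m : (a0 + t + (a0 - t)) / 2 = a0 by lra.
have e1 := H1 (a0 + t) (a0 - t); rewrite m in e1.
have e2 := H2 (a0 + t) (a0 - t); rewrite m in e2.
have e3 := H3 (a0 + t) (a0 - t); rewrite m in e3.
have h1 : F2 (a0 + t) = F1 (a0 + t) by apply: H21; rewrite /a0; lra.
have h2 : F2 a0 = F1 a0 by apply: H21; rewrite /a0; lra.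
have h3 : F3 a0 = F2 a0 by apply: H32; rewrite /a0; lra.
have h4 : F3 (a0 - t) = F2 (a0 - t) by apply: H32; rewrite /a0; lra.
have h5 : F3 (a0 + t) = F1 (a0 - t).
  rewrite H31; last by rewrite /a0; lra.
  by congr F1; rewrite /a0; lra.
by move: e1 e2 e3; rewrite h1 h2 h3 h4 h5 h2; lra.
Qed.

(** * Moving a self-dual norm along a hyperbolic plane *)

Section Modification.
Variables (R : realType) (A : unitRingType) (w : A -> \bar R).
Hypothesis Hw : dvaluation w.
Notation nu := (nu_step w).
Notation LB := (LB w).
Let Hv := dv_val Hw.
Let Adiv := dv_div Hw.
Variables (V : lmodType A^c).
Notation act := (@ract A V).
Variables (rho : A -> A) (eps : A) (h : V -> V -> A).
Notation SD := (SD w h).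
Notation hpair := (hpair h).
Notation self_proj := (self_proj h).
Let HW := ract_right_space V.
Hypothesis Hh : hermitian_form rho eps h.
Hypothesis Hrho : forall a, w (rho a) = w a.
Variables (n0 : nat) (b0 : 'I_n0 -> V).
Hypothesis Hb0 : act_basis act setT b0.
Implicit Types (L : R -> set V) (c : A) (u v z e f : V) (r s t a : R) (pi : V -> V).

(** The orthogonal projection onto the complement of the plane of a hyperbolic pair. *)
Definition perp e f z : V := z - act (h f z) e - act (eps * h e z) f.

(** L on the complement of the plane, and on the plane the norm with value a at e and - a at f. As a
    varies, this is a line of self-dual norms. *)
Definition modL e f a L : R -> set V := fun r =>
  [set z | [/\ vge w (r - a) (h f z), vge w (r + a) (h e z) & L r (perp e f z)]].

Lemma perp_decomp e f z : z = act (h f z) e + (act (eps * h e z) f + perp e f z).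
Proof. by rewrite /perp (addrC (act (eps * h e z) f)) subrK addrC subrK. Qed.

Section Pair.
Variables (e f : V).
Hypothesis Hef : hpair e f.
Let ee : h e e = 0. Proof. by case: Hef. Qed.
Let ff : h f f = 0. Proof. by case: Hef. Qed.
Let fe : h f e = 1. Proof. by case: Hef. Qed.

Lemma hpair_ef : h e f = eps.
Proof. by rewrite (hsym Hh) fe (rho1 Hh) mulr1. Qed.

Lemma h_f_perp z : h f (perp e f z) = 0.
Proof. by rewrite /perp !(hBr Hh) !(hZr Hh) fe ff mul0r mul1r subrr subr0. Qed.

Lemma h_e_perp z : h e (perp e f z) = 0.
Proof.
rewrite /perp !(hBr Hh) !(hZr Hh) ee hpair_ef mul0r subr0.
by rewrite mulrA (eps2 Hh) mul1r subrr.
Qed.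

Lemma perp_id z : h f z = 0 -> h e z = 0 -> perp e f z = z.
Proof. by move=> E1 E2; rewrite /perp E1 E2 mulr0 !(act0r HW) !subr0. Qed.

Lemma perp_proj : self_proj (perp e f).
Proof.
split.
- apply/EndP; split=> [u v|c u]; rewrite /perp.
    rewrite !(hDr Hh) mulrDr !(actDl HW) !opprD.
    by rewrite (addrACA u v) (addrACA (u - _) (v - _)).
  by rewrite !(hZr Hh) mulrA !(actM HW) !(actDr HW) !(actrN HW).
- by move=> z; rewrite perp_id ?h_f_perp ?h_e_perp.
- move=> z z'.
  have E u : h (perp e f z) u = h (perp e f z) (perp e f u).
    rewrite {1}(perp_decomp e f u) !(hDr Hh) !(hZr Hh).
    by rewrite (hsym0 Hh (h_e_perp z)) (hsym0 Hh (h_f_perp z)) !mul0r !add0r.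
  rewrite E {2}(perp_decomp e f z) !(hDl Hh) !(hZl Hh) h_e_perp h_f_perp.
  by rewrite !mulr0 !add0r.
Qed.

Let Hpp := perp_proj.

Lemma h_decomp z z' : h z z' = rho (h f z) * h e z' + rho (eps * h e z) * h f z' +
  h (perp e f z) (perp e f z').
Proof.
have gen x y p : h (act x e + (act y f + p)) z' = rho x * h e z' + rho y * h f z' + h p z'.
  by rewrite !(hDl Hh) !(hZl Hh) addrA.
by rewrite {1}(perp_decomp e f z) gen -(sp_adj Hpp) (sp_idem Hpp).
Qed.

Definition hsplit a L := L a e /\ L (- a) f.

(** Pairing with f and e bounds the coordinates of a vector of L in the plane; hence lower bounds
    for the norms of e and f already force the plane to split off a self-dual norm. *)
Lemma hsplit_mod a L : SD L -> hsplit a L -> L = modL e f a L.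
Proof.
move=> SL [Le Lf]; have HL := SL.1; apply/funext => r; apply/seteqP; split=> z.
  move=> Lz; have h1 : vge w (r - a) (h f z) by rewrite addrC; exact: (SD_h SL Lf Lz).
  have h2 : vge w (r + a) (h e z) by rewrite addrC; exact: (SD_h SL Le Lz).
  split=> //; rewrite /perp; do 2?apply: (nfB Hw HW HL) => //.
    by rewrite -[r](subrKC a); exact: (nfZ HL).
  rewrite -[r](subrKC (- a)) opprK; apply: (nfZ HL) => //.
  exact/(vge_eps Hw Hh).
move=> [h1 h2 Lz]; rewrite (perp_decomp e f z); apply: (nfD HL).
  by rewrite -[r](subrKC a); exact: (nfZ HL).
apply: (nfD HL) => //; rewrite -[r](subrKC (- a)) opprK; apply: (nfZ HL) => //.
exact/(vge_eps Hw Hh).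
Qed.

Lemma hsplit_perp a L r z : SD L -> hsplit a L -> L r z -> L r (perp e f z).
Proof. by move=> SL Hs; rewrite {1}(hsplit_mod SL Hs) => -[]. Qed.

Lemma hsplit_nrm a L : SD L -> hsplit a L -> nrm L e = a /\ nrm L f = - a.
Proof.
move=> SL [Le Lf]; have HL := SL.1; have n1 : h f e != 0 by rewrite fe oner_neq0.
have e0 : e != 0 by apply/eqP => E; move: n1; rewrite E (h0r Hh) eqxx.
have f0 : f != 0 by apply/eqP => E; move: n1; rewrite E (h0l Hh) eqxx.
have := SD_h SL (nrm_mem HL (I : setT f)) (nrm_mem HL (I : setT e)).
rewrite fe => /(vgeE Hv _ (oner_neq0 A)); rewrite (nu_one_aux Hv).
move/(nrmP HL _ I e0): Le; move/(nrmP HL _ I f0): Lf; lra.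
Qed.

Lemma hpair_basis n (b : 'I_n -> V) : act_basis act (fixed (perp e f)) b ->
  act_basis act setT (consf e (consf f b)).
Proof.
have HF := fix_right_space (sp_End Hpp); move=> /(basisP HF) [Fb Sb Ib].
apply/(basisP HW); split=> //.
  move=> z _; have [x xE] := Sb _ (sp_idem Hpp z).
  exists (consf (h f z) (consf (eps * h e z) x)).
  by rewrite !comb_cons -xE -perp_decomp.
move=> x; rewrite (consf_eta2 x) !comb_cons.
move: (x ord0) (x (lift ord0 ord0)) (fun l => x (lift ord0 (lift ord0 l))) => x0 x1 y E.
have hb u : h u (comb act b y) = h u (perp e f (comb act b y)).
  by congr h; apply/esym; exact: (comb_W HF).
have x00 : x0 = 0.
  have := congr1 (h f) E; rewrite !(hDr Hh) !(hZr Hh) hb h_f_perp fe ff (h0r Hh).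
  by rewrite mul1r mul0r !addr0.
have x10 : x1 = 0.
  have := congr1 (h e) E; rewrite !(hDr Hh) !(hZr Hh) hb h_e_perp ee hpair_ef (h0r Hh).
  by rewrite mul0r add0r addr0 => /(congr1 (fun c => eps * c)); rewrite (epsK Hh) mulr0.
move: E; rewrite x00 x10 !(act0r HW) !add0r => /Ib y0.
by apply/forall_ord_recl2; split=> [||?]; rewrite ?(consf0, consfS) //.
Qed.

Lemma modL_LB L n (b : 'I_n -> V) (al : 'I_n -> R) a : normfam w act setT L ->
  act_basis act (fixed (perp e f)) b ->
  (fun r => [set z | L r z /\ fixed (perp e f) z]) = LB act b al ->
  modL e f a L = LB act (consf e (consf f b)) (consf a (consf (- a) al)).
Proof.
move=> HL Hb E; have HF := fix_right_space (sp_End Hpp).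
have EE q y : LB act b al q y <-> L q y /\ fixed (perp e f) y by rewrite -E.
apply/funext => r; apply/seteqP; split=> z.
  move=> [h1 h2 Lz]; have /EE [x xP xE] : L r (perp e f z) /\ fixed (perp e f) (perp e f z).
    by split=> //; exact: (sp_idem Hpp).
  exists (consf (h f z) (consf (eps * h e z) x)).
    apply/forall_ord_recl2; split=> [||?]; rewrite ?(consf0, consfS) //.
    by rewrite opprK; apply/(vge_eps Hw Hh).
  by rewrite !comb_cons xE -perp_decomp.
move=> [x xP <-]; move: xP; rewrite (consf_eta2 x) !comb_cons.
move: (x ord0) (x (lift ord0 ord0)) (fun l => x (lift ord0 (lift ord0 l))) => x0 x1 y xP.
have := xP ord0; have := xP (lift ord0 ord0); rewrite !consf0 !consfS !consf0 opprK => v1 v0.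
have [Ly py] : L r (comb act b y) /\ fixed (perp e f) (comb act b y).
  apply/EE; exists y => // l; have := xP (lift ord0 (lift ord0 l)).
  by rewrite !consfS.
have hb u : h u (comb act b y) = h u (perp e f (comb act b y)) by rewrite py.
have E1 : h f (act x0 e + (act x1 f + comb act b y)) = x0.
  by rewrite !(hDr Hh) !(hZr Hh) hb h_f_perp fe ff mul1r mul0r !addr0.
have E2 : h e (act x0 e + (act x1 f + comb act b y)) = eps * x1.
  by rewrite !(hDr Hh) !(hZr Hh) hb h_e_perp ee hpair_ef mul0r add0r addr0.
split; rewrite ?E1 ?E2 //; first exact/(vge_eps Hw Hh).
by rewrite /perp E1 E2 (epsK Hh) (addrC (act x0 e)) addrK (addrC (act x1 f)) addrK.
Qed.

Lemma modL_nf L a : normfam w act setT L -> (forall r z, L r z -> L r (perp e f z)) ->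
  normfam w act setT (modL e f a L).
Proof.
move=> HL Lp; have [n [b Hb]] := fix_basis Hw Hb0 (sp_End Hpp) (sp_idem Hpp).
have HF := fix_right_space (sp_End Hpp).
have HFL := fix_normfam (sp_End Hpp) (sp_idem Hpp) HL Lp.
have [b' [al [Hb' E]]] := normfam_LB Hw HF Hb HFL.
rewrite (modL_LB a HL Hb' E); apply: (LB_normfam Hw HW); exact: hpair_basis.
Qed.

Lemma modL_e L a : normfam w act setT L -> modL e f a L a e /\ modL e f a L (- a) f.
Proof.
move=> HL; have L0 := nf0 HL.
have pe : perp e f e = 0.
  by rewrite /perp fe ee mulr0 (act0r HW) (act1 HW) // subrr subr0.
have pf : perp e f f = 0.
  by rewrite /perp ff hpair_ef (eps2 Hh) (act0r HW) (act1 HW) // subr0 subrr.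
have v1 : vge w 0 1 by rewrite -(nu_one_aux Hv); exact: (vge_nu Hv).
split; split; rewrite ?fe ?ee ?ff ?pe ?pf ?subrr ?addNr //; try exact: (vge0 Hv); try exact: L0.
by rewrite hpair_ef -[eps]mulr1; apply/(vge_eps Hw Hh).
Qed.

Lemma modL_SD L a : SD L -> (forall r z, L r z -> L r (perp e f z)) -> SD (modL e f a L).
Proof.
move=> SL Lp; have HL := SL.1; split; first exact: modL_nf.
have [Me Mf] := modL_e a HL.
apply/funext => r; apply/seteqP; split=> z.
  move=> Dz; split.
  - by apply/(vge_sym Hw Hh Hrho); exact: (Dz _ _ Mf).
  - by apply/(vge_sym Hw Hh Hrho); exact: (Dz _ _ Me).
  apply: (SD_in SL) => s z' /Lp Lz'; rewrite (sp_adj Hpp); apply: Dz.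
  split; rewrite ?h_f_perp ?h_e_perp ?(sp_idem Hpp) //; exact: (vge0 Hv).
move=> [h1 h2 Lz] s z' [h1' h2' Lz']; rewrite h_decomp.
apply: (vgeD Hv); [apply: (vgeD Hv)|].
- have -> : r + s = (r - a) + (s + a) by lra.
  by apply: (vgeM Hv) => //; apply/(vge_rho Hrho).
- have -> : r + s = (r + a) + (s - a) by lra.
  by apply: (vgeM Hv) => //; apply/(vge_rho Hrho)/(vge_eps Hw Hh).
exact: (SD_h SL Lz Lz').
Qed.

Lemma modL_conv1 (c : R) L a a' : SD L -> (forall r z, L r z -> L r (perp e f z)) ->
  conv w act setT c (modL e f a L) (modL e f a' L) (modL e f (c * a + (1 - c) * a') L).
Proof.
move=> SL Lp; have HL := SL.1.
have [n [b Hb]] := fix_basis Hw Hb0 (sp_End Hpp) (sp_idem Hpp).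
have HF := fix_right_space (sp_End Hpp).
have HFL := fix_normfam (sp_End Hpp) (sp_idem Hpp) HL Lp.
have [b' [al [Hb' E]]] := normfam_LB Hw HF Hb HFL.
rewrite !(modL_LB _ HL Hb' E).
do 4!eexists; split; [exact: hpair_basis Hb'|by []|by []|]; congr LB; apply/funext.
by apply/forall_ord_recl2; split=> [||?]; rewrite ?(consf0, consfS) //; ring.
Qed.

(** The result depends on a and a' only through c a + (1 - c) a'. For c = 1/2 the pairs (a, a') and
    (a', a) give the same midpoint, so that an affine function has the same slope over L and over L'
    ([slope_indep]). *)
Lemma modL_conv (c : R) L L' : SD L -> SD L' ->
  (forall r z, L r z -> L r (perp e f z)) -> (forall r z, L' r z -> L' r (perp e f z)) ->
  exists M, forall a a' : R,
    conv w act setT c (modL e f a L) (modL e f a' L') (M (c * a + (1 - c) * a')).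
Proof.
move=> SL SL' Lp Lp'; have HL := SL.1; have HL' := SL'.1.
have [n [b Hb]] := fix_basis Hw Hb0 (sp_End Hpp) (sp_idem Hpp).
have HF := fix_right_space (sp_End Hpp).
have HFL := fix_normfam (sp_End Hpp) (sp_idem Hpp) HL Lp.
have HFL' := fix_normfam (sp_End Hpp) (sp_idem Hpp) HL' Lp'.
have [b' [al [al' [Hb' E E']]]] := normfam_LB2 Hw HF Hb HFL HFL'.
exists (fun m => LB act (consf e (consf f b'))
  (consf m (consf (- m) (fun l => c * al l + (1 - c) * al' l)))) => a a'.
rewrite (modL_LB _ HL Hb' E) (modL_LB _ HL' Hb' E').
do 4!eexists; split; [exact: hpair_basis Hb'|by []|by []|]; congr LB; apply/funext.
by apply/forall_ord_recl2; split=> [||?]; rewrite ?(consf0, consfS) //; ring.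
Qed.
End Pair.
End Modification.

(** * Affine functions and transvections *)

Section Folding.
Variables (R : realType) (A : unitRingType) (w : A -> \bar R).
Hypothesis Hw : dvaluation w.
Notation nu := (nu_step w).
Notation LB := (LB w).
Let Hv := dv_val Hw.
Let Adiv := dv_div Hw.
Variables (V : lmodType A^c).
Notation act := (@ract A V).
Variables (rho : A -> A) (eps : A) (h : V -> V -> A).
Notation SD := (SD w h).
Notation hpair := (hpair h).
Notation self_proj := (self_proj h).
Notation perp := (perp eps h).
Notation modL := (modL w eps h).
Let HW := ract_right_space V.
Hypothesis Hh : hermitian_form rho eps h.
Hypothesis Hrho : forall a, w (rho a) = w a.
Variables (n0 : nat) (b0 : 'I_n0 -> V).
Hypothesis Hb0 : act_basis act setT b0.
Hypothesis H2 : w 2%:R = 0%E.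
Implicit Types (L : R -> set V) (c : A) (u v z e f : V) (r s t a : R) (pi : V -> V).

Variable F : (R -> set V) -> R.
Hypothesis Faff : forall L1 L2 L3, SD L1 -> SD L2 -> SD L3 ->
  conv w act setT (1 / 2) L1 L2 L3 -> F L1 + F L2 = F L3 *+ 2.

Let half_in : (0 <= (1 / 2 : R)) && ((1 / 2 : R) <= 1). Proof. by apply/andP; split; lra. Qed.

Lemma slope_mid e f L a a' : hpair e f -> SD L -> (forall r z, L r z -> L r (perp e f z)) ->
  F (modL e f a L) + F (modL e f a' L) = F (modL e f ((a + a') / 2) L) *+ 2.
Proof.
move=> Hef SL Lp; have S b := modL_SD Hw Hh Hrho Hb0 Hef b SL Lp.
apply: Faff => //; have := modL_conv1 Hw Hh Hb0 Hef (1 / 2) a a' SL Lp.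
by have -> : 1 / 2 * a + (1 - 1 / 2) * a' = (a + a') / 2 by lra.
Qed.

Lemma slope_indep e f L L' a a' : hpair e f -> SD L -> SD L' ->
  (forall r z, L r z -> L r (perp e f z)) -> (forall r z, L' r z -> L' r (perp e f z)) ->
  F (modL e f a L) + F (modL e f a' L') = F (modL e f a' L) + F (modL e f a L').
Proof.
move=> Hef SL SL' Lp Lp'.
have S b := modL_SD Hw Hh Hrho Hb0 Hef b SL Lp.
have S' b := modL_SD Hw Hh Hrho Hb0 Hef b SL' Lp'.
have [M HM] := modL_conv Hw Hh Hb0 Hef (1 / 2) SL SL' Lp Lp'.
have E : 1 / 2 * a' + (1 - 1 / 2) * a = 1 / 2 * a + (1 - 1 / 2) * a' by lra.
have SM := conv_SD Hw Hh Hrho half_in (HM a a') (S a) (S' a').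
rewrite (Faff (S a) (S' a') SM (HM a a')).
by rewrite (Faff (S a') (S' a) _ (HM a' a)) E.
Qed.

(** The skew scalar c makes f + c e isotropic. The pairs (e, f), (e, f + c e) and (- c^-1 f, f + c
    e) span the same plane, and their lines of norms are glued pairwise along half lines at the
    branch point - nu c / 2, so [three_fold] applies. *)
Lemma fold_skew e f L c a a' : hpair e f -> SD L ->
  (forall r z, L r z -> L r (perp e f z)) -> c != 0 -> eps * rho c = - c ->
  F (modL e f a L) = F (modL e f a' L).
Proof.
move=> Hef SL Lp c0 Ec; have [ee ff fe] := Hef; have ef := hpair_ef Hh Hef.
have rc : rho c = - (c * eps) by rewrite -[LHS](epsK Hh) Ec mulrN (epsC Hh).
have rc0 : rho c != 0 by rewrite (rho_eq0 Hh).
have Uc := Adiv c0.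
pose f2 := f + act c e; pose e3 := act (- c^-1) f.
have hf2 z : h f2 z = h f z + rho c * h e z by rewrite (hDl Hh) (hZl Hh).
have rcV : rho c^-1 = - (eps * c^-1).
  apply: (mulrI (Adiv rc0)); rewrite -(rhoM Hh) mulVr // (rho1 Hh).
  by rewrite rc mulrNN mulrA -(mulrA c) (eps2 Hh) mulr1 divrr.
have he3 z : h e3 z = eps * (c^-1 * h f z).
  by rewrite (hZl Hh) (rhoN Hh) rcV opprK mulrA.
have Hef2 : hpair e f2.
  split=> //; rewrite hf2; last by rewrite fe ee mulr0 addr0.
  rewrite !(hDr Hh) !(hZr Hh) ff fe ef ee mul0r mul1r add0r addr0.
  by rewrite rc mulNr -mulrA (eps2 Hh) mulr1 subrr.
have Hef3 : hpair e3 f2.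
  split; first by rewrite he3 (hZr Hh) ff mul0r !mulr0.
    by case: Hef2.
  rewrite (hsym Hh) he3 (hDr Hh) (hZr Hh) ff fe add0r mul1r mulVr // mulr1.
  by rewrite (rho_eps Hh) (eps2 Hh).
have p2 z : perp e f2 z = perp e f z.
  rewrite /perp; rewrite -!addrA -!opprD; congr (z - _).
  rewrite hf2 (actDl HW) (actDr HW) -addrA; congr (_ + _).
  rewrite -(actM HW) addrCA -(actDl HW) rc mulNr -mulrA addNr (act0r HW) addr0 //.
have p3 z : perp e3 f2 z = perp e f z.
  rewrite /perp; rewrite -!addrA -!opprD; congr (z - _).
  rewrite he3 (epsK Hh) hf2 (actDr HW) -!(actM HW) mulVKr // addrA addrC; congr (_ + _).
  rewrite -(actDl HW) !mulNr mulrDr opprD addrAC addNr add0r.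
  by rewrite rc mulNr mulrN opprK mulrA mulKr.
have vrc r (d : A) : vge w r (rho c * d) <-> vge w (r - nu c) d.
  by rewrite (vge_mull Hw) // (nu_rho Hrho).
have ve3 r z : vge w r (h e3 z) <-> vge w (r + nu c) (h f z).
  rewrite he3 (vge_eps Hw Hh) (vge_mull Hw); last exact: (inv_neq0 Hw).
  by rewrite (nuV Hw) // opprK.
have Lp2 r z : L r z -> L r (perp e f2 z) by rewrite p2; exact: Lp.
have Lp3 r z : L r z -> L r (perp e3 f2 z) by rewrite p3; exact: Lp.
have subE z : rho c * h e z = h f z + rho c * h e z - h f z.
  by rewrite addrAC subrr add0r.
have M2 b r z : modL e f2 b L r z <-> [/\ vge w (r - b) (h f z + rho c * h e z),
    vge w (r + b) (h e z) & L r (perp e f z)].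
  by rewrite /modL /= p2 hf2.
have M3 b r z : modL e3 f2 b L r z <-> [/\ vge w (r - b) (h f z + rho c * h e z),
    vge w (r + b + nu c) (h f z) & L r (perp e f z)].
  by rewrite /modL /= p3 hf2; split=> -[h1 /ve3 h2 Lz].
apply: (three_fold (F1 := fun a => F (modL e f a L)) (F2 := fun a => F (modL e f2 a L))
  (F3 := fun a => F (modL e3 f2 a L)) (g := nu c)).
- by move=> b b'; exact: slope_mid.
- by move=> b b'; exact: slope_mid.
- by move=> b b'; exact: slope_mid.
- move=> b hb; congr F; apply/funext => r; apply/seteqP; split=> z.
    move=> /M2 [h1 h2 Lz]; split=> //.
    rewrite -[h f z](addrK (rho c * h e z)); apply: (vgeB Hv) => //.
    by apply/vrc; apply: vgeW h2; lra.
  move=> [h1 h2 Lz]; apply/M2; split=> //; apply: (vgeD Hv) => //.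
  by apply/vrc; apply: vgeW h2; lra.
- move=> b hb; congr F; apply/funext => r; apply/seteqP; split=> z.
    move=> /M3 [h1 h2 Lz]; apply/M2; split=> //.
    suff /vrc : vge w (r + b + nu c) (rho c * h e z) by rewrite addrK.
    rewrite subE; apply: (vgeB Hv) => //.
    by apply: vgeW h1; lra.
  move=> /M2 [h1 h2 Lz]; apply/M3; split=> //.
  rewrite -[h f z](addrK (rho c * h e z)); apply: (vgeB Hv).
    by apply: vgeW h1; lra.
  by apply/vrc; apply: vgeW h2; lra.
- move=> b hb; congr F; apply/funext => r; apply/seteqP; split=> z.
    move=> /M3 [h1 h2 Lz]; split=> //; first by apply: vgeW h2; lra.
    suff /vrc : vge w (r - b) (rho c * h e z) by apply: vgeW; lra.
    rewrite subE; apply: (vgeB Hv) => //.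
    by apply: vgeW h2; lra.
  move=> [h1 h2 Lz]; apply/M3; split=> //; last by apply: vgeW h1; lra.
  apply: (vgeD Hv); first by apply: vgeW h1; lra.
  by apply/vrc; apply: vgeW h2; lra.
Qed.
End Folding.

(** * Orthogonal spaces: Eichler transformations *)

Section Symmetric.
Variables (R : realType) (A : unitRingType) (w : A -> \bar R).
Hypothesis Hw : dvaluation w.
Notation nu := (nu_step w).
Notation LB := (LB w).
Let Hv := dv_val Hw.
Let Adiv := dv_div Hw.
Variables (V : lmodType A^c).
Notation act := (@ract A V).
Variables (rho : A -> A) (eps : A) (h : V -> V -> A).
Notation SD := (SD w h).
Notation hpair := (hpair h).
Let HW := ract_right_space V.
Hypothesis Hh : hermitian_form rho eps h.
Hypothesis H2 : w 2%:R = 0%E.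
Hypotheses (Hsym : forall a, rho a = a) (Heps : eps = 1).
Implicit Types (L : R -> set V) (c : A) (u v z e f : V) (r s t a : R) (pi : V -> V).

Lemma sym_comm (a c : A) : a * c = c * a.
Proof. by have := rhoM Hh c a; rewrite !Hsym. Qed.

Lemma sym_h u v : h u v = h v u.
Proof. by rewrite (hsym Hh) Heps Hsym mul1r. Qed.

Lemma sym_hZl c u v : h (act c u) v = c * h u v.
Proof. by rewrite (hZl Hh) Hsym. Qed.

(** Gram-Schmidt; an anisotropic vector exists by polarization, as 2 is invertible. *)
Lemma orth_basis n (W : set V) (b : 'I_n -> V) : right_space act W -> act_basis act W b ->
  (forall u, W u -> (forall z, W z -> h u z = 0) -> u = 0) ->
  exists b' : 'I_n -> V, [/\ act_basis act W b',
    forall l m, l != m -> h (b' l) (b' m) = 0 & forall l, h (b' l) (b' l) != 0].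
Proof.
elim: n W b => [|n IH] W b HV Hb Hn; first by exists b; split=> // -[].
have [u [Wu q0]] : exists u, W u /\ h u u != 0.
  apply: contrapT => H; have := basis_neq0 HV Hb ord0; case/eqP.
  apply: Hn; first exact: (basisW Hb).
  have hu u : W u -> h u u = 0.
    by move=> Wu; apply/eqP; apply: contrapT => /negP q; apply: H; exists u.
  move=> z Wz; have Wb := basisW Hb ord0.
  have := hu _ (rsD HV Wb Wz); rewrite (hDl Hh) !(hDr Hh) !hu // add0r addr0.
  rewrite [h z _]sym_h -mulr2n -mulr_natr => /(congr1 (fun c => c * (ihalf A))).
  by rewrite -mulrA mulrV ?Adiv ?(two_neq0 Hw H2) // mulr1 mul0r.
set q := h u u in q0; pose lam z := q^-1 * h u z.
have Hl : lform act W lam.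
  by split=> [y z _ _|c z _]; rewrite /lam ?(hDr Hh) ?mulrDr // (hZr Hh) mulrA.
have lu : lam u = 1 by rewrite /lam mulVr ?Adiv.
have l0 z : lam z = 0 -> h u z = 0.
  by move=> /(congr1 (fun c => q * c)); rewrite mulVKr ?Adiv // mulr0.
have [|b1 Hb1] := ker_basis HV Adiv Hb Hl Wu _; first by rewrite lu oner_neq0.
have [|b2 [Hb2 o2 n2]] := IH _ _ (ker_right_space HV Hl) Hb1.
  move=> z [Wz lz] Hz; apply: Hn => // y Wy.
  have -> : y = (y - act (lam y) u) + act (lam y) u by rewrite subrK.
  rewrite (hDr Hh) (hZr Hh) [h z u]sym_h (l0 z lz) mul0r addr0.
  apply: Hz; split; first by apply: (rsB HV) => //; exact: (rsZ HV).
  by rewrite (lformB HV Hl) ?(lformZ Hl) ?lu ?mul1r ?subrr //; exact: (rsZ HV).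
have Kb l : h u (b2 l) = 0 by have [_ /l0] := basisW Hb2 l.
exists (consf u b2); split; first exact: (cons_basis HV Hl Wu lu Hb2).
  move=> l m; case: (unliftP ord0 l) => [l'|] ->; case: (unliftP ord0 m) => [m'|] ->;
    rewrite ?consf0 ?consfS ?eqxx // => lm.
    by apply: o2; move: lm; rewrite (inj_eq lift_inj).
  by rewrite sym_h.
by apply/forall_ord_recl; split=> [|l]; rewrite ?consf0 ?consfS.
Qed.

Record frame e f n (b : 'I_n -> V) : Prop := {
  fr_pair : hpair e f;
  fr_e : forall l, h e (b l) = 0;
  fr_f : forall l, h f (b l) = 0;
  fr_o : forall l m, l != m -> h (b l) (b m) = 0;
  fr_n : forall l, h (b l) (b l) != 0 }.

(** Self-duality forces the norm of an orthogonal basis vector to be half the value of the form on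
    it. *)
Definition fr_val n (b : 'I_n -> V) l : R := nu (h (b l) (b l)) / 2.

Definition Kfr e f n (b : 'I_n -> V) a : R -> set V :=
  LB act (consf e (consf f b)) (consf a (consf (- a) (fr_val b))).

Section Frame.
Variables (e f : V) (n : nat) (b : 'I_n -> V).
Hypothesis Hf : frame e f b.
Variable b0 : 'I_n.+2 -> V.
Hypothesis Hb0 : act_basis act setT b0.

Lemma frame_h x0 x1 (y : 'I_n -> A) :
  let z := act x0 e + (act x1 f + comb act b y) in
  [/\ h f z = x0, h e z = x1 & forall l, h (b l) z = h (b l) (b l) * y l].
Proof.
have [ee ff fe] := fr_pair Hf => z; rewrite /z; split; last move=> l.
- rewrite !(hDr Hh) !(hZr Hh) (h_combr Hh) fe ff mul1r mul0r big1 ?addr0 // => l _.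
  by rewrite (fr_f Hf) mul0r.
- rewrite !(hDr Hh) !(hZr Hh) (h_combr Hh) ee (sym_h e) fe mul1r mul0r big1 ?addr0 ?add0r // => l _.
  by rewrite (fr_e Hf) mul0r.
rewrite !(hDr Hh) !(hZr Hh) (h_combr Hh) !(sym_h (b l)) (fr_e Hf) (fr_f Hf) !mul0r !add0r.
rewrite (bigD1 l) //= big1 ?addr0 // => m ml.
by rewrite (fr_o Hf) ?mul0r // eq_sym.
Qed.

Lemma frame_basis : act_basis act setT (consf e (consf f b)).
Proof.
apply: (indep_basis Adiv HW Hb0) => // x; rewrite (consf_eta2 x) !comb_cons.
move: (x ord0) (x (lift ord0 ord0)) (fun l => x (lift ord0 (lift ord0 l))) => x0 x1 y E.
have [h1 h2 h3] := frame_h x0 x1 y; move: h1 h2 h3; rewrite E !(h0r Hh) => <- <- h3.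
apply/forall_ord_recl2; split=> [||l]; rewrite ?(consf0, consfS) //.
apply: (mulrI (Adiv (fr_n Hf l))); rewrite mulr0 -h3 (h0r Hh) //.
Qed.

Lemma frame_mem a r z : Kfr e f b a r z <-> [/\ vge w (r - a) (h f z), vge w (r + a) (h e z) &
  forall l, vge w (r + fr_val b l) (h (b l) z)].
Proof.
have q2 l : nu (h (b l) (b l)) = fr_val b l + fr_val b l by rewrite /fr_val; lra.
split=> [[x xP <-]|[h1 h2 h3]].
  move: xP; rewrite (consf_eta2 x) !comb_cons.
  move: (x ord0) (x (lift ord0 ord0)) (fun l => x (lift ord0 (lift ord0 l))) => x0 x1 y xP.
  have [-> -> h3] := frame_h x0 x1 y.
  have := xP ord0; have := xP (lift ord0 ord0); rewrite !(consf0, consfS) opprK => v1 v0.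
  split=> // l; rewrite h3; apply/(vge_mull Hw _ _ (fr_n Hf l)); rewrite q2.
  by have := xP (lift ord0 (lift ord0 l)); rewrite !(consf0, consfS); apply: vgeW; lra.
have Hb := frame_basis; move: h1 h2 h3; rewrite -(crdP HW Hb (I : setT z)).
set x := crd _ _ _; rewrite (consf_eta2 x) !comb_cons.
move: (x ord0) (x (lift ord0 ord0)) (fun l => x (lift ord0 (lift ord0 l))) => x0 x1 y.
have [-> -> h3] := frame_h x0 x1 y => v0 v1 v2.
exists (consf x0 (consf x1 y)); last by rewrite !comb_cons.
apply/forall_ord_recl2; split=> [||l]; rewrite ?(consf0, consfS) ?opprK //.
have := v2 l; rewrite h3 => /(vge_mull Hw _ _ (fr_n Hf l)); rewrite q2.
by apply: vgeW; lra.
Qed.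

Lemma frame_SD a : SD (Kfr e f b a).
Proof.
have [ee ff fe] := fr_pair Hf; have Hb := frame_basis; have ef := sym_h e f.
have LBl := LB_b Hw HW; split; first exact: (LB_normfam Hw HW).
apply/funext => r; apply/seteqP; split=> z.
  move=> Dz; apply/frame_mem; split; last move=> l; rewrite sym_h; apply: Dz.
  - have := iffRL (LBl _ _ (consf a (consf (- a) (fr_val b))) (lift ord0 ord0) _ Hb) (lexx _).
    by rewrite !(consf0, consfS).
  - have := iffRL (LBl _ _ (consf a (consf (- a) (fr_val b))) ord0 _ Hb) (lexx _).
    by rewrite !(consf0, consfS).
  - have := iffRL (LBl _ _ (consf a (consf (- a) (fr_val b))) (lift ord0 (lift ord0 l)) _ Hb) (lexx _).
    by rewrite !(consf0, consfS).
move=> /frame_mem [h1 h2 h3] s z' [x xP <-].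
move: xP; rewrite (consf_eta2 x) !comb_cons.
move: (x ord0) (x (lift ord0 ord0)) (fun l => x (lift ord0 (lift ord0 l))) => x0 x1 y xP.
have := xP ord0; have := xP (lift ord0 ord0); rewrite !(consf0, consfS) opprK => v1 v0.
rewrite !(hDr Hh) !(hZr Hh) (h_combr Hh); apply: (vgeD Hv); last apply: (vgeD Hv).
- have -> : r + s = (r + a) + (s - a) by lra.
  by apply: (vgeM Hv) => //; rewrite sym_h.
- have -> : r + s = (r - a) + (s + a) by lra.
  by apply: (vgeM Hv) => //; rewrite sym_h.
apply: (vge_sum Hv) => l _; have := xP (lift ord0 (lift ord0 l)).
rewrite !(consf0, consfS) => vl; have -> : r + s = (r + fr_val b l) + (s - fr_val b l) by lra.
by apply: (vgeM Hv) => //; rewrite sym_h.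
Qed.

Lemma frame_conv (c : R) a a' :
  conv w act setT c (Kfr e f b a) (Kfr e f b a') (Kfr e f b (c * a + (1 - c) * a')).
Proof.
do 4!eexists; split; [exact: frame_basis|by []|by []|]; congr LB; apply/funext.
by apply/forall_ord_recl2; split=> [||?]; rewrite ?(consf0, consfS) //; ring.
Qed.
End Frame.

Variable F : (R -> set V) -> R.
Hypothesis Faff : forall L1 L2 L3, SD L1 -> SD L2 -> SD L3 ->
  conv w act setT (1 / 2) L1 L2 L3 -> F L1 + F L2 = F L3 *+ 2.

(** Let u be orthogonal to e and f with q = h u u nonzero. An Eichler transformation fixes e and
    sends f to f2 = f + u - (q/2) e and u to u - q e. A second one yields the pair formed by - (2/q)
    f and f2, with u replaced by u + 2 f. The norms of the three frames form lines glued along half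
    lines at the branch point - nu q / 2. *)
Lemma fold_orth e f n (b : 'I_n.+1 -> V) (b0 : 'I_n.+3 -> V) a a' : act_basis act setT b0 ->
  frame e f b -> F (Kfr e f b a) = F (Kfr e f b a').
Proof.
move=> Hb0 Hf; have [ee ff fe] := fr_pair Hf; have ef : h e f = 1 by rewrite sym_h.
set u := b ord0; pose b1 l := b (lift ord0 l).
have bE : b = consf u b1 by rewrite consf_eta.
set q := h u u; have q0 : q != 0 by exact: (fr_n Hf).
have eu : h e u = 0 by exact: (fr_e Hf). have fu : h f u = 0 by exact: (fr_f Hf).
have ue : h u e = 0 by rewrite sym_h. have uf : h u f = 0 by rewrite sym_h.
have ub l : h u (b1 l) = 0 by apply: (fr_o Hf).
pose hq := ihalf A * q.
pose f2 := f + u - act hq e; pose u2 := u - act q e.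
pose e3 := act (- (2%:R * q^-1)) f; pose u3 := u + act 2%:R f.
have hqq : hq + hq = q by exact: (half_add Hw H2).
have hf2 z : h f2 z = h f z + h u z - hq * h e z by rewrite (hBl Hh) (hDl Hh) sym_hZl.
have hu2 z : h u2 z = h u z - q * h e z by rewrite (hBl Hh) sym_hZl.
have hu3 z : h u3 z = h u z + 2%:R * h f z by rewrite (hDl Hh) sym_hZl.
have he3 z : h e3 z = - (2%:R * q^-1) * h f z by rewrite sym_hZl.
have f2e : h f2 e = 1 by rewrite hf2 fe ue ee mulr0 subr0 addr0.
have f2f : h f2 f = - hq by rewrite hf2 ff uf ef mulr1 !add0r.
have f2u : h f2 u = q by rewrite hf2 fu eu mulr0 subr0 add0r.
have f2f2 : h f2 f2 = 0.
  by rewrite {2}/f2 (hBr Hh) (hDr Hh) (hZr Hh) f2e f2f f2u mul1r -{1}hqq addKr subrr.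
have f2b l : h f2 (b1 l) = 0.
  by rewrite hf2 ub [h f _](fr_f Hf) [h e _](fr_e Hf) mulr0 subr0 addr0.
have nu2 : nu 2%:R = 0 by rewrite /nu_step H2.
have two_inv : 2%:R * ihalf A = 1 by rewrite mulrV // Adiv // (two_neq0 Hw H2).
have Hf2 : frame e f2 (consf u2 b1).
  have u2b l : h u2 (b1 l) = 0 by rewrite hu2 ub [h e _](fr_e Hf) mulr0 subr0.
  split=> //.
  - apply/forall_ord_recl; split=> [|l]; rewrite ?(consf0, consfS); last exact: (fr_e Hf).
    by rewrite sym_h hu2 ue ee mulr0 subr0.
  - apply/forall_ord_recl; split=> [|l]; rewrite ?(consf0, consfS) //.
    by rewrite /u2 (hBr Hh) (hZr Hh) f2u f2e mul1r subrr.
  - move=> l m; case: (unliftP ord0 l) => [l'|] ->; case: (unliftP ord0 m) => [m'|] ->;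
      rewrite ?(consf0, consfS) ?eqxx // => lm.
      by apply: (fr_o Hf).
    by rewrite sym_h.
  - apply/forall_ord_recl; split=> [|l]; rewrite ?(consf0, consfS); last exact: (fr_n Hf).
    by rewrite /u2 (hBr Hh) (hZr Hh) !hu2 ue ee eu !mulr0 !subr0 mul0r subr0.
have q2 : h u2 u2 = q by rewrite /u2 (hBr Hh) (hZr Hh) !hu2 ue ee eu !mulr0 !subr0 mul0r subr0.
have f3u : h f2 u3 = 0.
  by rewrite /u3 (hDr Hh) (hZr Hh) f2u f2f sym_comm mulrN mulrA two_inv mul1r subrr.
have q3 : h u3 u3 = q by rewrite {2}/u3 (hDr Hh) (hZr Hh) !hu3 uf ff fu !mulr0 !addr0 mul0r addr0.
have Hf3 : frame e3 f2 (consf u3 b1).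
  have u3b l : h u3 (b1 l) = 0 by rewrite hu3 ub [h f _](fr_f Hf) mulr0 addr0.
  split=> //.
  - split=> //; first by rewrite he3 /e3 (hZr Hh) ff mul0r mulr0.
    rewrite /e3 (hZr Hh) f2f mulrNN /hq -mulrA (mulrA q) (sym_comm q) mulrK ?Adiv //.
    by rewrite sym_comm.
  - apply/forall_ord_recl; split=> [|l]; rewrite ?(consf0, consfS) he3.
      by rewrite /u3 (hDr Hh) (hZr Hh) fu ff mul0r addr0 mulr0.
    by rewrite [h f _](fr_f Hf) mulr0.
  - by apply/forall_ord_recl; split=> [|l]; rewrite ?(consf0, consfS).
  - move=> l m; case: (unliftP ord0 l) => [l'|] ->; case: (unliftP ord0 m) => [m'|] ->;
      rewrite ?(consf0, consfS) ?eqxx // => lm.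
      by apply: (fr_o Hf).
    by rewrite sym_h.
  - apply/forall_ord_recl; split=> [|l]; rewrite ?(consf0, consfS) ?q3 //; exact: (fr_n Hf).
set k := nu q / 2; have k2 : nu q = k + k by rewrite /k; lra.
have M1 a0 r z : Kfr e f b a0 r z <-> [/\ vge w (r - a0) (h f z), vge w (r + a0) (h e z),
    vge w (r + k) (h u z) & forall l, vge w (r + fr_val b1 l) (h (b1 l) z)].
  rewrite (frame_mem Hf Hb0); split=> [[h1 h2 h3]|[h1 h2 h3 h4]]; split=> //.
  - exact: (h3 ord0).
  - by move=> l; exact: (h3 (lift ord0 l)).
  - by apply/forall_ord_recl.
have cE n' (x : V) (y : 'I_n' -> V) : fr_val (consf x y) = consf (nu (h x x) / 2) (fr_val y).
  by apply/funext; apply/forall_ord_recl; split=> [|l]; rewrite /fr_val ?(consf0, consfS).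
have M2 a0 r z : Kfr e f2 (consf u2 b1) a0 r z <->
    [/\ vge w (r - a0) (h f z + h u z - hq * h e z), vge w (r + a0) (h e z),
    vge w (r + k) (h u z - q * h e z) & forall l, vge w (r + fr_val b1 l) (h (b1 l) z)].
  rewrite (frame_mem Hf2 Hb0) cE q2 hf2 -hu2.
  split=> [[h1 h2 h3]|[h1 h2 h3 h4]]; split=> //.
  - by have := h3 ord0; rewrite !consf0.
  - by move=> l; have := h3 (lift ord0 l); rewrite !consfS.
  - by apply/forall_ord_recl; split=> [|l]; rewrite ?(consf0, consfS).
have ve3 r z : vge w r (h e3 z) <-> vge w (r + k + k) (h f z).
  rewrite he3 mulNr; split=> [/(vgeN Hv)|H]; last apply/(vgeN Hv).
    rewrite -mulrA; move=> /(vge_mull Hw _ _ (two_neq0 Hw H2)).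
    rewrite nu2 subr0 => /(vge_mull Hw _ _ (inv_neq0 Hw q0)).
    by rewrite (nuV Hw) // k2; apply: vgeW; lra.
  rewrite -mulrA; apply/(vge_mull Hw _ _ (two_neq0 Hw H2)).
  rewrite nu2 subr0; apply/(vge_mull Hw _ _ (inv_neq0 Hw q0)).
  by rewrite (nuV Hw) // k2; apply: vgeW H; lra.
have M3 a0 r z : Kfr e3 f2 (consf u3 b1) a0 r z <->
    [/\ vge w (r - a0) (h f z + h u z - hq * h e z), vge w (r + a0 + k + k) (h f z),
    vge w (r + k) (h u z + 2%:R * h f z) & forall l, vge w (r + fr_val b1 l) (h (b1 l) z)].
  rewrite (frame_mem Hf3 Hb0) cE q3 hf2 -hu3.
  split=> [[h1 /ve3 h2 h3]|[h1 /ve3 h2 h3 h4]]; split=> //.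
  - by have := h3 ord0; rewrite !consf0.
  - by move=> l; have := h3 (lift ord0 l); rewrite !consfS.
  - by apply/forall_ord_recl; split=> [|l]; rewrite ?(consf0, consfS).
have mid e' f' b' a0 a0' : @frame e' f' n.+1 b' ->
    F (Kfr e' f' b' a0) + F (Kfr e' f' b' a0') = F (Kfr e' f' b' ((a0 + a0') / 2)) *+ 2.
  move=> Hf'; apply: Faff; try exact: (frame_SD Hf' Hb0).
  have := frame_conv Hf' Hb0 (1 / 2) a0 a0'.
  by have -> : 1 / 2 * a0 + (1 - 1 / 2) * a0' = (a0 + a0') / 2 by lra.
have vq r (z : A) : vge w r (q * z) <-> vge w (r - k - k) z.
  by rewrite (vge_mull Hw) // k2 opprD addrA.
have vhq r (z : A) : vge w r (hq * z) <-> vge w (r - k - k) z.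
  by rewrite -mulrA (vge_half Hw H2) vq.
have v2 r (z : A) : vge w r (2%:R * z) <-> vge w r z.
  by rewrite (vge_mull Hw _ _ (two_neq0 Hw H2)) nu2 subr0.
have sumE (x y : A) : x + y - x = y by rewrite addrAC subrr add0r.
apply: (three_fold (F1 := fun a => F (Kfr e f b a)) (F2 := fun a => F (Kfr e f2 (consf u2 b1) a))
  (F3 := fun a => F (Kfr e3 f2 (consf u3 b1) a)) (g := k + k)).
- by move=> *; exact: mid.
- by move=> *; exact: mid.
- by move=> *; exact: mid.
- move=> t ht; congr F; apply/funext => r; apply/seteqP; split=> z; set X := h f z; set Y := h e z; set U := h u z.
    move=> /M2; rewrite -/X -/Y -/U => -[h1 h2 h3 h4]; apply/M1; rewrite -/X -/Y -/U.
    have h5 : vge w (r + k) U.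
      by rewrite -[U](subrK (q * Y)); apply: (vgeD Hv) => //; apply/vq; apply: vgeW h2; lra.
    split=> //; have -> : X = X + U - hq * Y - U + hq * Y by rewrite [X + U - _ - U]addrAC addrK subrK.
    apply: (vgeD Hv); last by apply/vhq; apply: vgeW h2; lra.
    by apply: (vgeB Hv) => //; apply: vgeW h5; lra.
  move=> /M1; rewrite -/X -/Y -/U => -[h1 h2 h3 h4]; apply/M2; rewrite -/X -/Y -/U; split=> //.
    apply: (vgeB Hv); last by apply/vhq; apply: vgeW h2; lra.
    by apply: (vgeD Hv) => //; apply: vgeW h3; lra.
  by apply: (vgeB Hv) => //; apply/vq; apply: vgeW h2; lra.
- move=> t ht; congr F; apply/funext => r; apply/seteqP; split=> z; set X := h f z; set Y := h e z; set U := h u z.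
    move=> /M3; rewrite -/X -/Y -/U => -[h1 h2 h3 h4]; apply/M2; rewrite -/X -/Y -/U.
    have hY : vge w (r + t + k + k) (hq * Y).
      have -> : hq * Y = U + 2%:R * X - X - (X + U - hq * Y).
        by rewrite mulr_natl mulr2n addrA addrK opprB [U + X]addrC addrCA subrr addr0.
      apply: (vgeB Hv); last by apply: vgeW h1; lra.
      by apply: (vgeB Hv) => //; apply: vgeW h3; lra.
    split=> //; first by move/vhq: hY; apply: vgeW; lra.
    have -> : U - q * Y = 2%:R * (X + U - hq * Y) - (U + 2%:R * X).
      rewrite !mulr_natl -hqq mulrDl; move: (hq * Y) => W.
      rewrite !mulr2n !opprD !addrA [RHS](ACl ((1*8)*(4*9)*(2*7)*5*3*6)) /=.
      by rewrite !subrr !add0r.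
    by apply: (vgeB Hv) => //; apply/v2; apply: vgeW h1; lra.
  move=> /M2; rewrite -/X -/Y -/U => -[h1 h2 h3 h4]; apply/M3; rewrite -/X -/Y -/U; split=> //.
    have -> : X = X + U - hq * Y - (U - q * Y) - hq * Y.
      rewrite -hqq mulrDl; move: (hq * Y) => W.
      rewrite opprB !addrA [RHS](ACl (1*(2*6)*(4*3)*(5*7))) /=.
      by rewrite !subrr !addr0.
    apply: (vgeB Hv); last by apply/vhq; apply: vgeW h2; lra.
    by apply: (vgeB Hv); [apply: vgeW h1; lra | apply: vgeW h3; lra].
  have -> : U + 2%:R * X = 2%:R * (X + U - hq * Y) - (U - q * Y).
    rewrite !mulr_natl -hqq mulrDl; move: (hq * Y) => W.
    rewrite !mulr2n opprB !addrA [RHS](ACl (2*1*4*(5*9)*(7*3)*(8*6))) /=.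
    by rewrite !subrr !addr0.
  by apply: (vgeB Hv) => //; apply/v2; apply: vgeW h1; lra.
- move=> t ht; congr F; apply/funext => r; apply/seteqP; split=> z; set X := h f z; set Y := h e z; set U := h u z.
    move=> /M3; rewrite -/X -/Y -/U => -[h1 h2 h3 h4]; apply/M1; rewrite -/X -/Y -/U.
    have hU : vge w (r + k) U.
      rewrite -[U](addrK (2%:R * X)); apply: (vgeB Hv) => //; apply/v2; apply: vgeW h2; lra.
    split=> //; first by apply: vgeW h2; lra.
    have : vge w (r - t) (hq * Y).
      have -> : hq * Y = X + U - (X + U - hq * Y) by rewrite opprB addrCA subrr addr0.
      apply: (vgeB Hv) => //; apply: (vgeD Hv); [apply: vgeW h2; lra | apply: vgeW hU; lra].
    by move/vhq; apply: vgeW; lra.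
  move=> /M1; rewrite -/X -/Y -/U => -[h1 h2 h3 h4]; apply/M3; rewrite -/X -/Y -/U; split=> //.
  - apply: (vgeB Hv); last by apply/vhq; apply: vgeW h2; lra.
    by apply: (vgeD Hv); [apply: vgeW h1; lra | apply: vgeW h3; lra].
  - by apply: vgeW h1; lra.
  by apply: (vgeD Hv) => //; apply/v2; apply: vgeW h1; lra.
Qed.
End Symmetric.

(** * Rigidity of self-dual norms away from split planes *)

Section Rigidity.
Variables (R : realType) (A : unitRingType) (w : A -> \bar R).
Hypothesis Hw : dvaluation w.
Notation nu := (nu_step w).
Notation LB := (LB w).
Let Hv := dv_val Hw.
Let Adiv := dv_div Hw.
Variables (V : lmodType A^c).
Notation act := (@ract A V).
Variables (rho : A -> A) (eps : A) (h : V -> V -> A).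
Notation SD := (SD w h).
Notation hpair := (hpair h).
Notation self_proj := (self_proj h).
Notation perp := (perp eps h).
Notation modL := (modL w eps h).
Let HW := ract_right_space V.
Hypothesis Hh : hermitian_form rho eps h.
Hypothesis Hrho : forall a, w (rho a) = w a.
Variables (n0 : nat) (b0 : 'I_n0 -> V).
Hypothesis Hb0 : act_basis act setT b0.
Hypothesis H2 : w 2%:R = 0%E.
Hypothesis Hc : val_complete w.
Implicit Types (L : R -> set V) (c : A) (u v z e f : V) (r s t a : R) (pi : V -> V).

(* [V] is a quadratic plane over a commutative field with isotropic basis [e], [f]. *)
Record splane e f : Prop := {
  spl_pair : hpair e f;
  spl_perp : forall z, perp e f z = 0;
  spl_rho : forall c, rho c = c;
  spl_eps : eps = 1 }.

(** The element c - eps rho(c) is always skew. If it vanishes for every c, then c = 1 gives eps = 1,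
    and rho is trivial. *)
Lemma skew_or_sym : (exists2 c, c != 0 & eps * rho c = - c) \/
  ((forall c, rho c = c) /\ eps = 1).
Proof.
have [|H] := pselect (exists2 c, c != 0 & eps * rho c = - c); [by left|right].
have fixE c : eps * rho c = c.
  apply/eqP; rewrite eq_sym -subr_eq0; apply/negPn/negP => d0; apply: H.
  exists (c - eps * rho c) => //.
  rewrite (rhoB Hh) (rhoM Hh) (rhoK Hh) (rho_eps Hh) mulrBr -(epsC Hh c) (epsK Hh).
  by rewrite opprB.
have e1 : eps = 1 by rewrite -[RHS]fixE (rho1 Hh) mulr1.
by split=> // c; rewrite -[RHS]fixE e1 mul1r.
Qed.

Section Affine.
Variable F : (R -> set V) -> R.
Hypothesis Faff : forall L1 L2 L3, SD L1 -> SD L2 -> SD L3 ->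
  conv w act setT (1 / 2) L1 L2 L3 -> F L1 + F L2 = F L3 *+ 2.

(** With a skew scalar this is [fold_skew]. In the orthogonal case the slope along the plane is the
    same over every norm ([slope_indep]), so it may be computed over a frame norm, where [fold_orth]
    makes it 0; a zero complement would make the plane split. *)
Lemma fold_slope e f L a a' : hpair e f -> SD L ->
  (forall r z, L r z -> L r (perp e f z)) -> ~ splane e f ->
  F (modL e f a L) = F (modL e f a' L).
Proof.
move=> Hef SL Lp Hns; have [[c c0 Ec]|[Hsym Heps]] := skew_or_sym.
  exact: (fold_skew Hw Hh Hrho Hb0 Faff _ _ Hef SL Lp c0 Ec).
have Hpp := perp_proj Hh Hef.
have [n [b Hb]] := fix_basis Hw Hb0 (sp_End Hpp) (sp_idem Hpp).
have HF := fix_right_space (sp_End Hpp).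
case: n b Hb => [|n] b Hb.
  case: Hns; split=> // z; apply: (basis0 HF Hb); exact: (sp_idem Hpp).
have [u Fu Hu|b1 [Hb1 o1 n1]] := orth_basis Hw Hh H2 Hsym Heps HF Hb.
  by apply: (h_nondegl Hh) => z; rewrite -Fu (sp_adj Hpp); apply: Hu; exact: (sp_idem Hpp).
have Hfr : frame h e f b1.
  split=> // l; have <- : perp e f (b1 l) = b1 l by exact: (basisW Hb1).
    exact: (h_e_perp Hh Hef).
  exact: (h_f_perp Hh Hef).
have HB := hpair_basis Hh Hef Hb1.
have SK a1 := frame_SD Hw Hh Hsym Heps Hfr HB a1.
have Kmem a1 r z := frame_mem Hw Hh Hsym Heps Hfr HB a1 r z.
have hb l z : h (b1 l) (perp e f z) = h (b1 l) z.
  rewrite -(sp_adj Hpp); congr (h _ z); exact: (basisW Hb1).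
pose K := Kfr w h e f b1.
have Kp r z : K 0 r z -> K 0 r (perp e f z).
  move=> /Kmem [_ _ h3]; apply/Kmem; rewrite (h_e_perp Hh Hef) (h_f_perp Hh Hef).
  by split; try exact: (vge0 Hv); move=> l; rewrite hb.
have KE a1 : modL e f a1 (K 0) = K a1.
  apply/funext => r; apply/seteqP; split=> z.
    move=> [h1 h2 /Kmem [_ _ h3]]; apply/Kmem; split=> // l; by rewrite -hb.
  move=> /Kmem [h1 h2 h3]; split=> //; apply/Kmem.
  rewrite (h_e_perp Hh Hef) (h_f_perp Hh Hef).
  by split; try exact: (vge0 Hv); move=> l; rewrite hb.
have := slope_indep Hw Hh Hrho Hb0 Faff a a' Hef SL (SK 0) Lp Kp.
rewrite -/(K 0) !KE (fold_orth Hw Hh H2 Hsym Heps Faff a a' HB Hfr) => /addIr; exact.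
Qed.

(** Induction on the dimension of the image of pi, on whose complement L and L' agree. A hyperbolic
    pair splitting both norms is found; sliding L along its line until the norms agree on the plane
    leaves F unchanged, and the plane is removed from the image of pi. *)
Lemma SD_affine_aux n pi L L' (b : 'I_n -> V) : ~ (exists e f, splane e f) ->
  self_proj pi -> act_basis act (fixed pi) b -> SD L -> SD L' ->
  (forall r z, L r z -> L r (pi z)) -> (forall r z, L' r z -> L' r (pi z)) ->
  (forall r z, L r (z - pi z) <-> L' r (z - pi z)) -> F L = F L'.
Proof.
move=> Hns; elim/ltn_ind: n pi L b => n IH pi L b Hpi Hb SL SL' Lp Lp' Hoff.
have HL := SL.1; have HL' := SL'.1.
have [Heq|[e [f [a [a' [Hef pe pf _ [Le Lf Le' Lf' _]]]]]]] :=
  hyperbolic_step Hw Hh Hrho Hc H2 SL SL' Hpi Lp Lp' Hb.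
  congr F; apply/funext => r; apply/seteqP; split=> z Lz.
    rewrite -(subrK (pi z) z); apply: (nfD HL').
      by apply/Hoff; apply: (nfB Hw HW HL) => //; exact: Lp.
    by apply/Heq; [exact: (sp_idem Hpi) | exact: Lp].
  rewrite -(subrK (pi z) z); apply: (nfD HL).
    by apply/Hoff; apply: (nfB Hw HW HL') => //; exact: Lp'.
  by apply/Heq; [exact: (sp_idem Hpi) | exact: Lp'].
have Hs : hsplit e f a L by [].
have Hs' : hsplit e f a' L' by [].
have Hpp := perp_proj Hh Hef.
have Lq r z : L r z -> L r (perp e f z) by exact: (hsplit_perp Hw Hh SL Hs).
have Lq' r z : L' r z -> L' r (perp e f z) by exact: (hsplit_perp Hw Hh SL' Hs').
(* On the line through L given by the pair, L sits at a; the position a' is that of L'. *)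
have FE : F L = F (modL e f a' L).
  rewrite {1}(hsplit_mod Hw Hh SL Hs); apply: fold_slope => // sp.
  by apply: Hns; exists e, f.
have SL1 := modL_SD Hw Hh Hrho Hb0 Hef a' SL Lq.
have pq z : pi (perp e f z) = perp e f (pi z).
  rewrite /perp !(EndB _ _ (sp_End Hpi)) !(EndZ _ _ (sp_End Hpi)) pe pf.
  by rewrite -(sp_adj Hpi) pf -(sp_adj Hpi) pe.
pose pi1 z := perp e f (pi z).
have Hpi1 : self_proj pi1.
  split; first exact: (End_comp (sp_End Hpp) (sp_End Hpi)).
    by move=> z; rewrite /pi1 pq (sp_idem Hpi) (sp_idem Hpp).
  by move=> z z'; rewrite /pi1 (sp_adj Hpp) (sp_adj Hpi) pq.
have n1 : h f e != 0 by case: Hef => _ _ ->; rewrite oner_neq0.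
have HF := fix_right_space (sp_End Hpi).
have [m [mn [b1 Hb1]]] : exists m, (m < n)%N /\ exists b1 : 'I_m -> V, act_basis act (fixed pi1) b1.
  have hl u := h_lform Hh u.
  have hl' (W : set V) u : lform act W (h u) by split=> *; rewrite ?(hDr Hh) ?(hZr Hh).
  case: n b Hb {IH} => [|n] b Hb.
    by move: n1; rewrite (basis0 HF Hb pe) (h0r Hh) eqxx.
  have [b2 Hb2] := ker_basis HF Adiv Hb (hl' _ f) pe n1.
  have HK := ker_right_space HF (hl' _ f).
  have n2 : h e f != 0 by rewrite (hpair_ef Hh Hef) (eps_neq0 Hh).
  have kf : [set u | fixed pi u /\ h f u = 0] f by split=> //; case: Hef.
  case: n b Hb b2 Hb2 => [|n] b Hb b2 Hb2.
    by move: n2; rewrite (basis0 HK Hb2 kf) (h0r Hh) eqxx.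
  have [b3 Hb3] := ker_basis HK Adiv Hb2 (hl' _ e) kf n2.
  exists n; split=> //; exists b3.
  suff <- : [set u | [set u | fixed pi u /\ h f u = 0] u /\ h e u = 0] = fixed pi1 by [].
  apply/seteqP; split=> z /=.
    by move=> [[pz fz] ez]; rewrite /fixed /pi1 /= pz perp_id.
  rewrite /fixed /pi1 /= => E; have pz : pi z = z by rewrite -E pq (sp_idem Hpi).
  by rewrite -E (h_f_perp Hh Hef) (h_e_perp Hh Hef) -{1}E pq (sp_idem Hpi) E.
rewrite FE; apply: (IH _ mn pi1 _ b1 Hpi1 Hb1 SL1 SL').
- move=> r z [_ _ Lz]; rewrite /pi1; split; rewrite ?(h_f_perp Hh Hef) ?(h_e_perp Hh Hef).
  + exact: (vge0 Hv).
  + exact: (vge0 Hv).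
  by rewrite (sp_idem Hpp) -pq; exact: Lp.
- by move=> r z /Lp' /Lq'.
move=> r z; rewrite (hsplit_mod Hw Hh SL' Hs').
have E : perp e f (z - pi1 z) = perp e f z - pi (perp e f z).
  by rewrite (EndB _ _ (sp_End Hpp)) (sp_idem Hpp) pq.
by split=> -[h1 h2]; rewrite E => h3; split=> //; rewrite E; apply/Hoff.
Qed.

Lemma SD_affine_const L L' : ~ (exists e f, splane e f) -> SD L -> SD L' -> F L = F L'.
Proof.
move=> Hns SL SL'; have E : fixed (@id V) = setT by apply/seteqP; split.
apply: (SD_affine_aux (pi := id) (b := b0)) => //; rewrite ?E //.
move=> r z; rewrite subrr.
by split=> _; [exact: (nf0 SL'.1) | exact: (nf0 SL.1)].
Qed.
End Affine.

(** With a skew scalar, skew maps of rank one detect the norm of each vector. In the orthogonal case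
    there are none, and skew maps of rank two built from a hyperbolic pair of maximal excess and a
    vector orthogonal to it are used; such a vector exists exactly because the space is not a split
    plane. *)
Lemma skew_square_eq L L' : ~ (exists e f, splane e f) -> SD L -> SD L' ->
  (forall t (g : V -> V), End g -> (forall v, adjoint h g v = - g v) ->
    in_square L t g -> in_square L' t g) -> L = L'.
Proof.
move=> Hns SL SL' H; have HL := SL.1; have HL' := SL'.1.
have [[c c0 Ec]|[Hsym Heps]] := skew_or_sym.
  apply: (SD_le SL SL') => r u Lu.
  have [->|u0] := eqVneq u 0; first exact: (nf0 HL').
  set al := nrm L u; suff : L' al u.
    by apply: (nfW HL'); apply/(nrmP HL _ I u0).
  set al' := nrm L' u; have [le|lt] := leP al al'; first exact/(nrmP HL' _ I u0).
  (* This map lies in the square lattice function of L at nu c + 2 nrm L u; its membership in that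
     of L' at the same index bounds the pairings of u on L'. *)
  pose g z := act (c * h u z) u.
  have Hg : End g.
    by apply: End_ract_form; split=> [y z _ _|d z _]; rewrite ?(hDr Hh) ?mulrDr ?(hZr Hh) ?mulrA.
  have adjg v : adjoint h g v = - g v.
    have := adjoint_uniq Hh Adiv Hb0 Hg (g := fun v => - g v) => -> // y z.
    have rcE : rho c = - (eps * c) by rewrite -mulrN -Ec (epsK Hh).
    rewrite /g (hZl Hh) (rhoM Hh) (hNr Hh) (hZr Hh) [h y u](hsym Hh) rcE.
    by rewrite mulrN mulNr (epsC Hh (rho _)) -!mulrA.
  have inL : in_square L (al + al + nu c) g.
    move=> s _ [z Lz <-]; have -> : s + (al + al + nu c) = al + (nu c + (al + s)) by lra.
    apply: (nfZ HL); first exact: (nrm_mem HL).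
    apply: (vgeM Hv); first exact: (vge_nu Hv).
    exact: (SD_h SL (nrm_mem HL (I : setT u)) Lz).
  have inL' := H _ _ Hg adjg inL.
  apply: (SD_in SL') => s z Lz.
  have [->|h0] := eqVneq (h u z) 0; first exact: (vge0 Hv).
  have ch : c * h u z != 0 by rewrite (mul_neq0 Hv).
  have /(nf_act Hw HW HL' _ ch (I : setT u)) : L' (s + (al + al + nu c)) (g z).
    by apply: inL'; exists z.
  move=> /(nrmP HL' _ I u0); rewrite (nuM Hv) // -/al' => h1.
  by apply/(vgeE Hv _ h0); lra.
have E : fixed (@id V) = setT by apply/seteqP; split.
have Hid : self_proj id by split=> //; exact: (@End_id _ V).
have Hb0' : act_basis act (fixed id) b0 by rewrite E.
have [Heq|[e [f [a [a' [Hef _ _ d0 [Le Lf Le' Lf' Hmax]]]]]]] :=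
  hyperbolic_step Hw Hh Hrho Hc H2 SL SL' Hid (fun _ _ H => H) (fun _ _ H => H) Hb0'.
  by apply/funext => r; apply/seteqP; split=> z /Heq; exact.
have Hs : hsplit e f a L by [].
have Hpp := perp_proj Hh Hef.
have [ee ff fe] := Hef.
have shl (x y : V) (d : A) : h (act d x) y = d * h x y by rewrite (hZl Hh) Hsym.
have sh x y : h x y = h y x by exact: (sym_h Hh Hsym Heps).
(* Pairing g z with f isolates h u z. Self-duality of L' then puts every vector of the complement
   deeper in L' than in L by the full excess a - a'. *)
have key u : perp e f u = u -> u != 0 -> L' (nrm L u + (a - a')) u.
  move=> pu u0; pose g z := act (h u z) e - act (h e z) u.
  have Hg : End g by apply: End_sub; apply: End_ract_form; exact: (h_lform Hh).
  have adjg v : adjoint h g v = - g v.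
    have := adjoint_uniq Hh Adiv Hb0 Hg (g := fun v => - g v) => -> // y z.
    rewrite /g (hBl Hh) !shl (hNr Hh) (hBr Hh) !(hZr Hh) opprB (sh y u) (sh y e) //.
  have inL : in_square L (a + nrm L u) g.
    move=> s _ [z Lz <-]; apply: (nfB Hw HW HL).
      have -> : s + (a + nrm L u) = a + (nrm L u + s) by lra.
      by apply: (nfZ HL) => //; exact: (SD_h SL (nrm_mem HL (I : setT u)) Lz).
    have -> : s + (a + nrm L u) = nrm L u + (a + s) by lra.
    by apply: (nfZ HL); [exact: (nrm_mem HL) | exact: (SD_h SL Le Lz)].
  have inL' := H _ _ Hg adjg inL.
  apply: (SD_in SL') => s z Lz.
  have /(SD_h SL' Lf') : L' (s + (a + nrm L u)) (g z) by apply: inL'; exists z.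
  have fu : h f u = 0 by rewrite -pu (h_f_perp Hh Hef).
  rewrite /g (hBr Hh) !(hZr Hh) fe fu mul1r mul0r subr0.
  by apply: vgeW; lra.
have [u pu u0] : exists2 u, perp e f u = u & u != 0.
  apply: contrapT => H'; apply: Hns; exists e, f; split=> // z.
  apply/eqP; apply: contrapT => /negP z0; apply: H'; exists (perp e f z) => //.
  exact: (sp_idem Hpp).
(* Self-duality of L and [key], applied to u and to the test vector, would put u strictly beyond its
   own norm in L. *)
have bad : ~ L (nrm L u + (a - a')) u.
  by move=> H'; have /(nrmP HL _ I u0) := H'; lra.
exfalso; apply: bad.
apply: (SD_in SL) => s z' Lz'.
have Lz1 := hsplit_perp Hw Hh SL Hs Lz'.
have -> : h u z' = h u (perp e f z') by rewrite -{1}pu (sp_adj Hpp).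
have [->|z0] := eqVneq (perp e f z') 0.
  by rewrite (h0r Hh); exact: (vge0 Hv).
have k2 := key _ (sp_idem Hpp z') z0.
apply: vgeW (SD_h SL' (key _ pu u0) k2).
by move/(nrmP HL _ I z0): Lz1; lra.
Qed.

End Rigidity.

(** For large n any point a' lies between a - np and a + np, where g takes the same value as at
    a. *)
Lemma periodic_affine (R : realType) (g : R -> R) (p : R) : p != 0 ->
  (forall c a a', 0 <= c <= 1 -> g (c * a + (1 - c) * a') = c * g a + (1 - c) * g a') ->
  (forall a, g (a + p) = g a) -> forall a a', g a = g a'.
Proof.
move=> p0 ga gp.
have gn (n : nat) a : g (a + p *+ n) = g a.
  elim: n a => [|n IH] a; first by rewrite mulr0n addr0.
  by rewrite mulrS addrA IH gp.
have gnN (n : nat) a : g (a - p *+ n) = g a by rewrite -[LHS](gn n) subrK.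
move=> a a'; apply/esym.
pose n := (Num.truncn (`|a' - a| / `|p|)).+1.
have pn : 0 < `|p| by rewrite normr_gt0.
have hn : `|a' - a| < `|p| *+ n.
  have := truncnS_gt (`|a' - a| / `|p|); rewrite ltr_pdivrMr // mulrC mulr_natr; exact.
set q := p *+ n; have qE : `|q| = `|p| *+ n by rewrite normrMn.
rewrite -qE in hn.
have q0 : q != 0 by rewrite -normr_gt0; apply: le_lt_trans hn.
pose c := ((a' - a) / q + 1) / 2.
have c01 : 0 <= c <= 1.
  have : `|(a' - a) / q| <= 1 by rewrite normrM normfV ler_pdivrMr ?normr_gt0 // mul1r ltW.
  by rewrite ler_norml => /andP[h1 h2]; apply/andP; split; rewrite /c; lra.
have idn (x y z : R) : z != 0 ->
    ((y - x) / z + 1) / 2 * (x + z) + (1 - ((y - x) / z + 1) / 2) * (x - z) = y.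
  by move=> z0; field.
have <- : c * (a + q) + (1 - c) * (a - q) = a' by exact: idn.
by rewrite ga // gn gnN; ring.
Qed.

(** * Split planes: the self-dual norms form a line *)

Section Plane.
Variables (R : realType) (A : unitRingType) (w : A -> \bar R).
Hypothesis Hw : dvaluation w.
Notation nu := (nu_step w).
Notation LB := (LB w).
Let Hv := dv_val Hw.
Let Adiv := dv_div Hw.
Variables (V : lmodType A^c).
Notation act := (@ract A V).
Variables (rho : A -> A) (eps : A) (h : V -> V -> A).
Notation SD := (SD w h).
Notation hpair := (hpair h).
Let HW := ract_right_space V.
Hypothesis Hh : hermitian_form rho eps h.
Variables (n0 : nat) (b0 : 'I_n0 -> V).
Hypothesis Hb0 : act_basis act setT b0.
Hypothesis H2 : w 2%:R = 0%E.
Hypothesis Hc : val_complete w.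
Variables (e f : V).
Hypothesis Hs : splane rho eps h e f.
Implicit Types (L : R -> set V) (c : A) (u v z : V) (r s t a : R).

Let Hef := spl_pair Hs.
Let Hsym := spl_rho Hs.
Let Heps := spl_eps Hs.
Let Hrho : forall c, w (rho c) = w c. Proof. by move=> c; rewrite Hsym. Qed.

Lemma splane_decomp z : z = act (h f z) e + act (h e z) f.
Proof. by rewrite {1}(perp_decomp eps h e f z) (spl_perp Hs) addr0 Heps mul1r. Qed.

Lemma splane_ef : h e f = 1.
Proof. by rewrite (hpair_ef Hh Hef). Qed.

Lemma splane_basis : act_basis act setT (consf e (consf f (fun l : 'I_0 => 0))).
Proof.
apply: (hpair_basis Hh Hef); apply/(basisP (fix_right_space (sp_End (perp_proj Hh Hef)))).
split=> [[]//|v|x _ []//].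
by rewrite /fixed /= (spl_perp Hs) => <-; exists (fun=> 0); rewrite (comb0 HW).
Qed.

Definition pl a : R -> set V := fun r => [set z | vge w (r - a) (h f z) /\ vge w (r + a) (h e z)].

Lemma pl_frame : frame h e f (fun l : 'I_0 => 0 : V).
Proof. by split=> // -[]. Qed.

Lemma pl_Kfr a : pl a = Kfr w h e f (fun l : 'I_0 => 0) a.
Proof.
apply/funext => r; apply/seteqP; split=> z.
  by move=> [h1 h2]; apply/(frame_mem Hw Hh Hsym Heps pl_frame splane_basis); split=> // -[].
by move=> /(frame_mem Hw Hh Hsym Heps pl_frame splane_basis) [].
Qed.

Lemma pl_SD a : SD (pl a).
Proof. by rewrite pl_Kfr; exact: (frame_SD Hw Hh Hsym Heps pl_frame splane_basis). Qed.

Lemma pl_conv (c : R) a a' : conv w act setT c (pl a) (pl a') (pl (c * a + (1 - c) * a')).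
Proof. by rewrite !pl_Kfr; exact: (frame_conv Hw Hh Hsym Heps pl_frame splane_basis). Qed.

Lemma pl_ef a : pl a a e /\ pl a (- a) f.
Proof.
have [ee ff fe] := Hef; have v1 : vge w 0 1 by rewrite -(nu_one_aux Hv); exact: (vge_nu Hv).
split; split; rewrite ?fe ?ee ?ff ?splane_ef ?subrr ?addNr //; exact: (vge0 Hv).
Qed.

Lemma nrm_pl a : nrm (pl a) e = a.
Proof. by have [] := hsplit_nrm Hw Hh Hef (pl_SD a) (pl_ef a). Qed.

Lemma pl_inj a a' : pl a = pl a' -> a = a'.
Proof. by move=> E; rewrite -(nrm_pl a) E nrm_pl. Qed.

Lemma hsplit_pl L a : SD L -> hsplit e f a L -> L = pl a.
Proof.
move=> SL HL; rewrite (hsplit_mod Hw Hh SL HL); apply/funext => r; apply/seteqP.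
split=> z; first by case.
by move=> [h1 h2]; split=> //; rewrite (spl_perp Hs); exact: (nf0 SL.1).
Qed.

Lemma splane_isotropic z : h z z = 0 -> h f z = 0 \/ h e z = 0.
Proof.
have [ee ff fe] := Hef; rewrite {2}(splane_decomp z) (hDr Hh) !(hZr Hh).
rewrite (sym_h Hh Hsym Heps z e) (sym_h Hh Hsym Heps z f).
rewrite (sym_comm Hh Hsym) -mulr2n -mulr_natr => E.
have [->|fz] := eqVneq (h f z) 0; first by left.
have [->|ez] := eqVneq (h e z) 0; first by right.
have := mul_neq0 Hv (mul_neq0 Hv fz ez) (two_neq0 Hw H2).
by rewrite E eqxx.
Qed.

(** Compare L with [pl 0]: either they agree or a hyperbolic pair splits L. An isotropic vector of
    the plane is a multiple of e or of f, so the pair is (e, f) up to rescaling and order. *)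
Lemma SD_pl L : SD L -> exists a, L = pl a.
Proof.
move=> SL; have SP := pl_SD 0; have [ee ff fe] := Hef.
have E : fixed (@id V) = setT by apply/seteqP; split.
have Hid : self_proj h (@id V) by split=> //; exact: (@End_id _ V).
have Hb0' : act_basis act (fixed id) b0 by rewrite E.
have [Heq|[e' [f' [a [a' [Hef' _ _ _ [Le Lf _ _ _]]]]]]] :=
  hyperbolic_step Hw Hh Hrho Hc H2 SL SP Hid (fun _ _ H => H) (fun _ _ H => H) Hb0'.
  by exists 0; apply/funext => r; apply/seteqP; split=> z /Heq; exact.
have HL := SL.1; have [e'e' f'f' f'e'] := Hef'.
have iso x y : h x x = 0 -> h y y = 0 -> h y x = 1 -> h e x = 0 ->
    [/\ x = act (h f x) e, y = act (h e y) f & h f x * h e y = 1].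
  move=> xx yy yx ex; have xE := splane_decomp x; rewrite ex (act0r HW) addr0 in xE.
  have yE := splane_decomp y.
  have [fy|ey] := splane_isotropic yy; last first.
    by move: yx; rewrite yE ey (act0r HW) addr0 (hZl Hh) ex mulr0 => /eqP; rewrite eq_sym oner_eq0.
  rewrite fy (act0r HW) add0r in yE; split=> //.
  by rewrite -yx {2}yE (hZl Hh) Hsym (sym_comm Hh Hsym).
have shift x c a1 : c != 0 -> L a1 (act c x) -> L (a1 - nu c) x.
  by move=> c0 /(nf_act Hw HW HL _ c0 I).
have unit1 (x y : A) : x * y = 1 -> [/\ x != 0, y != 0 & nu y = - nu x].
  move=> xy; have x0 : x != 0.
    by apply/eqP => x0; move: xy; rewrite x0 mul0r => /eqP; rewrite eq_sym oner_eq0.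
  have y0 : y != 0.
    by apply/eqP => y0; move: xy; rewrite y0 mulr0 => /eqP; rewrite eq_sym oner_eq0.
  split=> //; have := nuM Hv x0 y0; rewrite xy (nu_one_aux Hv); lra.
have [fe'|ee'] := splane_isotropic e'e'; last first.
  have [eE fE xy] := iso _ _ e'e' f'f' f'e' ee'; have [x0 y0 nE] := unit1 _ _ xy.
  exists (a - nu (h f e')); apply: hsplit_pl => //; split.
    by apply: shift; rewrite // -eE.
  have -> : - (a - nu (h f e')) = - a - nu (h e f') by lra.
  by apply: shift; rewrite // -fE.
have [ff'|ef'] := splane_isotropic f'f'.
  move: f'e'; rewrite (splane_decomp e') (splane_decomp f') fe' ff' !(act0r HW) !add0r.
  by rewrite (hZl Hh) (hZr Hh) ff mul0r mulr0 => /eqP; rewrite eq_sym oner_eq0.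
have [|fE eE xy] := iso _ _ f'f' e'e' _ ef'.
  by rewrite (sym_h Hh Hsym Heps).
have [x0 y0 nE] := unit1 _ _ xy.
exists (- a - nu (h f f')); apply: hsplit_pl => //; split.
  by apply: shift; rewrite // -fE.
have -> : - (- a - nu (h f f')) = a - nu (h e e') by lra.
by apply: shift; rewrite // -eE.
Qed.

Lemma plane_affine_const (F : (R -> set V) -> R) (p : R) : p != 0 ->
  (forall (c : R) L1 L2 L3, 0 <= c <= 1 -> SD L1 -> SD L2 -> SD L3 ->
    conv w act setT c L1 L2 L3 -> F L3 = c * F L1 + (1 - c) * F L2) ->
  (forall a, F (pl (a + p)) = F (pl a)) ->
  forall L L', SD L -> SD L' -> F L = F L'.
Proof.
move=> p0 Faff Fp L L' /SD_pl [a ->] /SD_pl [a' ->].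
apply: (periodic_affine (g := fun a => F (pl a)) p0) => // c a1 a2 c01.
by apply: Faff => //; try exact: pl_SD; exact: pl_conv.
Qed.
End Plane.

(** * Affine functions on the building of a general linear group *)

Section GeneralLinear.
Variables (R : realType) (A : unitRingType) (w : A -> \bar R).
Hypothesis Hw : dvaluation w.
Notation nu := (nu_step w).
Notation LB := (LB w).
Let Hv := dv_val Hw.
Let Adiv := dv_div Hw.
Variables (V : zmodType) (act : A -> V -> V) (W : set V).
Hypothesis HW : right_space act W.
Implicit Types (L : R -> set V) (r s t : R) (c : A).
Variables (n0 : nat) (b0 : 'I_n0 -> V).
Hypothesis Hb0 : act_basis act W b0.
Variable F : (R -> set V) -> R.
Hypothesis Faff : forall (c : R) L1 L2 L3, 0 <= c <= 1 -> conv w act W c L1 L2 L3 ->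
  F L3 = c * F L1 + (1 - c) * F L2.
Variable p : R.
Hypothesis p0 : p != 0.
Hypothesis Fp : forall L, normfam w act W L -> F (lf_translate L p) = F L.

Section Basis.
Variables (n : nat).
Implicit Types (b : 'I_n -> V) (a : 'I_n -> R).

Lemma F_LB b (c : R) a a' : act_basis act W b -> 0 <= c <= 1 ->
  F (LB act b (fun l => c * a l + (1 - c) * a' l)) = c * F (LB act b a) + (1 - c) * F (LB act b a').
Proof. by move=> Hb c01; apply: Faff => //; exists n, b, a, a'. Qed.

Lemma F_shift b a (s s' : R) : act_basis act W b ->
  F (LB act b (fun l => a l + s)) = F (LB act b (fun l => a l + s')).
Proof.
move=> Hb; apply: (periodic_affine (g := fun s => F (LB act b (fun l => a l + s))) p0).
  move=> c s1 s2 c01; rewrite -F_LB //; congr (F (LB act b _)).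
  by apply/funext => l; ring.
move=> s1; rewrite -[RHS](Fp (LB_normfam Hw HW _ Hb)) translate_LB.
by congr (F (LB act b _)); apply/funext => l; rewrite addrA.
Qed.

Definition upd2 a (i j : 'I_n) (x y : R) : 'I_n -> R :=
  fun l => if l == i then x else if l == j then y else a l.

Definition addv b (k m : 'I_n) : 'I_n -> V :=
  fun l => if l == k then b k + b m else b l.

Lemma addv_basis b k m : m != k -> act_basis act W b -> act_basis act W (addv b k m).
Proof.
move=> mk Hb; have Wb := basisW Hb.
have Wu l : W (addv b k m l) by rewrite /addv; case: eqP => // _; exact: (rsD HW).
apply: (indep_basis Adiv HW Hb Wu) => z.
pose z' l := z l + (if l == m then z k else 0).
have -> : comb act (addv b k m) z = comb act b z'.
  rewrite (combD HW) /comb [X in _ = _ + X](bigD1 m) //= eqxx.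
  rewrite [X in _ = _ + (_ + X)]big1 ?addr0; last by move=> l /negbTE ->; rewrite (act0r HW).
  rewrite (bigD1 k) //= [X in _ = X + _](bigD1 k) //= /addv eqxx (actDr HW) addrAC.
  by congr (_ + _ + _); apply: eq_bigr => l /negbTE ->.
have [_ _ Ib] := iffLR (basisP HW b) Hb; move=> /Ib z0 l.
have zk : z k = 0 by have := z0 k; rewrite /z' eq_sym (negbTE mk) addr0.
by have := z0 l; rewrite /z' zk if_same addr0.
Qed.

Lemma LB_eq b b' a a' : act_basis act W b -> act_basis act W b' ->
  (forall l, LB act b a (a' l) (b' l)) -> (forall l, LB act b' a' (a l) (b l)) ->
  LB act b a = LB act b' a'.
Proof.
move=> Hb Hb' H H'; apply/funext => r; apply/seteqP; split=> v.
  exact: (nf_LB_sub (LB_normfam Hw HW _ Hb')).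
exact: (nf_LB_sub (LB_normfam Hw HW _ Hb)).
Qed.

(** Replacing b j by b j + b i, or b i by b i + b j, changes LB only where the sum is dominated the
    wrong way. With the original basis this gives three lines glued along half lines, to which
    [three_fold] applies with branch point 0. *)
Lemma F_swap b a i j (m s s' : R) : act_basis act W b -> i != j ->
  F (LB act b (upd2 a i j (m + s) (m - s))) = F (LB act b (upd2 a i j (m + s') (m - s'))).
Proof.
move=> Hb ij; have ji : j != i by rewrite eq_sym.
have Hb1 : act_basis act W (addv b j i) by exact: addv_basis.
have Hb2 : act_basis act W (addv b i j) by exact: addv_basis.
have mid b' x x' y y' : act_basis act W b' -> F (LB act b' (upd2 a i j x y)) +
    F (LB act b' (upd2 a i j x' y')) = F (LB act b' (upd2 a i j ((x + x') / 2) ((y + y') / 2))) *+ 2.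
  move=> Hb'; have h01 : 0 <= (1 / 2 : R) <= 1 by apply/andP; split; lra.
  have := F_LB (upd2 a i j x y) (upd2 a i j x' y') Hb' h01.
  have -> : (fun l => 1 / 2 * upd2 a i j x y l + (1 - 1 / 2) * upd2 a i j x' y' l) =
      upd2 a i j ((x + x') / 2) ((y + y') / 2).
    by apply/funext => l; rewrite /upd2; case: eqP => _; [|case: eqP => _]; lra.
  lra.
have mem b' x y r l : act_basis act W b' -> r <= upd2 a i j x y l ->
    LB act b' (upd2 a i j x y) r (b' l) by move=> Hb' ?; apply/(LB_b Hw HW).
have ui x y : upd2 a i j x y i = x by rewrite /upd2 eqxx.
have uj x y : upd2 a i j x y j = y by rewrite /upd2 (negbTE ji) eqxx.
have b1i : addv b j i i = b i by rewrite /addv (negbTE ij).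
have b1j : addv b j i j = b j + b i by rewrite /addv eqxx.
have b2i : addv b i j i = b i + b j by rewrite /addv eqxx.
have b2j : addv b i j j = b j by rewrite /addv (negbTE ji).
have b12 l : l != i -> l != j -> addv b j i l = b l /\ addv b i j l = b l.
  by move=> li lj; rewrite /addv (negbTE li) (negbTE lj).
have uo x y l : l != i -> l != j -> upd2 a i j x y l = a l.
  by move=> li lj; rewrite /upd2 (negbTE li) (negbTE lj).
have N b' x y : act_basis act W b' -> normfam w act W (LB act b' (upd2 a i j x y)).
  by move=> Hb'; exact: (LB_normfam Hw HW).
have D b' x y r u v : act_basis act W b' -> LB act b' (upd2 a i j x y) r u ->
    LB act b' (upd2 a i j x y) r v -> LB act b' (upd2 a i j x y) r (u + v).
  by move=> Hb'; exact: (nfD (N _ _ _ Hb')).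
have B b' x y r u v : act_basis act W b' -> LB act b' (upd2 a i j x y) r u ->
    LB act b' (upd2 a i j x y) r v -> LB act b' (upd2 a i j x y) r (u - v).
  by move=> Hb'; exact: (nfB Hw HW (N _ _ _ Hb')).
apply: (three_fold (F1 := fun s => F (LB act b (upd2 a i j (m + s) (m - s))))
  (F2 := fun s => F (LB act (addv b j i) (upd2 a i j (m + s) (m - s))))
  (F3 := fun s => F (LB act (addv b i j) (upd2 a i j (m - s) (m + s)))) (g := 0)).
- move=> t t'; rewrite mid //; congr (F (LB act _ (upd2 _ _ _ _ _)) *+ 2); lra.
- move=> t t'; rewrite mid //; congr (F (LB act _ (upd2 _ _ _ _ _)) *+ 2); lra.
- move=> t t'; rewrite mid //; congr (F (LB act _ (upd2 _ _ _ _ _)) *+ 2); lra.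
- move=> t; rewrite oppr0 pmulrn_lge0 // => t0; congr F; apply: LB_eq => // l;
    (have [->|li] := eqVneq l i; [|have [->|lj] := eqVneq l j]).
  + by rewrite -b1i; apply: mem; rewrite ?ui.
  + have -> : b j = addv b j i j - addv b j i i by rewrite b1i b1j addrK.
    by apply: B => //; apply: mem; rewrite ?ui ?uj //; lra.
  + by have [<- _] := b12 _ li lj; apply: mem.
  + by rewrite b1i; apply: mem; rewrite ?ui.
  + by rewrite b1j; apply: D => //; apply: mem; rewrite ?ui ?uj //; lra.
  + by have [-> _] := b12 _ li lj; apply: mem.
- move=> t; rewrite oppr0 pmulrn_lle0 // => t0; congr F; apply: LB_eq => // l;
    (have [->|li] := eqVneq l i; [|have [->|lj] := eqVneq l j]).
  + rewrite b1i; have -> : b i = addv b i j i - addv b i j j by rewrite b2i b2j addrK.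
    by apply: B => //; apply: mem; rewrite ?ui ?uj //; lra.
  + by rewrite b1j (addrC (b j)) -b2i; apply: mem; rewrite // ?ui ?uj; lra.
  + by have [-> <-] := b12 _ li lj; rewrite uo // -(uo (m - t) (m + t)) //; apply: mem.
  + by rewrite b2i (addrC (b i)) -b1j; apply: mem; rewrite // ?ui ?uj; lra.
  + rewrite b2j; have -> : b j = addv b j i j - addv b j i i by rewrite b1i b1j addrK.
    by apply: B => //; apply: mem; rewrite ?ui ?uj //; lra.
  + by have [<- ->] := b12 _ li lj; rewrite uo // -(uo (m + t) (m - t)) //; apply: mem.
- move=> t; rewrite oppr0 pmulrn_lge0 // => t0; congr F; apply: LB_eq => // l;
    (have [->|li] := eqVneq l i; [|have [->|lj] := eqVneq l j]).
  + have -> : b i = addv b i j i - addv b i j j by rewrite b2i b2j addrK.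
    by apply: B => //; apply: mem; rewrite ?ui ?uj //; lra.
  + by rewrite -b2j; apply: mem; rewrite // ?ui ?uj; lra.
  + by have [_ <-] := b12 _ li lj; rewrite uo // -(uo (m - t) (m + t)) //; apply: mem.
  + by rewrite b2i; apply: D => //; apply: mem; rewrite // ?ui ?uj; lra.
  + by rewrite b2j; apply: mem; rewrite // ?ui ?uj; lra.
  + by have [_ ->] := b12 _ li lj; rewrite uo // -(uo (m + (- t + 0)) (m - (- t + 0))) //; apply: mem.
Qed.
End Basis.

(** Induction on the number of indices other than [ord0] where a and a' differ: [F_swap] moves the
    discrepancy at one index onto [ord0], and equality of the sums settles the last one. *)
Lemma F_sum n (b : 'I_n.+1 -> V) (a a' : 'I_n.+1 -> R) : act_basis act W b ->
  \sum_l a l = \sum_l a' l -> F (LB act b a) = F (LB act b a').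
Proof.
move=> Hb; have [k Hk] : exists k, #|[pred l | (l != ord0) && (a l != a' l)]| = k by eexists.
elim: k a Hk => [|k IH] a Hk Hs.
  have off l : l != ord0 -> a l = a' l.
    move=> l0; have := card0_eq Hk l; rewrite !inE l0 /= => /negbFE /eqP; exact.
  congr (F (LB act b _)); apply/funext => l; have [->|] := eqVneq l ord0; last exact: off.
  move: Hs; rewrite (bigD1 ord0) //= [RHS](bigD1 ord0) //=.
  by rewrite (eq_bigr a') => [/addIr|i /off].
have /card_gt0P [l] : (0 < #|[pred l | (l != ord0) && (a l != a' l)]|)%N by rewrite Hk.
rewrite inE => /andP[l0 al].
pose a1 := upd2 a l ord0 (a' l) (a ord0 + a l - a' l).
have aE : a = upd2 a l ord0 (a l) (a ord0).
  by apply/funext => i; rewrite /upd2; case: eqP => [->//|_]; case: eqP => [->|].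
have E1 : F (LB act b a) = F (LB act b a1).
  pose m := (a l + a ord0) / 2.
  have := F_swap a m (a l - m) (a' l - m) Hb l0.
  have -> : m + (a l - m) = a l by lra.
  have -> : m - (a l - m) = a ord0 by rewrite /m; lra.
  have -> : m + (a' l - m) = a' l by lra.
  have -> : m - (a' l - m) = a ord0 + a l - a' l by rewrite /m; lra.
  by rewrite -aE.
rewrite E1; apply: IH.
  apply/eqP; rewrite -eqSS -Hk (cardD1 l [pred l | (l != ord0) && (a l != a' l)]) inE l0 al /=.
  rewrite eqSS; apply/eqP; apply: eq_card => i; rewrite !inE /a1 /upd2.
  have [->|il] := eqVneq i l; first by rewrite eqxx andbF.
  by case: (i =P ord0).
rewrite -Hs (bigD1 l) //= [RHS](bigD1 l) //= (bigD1 ord0) 1?eq_sym //=.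
rewrite [X in _ = _ + X](bigD1 ord0) 1?eq_sym //=.
rewrite /a1 /upd2 !eqxx [ord0 == l]eq_sym (negbTE l0).
rewrite (eq_bigr a) => [|i /andP[/negbTE -> /negbTE ->]//]; lra.
Qed.

Lemma gl_affine_const L L' : normfam w act W L -> normfam w act W L' -> F L = F L'.
Proof.
move=> HL HL'; have [b [a [a' [Hb -> ->]]]] := normfam_LB2 Hw HW Hb0 HL HL'.
case: (n0) b a a' Hb => [|n] b a a' Hb; first by congr (F (LB act b _)); apply/funext => -[].
(* The average discrepancy: after shifting a' by s the sums agree, and the shift is harmless by
   periodicity. *)
pose s := (\sum_l a l - \sum_l a' l) / n.+1%:R.
rewrite (@F_sum _ b a (fun l => a' l + s)) //.
  rewrite (F_shift a' s 0 Hb); congr (F (LB act b _)); apply/funext => l.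
  by rewrite addr0.
rewrite big_split /= sumr_const card_ord -mulr_natr /s divfK ?pnatr_eq0 //; lra.
Qed.
End GeneralLinear.

(** * Algebraic groups of isometries *)

Record subfield_set (E : fieldType) (F : set E) : Prop := {
  sfs1 : F 1;
  sfsB : forall x y, F x -> F y -> F (x - y);
  sfsM : forall x y, F x -> F y -> F (x * y);
  sfsV : forall x, F x -> F x^-1 }.

Section SubfieldSet.
Variables (E : fieldType) (F : set E).
Hypothesis HF : subfield_set F.

Lemma sfs0 : F 0. Proof. by rewrite -(subrr 1); exact: (sfsB HF) (sfs1 HF) (sfs1 HF). Qed.
Lemma sfsN x : F x -> F (- x). Proof. by move=> Fx; rewrite -sub0r; exact: (sfsB HF) sfs0 Fx. Qed.
Lemma sfsD x y : F x -> F y -> F (x + y).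
Proof. by move=> Fx Fy; rewrite -[y]opprK; exact: (sfsB HF) Fx (sfsN Fy). Qed.
Lemma sfs_sum I (r : seq I) (P : pred I) (f : I -> E) : (forall i, P i -> F (f i)) -> F (\sum_(i <- r | P i) f i).
Proof. by move=> H; elim/big_ind: _ => //; [exact: sfs0|exact: sfsD]. Qed.
Lemma sfsX x n : F x -> F (x ^+ n).
Proof. by move=> Fx; elim: n => [|n IH]; rewrite ?expr0 ?exprS; [exact: (sfs1 HF)|exact: (sfsM HF)]. Qed.

End SubfieldSet.

Lemma sfsT (E : fieldType) : subfield_set [set: E].
Proof. by []. Qed.

(** * Laurent curves and Zariski connectedness *)

Section Laurent.
Variables (E K : fieldType) (F : set E) (tau : {rmorphism E -> K}).
Hypothesis HF : subfield_set F.

Definition poly_in (p : {poly E}) := forall n, F p`_n.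

Lemma poly_inD p q : poly_in p -> poly_in q -> poly_in (p + q).
Proof. by move=> hp hq n; rewrite coefD; exact: (sfsD HF). Qed.
Lemma poly_inM p q : poly_in p -> poly_in q -> poly_in (p * q).
Proof. by move=> hp hq n; rewrite coefM; apply: (sfs_sum HF) => i _; exact: (sfsM HF). Qed.
Lemma poly_inC c : F c -> poly_in c%:P.
Proof. by move=> hc n; rewrite coefC; case: ifP => // _; exact: (sfs0 HF). Qed.
Lemma poly_inXn n : poly_in 'X^n.
Proof. by move=> m; rewrite coefXn; case: eqP => _; [exact: (sfs1 HF)|exact: (sfs0 HF)]. Qed.

(** Functions of the form c^-N p(c) on the nonzero elements of F, with p having coefficients in F
    and values read in K through tau. *)
Definition laurent (f : E -> K) := exists N p, poly_in p /\
  forall c, F c -> c != 0 -> f c * tau c ^+ N = tau p.[c].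

Lemma laurent_const c : F c -> laurent (fun=> tau c).
Proof. by move=> hc; exists 0%N, c%:P; split=> [|x _ _]; [exact: poly_inC|rewrite expr0 mulr1 hornerC]. Qed.
Lemma laurent_var : laurent tau.
Proof.
exists 0%N, 'X^1; split=> [|x _ _]; first exact: poly_inXn.
by rewrite expr0 mulr1 hornerXn expr1.
Qed.
Lemma laurent_inv : laurent (fun c => (tau c)^-1).
Proof.
exists 1%N, 1%:P; split=> [|x _ x0]; first by apply: poly_inC; exact: (sfs1 HF).
by rewrite expr1 hornerC rmorph1 mulVf // fmorph_eq0.
Qed.
Lemma laurentD f g : laurent f -> laurent g -> laurent (fun c => f c + g c).
Proof.
move=> [N [p [hp Hp]]] [M [q [hq Hq]]]; exists (N + M)%N, (p * 'X^M + q * 'X^N); split.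
  by apply: poly_inD; apply: poly_inM => //; exact: poly_inXn.
move=> c Fc c0; rewrite hornerD !hornerM !hornerXn rmorphD !rmorphM !rmorphXn.
by rewrite -Hp // -Hq // exprD; ring.
Qed.
Lemma laurentM f g : laurent f -> laurent g -> laurent (fun c => f c * g c).
Proof.
move=> [N [p [hp Hp]]] [M [q [hq Hq]]]; exists (N + M)%N, (p * q); split; first exact: poly_inM.
by move=> c Fc c0; rewrite hornerM rmorphM -Hp // -Hq // exprD; ring.
Qed.
Lemma laurent_ext f g : laurent f -> (forall c, F c -> c != 0 -> f c = g c) -> laurent g.
Proof. by move=> [N [p [hp Hp]]] H; exists N, p; split=> // c Fc c0; rewrite -H // Hp. Qed.
Lemma laurent_big I (r : seq I) (f : I -> E -> K) :
  (forall i, laurent (f i)) -> laurent (fun c => \sum_(i <- r) f i c).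
Proof.
move=> H; elim: r => [|i r IH].
  apply: laurent_ext (laurent_const (sfs0 HF)) _ => c _ _.
  by rewrite big_nil rmorph0.
by apply: laurent_ext (laurentD (H i) IH) _ => c _ _; rewrite big_cons.
Qed.
Lemma laurentX f n : laurent f -> laurent (fun c => f c ^+ n).
Proof.
move=> H; elim: n => [|n IH].
  by apply: laurent_ext (laurent_const (sfs1 HF)) _ => c _ _; rewrite expr0 rmorph1.
by apply: laurent_ext (laurentM H IH) _ => c _ _; rewrite exprS.
Qed.
Lemma laurent_prod I (r : seq I) (f : I -> E -> K) :
  (forall i, laurent (f i)) -> laurent (fun c => \prod_(i <- r) f i c).
Proof.
move=> H; elim: r => [|i r IH].
  apply: laurent_ext (laurent_const (sfs1 HF)) _ => c _ _.
  by rewrite big_nil rmorph1.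
by apply: laurent_ext (laurentM (H i) IH) _ => c _ _; rewrite big_cons.
Qed.
Lemma laurent_meval n (p : mpoly.mpoly n K) (v : E -> 'I_n -> K) :
  (forall mon, (tau @` F) (mpoly.mcoeff mon p)) ->
  (forall l, laurent (v^~ l)) -> laurent (fun c => mpoly.meval (v c) p).
Proof.
move=> hp hv; apply: (@laurent_ext (fun c => \sum_(m <- mpoly.msupp p)
   mpoly.mcoeff m p * \prod_i v c i ^+ mpoly.fun_of_multinom m i)); last first.
  by move=> c _ _; rewrite mpoly.mevalE.
apply: laurent_big => m; apply: laurentM.
  by have [x Fx <-] := hp m; exact: laurent_const.
by apply: laurent_prod => i; apply: laurentX.
Qed.

End Laurent.

(** The curve is irreducible: if neither closed set contains it, pulling back equations gives two
    nonzero polynomials, and a nonzero parameter that is a root of neither yields a point outside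
    both sets. *)
Lemma curve_connected (K : closedFieldType) n (v : K -> 'I_n -> K) :
  (forall l, laurent [set: K] idfun (v^~ l)) ->
  zariski_connected (v @` [set c | c != 0]).
Proof.
move=> hv Z1 Z2 [P1 ->] [P2 ->] cov _.
pose good P := forall p, P p -> forall c : K, c != 0 -> mpoly.meval (v c) p = 0.
have bad P : ~ good P -> exists2 p, P p &
    exists N (q : {poly K}), q != 0 /\ forall c, c != 0 -> mpoly.meval (v c) p * c ^+ N = q.[c].
  move=> /asboolP; rewrite asbool_neg; move=> /existsp_asboolPn [p /asboolP].
  rewrite asbool_neg => /imply_asboolPn [Pp /asboolP].
  rewrite asbool_neg => /existsp_asboolPn [c /asboolP]; rewrite asbool_neg.
  move=> /imply_asboolPn [c0 hc]; exists p => //.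
  have [N [q [_ Hq]]] : laurent setT idfun (fun c => mpoly.meval (v c) p).
    by apply: (laurent_meval (sfsT K)) => // mo; exists (mpoly.mcoeff mo p).
  exists N, q; split; last by move=> x x0; exact: (Hq x I x0).
  apply/eqP => q0; apply: hc.
  have := Hq c I c0; rewrite q0 horner0 => /eqP.
  by rewrite mulf_eq0 expf_eq0 (negbTE c0) andbF orbF => /eqP.
have goodS P : good P -> v @` [set c | c != 0] `<=` [set x | forall p, P p -> mpoly.meval x p = 0].
  by move=> gP _ [c c0 <-] p /gP; exact.
have [g1|/bad [p1 Pp1 [N1 [q1 [q10 H1]]]]] := pselect (good P1).
  by left; exact: goodS.
have [g2|/bad [p2 Pp2 [N2 [q2 [q20 H2]]]]] := pselect (good P2).
  by right; exact: goodS.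
have : 'X * q1 * q2 != 0 :> {poly K} by rewrite !mulf_neq0 // polyX_eq0.
move=> /closed_nonrootP [c]; rewrite /root !hornerM hornerX !mulf_eq0 => /norP[/norP[c0 r1] r2].
have [|hc|hc] := cov (v c); first by exists c.
  by move: r1; rewrite -H1 // hc // mul0r eqxx.
by move: r2; rewrite -H2 // hc // mul0r eqxx.
Qed.

(** * Coordinates on the endomorphism algebra *)

Section FBasis.
Variables (E : fieldType) (F : set E) (D : falgType E) (V : lmodType D^c).
Hypothesis HF : subfield_set F.
Hypothesis Adiv : forall x : D, x != 0 -> x \is a GRing.unit.
Notation act := (@ract D V).
Let HW := ract_right_space V.
Notation sc c := (act ((c : E)%:A : D)).

Lemma alg_comm (c : E) (x : D) : c%:A * x = x * c%:A.
Proof. by rewrite mulr_algl mulr_algr. Qed.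

Lemma sc_comm (c : E) (x : D) (v : V) : sc c (act x v) = act x (sc c v).
Proof. by rewrite -!(actM HW) alg_comm. Qed.

Lemma scM (c c' : E) (v : V) : sc (c * c') v = sc c (sc c' v).
Proof. by rewrite -(actM HW) -scalerAl mul1r scalerA mulrC. Qed.
Lemma scD (c c' : E) (v : V) : sc (c + c') v = sc c v + sc c' v.
Proof. by rewrite scalerDl (actDl HW). Qed.
Lemma sc0 (v : V) : sc 0 v = 0.
Proof. by rewrite scale0r (act0r HW). Qed.
Lemma sc1 (v : V) : sc 1 v = v.
Proof. by rewrite scale1r (act1 HW). Qed.
Lemma sc_sum (J : Type) (r : seq J) (f : J -> E) (v : V) : sc (\sum_(j <- r) f j) v = \sum_(j <- r) sc (f j) v.
Proof. by elim: r => [|j r IH]; rewrite ?big_nil ?sc0 // !big_cons scD IH. Qed.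

Lemma End_sc (c : E) (f : V -> V) : End f -> End (fun v => sc c (f v)).
Proof.
move=> Ef; apply/EndP; split=> [u v|a u]; first by rewrite (EndD _ _ Ef) (actDr HW).
by rewrite (EndZ _ _ Ef) sc_comm.
Qed.

Lemma End_Fcomb n (c : 'I_n -> E) (b : 'I_n -> V -> V) : (forall l, End (b l)) -> End (Fcomb c b).
Proof. by move=> Eb; apply: End_bigsum => l _; exact: End_sc. Qed.

Section Coordinates.
Variables (n : nat) (b : 'I_n -> V -> V).
Hypothesis Hb : Fbasis F b.
Notation crdF := (Fcoord F b).
Let Eb := Hb.1.

Lemma FcoordP a : End a -> (forall l, F (crdF a l)) /\ a = Fcomb (crdF a) b.
Proof. by move=> /Hb.2 [c [Hc _]]; rewrite /Fcoord; case: xgetP => [y _ //|/(_ c)]. Qed.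

Lemma Fcoord_uniq a c : End a -> (forall l, F (c l)) -> a = Fcomb c b -> crdF a = c.
Proof. by move=> Ea Fc ac; have [c' [_ U]] := Hb.2 a Ea; rewrite -(U c) // -(U (crdF a)) //; exact: FcoordP. Qed.

Lemma Fcoord_lin (J : Type) (r : seq J) (c : J -> E) (f : J -> V -> V) :
  (forall j, F (c j)) -> (forall j, End (f j)) ->
  crdF (fun v => \sum_(j <- r) sc (c j) (f j v)) = fun p => \sum_(j <- r) c j * crdF (f j) p.
Proof.
move=> Fc Ef; apply: Fcoord_uniq.
- by apply: End_bigsum => j _; exact: End_sc.
- by move=> l; apply: (sfs_sum HF) => j _; apply: (sfsM HF) => //; exact: (FcoordP (Ef j)).1.
apply/funext => v; rewrite /Fcomb.
under [RHS]eq_bigr do rewrite sc_sum.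
rewrite exchange_big; apply: eq_bigr => j _.
rewrite {1}(FcoordP (Ef j)).2 /Fcomb (act_sumr HW); apply: eq_bigr => l _.
by rewrite scM.
Qed.

Variables (K : fieldType) (tau : {rmorphism E -> K}).
Notation bar := (bar F tau b).
Notation bar_mul := (bar_mul F tau b).

Lemma bar_inj a a' : End a -> End a' -> bar a = bar a' -> a = a'.
Proof.
move=> Ea Ea' H; rewrite (FcoordP Ea).2 (FcoordP Ea').2; congr (Fcomb _ b).
by apply/funext => l; have /(fmorph_inj tau) := congr1 (@^~ l) H.
Qed.

Lemma bar_comp a a' : End a -> End a' -> bar_mul (bar a) (bar a') = bar (a \o a').
Proof.
move=> Ea Ea'; apply/funext => p; rewrite /bar_mul /Defs.bar.
have -> : a \o a' = fun v => \sum_l sc (crdF a l) (b l (a' v)).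
  by apply/funext => v; rewrite {1}(FcoordP Ea).2.
rewrite Fcoord_lin; last first.
- by move=> l; exact: (End_comp (Eb l) Ea').
- exact: (FcoordP Ea).1.
rewrite rmorph_sum; apply: eq_bigr => l _ /=.
have -> : (fun v => b l (a' v)) = fun v => \sum_m sc (crdF a' m) (b l (b m v)).
  apply/funext => v; rewrite {1}(FcoordP Ea').2 /Fcomb (End_sum _ _ _ (Eb l)).
  by apply: eq_bigr => m _; rewrite (EndZ _ _ (Eb l)).
rewrite Fcoord_lin; last first.
- by move=> m; exact: (End_comp (Eb l) (Eb m)).
- exact: (FcoordP Ea').1.
rewrite rmorphM rmorph_sum mulr_sumr; apply: eq_bigr => m _ /=.
by rewrite rmorphM mulrA.
Qed.

Variables (rho : D -> D) (eps : D) (h : V -> V -> D).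
Hypothesis Hh : hermitian_form rho eps h.
Hypothesis Frho : forall c, F c -> rho c%:A = c%:A.
Variables (n0 : nat) (b0 : 'I_n0 -> V).
Hypothesis Hb0 : act_basis act setT b0.

Lemma adjoint_lin (J : Type) (r : seq J) (c : J -> E) (f : J -> V -> V) :
  (forall j, F (c j)) -> (forall j, End (f j)) ->
  adjoint h (fun v => \sum_(j <- r) sc (c j) (f j v)) = fun v => \sum_(j <- r) sc (c j) (adjoint h (f j) v).
Proof.
move=> Fc Ef; apply: (adjoint_uniq Hh Adiv Hb0).
  by apply: End_bigsum => j _; exact: End_sc.
move=> u v; elim: r => [|j r IH]; first by rewrite !big_nil (h0l Hh) (h0r Hh).
rewrite !big_cons (hDl Hh) (hDr Hh) IH; congr (_ + _).
by rewrite (hZl Hh) (hZr Hh) Frho // -(adjE Hh Adiv Hb0) // alg_comm.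
Qed.

Lemma bar_adj a : End a -> bar_adjoint F tau h b (bar a) = bar (adjoint h a).
Proof.
move=> Ea; apply/funext => p; rewrite /bar_adjoint /Defs.bar.
rewrite {2}(FcoordP Ea).2 /Fcomb adjoint_lin //; last exact: (FcoordP Ea).1.
rewrite Fcoord_lin; last first.
- by move=> l; exact: (adjoint_End Hh Adiv Hb0).
- exact: (FcoordP Ea).1.
by rewrite rmorph_sum; apply: eq_bigr => l _; rewrite rmorphM.
Qed.

Lemma bar_unitaryP a : End a -> bar_unitary F tau h b (bar a) <-> unitary_group h a.
Proof.
move=> Ea; have Ea' := adjoint_End Hh Adiv Hb0 Ea.
rewrite /bar_unitary /= bar_adj // bar_comp //; split=> [H|[_ ->] //].
by split=> //; apply: bar_inj H; [exact: End_comp|exact: End_id].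
Qed.

End Coordinates.

(** Products of the matrix units of a D-basis with an E-basis of D span the endomorphisms over E. *)
Lemma Fbasis_field m (b0 : 'I_m -> V) : act_basis act setT b0 ->
  exists n (b : 'I_n -> V -> V), Fbasis [set: E] b.
Proof.
move=> Hb0.
pose actE (c : E) (f : V -> V) : V -> V := fun v => sc c (f v).
have HE : right_space actE (@End D V).
  split=> /=.
  - exact: End_zero.
  - by move=> f g; exact: End_add.
  - by move=> a f; exact: End_sc.
  - by move=> a f g; apply/funext => v; rewrite /actE /= (actDr HW).
  - by move=> a c f; apply/funext => v; rewrite /actE scD.
  - by move=> a c f; apply/funext => v; rewrite /actE mulrC scM.
  - by move=> f _; apply/funext => v; rewrite /actE sc1.
pose e := vbasis {:D}.
pose J : finType := ('I_m * 'I_m * 'I_(\dim {:D}))%type.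
pose g (x : J) : V -> V := fun v => act (tnth e x.2 * crd act b0 v x.1.2) (b0 x.1.1).
have Eg x : End (g x).
  apply: End_ract_form; split=> [u v _ _|a u _].
    by rewrite (crdD HW Hb0) // mulrDr.
  by rewrite (crdZ HW Hb0) // mulrA.
have Sg f : End f -> exists x : J -> E, f = \sum_j actE (x j) (g j).
  move=> Ef; pose M p q : D := crd act b0 (f (b0 q)) p.
  exists (fun j => coord e j.2 (M j.1.1 j.1.2)); apply/funext => v.
  rewrite -{1}(crdP HW Hb0 (v := v)) // (End_comb _ _ Ef) /comb.
  rewrite fct_sumE -[RHS](pair_bigA _ (fun (j1 : 'I_m * 'I_m) (r : 'I_(\dim {:D})) =>
     actE (coord e r (M j1.1 j1.2)) (g (j1, r)) v)) /=.
  rewrite -(pair_bigA _ (fun p q => \sum_r actE (coord e r (M p q)) (g (p, q, r)) v)) /=.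
  rewrite exchange_big; apply: eq_bigr => q _.
  rewrite -{1}(crdP HW Hb0 (v := f (b0 q))) // /comb (act_sumr HW); apply: eq_bigr => p _.
  rewrite -(actM HW) -/(M p q) /actE /g /=.
  rewrite {1}(coord_vbasis (memvf (M p q))) mulr_suml (act_suml HW); apply: eq_bigr => r _.
  by rewrite -(actM HW) (tnth_nth 0) -/e -scalerAl mulr_algr.
have [c c0||f Ef|n [b Hb]] := spanning_basis HE _ (g := fun l : 'I_#|J| => g (enum_val l)).
- by rewrite unitfE.
- by move=> l; exact: Eg.
- have [x ->] := Sg f Ef; exists (fun l => x (enum_val l)).
  by rewrite /comb (reindex (@enum_val _ (mem J))) //; exact: onW_bij (@enum_val_bij _).
exists n, b; split=> [|a Ea]; first exact: Hb.1.
have [c [-> U]] := Hb.2 a Ea; exists c; split.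
  split=> //; apply/funext => v; rewrite fct_sumE; exact: eq_bigr.
by move=> c' [_ E']; apply: U; rewrite E'; apply/funext => v; rewrite fct_sumE.
Qed.

(** Since E is the direct sum of F and F s0, the maps b together with s0 b form a basis over F. *)
Lemma Fbasis_index2 (s0 : E) n (b : 'I_n -> V -> V) : ~ F s0 ->
  (forall c, exists x y, [/\ F x, F y & c = x + y * s0]) ->
  Fbasis [set: E] b -> exists b2 : 'I_(n + n) -> V -> V, Fbasis F b2.
Proof.
move=> Fs0 Hs [Eb Hb].
pose b2 (l : 'I_(n + n)) : V -> V :=
  match fintype.split l with inl p => b p | inr p => fun v => sc s0 (b p v) end.
have b2E (c : 'I_(n + n) -> E) :
    Fcomb c b2 = Fcomb (fun p => c (lshift n p) + c (rshift n p) * s0) b.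
  apply/funext => v; rewrite /Fcomb big_split_ord /=.
  under [RHS]eq_bigr do rewrite scD scM.
  rewrite big_split /=; congr (_ + _); apply: eq_bigr => p _; rewrite /b2.
    by rewrite (unsplitK (inl p)).
  by rewrite (unsplitK (inr p)).
exists b2; split=> [l|a Ea].
  by rewrite /b2; case: (fintype.split l) => p //; exact: End_sc.
have [c [[_ ac] U]] := Hb a Ea.
have [x Hx] := choice (fun p => Hs (c p)).
have [y Hy] := choice Hx.
exists (fun l => match fintype.split l with inl p => x p | inr p => y p end); split.
  split=> [l|]; first by case: (fintype.split l) => p; have [] := Hy p.
  rewrite b2E ac; congr (Fcomb _ b); apply/funext => p.
  by rewrite (unsplitK (inl p)) (unsplitK (inr p)); have [] := Hy p.
move=> c' [Fc' ac']; rewrite b2E in ac'.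
have {}U := U _ (conj (fun=> I) ac').
have key p : x p = c' (lshift n p) /\ y p = c' (rshift n p).
  have [Fx Fy] := Hy p; rewrite U => Exy.
  set x1 := c' (lshift n p) in Exy *; set y1 := c' (rshift n p) in Exy *.
  have Fx1 : F x1 by exact: Fc'. have Fy1 : F y1 by exact: Fc'.
  have Ey : (y p - y1) * s0 = x1 - x p.
    have -> : (y p - y1) * s0 = (x p + y p * s0) - (x1 + y1 * s0) + (x1 - x p) by ring.
    by rewrite Exy subrr add0r.
  have [y0|y0] := eqVneq (y p - y1) 0; last first.
    case: Fs0; have -> : s0 = (x1 - x p) / (y p - y1) by rewrite -Ey mulrAC mulfV // mul1r.
    by apply: (sfsM HF); [exact: (sfsB HF)|apply: (sfsV HF); exact: (sfsB HF)].
  move: Ey; rewrite y0 mul0r => /esym/eqP; rewrite subr_eq0 => /eqP ->.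
  by move/eqP: y0; rewrite subr_eq0 => /eqP ->.
apply/funext => l; rewrite -[l]splitK; case: (fintype.split l) => p /=.
  by rewrite (unsplitK (inl p)); exact: (key p).1.
by rewrite (unsplitK (inr p)); exact: (key p).2.
Qed.

End FBasis.


(** * Points of unitary and general linear groups *)

Section UnitaryPoints.
Variables (E : fieldType) (D : falgType E) (V : lmodType D^c).
Hypothesis HD : central_division_algebra D.
Variables (rho : D -> D) (eps : D) (h : V -> V -> D).
Hypothesis Hh : hermitian_form rho eps h.
Hypothesis D2 : 2%:R != 0 :> D.
Variables (n0 : nat) (b0 : 'I_n0 -> V).
Hypothesis Hb0 : act_basis (@ract D V) setT b0.
Notation act := (@ract D V).
Let HW := ract_right_space V.
Let Adiv := cda_division HD.
Let Hr := hermitian_involution Hh.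
Notation F := [set c : E | rho c%:A = c%:A].
Variables (K : closedFieldType) (tau : {rmorphism E -> K}).

Lemma central_scalar (x : D) : (forall y, x * y = y * x) -> exists c : E, x = c%:A.
Proof. exact: (iffLR (cda_central HD x)). Qed.

Lemma algM (c c' : E) : (c * c')%:A = c%:A * c'%:A :> D.
Proof. by rewrite -scalerAl mul1r scalerA. Qed.

Lemma algV (c : E) : (c^-1)%:A = (c%:A)^-1 :> D.
Proof. exact: (fmorphV (in_alg D)). Qed.

Lemma alg_eq0 (c : E) : (c%:A == 0 :> D) = (c == 0).
Proof. by rewrite scaler_eq0 oner_eq0 orbF. Qed.

Lemma alg_inj (c c' : E) : c%:A = c'%:A :> D -> c = c'.
Proof. by move=> /eqP; rewrite -subr_eq0 -scalerBl alg_eq0 subr_eq0 => /eqP. Qed.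

Lemma fixed_subfield : subfield_set F.
Proof.
split=> /=; first by rewrite scale1r (rho1 Hh).
- by move=> x y hx hy; rewrite scalerBl (rhoB Hh) hx hy.
- by move=> x y hx hy; rewrite algM (rhoM Hh) hx hy alg_comm.
- move=> x hx; have [->|x0] := eqVneq x 0; first by rewrite invr0 scale0r (rho0 Hh).
  by rewrite algV (rhoV Hh) ?hx // Adiv // alg_eq0.
Qed.

Lemma rho_scalar (c : E) : exists c' : E, rho c%:A = c'%:A.
Proof.
apply: central_scalar => y; rewrite -[y](rhoK Hh) -!(rhoM Hh); congr rho.
by rewrite alg_comm.
Qed.

(** The involution preserves the centre E. If c is moved, then c minus its conjugate is skew, and
    splitting scalars into symmetric and skew parts shows that it spans E over F together with 1. *)
Lemma fixed_index2 : F = setT \/ exists s0, ~ F s0 /\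
  forall c, exists x y, [/\ F x, F y & c = x + y * s0].
Proof.
have [FT|/existsNP [c Fc]] := pselect (forall c, F c).
  by left; apply/seteqP; split=> // c _; exact: FT.
have [c' hc'] := rho_scalar c.
have hc : rho c'%:A = c%:A by rewrite -hc' (rhoK Hh).
have E2 : 2%:R != 0 :> E.
  by apply: contra D2 => /eqP E2; rewrite -[2%:R]scale1r -(scaler_nat 2 (1 : D)) E2 !scale0r scaler0.
have s0F : c - c' != 0.
  by apply: contra_not_neq Fc => /eqP; rewrite subr_eq0 => /eqP cc; rewrite /= hc' -cc.
have rs0 : rho (c - c')%:A = - (c - c')%:A by rewrite scalerBl (rhoB Hh) hc' hc opprB.
right; exists (c - c'); split.
  rewrite /= rs0 -scaleNr => /alg_inj/eqP; rewrite eq_sym -addr_eq0 -mulr2n -mulr_natl.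
  by rewrite mulf_eq0 (negbTE E2) (negbTE s0F).
move=> x; have [x' hx'] := rho_scalar x.
have hx : rho x'%:A = x%:A by rewrite -hx' (rhoK Hh).
have F2 : F 2%:R by rewrite /= scaler_nat mulr2n (rhoD Hh) (rho1 Hh).
exists ((x + x') / 2%:R), ((x - x') / (2%:R * (c - c'))); split.
- apply: (sfsM fixed_subfield); last exact: (sfsV fixed_subfield).
  by rewrite /= scalerDl (rhoD Hh) hx' hx addrC.
- rewrite /= algM (rhoM Hh) algV (rhoV Hh); last by rewrite Adiv // alg_eq0 mulf_neq0.
  have -> : rho (2%:R * (c - c'))%:A = - (2%:R * (c - c'))%:A.
    by rewrite algM (rhoM Hh) F2 rs0 mulNr alg_comm.
  have -> : rho (x - x')%:A = - (x - x')%:A by rewrite scalerBl (rhoB Hh) hx' hx opprB.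
  by rewrite invrN mulrNN -algV alg_comm.
- by field; rewrite s0F E2.
Qed.

Lemma neutral_basis : exists n (b : 'I_n -> V -> V), Fbasis F b.
Proof.
have [n [b Hb]] := Fbasis_field Hb0.
have [FT|[s0 [Fs0 Hs0]]] := fixed_index2; first by exists n, b; rewrite FT.
by have [b2 Hb2] := Fbasis_index2 fixed_subfield Fs0 Hs0 Hb; exists (n + n)%N, b2.
Qed.

Lemma unitaryP g : unitary_group h g <-> End g /\ forall u v, h (g u) (g v) = h u v.
Proof.
split=> [[Eg gg]|[Eg gg]]; split=> //.
  by move=> u v; rewrite (adjE Hh Adiv Hb0) // -[adjoint h g (g v)]/((adjoint h g \o g) v) gg.
apply/funext => v; apply/eqP; rewrite -subr_eq0; apply/eqP; apply: (h_nondegr Hh) => u.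
by rewrite (hBr Hh) /= -(adjE Hh Adiv Hb0) // gg subrr.
Qed.

Lemma connected1 n (x : 'I_n -> K) : zariski_connected [set x].
Proof.
move=> Z1 Z2 _ _ cov _; have [|Zx|Zx] := cov x; rewrite //=.
  by left=> _ ->.
by right=> _ ->.
Qed.

Lemma unitary_neutral_id : unitary_neutral F tau h id.
Proof.
have Ui : unitary_group h id by apply/unitaryP; split=> //; exact: End_id.
have [n [b Hb]] := neutral_basis; split=> //; exists n, b; split=> //.
exists [set bar F tau b id]; split=> //; last exact: connected1.
move=> _ ->; apply/(bar_unitaryP fixed_subfield Adiv Hb tau Hh (fun c Fc => Fc) Hb0) => //.
Qed.

Section GL.
Notation FT := [set: E].

(** The curve of all nonzero multiples of the identity is connected and passes through 1 and c. *)
Lemma gl_neutral_scalar (c : E) : c != 0 -> gl_neutral FT tau (fun v => act c%:A v).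
Proof.
move=> c0; have Ei := @End_id _ V.
have Ec x : End (fun v : V => act x%:A v) by exact: (End_sc x Ei).
split.
  split; first exact: Ec.
  exists (fun v => act (c^-1)%:A v) => v.
    by rewrite -scM mulVf // sc1.
  by rewrite -scM mulfV // sc1.
have [n [b Hb]] := Fbasis_field Hb0; exists n, b; split=> //.
have lin x (y z : 'I_n -> K) p : bar_mul FT tau b (fun l => x * y l) z p = x * bar_mul FT tau b y z p.
  rewrite /bar_mul mulr_sumr; apply: eq_bigr => l _; rewrite mulr_sumr; apply: eq_bigr => m _.
  by rewrite !mulrA.
have linr x (y z : 'I_n -> K) p : bar_mul FT tau b y (fun l => x * z l) p = x * bar_mul FT tau b y z p.
  rewrite /bar_mul mulr_sumr; apply: eq_bigr => l _; rewrite mulr_sumr; apply: eq_bigr => m _.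
  by rewrite !mulrA (mulrC x).
pose v (x : K) l := x * bar FT tau b id l.
have vv x y : x * y = 1 -> bar_mul FT tau b (v x) (v y) = bar FT tau b id.
  move=> xy; apply/funext => p; rewrite /v lin linr mulrA xy mul1r.
  by rewrite (bar_comp (sfsT E) Hb tau Ei Ei).
exists (v @` [set x | x != 0]); split.
- by move=> _ [x x0 <-]; exists (v x^-1); rewrite !vv ?mulfV ?mulVf.
- apply: curve_connected => l; apply: (laurentM (sfsT K)); first exact: (laurent_var idfun (sfsT K)).
  exact: (laurent_const idfun (sfsT K)).
- by exists 1; [exact: oner_neq0|apply/funext => l; rewrite /v mul1r].
- exists (tau c); first by rewrite /= fmorph_eq0.
  apply/funext => l; rewrite /v /bar -rmorphM; congr (tau _).
  have := @Fcoord_lin E FT D V (sfsT E) n b Hb unit [:: tt] (fun=> c) (fun=> id) (fun=> I) (fun=> Ei).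
  have -> : (fun v => \sum_(j <- [:: tt]) act c%:A (id v)) = (fun v => act c%:A v).
    by apply/funext => u; rewrite big_seq1.
  by move=> ->; rewrite big_seq1.
Qed.

End GL.

(** * The unitary group of a split plane is O_2^is *)

Section Plane.
Variables (e f : V).
Hypothesis Hs : splane rho eps h e f.
Let Hsym := spl_rho Hs.
Let Heps := spl_eps Hs.
Let ee : h e e = 0. Proof. by case: (spl_pair Hs). Qed.
Let ff : h f f = 0. Proof. by case: (spl_pair Hs). Qed.
Let fe : h f e = 1. Proof. by case: (spl_pair Hs). Qed.
Let ef : h e f = 1. Proof. exact: (splane_ef Hh Hs). Qed.
Let FT : F = setT. Proof. by apply/seteqP; split=> // c _ /=; rewrite Hsym. Qed.

(** With trivial rho the algebra D is commutative, hence equal to its centre E; this is the inverse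
    of the inclusion of scalars. *)
Definition sca (x : D) : E := xget 0 [set c | x = c%:A].
Let scaK x : (sca x)%:A = x.
Proof.
rewrite /sca; case: xgetP => [c _ /= -> //|].
by have [y|c xc /(_ c)] := @central_scalar x; first exact: (sym_comm Hh Hsym).
Qed.
Let scaE c : sca c%:A = c. Proof. by apply: alg_inj; rewrite scaK. Qed.
Let scaD x y : sca (x + y) = sca x + sca y.
Proof. by apply: alg_inj; rewrite scalerDl !scaK. Qed.
Let scaM x y : sca (x * y) = sca x * sca y.
Proof. by apply: alg_inj; rewrite algM !scaK. Qed.

(* The matrix of an endomorphism in the basis [e, f]; the coordinates of [z] are *)
(* [h f z] and [h e z]. *)
Definition pvec (p : 'I_2) : V := if p == 0 then e else f.
Definition pmat (a : V -> V) (p q : 'I_2) : E := sca (h (pvec (rev_ord p)) (a (pvec q))).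

Lemma ord2_ind (P : 'I_2 -> Prop) : P 0 -> P 1 -> forall p, P p.
Proof. by move=> P0 P1 p; have [->|] := eqVneq p 0; [|have := ord1 0; case: p => [[|[|//]]] i //= _ _; rewrite (_ : Ordinal i = 1) //; exact: val_inj]. Qed.

Let rev0 : rev_ord (0 : 'I_2) = 1. Proof. exact: val_inj. Qed.
Let rev1 : rev_ord (1 : 'I_2) = 0. Proof. exact: val_inj. Qed.
Let sum2 (M : zmodType) (g : 'I_2 -> M) : \sum_p g p = g 0 + g 1.
Proof. by rewrite big_ord_recl big_ord1; congr (_ + g _); exact: val_inj. Qed.

Lemma pvec_decomp z : z = \sum_p act (h (pvec (rev_ord p)) z) (pvec p).
Proof. by rewrite sum2 rev0 rev1 /pvec /= -(splane_decomp Hs). Qed.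

Lemma pvec_h p q : h (pvec (rev_ord p)) (pvec q) = (p == q)%:R.
Proof.
by move: p; apply: ord2_ind; move: q; apply: ord2_ind; rewrite ?rev0 ?rev1 /pvec /=.
Qed.

Lemma pmat_id p q : pmat id p q = (p == q)%:R.
Proof. by apply: alg_inj; rewrite /pmat scaK pvec_h; case: eqP; rewrite ?scale1r ?scale0r. Qed.

Lemma pmat_comp a a' p q : End a -> pmat (a \o a') p q = \sum_r pmat a p r * pmat a' r q.
Proof.
move=> Ea; apply: alg_inj; rewrite /pmat scaK /= [in LHS](pvec_decomp (a' _)) !sum2 (EndD _ _ Ea) !(EndZ _ _ Ea).
by rewrite (hDr Hh) !(hZr Hh) scalerDl !algM !scaK.
Qed.

Lemma pmat_adj a p q : End a -> pmat (adjoint h a) p q = pmat a (rev_ord q) (rev_ord p).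
Proof.
by move=> Ea; rewrite /pmat rev_ordK -(adjE Hh Adiv Hb0) // (sym_h Hh Hsym Heps).
Qed.

Lemma pmat_lin (J : Type) (r : seq J) (c : J -> E) (g : J -> V -> V) p q :
  pmat (fun v => \sum_(j <- r) act (c j)%:A (g j v)) p q = \sum_(j <- r) c j * pmat (g j) p q.
Proof.
rewrite /pmat; elim: r => [|j r IH].
  by rewrite !big_nil (h0r Hh) -(scale0r (1 : D)) scaE.
by rewrite !big_cons (hDr Hh) (hZr Hh) scaD IH scaM scaE mulrC.
Qed.

Definition tmatb n (b : 'I_n -> V -> V) (x : 'I_n -> K) (p q : 'I_2) : K :=
  \sum_l x l * tau (pmat (b l) p q).

Section AnyBasis.
Variables (n : nat) (b : 'I_n -> V -> V).
Hypothesis Hb : Fbasis F b.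
Notation tmat := (tmatb b).

Lemma tmat_bar a p q : End a -> tmat (bar F tau b a) p q = tau (pmat a p q).
Proof.
move=> Ea; rewrite [in RHS](FcoordP Hb Ea).2 /Fcomb pmat_lin rmorph_sum.
by apply: eq_bigr => l _; rewrite rmorphM.
Qed.

Lemma tmat_id p q : tmat (bar F tau b id) p q = (p == q)%:R.
Proof. by rewrite tmat_bar ?pmat_id ?rmorph_nat //; exact: End_id. Qed.

Lemma tmat_mul x y p q : tmat (bar_mul F tau b x y) p q = \sum_r tmat x p r * tmat y r q.
Proof.
rewrite /tmatb /bar_mul.
under eq_bigr => l _ do rewrite mulr_suml.
rewrite exchange_big /=.
under eq_bigr => l _ do under eq_bigr => m _ do rewrite mulr_suml.
under eq_bigr => l _ do rewrite exchange_big /=.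
have E1 l m : \sum_j x l * y m * bar F tau b (b l \o b m) j * tau (pmat (b j) p q) =
    \sum_r (x l * tau (pmat (b l) p r)) * (y m * tau (pmat (b m) r q)).
  under eq_bigr do rewrite -mulrA.
  rewrite -mulr_sumr -[\sum_j _]/(tmat (bar F tau b (b l \o b m)) p q).
  rewrite tmat_bar; last by exact: (End_comp (Hb.1 l) (Hb.1 m)).
  rewrite pmat_comp ?rmorph_sum ?mulr_sumr; last exact: (Hb.1 l).
  by apply: eq_bigr => r _; rewrite rmorphM mulrACA.
under eq_bigr => l _ do under eq_bigr => m _ do rewrite E1.
under eq_bigr => l _ do rewrite exchange_big /=.
rewrite exchange_big /=; apply: eq_bigr => r _.
by rewrite mulr_suml; apply: eq_bigr => l _; rewrite mulr_sumr.
Qed.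

Lemma tmat_adj x p q : tmat (bar_adjoint F tau h b x) p q = tmat x (rev_ord q) (rev_ord p).
Proof.
rewrite /tmatb /bar_adjoint.
under eq_bigr => l _ do rewrite mulr_suml.
rewrite exchange_big /=; apply: eq_bigr => l _.
under eq_bigr do rewrite -mulrA.
rewrite -mulr_sumr -[\sum_j _]/(tmat (bar F tau b (adjoint h (b l))) p q).
by rewrite tmat_bar ?pmat_adj //; [exact: (Hb.1 l)|apply: (adjoint_End Hh Adiv Hb0); exact: (Hb.1 l)].
Qed.

(** The adjoint reflects a matrix in the antidiagonal, so the off-diagonal entries of the unitary
    equation are twice a product of two entries, and 2 is invertible. *)
Lemma tmat_unitary x : bar_unitary F tau h b x ->
  [/\ tmat x 1 1 * tmat x 0 1 = 0, tmat x 1 0 * tmat x 0 0 = 0 &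
      tmat x 1 1 * tmat x 0 0 + tmat x 0 1 * tmat x 1 0 = 1].
Proof.
move=> Ux; have H p q : \sum_r tmat x (rev_ord r) (rev_ord p) * tmat x r q = (p == q)%:R.
  by rewrite -tmat_id -Ux tmat_mul; apply: eq_bigr => r _; rewrite tmat_adj.
have K2 (z : K) : z + z = 0 -> z = 0.
  rewrite -mulr2n -mulr_natl => /eqP; rewrite mulf_eq0 => /orP[/eqP E2|/eqP //].
  have : tau 2%:R == 0 by rewrite rmorph_nat E2.
  rewrite fmorph_eq0 => /eqP E2'; case/eqP: D2.
  by rewrite -[2%:R]scaler_nat E2' scale0r.
have H00 := H 0 0; have H01 := H 0 1; have H10 := H 1 0.
rewrite !sum2 ?rev0 ?rev1 /= in H00 H01 H10; split=> //.
  by apply: K2; rewrite -[RHS]H01; congr (_ + _); rewrite mulrC.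
by apply: K2; rewrite -[RHS]H10 addrC; congr (_ + _); rewrite mulrC.
Qed.

Lemma tmat_O2is x : bar_unitary F tau h b x -> O2is (\matrix_(p, q) tmat x p q).
Proof.
move=> /tmat_unitary [h1 h2 h3]; have [x0|x0] := eqVneq (tmat x 0 0) 0.
  have h4 : tmat x 0 1 * tmat x 1 0 = 1 by rewrite -h3 x0 mulr0 add0r.
  have x1 : tmat x 0 1 != 0 by apply: contra_eq_neq h4 => ->; rewrite mul0r eq_sym oner_eq0.
  have x3 : tmat x 1 1 = 0 by move/eqP: h1; rewrite mulf_eq0 (negbTE x1) orbF => /eqP.
  exists (tmat x 0 1) => //; right; apply/matrixP => p q; rewrite !mxE.
  move: p; apply: ord2_ind; move: q; apply: ord2_ind; rewrite //=.
  by rewrite -[RHS]mul1r -h4 mulrAC mulfV ?mul1r.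
have x1 : tmat x 1 0 = 0 by move/eqP: h2; rewrite mulf_eq0 (negbTE x0) orbF => /eqP.
have h4 : tmat x 1 1 * tmat x 0 0 = 1 by rewrite -h3 x1 mulr0 addr0.
have x3 : tmat x 1 1 != 0 by apply: contra_eq_neq h4 => ->; rewrite mul0r eq_sym oner_eq0.
have x4 : tmat x 0 1 = 0 by move/eqP: h1; rewrite mulf_eq0 (negbTE x3) => /eqP.
exists (tmat x 0 0) => //; left; apply/matrixP => p q; rewrite !mxE.
move: p; apply: ord2_ind; move: q; apply: ord2_ind; rewrite //=.
by rewrite -[RHS]mul1r -h4 mulfK.
Qed.

Definition mpoly_tmat (p q : 'I_2) : mpoly.mpoly n K :=
  \sum_l tau (pmat (b l) p q) *: mpoly.mpolyX K (mpoly.mnm1 l).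

Lemma meval_tmat x p q : mpoly.meval x (mpoly_tmat p q) = tmat x p q.
Proof.
rewrite /mpoly_tmat raddf_sum; apply: eq_bigr => l _ /=.
by rewrite mpoly.mevalZ mpoly.mevalXU mulrC.
Qed.

Lemma closed_tmat p q p' q' :
  zariski_closed [set x | tmat x p q = 0 /\ tmat x p' q' = 0].
Proof.
exists [set mpoly_tmat p q; mpoly_tmat p' q'] => //.
apply/seteqP; split=> [x [h1 h2] _ [->|->]|x H]; rewrite ?meval_tmat //.
by split; rewrite -meval_tmat; apply: H; [left|right].
Qed.

End AnyBasis.

(** Unitary matrices are diagonal or antidiagonal, and these two conditions define disjoint closed
    sets; a connected set through the identity stays among the diagonal ones. *)
Lemma neutral_lines g : unitary_neutral F tau h g ->
  End g /\ (g e = act (h f (g e)) e /\ g f = act (h e (g f)) f).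
Proof.
move=> [Ug [n [b [Hb [S [SU Sc Si Sg]]]]]]; have Eg := Ug.1; split=> //.
have := Sc _ _ (closed_tmat b 0 1 1 0) (closed_tmat b 0 0 1 1).
have sub0 : h e (g e) = 0 /\ h f (g f) = 0 -> g e = act (h f (g e)) e /\ g f = act (h e (g f)) f.
  move=> [h1 h2]; rewrite {1}(splane_decomp Hs (g e)) {1}(splane_decomp Hs (g f)) h1 h2.
  by rewrite !(act0r HW) addr0 add0r.
have cov x : S x -> [set x | tmatb b x 0 1 = 0 /\ tmatb b x 1 0 = 0] x \/
    [set x | tmatb b x 0 0 = 0 /\ tmatb b x 1 1 = 0] x.
  move=> /SU /(tmat_unitary Hb) [h1 h2 h3]; have [x0|x0] := eqVneq (tmatb b x 0 0) 0; last first.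
    left; split; last by move/eqP: h2; rewrite mulf_eq0 (negbTE x0) orbF => /eqP.
    move/eqP: h1; rewrite mulf_eq0 => /orP[/eqP x3|/eqP //].
    move/eqP: h2; rewrite mulf_eq0 (negbTE x0) orbF => /eqP x1.
    by move: h3; rewrite x3 x1 mul0r mulr0 add0r => /eqP; rewrite eq_sym oner_eq0.
  right; split=> //; move/eqP: h1; rewrite mulf_eq0 => /orP[/eqP //|/eqP x1].
  by move: h3; rewrite x0 x1 mulr0 mul0r add0r => /eqP; rewrite eq_sym oner_eq0.
case=> // [|H|/(_ _ Si) [+ _]].
- apply/seteqP; split=> // x [Sx [[h1 h2] [h3 h4]]].
  have [_ _] := tmat_unitary Hb (SU _ Sx); rewrite h3 h1 mulr0 mul0r add0r => /eqP.
  by rewrite eq_sym oner_eq0.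
- apply: sub0; have [] := H _ Sg; rewrite !(tmat_bar Hb) // => /eqP; rewrite fmorph_eq0 => /eqP m1.
  move=> /eqP; rewrite fmorph_eq0 => /eqP m2.
  move: m1 m2; rewrite /pmat rev0 rev1 /pvec /= => /(congr1 (fun c => c%:A : D)) + /(congr1 (fun c => c%:A : D)).
  by rewrite !scaK scale0r.
- by rewrite (tmat_id Hb) eqxx => /eqP; rewrite oner_eq0.
Qed.

Definition mendo (M : 'M[E]_2) : V -> V := fun z =>
  \sum_p act (\sum_q (M p q)%:A * h (pvec (rev_ord q)) z) (pvec p).

Lemma mendo_End M : End (mendo M).
Proof.
apply: End_bigsum => p _; apply: End_ract_form; split=> [u v _ _|a u _].
  by rewrite -big_split; apply: eq_bigr => q _; rewrite (hDr Hh) mulrDr.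
by rewrite mulr_suml; apply: eq_bigr => q _; rewrite (hZr Hh) mulrA.
Qed.

Lemma pmat_mendo M p q : pmat (mendo M) p q = M p q.
Proof.
apply: alg_inj; rewrite /pmat scaK /mendo (h_combr Hh _ pvec).
rewrite (bigD1 p) //= [X in _ + X]big1 ?addr0 => [|p' np]; last first.
  by rewrite pvec_h eq_sym (negbTE np) mul0r.
rewrite pvec_h eqxx mul1r (bigD1 q) //= big1 ?addr0 => [|q' nq].
  by rewrite pvec_h eqxx mulr1.
by rewrite pvec_h (negbTE nq) mulr0.
Qed.

Lemma mendo_pmat a : End a -> mendo (\matrix_(p, q) pmat a p q) = a.
Proof.
move=> Ea; apply/funext => z; rewrite [in RHS](pvec_decomp (a z)); apply: eq_bigr => p _; congr act.
rewrite [in RHS](pvec_decomp z) (End_sum _ _ _ Ea).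
rewrite -[RHS]/(h _ _) (eq_bigr (fun q => act (h (pvec (rev_ord q)) z) (a (pvec q)))); last first.
  by move=> q _; rewrite (EndZ _ _ Ea).
rewrite (h_combr Hh _ (a \o pvec)); apply: eq_bigr => q _ /=.
by rewrite mxE /pmat scaK.
Qed.

Definition munit (l : 'I_(2 * 2)) : V -> V := mendo (vec_mx (delta_mx 0 l)).

Lemma Fcomb_munit c : Fcomb c munit = mendo (vec_mx (\row_l c l)).
Proof.
rewrite -[LHS](mendo_pmat (a := Fcomb c munit)); last by apply: (End_Fcomb c) => l; exact: mendo_End.
congr mendo; apply/matrixP => p q; rewrite mxE /Fcomb pmat_lin.
under eq_bigr do rewrite pmat_mendo.
have -> : \row_l c l = \sum_l c l *: delta_mx 0 l.
  by rewrite [LHS]row_sum_delta; apply: eq_bigr => l _; rewrite mxE.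
by rewrite linear_sum summxE; apply: eq_bigr => l _; rewrite !mxE.
Qed.

Lemma munit_basis : Fbasis F munit.
Proof.
split=> [l|a Ea]; first exact: mendo_End.
exists (fun l => mxvec (\matrix_(p, q) pmat a p q) 0 l); split.
  split=> [l /=|]; first by rewrite Hsym.
  rewrite Fcomb_munit -[LHS]mendo_pmat //; congr mendo; rewrite -[LHS]mxvecK; congr vec_mx.
  by apply/rowP => l; rewrite mxE.
move=> c [_ ac]; apply/funext => l; rewrite ac Fcomb_munit.
rewrite (_ : \matrix_(p, q) _ = vec_mx (\row_l c l)) ?vec_mxK ?mxE //.
by apply/matrixP => p q; rewrite mxE pmat_mendo.
Qed.

Lemma tmat_munit x p q : tmatb munit x p q = (vec_mx (\row_l x l)) p q.
Proof.
have -> : \row_l x l = \sum_l x l *: delta_mx 0 l.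
  by rewrite [LHS]row_sum_delta; apply: eq_bigr => l _; rewrite mxE.
rewrite linear_sum summxE; apply: eq_bigr => l _; rewrite /munit pmat_mendo.
by rewrite !mxE rmorph_nat.
Qed.

Lemma tmat_munit_inj x y : (forall p q, tmatb munit x p q = tmatb munit y p q) -> x = y.
Proof.
move=> H; apply/funext => l.
have : vec_mx (\row_l x l) = vec_mx (\row_l y l) :> 'M_2.
  by apply/matrixP => p q; rewrite -!tmat_munit.
by move=> /(congr1 mxvec); rewrite !vec_mxK => /rowP /(_ l); rewrite !mxE.
Qed.

Lemma tmat_mxvec (M : 'M[K]_2) p q : tmatb munit (fun l => mxvec M 0 l) p q = M p q.
Proof.
by rewrite tmat_munit; have -> : \row_l mxvec M 0 l = mxvec M;
  [apply/rowP => l; rewrite mxE|rewrite mxvecK].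
Qed.

Lemma bar_unitary_mxvec (M : 'M[K]_2) : O2is M -> bar_unitary F tau h munit (fun l => mxvec M 0 l).
Proof.
move=> OM; apply: tmat_munit_inj => p q.
rewrite (tmat_mul munit_basis) (tmat_id munit_basis).
under eq_bigr do rewrite (tmat_adj munit_basis) !tmat_mxvec.
rewrite sum2 rev0 rev1; have [c c0 [->|->]] := OM; rewrite !mxE; move: p; apply: ord2_ind; move: q; apply: ord2_ind;
  by rewrite ?rev0 ?rev1 /= ?mulr0 ?mul0r ?addr0 ?add0r ?mulfV ?mulVf.
Qed.

(** In the basis of matrix units the coordinates of an endomorphism are its matrix entries, so the
    isomorphism and its inverse are linear. *)
Lemma splane_is_O2is : is_O2is F tau h.
Proof.
exists (2 * 2)%N, munit; split; first exact: munit_basis.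
exists (mpoly_tmat munit), (fun l => mpoly.mpolyX K (mpoly.mnm1 l)).
have fE x : (\matrix_(i, j) mpoly.meval x (mpoly_tmat munit i j)) = \matrix_(i, j) tmatb munit x i j.
  by apply/matrixP => i j; rewrite !mxE meval_tmat.
have gE (M : 'M[K]_2) : (fun l => mpoly.meval (fun q => mxvec M 0 q) (mpoly.mpolyX K (mpoly.mnm1 l))) =
    (fun l => mxvec M 0 l).
  by apply/funext => l; rewrite mpoly.mevalXU.
split=> /=.
- move=> i j mon; rewrite /mpoly_tmat raddf_sum /=.
  exists (\sum_l pmat (munit l) i j * (mpoly.mnm1 l == mon)%:R).
    by rewrite Hsym.
  rewrite rmorph_sum; apply: eq_bigr => l _.
  by rewrite mpoly.mcoeffZ mpoly.mcoeffX rmorphM rmorph_nat.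
- move=> l mon; exists (mpoly.mnm1 l == mon)%:R; first by rewrite /= Hsym.
  by rewrite mpoly.mcoeffX rmorph_nat.
- move=> x Ux; rewrite fE gE; split; first exact: (tmat_O2is munit_basis).
  by apply: tmat_munit_inj => p q; rewrite tmat_mxvec mxE.
- move=> M OM; rewrite gE fE; split; first exact: bar_unitary_mxvec.
  by apply/matrixP => p q; rewrite mxE tmat_mxvec.
- move=> x y _ _; rewrite !fE; apply/matrixP => p q; rewrite !mxE (tmat_mul munit_basis).
  by apply: eq_bigr => r _; rewrite !mxE.
Qed.

Definition torus (c : E) : V -> V := fun z => act (c%:A * h f z) e + act ((c^-1)%:A * h e z) f.

Lemma torus_neutral c : c != 0 -> unitary_neutral F tau h (torus c).
Proof.
move=> c0; pose dg (L : fieldType) (x : L) : 'M[L]_2 :=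
  \matrix_(i, j) (if i == j then (if i == 0 then x else x^-1) else 0).
have tE : torus c = mendo (dg E c).
  apply/funext => z; rewrite /mendo /torus !sum2 rev0 rev1 !mxE /pvec /=.
  by rewrite !scale0r !mul0r addr0 add0r.
have Et : End (torus c) by rewrite tE; exact: mendo_End.
pose v (x : K) l := mxvec (dg K x) 0 l.
have Uv x : x != 0 -> bar_unitary F tau h munit (v x).
  by move=> x0; apply: bar_unitary_mxvec; exists x => //; left.
have vt : v (tau c) = bar F tau munit (torus c).
  apply: tmat_munit_inj => p q; rewrite tmat_mxvec (tmat_bar munit_basis) // tE pmat_mendo !mxE.
  by case: ifP => _; [case: ifP; rewrite ?fmorphV|rewrite rmorph0].
have tc0 : tau c != 0 by rewrite fmorph_eq0.
split.
  apply/(bar_unitaryP fixed_subfield Adiv munit_basis tau Hh (fun c Fc => Fc) Hb0) => //.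
  by rewrite -vt; exact: Uv.
exists (2 * 2)%N, munit; split; first exact: munit_basis.
exists (v @` [set x | x != 0]); split.
- by move=> _ [x x0 <-]; exact: Uv.
- apply: curve_connected => l; case/mxvec_indexP: l => p q.
  apply: (laurent_ext (f := fun x => if p == q then (if p == 0 then x else x^-1) else 0)).
    case: (p == q); last exact: (laurent_const idfun (sfsT K) (c := 0)).
    case: (p == 0); first exact: (laurent_var idfun (sfsT K)).
    exact: (laurent_inv idfun (sfsT K)).
  by move=> x _ _; rewrite /v mxvecE mxE.
- exists 1; first exact: oner_neq0.
  apply: tmat_munit_inj => p q; rewrite tmat_mxvec (tmat_id munit_basis) mxE invr1.
  by case: ifP => //; rewrite if_same.
- by exists (tau c).
Qed.
End Plane.

End UnitaryPoints.


(** * A unitary group isomorphic to O_2^is comes from a split plane *)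

Section O2isSplit.
Variables (E : fieldType) (D : falgType E) (V : lmodType D^c).
Hypothesis HD : central_division_algebra D.
Variables (rho : D -> D) (eps : D) (h : V -> V -> D).
Hypothesis Hh : hermitian_form rho eps h.
Hypothesis D2 : 2%:R != 0 :> D.
Hypothesis Einf : infinite_set [set: E].
Variables (n0 : nat) (b0 : 'I_n0 -> V).
Hypothesis Hb0 : act_basis (@ract D V) setT b0.
Notation act := (@ract D V).
Let HW := ract_right_space V.
Let Adiv := cda_division HD.
Notation F := [set c : E | rho c%:A = c%:A].
Variables (K : closedFieldType) (tau : {rmorphism E -> K}).
Let HF := fixed_subfield HD Hh.

Let E2 : 2%:R != 0 :> E.
Proof.
by apply: contra D2 => /eqP E2; rewrite -[2%:R]scale1r -(scaler_nat 2 (1 : D)) E2 !scale0r scaler0.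
Qed.

Lemma fixed_infinite : infinite_set F.
Proof.
have [->|[s0 [_ Hs0]]] := fixed_index2 HD Hh D2; first exact: Einf.
move=> Ff; apply: Einf.
apply: (sub_finite_set _ (finite_image2 (fun x y => x + y * s0) Ff Ff)) => c _.
by have [x [y [Fx Fy ->]]] := Hs0 c; exists x => //; exists y.
Qed.

Lemma fixed_nonroot (p : {poly E}) : p != 0 -> exists c, [/\ F c, c != 0 & p.[c] != 0].
Proof.
move=> p0; have p1 : 'X * p != 0 by rewrite mulf_neq0 // polyX_eq0.
have [B BF Bn] := infinite_set_fset (size ('X * p)) fixed_infinite.
have [/allP H|/allPn [c cB]] := boolP (all (root ('X * p)) (finmap.enum_fset B)).
  have := max_poly_roots p1 (introT allP H) (finmap.fset_uniq B).
  by rewrite ltnNge Bn.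
rewrite /root hornerM hornerX mulf_eq0 => /norP [c0 pc]; exists c; split=> //.
exact: BF.
Qed.

(** Coordinates in a basis of D over E give polynomials over E, and a nonzero one has a nonzero
    non-root in the infinite field F. *)
Lemma dpoly_eq0 (G : {poly D}) : (forall c, F c -> c != 0 -> G.[c%:A] = 0) -> G = 0.
Proof.
move=> HG; apply/polyP => n; rewrite coef0 (coord_vbasis (memvf G`_n)); apply: big1 => r _.
pose p : {poly E} := \poly_(i < size G) coord (vbasis {:D}) r G`_i.
have p0 : p = 0.
  apply/eqP/negPn/negP => /fixed_nonroot [c [Fc c0]]; rewrite horner_poly.
  have := congr1 (coord (vbasis {:D}) r) (HG c Fc c0).
  rewrite horner_coef linear0 linear_sum => E0; case/eqP.
  rewrite -[RHS]E0; apply: eq_bigr => i _.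
  have -> : (c%:A : D) ^+ i = (c ^+ i)%:A by rewrite -(rmorphXn (in_alg D)).
  by rewrite mulr_algr linearZ mulrC.
have := congr1 (fun q : {poly E} => q`_n) p0; rewrite coef0 coef_poly.
by case: ltnP => [_ ->|/leq_sizeP -> //]; rewrite ?scale0r // linear0 scale0r.
Qed.

Lemma isotropic_hpair u : u != 0 -> h u u = 0 -> exists f, hpair h u f.
Proof.
move=> u0 uu; have [v hv] : exists v, h v u != 0.
  have [//|H] := pselect (exists v, h v u != 0).
  case/eqP: u0; apply: (h_nondegr Hh) => v; apply/eqP/negPn/negP => hv.
  by apply: H; exists v.
have Uv := Adiv hv.
have [v1 v1u] : exists v1, h v1 u = 1.
  by exists (act (rho (h v u)^-1) v); rewrite (hZl Hh) (rhoK Hh) mulVr.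
have uv1 : h u v1 = eps by rewrite (hsym Hh) v1u (rho1 Hh) mulr1.
pose t : D := (2%:R^-1)%:A; have tt : t + t = 1 
  by rewrite /t -scalerDl (_ : 2%:R^-1 + 2%:R^-1 = 1) ?scale1r //; field; rewrite E2.
have tC x : t * x = x * t by rewrite alg_comm.
have F2 : F 2%:R by rewrite /= scaler_nat mulr2n (rhoD Hh) (rho1 Hh).
have rt : rho t = t := sfsV HF F2.
set q := h v1 v1; set x := - (t * q).
have eq : eps * rho q = q by rewrite -(hsym Hh).
exists (v1 + act x u); split=> //; last by rewrite (hDl Hh) (hZl Hh) v1u uu mulr0 addr0.
rewrite !(hDl Hh) !(hDr Hh) !(hZr Hh) !(hZl Hh) v1u uv1 uu !mulr0 mul0r addr0 mul1r -/q /x.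
rewrite (rhoN Hh) (rhoM Hh) rt mulNr -(epsC Hh) mulrA eq -tC.
by rewrite -addrA -opprD -mulrDl tt mul1r subrr.
Qed.

Section Pair.
Variables (e f : V).
Hypothesis Hef : hpair h e f.
Let ee : h e e = 0. Proof. by case: Hef. Qed.
Let ff : h f f = 0. Proof. by case: Hef. Qed.
Let fe : h f e = 1. Proof. by case: Hef. Qed.
Let ef : h e f = eps. Proof. exact: (hpair_ef Hh Hef). Qed.
Notation pperp := (perp eps h e f).

Lemma pair_coords x y p : h f p = 0 -> h e p = 0 ->
  [/\ h f (act x e + act y f + p) = x, h e (act x e + act y f + p) = eps * y &
      pperp (act x e + act y f + p) = p].
Proof.
move=> fp ep; set z := act x e + act y f + p.
have h1 : h f z = x by rewrite !(hDr Hh) !(hZr Hh) fe ff fp mul1r mul0r !addr0.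
have h2 : h e z = eps * y by rewrite !(hDr Hh) !(hZr Hh) ee ef ep mul0r add0r addr0.
split=> //; rewrite /perp h1 h2 mulrA (eps2 Hh) mul1r /z.
by rewrite -addrA -opprD [_ + _ + p]addrC addrK.
Qed.

Lemma pair_map X Y P : lform act setT X -> lform act setT Y -> End P ->
  (forall z, h f (P z) = 0 /\ h e (P z) = 0) ->
  (forall z z', rho (X z) * (eps * Y z') + rho (Y z) * X z' + h (P z) (P z') = h z z') ->
  exists g, [/\ unitary_group h g, forall z, h f (g z) = X z, forall z, h e (g z) = eps * Y z
    & forall z, pperp (g z) = P z].
Proof.
move=> HX HY EP HP U; exists (fun z => act (X z) e + act (Y z) f + P z).
have H z := pair_coords (X z) (Y z) (HP z).1 (HP z).2.
split; try by move=> z; case: (H z).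
apply/(unitaryP HD Hh Hb0); split.
  by apply: End_add EP; apply: End_add; exact: End_ract_form.
move=> z z'; rewrite (h_decomp Hh Hef); have [-> -> ->] := H z; have [-> -> ->] := H z'.
by rewrite (epsK Hh) U.
Qed.

Let lf : lform act setT (h f) := h_lform Hh f.
Let le : lform act setT (h e) := h_lform Hh e.
Let Ep : End pperp := sp_End (perp_proj Hh Hef).

Lemma lform_mull c (lam : V -> D) : lform act setT lam -> lform act setT (fun z => c * lam z).
Proof.
move=> Hl; split=> [u v _ _|a u _]; first by rewrite (lformD Hl) // mulrDr.
by rewrite (lformZ Hl) // mulrA.
Qed.

Lemma lform_add (lam mu : V -> D) : lform act setT lam -> lform act setT mu ->
  lform act setT (fun z => lam z + mu z).
Proof.
move=> Hl Hm; split=> [u v _ _|a u _]; first by rewrite (lformD Hl) // (lformD Hm) // addrACA.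
by rewrite (lformZ Hl) // (lformZ Hm) // mulrDl.
Qed.

Let h_dec z z' : h z z' = rho (h f z) * h e z' + rho (h e z) * eps * h f z' + h (pperp z) (pperp z').
Proof. by rewrite (h_decomp Hh Hef) (rhoM Hh) (rho_eps Hh). Qed.

Lemma pair_torus c : c != 0 -> F c -> exists g,
  [/\ unitary_group h g, forall z, h f (g z) = c%:A * h f z,
      forall z, h e (g z) = (c^-1)%:A * h e z & forall z, pperp (g z) = pperp z].
Proof.
move=> c0 Fc; have Fc' := sfsV HF Fc.
have cc : c%:A * (c^-1)%:A = 1 :> D by rewrite -algM mulfV // scale1r.
have cc' : (c^-1)%:A * c%:A = 1 :> D by rewrite -algM mulVf // scale1r.
have [||//|z|z z'|g [H1 H2 H3 H4]] := @pair_map (fun z => c%:A * h f z)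
  (fun z => (c^-1)%:A * (eps * h e z)) pperp.
- exact: lform_mull.
- by apply: lform_mull; exact: lform_mull.
- by rewrite (h_f_perp Hh Hef) (h_e_perp Hh Hef).
- rewrite [RHS]h_dec !(rhoM Hh) (rho_eps Hh) Fc Fc'; congr (_ + _ + _).
    by rewrite -mulrA (mulrA eps) -(alg_comm _ eps) -(mulrA _ eps) (epsK Hh) (mulrA c%:A) cc mul1r.
  by rewrite -!mulrA (mulrA (c^-1)%:A) cc' mul1r.
exists g; split=> // z; rewrite H3 (mulrA eps) -(alg_comm _ eps) -mulrA (epsK Hh) //.
Qed.

Lemma pair_transvection d : eps * rho d = - d -> exists g,
  [/\ unitary_group h g, forall z, h f (g z) = h f z + d * (eps * h e z)
    & forall z, h e (g z) = h e z].
Proof.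
move=> Ed; have [||//|z|z z'|g [H1 H2 H3 H4]] := @pair_map (fun z => h f z + d * (eps * h e z))
  (fun z => eps * h e z) pperp.
- by apply: lform_add lf _; apply: lform_mull; exact: lform_mull.
- exact: lform_mull.
- by rewrite (h_f_perp Hh Hef) (h_e_perp Hh Hef).
- rewrite [RHS]h_dec (epsK Hh) (rhoD Hh) mulrDl mulrDr !(rhoM Hh) (rho_eps Hh); congr (_ + _).
  rewrite -!addrA; congr (_ + _); rewrite addrC -!addrA -[RHS]addr0; congr (_ + _).
  rewrite -!mulrA (mulrA eps d) (epsC Hh) -(mulrA d) (epsK Hh) (mulrA eps (rho d)) Ed.
  by rewrite mulNr mulrN subrr.
by exists g; split=> // z; rewrite H3 (epsK Hh).
Qed.

Lemma pair_eichler w0 : (forall c, rho c = c) -> eps = 1 -> h f w0 = 0 -> h e w0 = 0 -> exists g,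
  [/\ unitary_group h g, forall z, h e (g z) = h e z
    & forall z, pperp (g z) = pperp z + act (h e z) w0].
Proof.
move=> Hsym Heps fw ew.
have sc (x : D) : exists c : E, x = c%:A.
  by apply: (central_scalar HD) => y; exact: (sym_comm Hh Hsym).
have hp z : h w0 (pperp z) = h w0 z.
  by rewrite -(sp_adj (perp_proj Hh Hef)) (perp_id _ fw ew).
pose t : D := (2%:R^-1)%:A.
have [||||z z'|g [H1 H2 H3 H4]] := @pair_map
  (fun z => h f z + (- 1 * h w0 z + (- (t * h w0 w0)) * h e z)) (h e) (fun z => pperp z + act (h e z) w0).
- by apply: lform_add lf _; apply: lform_add; apply: lform_mull => //; exact: (h_lform Hh).
- exact: le.
- by apply: End_add Ep _; exact: End_ract_form.
- by move=> z; rewrite !(hDr Hh (pperp z)) (hZr Hh _ f) (hZr Hh _ e) fw ew (h_f_perp Hh Hef) (h_e_perp Hh Hef) !mul0r !addr0.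
- rewrite [RHS]h_dec (hDl Hh (pperp z)) !(hDr Hh (pperp z')) !(hZl Hh _ w0) !(hZr Hh _ _ w0).
  rewrite [h (pperp z) w0](sym_h Hh Hsym Heps) !hp; set pz := h (pperp z) (pperp z').
  rewrite !Hsym Heps !mul1r !mulr1.
  have [x ->] := sc (h f z); have [x' ->] := sc (h f z').
  have [y ->] := sc (h e z); have [y' ->] := sc (h e z').
  have [u ->] := sc (h w0 z); have [u' ->] := sc (h w0 z').
  have [q ->] := sc (h w0 w0); have [r ->] := sc pz.
  rewrite /t !mulN1r !mulNr -!algM -!scaleNr -!scalerDl -!algM -!scalerDl.
  by congr (_ *: 1); field; rewrite E2.
exists g; split=> // z; by rewrite H3 Heps mul1r.
Qed.

(** A torus element scales e and f differently, so it fails to commute with a transvection, which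
    exists if there is a skew scalar, and with an Eichler transformation, which exists if the
    complement of the plane is nonzero. None of these has square 1. *)
Lemma comm_splane : (forall g g', unitary_group h g -> unitary_group h g' ->
  g \o g <> id -> g' \o g' <> id -> g \o g' = g' \o g) -> splane rho eps h e f.
Proof.
move=> comm.
(* The condition that c^2 differs from 1 makes the square of the torus element nontrivial, and keeps
   c and 1 both distinct from c^-1. *)
have [c [Fc c0 c2]] : exists c, [/\ F c, c != 0 & ('X^2 - 1%:P : {poly E}).[c] != 0].
  by apply: fixed_nonroot; rewrite -size_poly_eq0 size_XnsubC.
rewrite !hornerE in c2.
have cV : c - c^-1 != 0.
  apply: contra c2 => /eqP cc; have -> : c ^+ 2 - 1 = c * (c - c^-1) by field.
  by rewrite cc mulr0.
have c1 : 1 - c^-1 != 0.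
  apply: contra c2 => /eqP cc; have -> : c ^+ 2 - 1 = (c + 1) * c * (1 - c^-1) by field.
  by rewrite cc mulr0.
have A2 (x : D) : x != 0 -> x + x != 0.
  by rewrite -mulr2n -scaler_nat scaler_eq0 (negbTE E2).
have act_neq (a : E) (x : D) : a != 0 -> x != 0 -> a%:A * x != 0.
  by move=> a0 x0; rewrite mulr_algl scaler_eq0 (negbTE a0).
have [T [UT Tf Te Tp]] := pair_torus c0 Fc.
have TT : T \o T <> id.
  move=> /(congr1 (fun g => h f (g e))); rewrite /= !Tf fe !mulr1 -algM -[RHS]scale1r => /alg_inj cc.
  by move: c2; rewrite expr2 cc subrr eqxx.
have [[d d0 Ed]|[Hsym Heps]] := skew_or_sym Hh.
  have [u [Uu uf ue]] := pair_transvection Ed.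
  have dd (x : D) : d * (eps * (x * h e f)) = d * x.
    by rewrite ef (epsC Hh) -mulrA (eps2 Hh) mulr1.
  have def : d * (eps * h e f) = d by rewrite ef (eps2 Hh) mulr1.
  have uu : u \o u <> id.
    move=> /(congr1 (fun g => h f (g f))); rewrite /= !uf ue ff add0r def => E0.
    by have := A2 d d0; rewrite E0 eqxx.
  have := congr1 (fun g => h f (g f)) (comm _ _ UT Uu TT uu).
  rewrite /= Tf !uf Tf Te ff add0r mulr0 add0r def dd => /eqP.
  rewrite -[d * (c^-1)%:A]alg_comm -subr_eq0 -mulrBl -scalerBl.
  by rewrite (negbTE (act_neq _ _ cV d0)).
split=> // w1; apply/eqP/negPn/negP => w0.
have [u [Uu ue up]] := pair_eichler Hsym Heps (h_f_perp Hh Hef w1) (h_e_perp Hh Hef w1).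
have pf : pperp f = 0 by rewrite /perp ff ef (eps2 Hh) (act0r HW) subr0 (act1 HW) // subrr.
have ef1 : h e f = 1 by rewrite ef.
have uu : u \o u <> id.
  move=> /(congr1 (fun g => pperp (g f))); rewrite /= !up ue pf ef1 add0r (act1 HW) // => E0.
  case/eqP: w0; have := congr1 (act ((2%:R^-1)%:A)) E0.
  rewrite (actDr HW) -scD (actr0 HW) (_ : 2%:R^-1 + 2%:R^-1 = 1); first by rewrite sc1.
  by field; rewrite E2.
have := congr1 (fun g => pperp (g f)) (comm _ _ UT Uu TT uu).
rewrite /= Tp !up Tp Te pf ef1 !add0r mulr1 (act1 HW) // => E0.
have : act (1 - c^-1)%:A (pperp w1) = 0.
  by rewrite scalerBl (actDl HW) scale1r (act1 HW) // (actNr HW) -E0 subrr.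
move=> /(congr1 (act ((1 - c^-1)^-1)%:A)); rewrite -scM mulVf // sc1 (actr0 HW) => E1.
by rewrite E1 eqxx in w0.
Qed.

End Pair.

Definition dgmx (x : K) : 'M[K]_2 :=
  \matrix_(i, j) (if i == j then (if i == 0 then x else x^-1) else 0).

Lemma dgmx_O2is x : x != 0 -> O2is (dgmx x).
Proof. by move=> x0; exists x => //; left. Qed.

Lemma O2is_cases (M : 'M[K]_2) : O2is M -> (exists2 x, x != 0 & M = dgmx x) \/ M *m M = 1%:M.
Proof.
move=> [x x0 [->|->]]; [by left; exists x|right].
apply/matrixP => i j; rewrite !mxE big_ord_recl big_ord1 !mxE /=.
move: i; apply: ord2_ind; move: j; apply: ord2_ind; rewrite /= ?mulr0 ?mul0r ?add0r ?addr0 ?mulfV ?mulVf //.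
Qed.

Lemma dgmxM x y : dgmx x *m dgmx y = dgmx (x * y).
Proof.
apply/matrixP => i j; rewrite !mxE big_ord_recl big_ord1 !mxE /=.
by move: i; apply: ord2_ind; move: j; apply: ord2_ind; rewrite /= ?mulr0 ?mul0r ?add0r ?addr0 ?invfM.
Qed.

Lemma dgmx_inj x y : dgmx x = dgmx y -> x = y.
Proof. by move=> /matrixP /(_ 0 0); rewrite !mxE. Qed.

Lemma dgmx1 : dgmx 1 = 1%:M.
Proof.
by apply/matrixP => i j; rewrite !mxE; case: eqP => // _; rewrite invr1 if_same.
Qed.

Section Iso.
Variables (n : nat) (b : 'I_n -> V -> V).
Hypothesis Hb : Fbasis F b.
Notation barU := (bar_unitary F tau h b).
Notation bar := (bar F tau b).
Variables (T : ('I_n -> K) -> 'M[K]_2) (Q : 'M[K]_2 -> 'I_n -> K).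
Hypothesis HT : forall x, barU x -> O2is (T x) /\ Q (T x) = x.
Hypothesis TM : forall x y, barU x -> barU y -> T (bar_mul F tau b x y) = T x *m T y.
Let barP a (Ea : End a) := bar_unitaryP HF Adiv Hb tau Hh (fun c Fc => Fc) Hb0 Ea.

Lemma iso_comp g g' : unitary_group h g -> unitary_group h g' -> T (bar (g \o g')) = T (bar g) *m T (bar g').
Proof.
move=> Ug Ug'; rewrite -TM; try by apply/barP => //; [exact: Ug.1|exact: Ug'.1].
- by rewrite (bar_comp HF Hb) //; [exact: Ug.1|exact: Ug'.1].
- by apply/barP => //; exact: Ug.1.
- by apply/barP => //; exact: Ug'.1.
Qed.

Lemma iso_inj g g' : unitary_group h g -> unitary_group h g' -> T (bar g) = T (bar g') -> g = g'.
Proof.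
move=> Ug Ug' E0; apply: (bar_inj Hb (tau := tau)); [exact: Ug.1|exact: Ug'.1|].
have /barP U1 := Ug; have /barP U2 := Ug'.
by rewrite -(HT (U1 Ug.1)).2 E0 (HT (U2 Ug'.1)).2.
Qed.

Lemma unitary_comp g g' : unitary_group h g -> unitary_group h g' -> unitary_group h (g \o g').
Proof.
move=> /(unitaryP HD Hh Hb0) [Eg gg] /(unitaryP HD Hh Hb0) [Eg' gg'].
apply/(unitaryP HD Hh Hb0); split; first exact: End_comp.
by move=> u v; rewrite /= gg gg'.
Qed.

Lemma unitary_id : unitary_group h id.
Proof. by apply/(unitaryP HD Hh Hb0); split=> //; exact: End_id. Qed.

(** Antidiagonal elements of O_2^is are involutions, so an isometry whose square is not 1
    corresponds to a diagonal matrix; two such isometries therefore commute ([iso_comm]). *)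
Lemma iso_diag g : unitary_group h g -> g \o g <> id -> exists2 x, x != 0 & T (bar g) = dgmx x.
Proof.
move=> Ug gg; have Ui := unitary_id.
have T1 : T (bar id) = 1%:M.
  have := iso_comp Ui Ui; rewrite -[id \o id]/id => E0.
  have [|[x x0 Ex]|<- //] := O2is_cases (M := T (bar id)).
    by apply: (HT _).1; apply/barP => //; exact: End_id.
  move: E0; rewrite Ex dgmxM => /dgmx_inj; rewrite -[LHS]mulr1 => /(mulfI x0) <-.
  exact: dgmx1.
have [||E0] := O2is_cases (M := T (bar g)) => //.
  by apply: (HT _).1; apply/barP => //; exact: Ug.1.
case: gg; apply: iso_inj => //; first exact: unitary_comp.
by rewrite (iso_comp Ug Ug) E0 T1.
Qed.

Lemma iso_comm g g' : unitary_group h g -> unitary_group h g' ->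
  g \o g <> id -> g' \o g' <> id -> g \o g' = g' \o g.
Proof.
move=> Ug Ug' gg gg'; apply: iso_inj; try exact: unitary_comp.
have [x _ Ex] := iso_diag Ug gg; have [y _ Ey] := iso_diag Ug' gg'.
by rewrite (iso_comp Ug Ug') (iso_comp Ug' Ug) Ex Ey !dgmxM mulrC.
Qed.

Hypothesis HQ : forall M, O2is M -> barU (Q M) /\ T (Q M) = M.
Hypothesis QL : forall l, laurent F tau (fun c => Q (dgmx (tau c)) l).

(* The one-parameter group [c |-> Q (diag(c, c^-1))] is a Laurent polynomial in  *)
(* [c]; an extreme coefficient of it takes isotropic values.                     *)
Lemma iso_isotropic : exists2 u, u != 0 & h u u = 0.
Proof.
have [N0 /choice [p0 Hp0]] := choice QL.
pose N := (\sum_l N0 l)%N.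
pose p l := p0 l * 'X^(N - N0 l).
have Hp l : poly_in F (p l) /\ forall c, F c -> c != 0 -> Q (dgmx (tau c)) l * tau c ^+ N = tau (p l).[c].
  have [h1 h2] := Hp0 l; split; first by apply: (poly_inM HF) => //; exact: (poly_inXn HF).
  move=> c Fc c0; rewrite hornerM hornerXn rmorphM rmorphXn -h2 // -mulrA -exprD subnKC //.
  by rewrite /N (bigD1 l) //= leq_addr.
pose Y m := Fcomb (fun l => (p l)`_m) b.
have EY m : End (Y m) := End_Fcomb _ Hb.1.
pose B := \max_l size (p l).
have YB m : (B <= m)%N -> Y m = fun=> 0.
  move=> Bm; apply/funext => z; apply: big1 => l _.
  by rewrite nth_default ?sc0 //; apply: leq_trans Bm; exact: leq_bigmax.
pose y c := Fcomb (fun l => (p l).[c] / c ^+ N) b.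
have Ey c : End (y c) := End_Fcomb _ Hb.1.
have hornF q c : poly_in F q -> F c -> F q.[c].
  move=> Fq Fc; rewrite horner_coef; apply: (sfs_sum HF) => i _.
  by apply: (sfsM HF) => //; exact: (sfsX HF).
have bary c : F c -> c != 0 -> bar (y c) = Q (dgmx (tau c)).
  move=> Fc c0; apply/funext => l; rewrite /Defs.bar (Fcoord_uniq Hb (c := fun l => (p l).[c] / c ^+ N)) //.
    by rewrite rmorphM -(Hp l).2 // fmorphV rmorphXn mulfK // expf_neq0 // fmorph_eq0.
  move=> m; apply: (sfsM HF); first by apply: hornF => //; exact: (Hp m).1.
  by apply: (sfsV HF); exact: (sfsX HF).
have tc0 c : c != 0 -> tau c != 0 by rewrite fmorph_eq0.
have Uy c : F c -> c != 0 -> unitary_group h (y c).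
  move=> Fc c0; apply/barP => //; rewrite bary //; exact: (HQ (dgmx_O2is (tc0 c c0))).1.
have Yy c z : F c -> c != 0 -> \sum_(m < B) act (c ^+ m)%:A (Y m z) = act (c ^+ N)%:A (y c z).
  move=> Fc c0; rewrite /Y /y /Fcomb (act_sumr HW).
  under eq_bigr do rewrite (act_sumr HW).
  rewrite exchange_big; apply: eq_bigr => l _.
  under eq_bigr do rewrite -scM.
  rewrite -sc_sum -scM mulrC mulfVK ?expf_neq0 //; congr act; congr (_ *: 1).
  rewrite (@horner_coef_wide _ B) ?leq_bigmax //; apply: eq_bigr => m _; exact: mulrC.
have rcX c m : F c -> rho (c ^+ m)%:A = (c ^+ m)%:A by move=> Fc; exact: (sfsX HF m Fc).
have hY c z z' : F c -> c != 0 ->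
    \sum_(m < B) \sum_(m' < B) (c ^+ (m + m'))%:A * h (Y m z) (Y m' z') = (c ^+ (N + N))%:A * h z z'.
  move=> Fc c0; have /(unitaryP HD Hh Hb0) [_ Uc] := Uy c Fc c0.
  have := congr2 h (Yy c z Fc c0) (Yy c z' Fc c0).
  rewrite (hZl Hh) (hZr Hh) Uc rcX // -alg_comm mulrA -algM -exprD => <-.
  rewrite (h_suml Hh); apply: eq_bigr => m _; rewrite (hZl Hh) rcX //.
  rewrite (lform_sum HW (h_lform Hh _)) // mulr_sumr; apply: eq_bigr => m' _.
  by rewrite (hZr Hh) -alg_comm mulrA -algM -exprD.
(* The isometry condition for y c with all c in F, with denominators cleared, is an identity of
   polynomials over D. *)
pose G z z' : {poly D} := \sum_(m < B) \sum_(m' < B) (h (Y m z) (Y m' z'))%:P * 'X^(m + m')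
   - (h z z')%:P * 'X^(N + N).
have G0 z z' : G z z' = 0.
  apply: dpoly_eq0 => c Fc c0; rewrite /G hornerD hornerN hornerCM hornerXn.
  have AX m : (c%:A : D) ^+ m = (c ^+ m)%:A by rewrite -(rmorphXn (in_alg D)).
  rewrite AX -alg_comm -hY // horner_sum; apply/eqP; rewrite subr_eq0; apply/eqP.
  apply: eq_bigr => m _; rewrite horner_sum; apply: eq_bigr => m' _.
  by rewrite hornerCM hornerXn AX -alg_comm.
(* In degree 2 m0 only the pair (m0, m0) contributes when m0 is extreme, while the term h z z' sits
   in degree 2N. *)
have ext m0 z : m0 <> N -> (m0 < B)%N -> (forall m, (m0 < m)%N -> Y m = fun=> 0) \/
    (forall m, (m < m0)%N -> Y m = fun=> 0) -> h (Y m0 z) (Y m0 z) = 0.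
  move=> mN mB Hext; have := congr1 (fun q : {poly D} => q`_(m0 + m0)) (G0 z z).
  rewrite coef0 /G coefB coefCM coefXn coef_sum.
  have -> : (m0 + m0 == N + N)%N = false.
    by apply/eqP; rewrite !addnn => /double_inj.
  rewrite mulr0 subr0 (bigD1 (Ordinal mB)) //= coef_sum (bigD1 (Ordinal mB)) //=.
  rewrite coefCM coefXn eqxx mulr1 big1 => [|m' /eqP nm].
    rewrite big1 ?addr0 // => m /eqP nm; rewrite coef_sum big1 // => m' _.
    rewrite coefCM coefXn; case: eqP => [E0|]; rewrite ?mulr0 //.
    have nm0 : m0 <> m by move=> E1; apply: nm; exact: val_inj.
    have [lt|lt|/esym/nm0//] := ltngtP m m0; case: Hext => H.
    - rewrite [Y m']H ?(h0r Hh) ?mul0r //.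
      by rewrite -(ltn_add2l m) -E0 ltn_add2r.
    - by rewrite [Y m]H ?(h0l Hh) ?mul0r.
    - by rewrite [Y m]H ?(h0l Hh) ?mul0r.
    - rewrite [Y m']H ?(h0r Hh) ?mul0r //.
      by rewrite -(ltn_add2l m) -E0 ltn_add2r.
  rewrite coefCM coefXn eqn_add2l; case: eqP => [E0|]; rewrite ?mulr0 //.
  by case: nm; exact: val_inj.
have Hiso m0 : m0 <> N -> ~ (Y m0 = fun=> 0) -> (forall m, (m0 < m)%N -> Y m = fun=> 0) \/
    (forall m, (m < m0)%N -> Y m = fun=> 0) -> exists2 u, u != 0 & h u u = 0.
  move=> mN Ym Hext; have mB : (m0 < B)%N by rewrite ltnNge; apply/negP => /YB.
  have [z Yz] : exists z, Y m0 z <> 0.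
    by have [//|H] := pselect (exists z, Y m0 z <> 0); case: Ym; apply/funext => z; apply: contrapT => Yz; apply: H; exists z.
  by exists (Y m0 z); [apply/eqP|exact: ext].
pose S m := `[< ~ (Y m = fun=> 0) >].
have SB m : S m -> (m <= B)%N.
  by move=> /asboolP Ym; rewrite leqNgt; apply/negP => /ltnW /YB.
have S0 m : ~~ S m -> Y m = fun=> 0 by move=> /asboolP; exact: contrapT.
have [[m [Sm mN]]|HS] := pselect (exists m, S m /\ m <> N).
  have ex : exists m, S m by exists m.
  have [lt|lt|/mN//] := ltngtP m N.
    case: (ex_minnP ex) => m0 /asboolP Sm0 min.
    apply: (Hiso m0) => //.
      by move=> E0; have := min _ Sm; rewrite E0 leqNgt lt.
    by right=> m1 lt1; apply: S0; apply/negP => /min; rewrite leqNgt lt1.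
  case: (ex_maxnP ex SB) => m0 /asboolP Sm0 max.
  apply: (Hiso m0) => //.
    by move=> E0; have := max _ Sm; rewrite E0 leqNgt lt.
  by left=> m1 lt1; apply: S0; apply/negP => /max; rewrite leqNgt lt1.
(* If only degree N survives then y c is independent of c up to the sign of c^N cancelling, so y(-1)
   = y(1); but these correspond to the distinct matrices with entries -1 and 1. *)
have Y0 m : m <> N -> Y m = fun=> 0.
  by move=> mN; apply: S0; apply/negP => Sm; apply: HS; exists m.
have F1 : F 1 := sfs1 HF; have FN1 : F (- 1) := sfsN HF F1.
have N10 : - 1 != 0 :> E by rewrite oppr_eq0 oner_eq0.
have y1 : y (- 1) = y 1.
  apply/funext => z.
  have E1 : act ((-1) ^+ N)%:A (y (- 1) z) = act ((-1) ^+ N)%:A (y 1 z).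
    rewrite -Yy //; have := Yy 1 z F1 (oner_neq0 E); rewrite expr1n sc1 => <-.
    rewrite (act_sumr HW); apply: eq_bigr => m _; rewrite expr1n sc1.
    by have [->//|/eqP/Y0 ->] := eqVneq (val m) N; rewrite !(actr0 HW).
  have := congr1 (act ((-1) ^+ N)%:A) E1; rewrite -!scM -exprD addnn -signr_odd odd_double.
  by rewrite expr0 !sc1.
have TE c : F c -> c != 0 -> T (bar (y c)) = dgmx (tau c).
  by move=> Fc c0; rewrite bary // (HQ (dgmx_O2is (tc0 c c0))).2.
have := TE _ FN1 N10; rewrite y1 TE ?oner_neq0 // => /dgmx_inj /(fmorph_inj tau) /eqP.
by rewrite -addr_eq0 -mulr2n (negbTE E2).
Qed.

End Iso.

Lemma is_O2is_splane : is_O2is F tau h -> exists e f, splane rho eps h e f.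
Proof.
move=> [n [b [Hb [P [Q [_ HQF H1 H2 H3]]]]]].
pose T x : 'M[K]_2 := \matrix_(i, j) mpoly.meval x (P i j).
pose Q' (M : 'M[K]_2) l := mpoly.meval (fun q => mxvec M 0 q) (Q l).
have [|e e0 ee] := iso_isotropic Hb (T := T) (Q := Q') H2.
  move=> l; apply: (laurent_meval HF) => [mon|q]; first exact: HQF.
  case/mxvec_indexP: q => i j.
  apply: (laurent_ext (f := fun x => if i == j then (if i == 0 then tau x else (tau x)^-1) else 0)).
    case: (i == j); last first.
      by apply: (laurent_ext (laurent_const tau HF (sfs0 HF))) => c _ _; rewrite rmorph0.
    by case: (i == 0); [exact: (laurent_var tau HF)|exact: (laurent_inv tau HF)].
  by move=> x _ _; rewrite mxvecE mxE.
have [f Hef] := isotropic_hpair e0 ee; exists e, f; apply: (comm_splane Hef).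
exact: (iso_comm Hb (T := T) (Q := Q') H1 H3).
Qed.

End O2isSplit.


(** * The centralizer of beta *)

Section ConvMore.
Variables (R : realType) (A : unitRingType) (w : A -> \bar R).
Hypothesis Hw : dvaluation w.
Variables (V : zmodType) (act : A -> V -> V) (W : set V).
Hypothesis HW : right_space act W.
Notation conv := (conv w act W).

Lemma conv_translate (c : R) L1 L2 L3 s1 s2 : conv c L1 L2 L3 ->
  conv c (lf_translate L1 s1) (lf_translate L2 s2) (lf_translate L3 (c * s1 + (1 - c) * s2)).
Proof.
move=> [n [b [a1 [a2 [Hb -> -> ->]]]]]; rewrite !translate_LB.
exists n, b, (fun l => a1 l + s1), (fun l => a2 l + s2); split=> //.
by congr LB; apply/funext => l; ring.
Qed.

Lemma conv_refl n (b : 'I_n -> V) (c : R) L : act_basis act W b -> normfam w act W L -> conv c L L L.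
Proof.
move=> Hb HL; have [b' [a [Hb' E]]] := normfam_LB Hw HW Hb HL.
exists n, b', a, a; split=> //; rewrite {1}E; congr LB; apply/funext => l; ring.
Qed.

Lemma translate0 (L : R -> set V) : lf_translate L 0 = L.
Proof. by apply/funext => r; rewrite /lf_translate subr0. Qed.

Lemma translateD (L : R -> set V) r t : lf_translate (lf_translate L r) t = lf_translate L (r + t).
Proof. by apply/funext => x; rewrite /lf_translate; congr L; lra. Qed.

Lemma translate_inj L r t v : normfam w act W L -> W v -> v != 0 ->
  lf_translate L r = lf_translate L t -> r = t.
Proof.
move=> HL Wv v0 E; have := nrm_translate r HL Wv v0.
by rewrite E (nrm_translate t HL Wv v0) => /addrI.
Qed.

(** A translate lies on the segment between two larger opposite translates. In this way an affine
    map that respects integral translations respects all of them. *)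
Lemma conv_between n (b : 'I_n -> V) L r t : act_basis act W b -> normfam w act W L -> `|r| <= t -> 0 < t ->
  let c := (r + t) / (2 * t) in
  0 <= c <= 1 /\ conv c (lf_translate L t) (lf_translate L (- t)) (lf_translate L r).
Proof.
move=> Hb HL; rewrite ler_norml => /andP[r1 r2] t0 /=; split.
  apply/andP; split; first by apply: divr_ge0; lra.
  by rewrite ler_pdivrMr; lra.
have := conv_translate t (- t) (conv_refl ((r + t) / (2 * t)) Hb HL).
set r' := (X in conv _ _ _ (lf_translate _ X)); have -> // : r' = r.
by rewrite /r'; field; lra.
Qed.

Lemma lf_act_scalar c L : normfam w act W L -> c != 0 -> lf_act (act c) L = lf_translate L (- nu_step w c).
Proof.
move=> HL c0; have Adiv := dv_div Hw; have ci0 := inv_neq0 Hw c0.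
apply/funext => r; rewrite /lf_act /lf_translate; apply/seteqP; split=> v.
  move=> [u Lu <-]; have [->|u0] := eqVneq u 0; first by rewrite (actr0 HW); exact: (nf0 HL).
  have Wu := nf_sub HL Lu.
  apply/(nrmP HL); [exact: (rsZ HW)|exact: (act_neq0 HW)|].
  have /(nrmP HL _ Wu u0) := Lu; rewrite (nrm_act Hw HW HL) // => h1; lra.
move=> Lv; have Wv := nf_sub HL Lv; exists (act c^-1 v); last exact: (actVK HW).
have [->|v0] := eqVneq v 0; first by rewrite (actr0 HW); exact: (nf0 HL).
apply/(nrmP HL); [exact: (rsZ HW)|exact: (act_neq0 HW)|].
have /(nrmP HL _ Wv v0) := Lv; rewrite (nrm_act Hw HW HL) // (nuV Hw c0) => h1; lra.
Qed.

End ConvMore.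

Section ActNormfam.
Variables (R : realType) (A : unitRingType) (w : A -> \bar R) (V : lmodType A^c).
Notation act := (@ract A V).
Variables (g g' : V -> V).
Hypotheses (Eg : End g) (Eg' : End g') (gK : cancel g g') (gK' : cancel g' g).

Lemma lf_actP L r v : lf_act g L r v <-> (L : R -> set V) r (g' v).
Proof. by split=> [[u Lu <-]|Lv]; [rewrite gK|exists (g' v)]. Qed.

Lemma lf_act_nf L : normfam w act setT L -> normfam w act setT (lf_act g L).
Proof.
move=> NL; split=> //.
- by move=> r; apply/lf_actP; rewrite (End0 Eg'); exact: (nf0 NL).
- by move=> r u v /lf_actP Lu /lf_actP Lv; apply/lf_actP; rewrite (EndD _ _ Eg'); exact: (nfD NL).
- by move=> r t x v /lf_actP Lv tx; apply/lf_actP; rewrite (EndZ _ _ Eg'); exact: (nfZ NL).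
- move=> v _ v0; have g0 : g' v != 0.
    by apply: contra v0 => /eqP E0; rewrite -(gK' v) E0 (End0 Eg).
  have [al Hal] := nf_val NL (I : setT _) g0; exists al => r.
  by split=> [/lf_actP/Hal//|/Hal Lv]; apply/lf_actP.
- move=> lam Hl; have Hl' : lform act setT (fun v => lam (g v)).
    by split=> [u v _ _|a u _]; rewrite ?(EndD _ _ Eg) ?(EndZ _ _ Eg);
      [exact: (lformD Hl)|exact: (lformZ Hl)].
  have [C HC] := nf_bd NL Hl'; exists C => r v /lf_actP /HC.
  by rewrite gK'.
Qed.

Lemma lf_act_SD (h : V -> V -> A) L : (forall u v, h (g u) (g v) = h u v) ->
  SD w h L -> SD w h (lf_act g L).
Proof.
move=> gh SL; split; first exact: lf_act_nf SL.1.
apply/funext => r; apply/seteqP; split=> z.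
  move=> H; apply/lf_actP; apply: (SD_in SL) => t z' Lz'.
  by rewrite -gh gK'; apply: H; exists z'.
by move=> /lf_actP Lz t z' /lf_actP Lz'; rewrite -(gK' z) -(gK' z') gh; exact: (SD_h SL).
Qed.

End ActNormfam.

Section PlaneAct.
Variables (R : realType) (A : unitRingType) (w : A -> \bar R).
Hypothesis Hw : dvaluation w.
Variables (V : lmodType A^c) (rho : A -> A) (eps : A) (h : V -> V -> A).
Hypothesis Hh : hermitian_form rho eps h.
Variables (e f : V).
Hypothesis Hs : splane rho eps h e f.
Notation act := (@ract A V).
Notation pl := (pl w h e f).
Let HW := ract_right_space V.
Let Hv := dv_val Hw.
Let Hsym := spl_rho Hs.
Let ee : h e e = 0. Proof. by case: (spl_pair Hs). Qed.
Let ff : h f f = 0. Proof. by case: (spl_pair Hs). Qed.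
Let fe : h f e = 1. Proof. by case: (spl_pair Hs). Qed.
Let ef : h e f = 1. Proof. exact: (splane_ef Hh Hs). Qed.

Lemma plane_coords x y : h f (act x e + act y f) = x /\ h e (act x e + act y f) = y.
Proof.
by rewrite !(hDr Hh) !(hZr Hh) fe ff ee ef !mul1r !mul0r addr0 add0r.
Qed.

Lemma plane_act g x y a : End g -> (forall u v, h (g u) (g v) = h u v) ->
  g e = act x e -> g f = act y f -> lf_act g (pl a) = pl (a + nu_step w y).
Proof.
move=> Eg gh ge gf.
have xy : x * y = 1 by have := gh e f; rewrite ge gf (hZl Hh) (hZr Hh) ef Hsym mul1r.
have yx : y * x = 1 by rewrite (sym_comm Hh Hsym).
have y0 : y != 0 by apply: contra_eq_neq yx => ->; rewrite mul0r eq_sym oner_eq0.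
have x0 : x != 0 by apply: contra_eq_neq xy => ->; rewrite mul0r eq_sym oner_eq0.
have nxy : nu_step w x = - nu_step w y.
  have := nuM Hv x0 y0; rewrite xy (nu_one_aux Hv) => /esym/eqP; rewrite addr_eq0 => /eqP //.
have gE u : g u = act (x * h f u) e + act (y * h e u) f.
  rewrite [in LHS](splane_decomp Hs u) (EndD _ _ Eg) !(EndZ _ _ Eg) ge gf -!(actM HW).
  by [].
apply/funext => r; apply/seteqP; split=> z.
  move=> [u [h1 h2] <-]; rewrite gE /pl /=; have [-> ->] := plane_coords (x * h f u) (y * h e u).
  split.
    by have := vgeM Hv (vge_nu Hv x) h1; apply: vgeW; rewrite nxy; lra.
  by have := vgeM Hv (vge_nu Hv y) h2; apply: vgeW; lra.
move=> [h1 h2]; exists (act (y * h f z) e + act (x * h e z) f).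
  have [E1 E2] := plane_coords (y * h f z) (x * h e z); split; rewrite ?E1 ?E2.
    by have := vgeM Hv (vge_nu Hv y) h1; apply: vgeW; lra.
  by have := vgeM Hv (vge_nu Hv x) h2; apply: vgeW; rewrite nxy; lra.
rewrite gE; have [-> ->] := plane_coords (y * h f z) (x * h e z).
by rewrite !mulrA xy yx !mul1r -(splane_decomp Hs).
Qed.

Definition plane_shift (t : R) (L : R -> set V) : R -> set V := fun r =>
  [set u1 + u2 | u1 in L (r - t) `&` range (act^~ e) & u2 in L (r + t) `&` range (act^~ f)].

Lemma plane_shiftE t a : plane_shift t (pl a) = pl (a + t).
Proof.
apply/funext => r; apply/seteqP; split=> z.
  move=> [u1 [[h1 _] [x _ X1]] [u2 [[_ h2] [y _ X2]] <-]].
  have := plane_coords x 0; rewrite (act0r HW) addr0 => -[E1 _].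
  have := plane_coords 0 y; rewrite (act0r HW) add0r => -[_ E2].
  rewrite -X1 E1 in h1; rewrite -X2 E2 in h2; rewrite -X1 -X2; have [F1 F2] := plane_coords x y.
  split; rewrite ?F1 ?F2; first by apply: vgeW h1; lra.
  by apply: vgeW h2; lra.
move=> [h1 h2]; have v0 r' : vge w r' (0 : A) := vge0 Hv r'.
exists (act (h f z) e).
  split; last by exists (h f z).
  have := plane_coords (h f z) 0; rewrite (act0r HW) addr0 => -[E1 E2].
  by split; rewrite ?E1 ?E2 //; apply: vgeW h1; lra.
exists (act (h e z) f); last by rewrite -(splane_decomp Hs).
split; last by exists (h e z).
have := plane_coords 0 (h e z); rewrite (act0r HW) add0r => -[E1 E2].
by split; rewrite ?E1 ?E2 //; apply: vgeW h2; lra.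
Qed.

Lemma plane_basis2 : act_basis act setT (fun l : 'I_2 => if l == 0 then e else f).
Proof.
have -> : (fun l : 'I_2 => if l == 0 then e else f) = consf e (consf f (fun l : 'I_0 => 0)).
  apply/funext; apply: ord2_ind; first by rewrite /= (consf0 e).
  by rewrite (_ : 1 = lift ord0 ord0) ?consfS ?consf0 //; exact: val_inj.
exact: (splane_basis Hh Hs).
Qed.

End PlaneAct.

(** * The algebra k[beta], its fields E_i and the involution on them *)

Section Main.
Variables (R : realType) (k : fieldType) (nu : k -> \bar R).
Hypotheses (hk : local_field nu) (hodd : odd_residue_char nu).
Variables (D : falgType k) (d : nat) (nuD : D -> \bar R).
Hypothesis hD : central_division_algebra D.
Hypothesis hnuD : extends_valuation nu nuD.
Variables (V : lmodType D^c) (m : nat) (bV : 'I_m -> V).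
Hypothesis HbV : act_basis (@ract D V) setT bV.
Variables (rho : D -> D) (eps : D) (h : V -> V -> D).
Hypothesis hh : hermitian_form rho eps h.
Variable beta : V -> V.
Hypothesis hbeta : unitary_lie h beta.
Variables (I : finType) (E : I -> fieldExtType k) (nuE : forall i, E i -> \bar R).
Hypothesis hnuE : forall i, extends_valuation nu (@nuE i).
Variable iota : forall i, E i -> V -> V.
Hypothesis hE : product_of_fields beta iota.
Variable s : I -> I.
Hypothesis hs : sigma_on_index h iota s.
Variables (D' : forall i, falgType (E i)) (nuD' : forall i, D' i -> \bar R).
Hypothesis hD' : forall i, central_division_algebra (D' i).
Hypothesis hnuD' : forall i, extends_valuation (@nuE i) (@nuD' i).
Variable V' : forall i, lmodType (D' i)^c.
Hypothesis hV' : forall i, exists n (b : 'I_n -> V' i), act_basis (@ract (D' i) (V' i)) setT b.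
Variable psi : forall i, (V -> V) -> (V' i -> V' i).
Hypothesis hpsi : forall i, centralizer_iso iota psi i.
Variable jt : forall i, (R -> set (V' i)) -> (R -> set V).
Hypothesis hjt : forall i, BL_map d nuD nuE iota nuD' psi (@jt i).
Hypothesis hd : \dim {:D} = (d ^ 2)%N.

Notation act := (@ract D V).
Notation idem i := (idem iota i).
Notation Vcomp i := (Vcomp iota i).
Notation adj := (adjoint h).
Let HW := ract_right_space V.
Let Adiv := cda_division hD.
Let Hw0 := local_dvaluation hk.
Let Hc0 := local_complete hk.
Let Hw : dvaluation nuD := ext_dvaluation Hw0 Hc0 hnuD Adiv.
Let Hc : val_complete nuD := ext_complete Hw0 Hc0 hnuD.
Let Hv := dv_val Hw.

Lemma iota_End i (x : E i) : End (iota x). Proof. exact: (pf_end hE). Qed.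
Lemma iotaD i (x y : E i) v : iota (x + y) v = iota x v + iota y v. Proof. exact: (pf_add hE). Qed.
Lemma iotaM i (x y : E i) v : iota (x * y) v = iota x (iota y v). Proof. by rewrite (pf_mul hE). Qed.
Lemma iota0 i v : iota (0 : E i) v = 0.
Proof. by apply: (addrI (iota (0 : E i) v)); rewrite -iotaD !addr0. Qed.
Lemma iotaN i (x : E i) v : iota (- x) v = - iota x v.
Proof. by apply: (addrI (iota x v)); rewrite -iotaD !subrr iota0. Qed.
Lemma iota_inj i (x y : E i) : iota x = iota y -> x = y. Proof. exact: (pf_inj hE). Qed.
Lemma iota_scal i (c : k) v : iota (c%:A : E i) v = act c%:A (idem i v). Proof. exact: (pf_scal hE). Qed.
Lemma iota_orth i i' (x : E i) (x' : E i') v : i != i' -> iota x (iota x' v) = 0.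
Proof. by move=> ne; exact: (pf_orth hE ne). Qed.
Lemma iota_idem i (x : E i) v : iota x (idem i v) = iota x v. Proof. by rewrite /Defs.idem -iotaM mulr1. Qed.
Lemma idem_iota i (x : E i) v : idem i (iota x v) = iota x v. Proof. by rewrite /Defs.idem -iotaM mul1r. Qed.
Lemma idemK i v : idem i (idem i v) = idem i v. Proof. exact: idem_iota. Qed.
Lemma idem_orth i i' v : i != i' -> idem i (idem i' v) = 0. Proof. exact: iota_orth. Qed.
Lemma idem_End i : End (idem i). Proof. exact: iota_End. Qed.

Lemma poly_iota p : exists x : forall i, E i, poly_end beta p = fun v => \sum_i iota (x i) v.
Proof.
have : range (poly_end beta) (poly_end beta p) by exists p.
by rewrite (pf_sum hE) => -[x _ <-]; exists x.
Qed.

Lemma iota_poly i (c : E i) : exists p, iota c = poly_end beta p.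
Proof.
have : range (poly_end beta) (fun v => \sum_j iota (dfwith (fun j => 0 : E j) i c j) v).
  by rewrite (pf_sum hE); exists (dfwith (fun j => 0 : E j) i c).
move=> [p _ Hp]; exists p; rewrite Hp; apply/funext => v.
rewrite (bigD1 i) //= dfwithin big1 ?addr0 // => j ne.
by rewrite dfwithout ?iota0 // eq_sym.
Qed.

Lemma iota_sum_comp i (x : forall i, E i) v : idem i (\sum_j iota (x j) v) = iota (x i) v.
Proof.
rewrite (End_sum _ _ _ (idem_End i)) (bigD1 i) //= big1 ?addr0 ?idem_iota // => j ne.
by rewrite /Defs.idem iota_orth // eq_sym.
Qed.

Lemma sum_iota_comp i (x : forall i, E i) v : \sum_j iota (x j) (idem i v) = iota (x i) v.
Proof.
rewrite (bigD1 i) //= big1 ?addr0 ?iota_idem // => j ne.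
by rewrite /Defs.idem iota_orth.
Qed.

Lemma sum_idem v : \sum_i idem i v = v.
Proof.
have [x Hx] := poly_iota 1.
have P1 u : poly_end beta 1 u = u.
  by rewrite /poly_end size_poly1 big_ord1 coef1 /= scale1r (act1 HW).
rewrite -[RHS]P1 Hx; apply: eq_bigr => i _.
by rewrite -[in LHS](P1 v) Hx iota_sum_comp.
Qed.

Lemma beta_iota : exists x : forall i, E i, forall v, beta v = \sum_i iota (x i) v.
Proof.
have [x Hx] := poly_iota 'X; exists x => v; rewrite -[RHS](congr1 (@^~ v) Hx) /poly_end size_polyX.
by rewrite !big_ord_recl big_ord0 !coefX /= scale0r scale1r (act0r HW) (act1 HW) // add0r addr0.
Qed.

Lemma idem_neq0 i : exists v, idem i v != 0.
Proof.
have [//|H] := pselect (exists v, idem i v != 0).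
have : (1 : E i) = 0.
  apply: iota_inj; apply/funext => v; rewrite iota0; apply/eqP/negPn/negP => v0.
  by apply: H; exists v.
by move/eqP; rewrite oner_eq0.
Qed.

Lemma idem_inj i i' : idem i = idem i' -> i = i'.
Proof.
move=> H; apply/eqP/negPn/negP => ne; have [v] := idem_neq0 i.
by rewrite -idemK {2}H idem_orth // eqxx.
Qed.

Lemma adj_idem i : adj (idem i) = idem (s i). Proof. exact: hs. Qed.

Lemma sK i : s (s i) = i.
Proof. by apply: idem_inj; rewrite -!adj_idem (adjointK hh Adiv HbV) //; exact: idem_End. Qed.

Lemma s_inj i i' : (s i == s i') = (i == i').
Proof. by apply/eqP/eqP => [E0|-> //]; rewrite -(sK i) E0 sK. Qed.

Lemma VcompP i v : Vcomp i v <-> idem i v = v.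
Proof. by split=> [[u _ <-]|<-]; [exact: idemK|exists v]. Qed.

Lemma iota_Vcomp i (x : E i) v : Vcomp i (iota x v).
Proof. by apply/VcompP; exact: idem_iota. Qed.

Lemma Vcomp_D i : right_space act (Vcomp i).
Proof.
split=> //.
- by apply/VcompP; rewrite (End0 (idem_End i)).
- by move=> u v /VcompP hu /VcompP hv; apply/VcompP; rewrite (EndD _ _ (idem_End i)) hu hv.
- by move=> a u /VcompP hu; apply/VcompP; rewrite (EndZ _ _ (idem_End i)) hu.
- exact: (actDr HW).
- exact: (actDl HW).
- exact: (actM HW).
- by move=> u _; exact: (act1 HW).
Qed.

Lemma Vcomp_E i : right_space (@iota i) (Vcomp i).
Proof.
have [S0 SDV SZ _ _ _ _] := Vcomp_D i; split=> //.
- by move=> a u _; exact: iota_Vcomp.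
- by move=> a u v; exact: (EndD _ _ (iota_End a)).
- by move=> a b u; exact: iotaD.
- by move=> a b u; rewrite mulrC iotaM.
- by move=> u /VcompP.
Qed.

Lemma End_iter n f : End f -> @End D V (iter n f).
Proof. by move=> Ef; elim: n => [|n IH]; [exact: End_id|exact: (End_comp Ef IH)]. Qed.

Lemma beta_End : End beta. Proof. exact: hbeta.1. Qed.

Lemma adj_act (c : k) f : End f ->
  exists c' : k, rho c%:A = c'%:A /\ adj (fun v => act c%:A (f v)) = fun v => act c'%:A (adj f v).
Proof.
move=> Ef; have [c' hc'] := rho_scalar hD hh c; exists c'; split=> //.
apply: (adjoint_uniq hh Adiv HbV); first exact: End_sc.
by move=> u v; rewrite (hZl hh) hc' (adjE hh Adiv HbV) // (hZr hh) alg_comm.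
Qed.

Lemma adj_beta_iter n : adj (iter n beta) = fun v => act ((-1) ^+ n)%:A (iter n beta v).
Proof.
apply: (adjoint_uniq hh Adiv HbV); first exact: (End_iter _ beta_End).
have adjb u v : h (beta u) v = - h u (beta v).
  by rewrite (adjE hh Adiv HbV) ?hbeta.2 ?(hNr hh) //; exact: beta_End.
elim: n => [|n IH] u v; first by rewrite /= expr0 sc1.
by rewrite iterSr IH adjb (EndZ _ _ beta_End) exprS mulN1r scaleNr (actNr HW) (hNr hh).
Qed.

Lemma adj_sum J (r : seq J) (f : J -> V -> V) : (forall j, End (f j)) ->
  adj (fun v => \sum_(j <- r) f j v) = fun v => \sum_(j <- r) adj (f j) v.
Proof.
move=> Ef; apply: (adjoint_uniq hh Adiv HbV); first by apply: End_bigsum => j _.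
move=> u v; rewrite (h_suml hh) (lform_sum HW (h_lform hh u)) //.
by apply: eq_bigr => j _; rewrite (adjE hh Adiv HbV).
Qed.

(** The adjoint of beta is - beta, so k[beta] is stable under adjunction. *)
Lemma adj_poly p : exists p', adj (poly_end beta p) = poly_end beta p'.
Proof.
have [c Hc'] := choice (fun n => rho_scalar hD hh p`_n).
exists (\poly_(n < size p) (c n * (-1) ^+ n)).
have -> : poly_end beta p = fun v => \sum_(n < size p) act (p`_n)%:A (iter n beta v) by [].
rewrite adj_sum; last by move=> n; apply: End_sc; exact: (End_iter _ beta_End).
apply/funext => v.
have -> : poly_end beta (\poly_(n < size p) (c n * (-1) ^+ n)) v =
    \sum_(n < size p) act (c n * (-1) ^+ n)%:A (iter n beta v).
  set q := \poly_(n < size p) _; have sq : (size q <= size p)%N by exact: size_poly.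
  rewrite /poly_end (big_ord_widen _ (fun n => act (q`_n)%:A (iter n beta v)) sq) big_mkcond.
  apply: eq_bigr => n _; case: ltnP => [_|le]; first by rewrite coef_poly ltn_ord.
  have : q`_n = 0 by exact: nth_default.
  by rewrite coef_poly ltn_ord => ->; rewrite sc0.
apply: eq_bigr => n _.
have [c' [h1 ->]] := adj_act p`_n (End_iter n beta_End).
by rewrite adj_beta_iter scM; congr act; rewrite -h1 Hc'.
Qed.

Lemma adj_iota i (c : E i) : exists c' : E (s i), adj (iota c) = iota c'.
Proof.
have [p Hp] := iota_poly c; have [p' Hp'] := adj_poly p.
have [x Hx] := poly_iota p'; exists (x (s i)).
have -> : iota c = idem i \o iota c by apply/funext => v; rewrite /= idem_iota.
rewrite (adjoint_comp hh Adiv HbV); [|exact: idem_End|exact: iota_End].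
by rewrite adj_idem Hp Hp' Hx; apply/funext => v; rewrite /= sum_iota_comp.
Qed.

Definition sigma i (c : E i) : E (s i) := xget 0 [set c' | adj (iota c) = iota c'].

Lemma sigmaP i (c : E i) : adj (iota c) = iota (sigma c).
Proof. by rewrite /sigma; case: xgetP => [x _ //|H]; have [c' /H] := adj_iota c. Qed.

Lemma sigma_eq i (c : E i) (c' : E (s i)) : adj (iota c) = iota c' -> sigma c = c'.
Proof. by rewrite sigmaP => /iota_inj. Qed.

Lemma sigmaD i (c c' : E i) : sigma (c + c') = sigma c + sigma c'.
Proof.
apply: sigma_eq; have -> : iota (c + c') = fun v => iota c v + iota c' v.
  by apply/funext => v; rewrite iotaD.
rewrite (adjoint_add hh Adiv HbV); [|exact: iota_End|exact: iota_End].
by apply/funext => v; rewrite !sigmaP iotaD.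
Qed.

Lemma sigmaM i (c c' : E i) : sigma (c * c') = sigma c * sigma c'.
Proof.
apply: sigma_eq; rewrite (pf_mul hE) (adjoint_comp hh Adiv HbV); [|exact: iota_End|exact: iota_End].
by rewrite !sigmaP -(pf_mul hE) mulrC.
Qed.

Lemma sigma1 i : sigma (1 : E i) = 1.
Proof. exact: (sigma_eq (adj_idem i)). Qed.

Lemma sigma0 i : sigma (0 : E i) = 0.
Proof. by apply: (addrI (sigma (0 : E i))); rewrite -sigmaD !addr0. Qed.

Lemma sigma_neq0 i (c : E i) : c != 0 -> sigma c != 0.
Proof.
move=> c0; apply/eqP => E0; have := sigma1 i.
by rewrite -(mulfV c0) sigmaM E0 mul0r => /eqP; rewrite eq_sym oner_eq0.
Qed.

Lemma sigma_scal i (c c' : k) : rho c%:A = c'%:A -> sigma (c%:A : E i) = c'%:A.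
Proof.
move=> hc; apply: sigma_eq.
have -> : iota (c%:A : E i) = fun v => act c%:A (idem i v).
  by apply/funext => v; exact: iota_scal.
have [c2 [h2 ->]] := adj_act c (idem_End i).
by apply/funext => v; rewrite iota_scal adj_idem -h2 hc.
Qed.

Lemma sigma_surj i (c : E (s i)) : exists c0 : E i, sigma c0 = c.
Proof.
have H i' : s (s i) = i' -> exists c0 : E i', adj (iota c) = iota c0.
  by move=> <-; exact: adj_iota.
have [c0 Hc0'] := H i (sK i); exists c0; apply: sigma_eq.
by rewrite -Hc0' (adjointK hh Adiv HbV) //; exact: iota_End.
Qed.

(** The valuation composed with sigma again extends nu, and the extension is unique. *)
Lemma nu_sigma_of (i : I) : (forall a, nuD (rho a) = nuD a) ->
  forall c : E i, nuE (sigma c) = nuE c.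
Proof.
move=> Hrho; have [Hvi Hei] := hnuE (s i).
have ext : extends_valuation nu (fun c : E i => nuE (sigma c)).
  split; first split.
  - move=> c; rewrite (valuation_eqy Hvi); split=> [E0|->]; last exact: sigma0.
    by apply/eqP/negPn/negP => /sigma_neq0; rewrite E0 eqxx.
  - by move=> c; exact: (valuation_neqNy Hvi).
  - by move=> c c'; rewrite sigmaM (valuationM Hvi).
  - by move=> c c'; rewrite sigmaD; exact: (valuationD Hvi).
  move=> c; have [c' hc] := rho_scalar hD hh c; rewrite (sigma_scal i hc) Hei.
  by rewrite -!hnuD.2 -hc Hrho.
by move=> c; rewrite -[RHS](congr1 (@^~ c) (ext_unique Hw0 Hc0 ext (hnuE i))).
Qed.

Let Hwe i : dvaluation (@nuE i).
Proof. by apply: (ext_dvaluation Hw0 Hc0 (hnuE i)) => x; rewrite unitfE. Qed.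
Let Hce i : val_complete (@nuE i) := ext_complete Hw0 Hc0 (hnuE i).
Let Hw' i : dvaluation (@nuD' i) := ext_dvaluation (Hwe i) (@Hce i) (hnuD' i) (cda_division (hD' i)).
Let Hc' i : val_complete (@nuD' i) := ext_complete (Hwe i) (@Hce i) (hnuD' i).
Let HW' i := ract_right_space (V' i).
Notation act' i := (@ract (D' i) (V' i)).
Notation nf' i := (normfam (@nuD' i) (act' i) setT).
Notation Cent i := (Cent iota i).

Lemma Latt'_nf i L : Latt (@nuD' i) (nu_step (@nuD' i)) L <-> nf' i L.
Proof. by have [n [b Hb]] := hV' i; exact: (Latt_nf (Hw' i) Hb). Qed.

Lemma nf'_ex i : exists L, nf' i L.
Proof.
have [n [b Hb]] := hV' i; exists (LB (@nuD' i) (act' i) b (fun=> 0)).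
exact: (LB_normfam (Hw' i) (HW' i) _ Hb).
Qed.

Lemma Cent_idem i : Cent i (idem i).
Proof.
split; first exact: idem_End.
  by apply/funext => v; rewrite /= !idemK.
by move=> x; apply/funext => v; rewrite /= idem_iota iota_idem.
Qed.

Lemma Cent_iota i (c : E i) : Cent i (iota c).
Proof.
split; first exact: iota_End.
  by apply/funext => v; rewrite /= iota_idem idem_iota.
by move=> x; apply/funext => v; rewrite /= -!iotaM mulrC.
Qed.

Lemma psi_idem i : @psi i (idem i) = id.
Proof. by apply/funext => v; rewrite (ci_scal (hpsi i)) scale1r (act1 (HW' i)). Qed.

Lemma psi_End i a : Cent i a -> End (@psi i a).
Proof. by have [H _ _] := ci_bij (hpsi i); exact: H. Qed.

Lemma psi_surj i g : End g -> exists2 a, Cent i a & @psi i a = g.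
Proof. by have [_ _ H] := ci_bij (hpsi i); exact: H. Qed.

Lemma psi_inj i a b : Cent i a -> Cent i b -> @psi i a = @psi i b -> a = b.
Proof. by have [_ + _] := ci_bij (hpsi i) => H ha hb; apply: H; rewrite inE. Qed.

Lemma V'_neq0 i : exists v : V' i, v != 0.
Proof.
have [//|H] := pselect (exists v : V' i, v != 0).
have V0 (v : V' i) : v = 0 by apply/eqP/negPn/negP => v0; apply: H; exists v.
have [v] := idem_neq0 i; have : iota (0 : E i) = idem i.
  apply: (@psi_inj i); [exact: Cent_iota|exact: Cent_idem|].
  by apply/funext => u; exact: (etrans (V0 _) (esym (V0 _))).
by move=> <-; rewrite iota0 eqxx.
Qed.

Definition bnorm i L := normfam nuD act (Vcomp i) L /\ normfam (@nuE i) (@iota i) (Vcomp i) L.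

Lemma basisD i : exists n (b : 'I_n -> V), act_basis act (Vcomp i) b.
Proof.
have [L /Latt'_nf HL] := nf'_ex i; have [+ _ _] := BL_bij (hjt i) => /(_ _ HL) [H _].
exact: (LF_basis Hw (Vcomp_D i) H).
Qed.

Lemma basisE i : exists n (b : 'I_n -> V), act_basis (@iota i) (Vcomp i) b.
Proof.
have [L /Latt'_nf HL] := nf'_ex i; have [+ _ _] := BL_bij (hjt i) => /(_ _ HL) [_ H].
exact: (LF_basis (Hwe i) (Vcomp_E i) H).
Qed.

Lemma LF_E_nf i L : lattice_function_E nuE iota i L <-> normfam (@nuE i) (@iota i) (Vcomp i) L.
Proof.
have [p up] := dv_unif (Hwe i); have [n [b Hb]] := basisE i.
by split=> H; [apply: (LF_normfam (Hwe i) (Vcomp_E i) _ H up)|apply: (normfam_LF (Hwe i) (Vcomp_E i) _ Hb H)].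
Qed.

(** The normalization by 1/d and the one by the valuation agree. A lattice function in the image of
    [jt] is normalized by 1/d over D and by nu over E_i, and an element of k of valuation 1 acts in
    the same way through both; comparing the two shifts gives the equality. *)
Lemma hstep (i0 : I) p : uniformizer nuD p -> index_step R d p = nu_step nuD p.
Proof.
move=> up; have [p0 pp _] := uniformizer_nu Hw up; set q := nu_step nuD p in pp *.
pose st : R := d%:R^-1; have st0 : 0 < st.
  rewrite invr_gt0 ltr0n lt0n; apply/eqP => d0; have := hd; rewrite d0 exp0n // => /eqP.
  rewrite dimv_eq0 => /eqP E0; have : (1 : D) \in 0%VS by rewrite -E0 memvf.
  by rewrite memv0 oner_eq0.
have [M HM] := nf'_ex i0; have HM2 := iffRL (Latt'_nf _) HM.
have [+ _ _] := BL_bij (hjt i0) => /(_ _ HM2) [[L1 L2 L3 L4] /LF_E_nf HE].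
set L := jt M in L1 L2 L3 L4 HE.
have q0 : q != 0 by rewrite gt_eqF. have st1 : st != 0 by rewrite gt_eqF.
(* Rescaling the parameter turns the shift 1/d into nu p, so that the theory of norms over D applies
   to L'. *)
pose L' r := L (r * (st / q)); have sq : 0 < st / q by exact: divr_gt0.
have sq0 : st / q != 0 by rewrite gt_eqF.
have HL' : normfam nuD act (Vcomp i0) L'.
  apply: (LF_normfam Hw (Vcomp_D i0) (step := nu_step nuD) _ _ up) => //; split.
  - by move=> r; exact: L1.
  - by move=> r t rt; apply: L2; rewrite ltr_pM2r.
  - move=> r; rewrite /L' L3; apply/seteqP; split=> v H t /= tr.
      by apply: H; rewrite /= ltr_pM2r.
    by have := H (t / (st / q)); rewrite /= divfK ?gt_eqF //; apply; rewrite /= ltr_pdivrMr.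
  - move=> p' up' r; rewrite /L' L4 //; congr L.
    by rewrite (uniformizer_eq Hw up' up) -/q /index_step -/st; field.
have [v0 /eqP] := idem_neq0 i0; set v := idem i0 v0 => vn; have vi : Vcomp i0 v by exists v0.
have v0' : v != 0 by apply/eqP.
have key x : Vcomp i0 x -> x != 0 -> nrm L x = nrm L' x * (st / q).
  move=> Wx x0; apply: (nrm_eq HE) => // r; rewrite -[r in L r](divfK sq0).
  by rewrite -/(L' _) (nrmP HL' _ Wx x0) ler_pdivrMr.
have [pi pi0 nupi] := local_val1 hk.
have piD : (pi%:A : D) != 0 by rewrite scaler_eq0 oner_eq0 orbF.
have piE : (pi%:A : E i0) != 0 by rewrite scaler_eq0 oner_eq0 orbF.
have nD : nu_step nuD pi%:A = 1 by rewrite /nu_step hnuD.2 nupi.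
have nE : nu_step (@nuE i0) pi%:A = 1 by rewrite /nu_step (hnuE i0).2 nupi.
have e1 : iota (pi%:A : E i0) v = act pi%:A v by rewrite iota_scal /v idemK.
have a0 : act pi%:A v != 0 := act_neq0 (Vcomp_D i0) Adiv piD vi v0'.
have Wa : Vcomp i0 (act pi%:A v) := rsZ (Vcomp_D i0) _ vi.
have := nrm_act (Hwe i0) (Vcomp_E i0) HE piE vi v0'; rewrite e1 nE key // key //.
rewrite (nrm_act Hw (Vcomp_D i0) HL' piD vi v0') nD mulrDl => /addrI.
by rewrite mul1r => /(canRL (divfK q0)); rewrite mul1r.
Qed.

Lemma LF_D_nf i L : lattice_function_D d nuD (Vcomp i) L <-> normfam nuD act (Vcomp i) L.
Proof.
have [p up] := dv_unif Hw; have [n [b Hb]] := basisD i.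
by split=> H; [apply: (LF_normfam Hw (Vcomp_D i) _ H up)|apply: (normfam_LF Hw (Vcomp_D i) _ Hb H)];
  exact: (hstep i).
Qed.

Lemma bnormP i L : bnorm i L <-> lattice_function_D d nuD (Vcomp i) L /\ lattice_function_E nuE iota i L.
Proof. by rewrite LF_D_nf LF_E_nf. Qed.

Lemma jt_bnorm i (M : R -> set (V' i)) : nf' i M -> bnorm i (jt M).
Proof. by move=> /Latt'_nf HM; apply/bnormP; have [H _ _] := BL_bij (hjt i); exact: H. Qed.

Lemma jt_inj i (M M' : R -> set (V' i)) : nf' i M -> nf' i M' -> jt M = jt M' -> M = M'.
Proof.
by move=> /Latt'_nf HM /Latt'_nf HM'; have [_ H _] := BL_bij (hjt i); apply: H; rewrite inE.
Qed.

Lemma jt_surj i L : bnorm i L -> exists2 M : R -> set (V' i), nf' i M & jt M = L.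
Proof.
move=> /bnormP HL; have [_ _ H] := BL_bij (hjt i); have [M HM <-] := H L HL.
by exists M => //; apply/Latt'_nf.
Qed.

Lemma jt_square i (M : R -> set (V' i)) a t : nf' i M -> Cent i a ->
  in_square (jt M) t a <-> in_square M t (@psi i a).
Proof. by move=> /Latt'_nf HM Ha; exact: (BL_square (hjt i)). Qed.

Lemma jt_conv i c (M1 M2 M3 : R -> set (V' i)) : 0 <= c <= 1 ->
  conv (@nuD' i) (act' i) setT c M1 M2 M3 -> conv nuD act (Vcomp i) c (jt M1) (jt M2) (jt M3).
Proof.
move=> c01 H; have [H1 H2 H3] := conv_nf (Hw' i) (HW' i) H.
apply/(convex_combP Hw (Vcomp_D i)); try by apply: (jt_bnorm _).1.
apply: (BL_affine (hjt i)) => //; try exact/Latt'_nf.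
exact/(convex_combP (Hw' i) (HW' i)).
Qed.

Let pi : k := s2val (cid2 (local_val1 hk)).
Let pi0 : pi != 0 := s2valP (cid2 (local_val1 hk)).
Let nupi : nu pi = 1%:E := s2valP' (cid2 (local_val1 hk)).

Lemma pi_neq0 (A : falgType k) : pi%:A != 0 :> A. Proof. by rewrite scaler_eq0 oner_eq0 orbF. Qed.
Lemma nu_piE i : nu_step (@nuE i) pi%:A = 1. Proof. by rewrite /nu_step (hnuE i).2 nupi. Qed.
Lemma piD'_neq0 i : (pi%:A : E i)%:A != 0 :> D' i.
Proof. by rewrite scaler_eq0 oner_eq0 orbF pi_neq0. Qed.
Lemma nu_piD' i : nu_step (@nuD' i) ((pi%:A : E i)%:A) = 1.
Proof. by rewrite /nu_step (hnuD' i).2 (hnuE i).2 nupi. Qed.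

Lemma psi_iota i (c : E i) : @psi i (iota c) = act' i c%:A.
Proof. by apply/funext => v; rewrite (ci_scal (hpsi i)). Qed.

Lemma psi_iota_gl i (c : E i) : c != 0 -> general_linear (@psi i (iota c)).
Proof.
move=> c0; split; first exact: (psi_End (Cent_iota c)).
by rewrite psi_iota; exists (act' i (c^-1)%:A) => v; rewrite -(@scM _ (D' i)) ?mulVf ?mulfV // (@sc1 _ (D' i)).
Qed.

Lemma iota_translate i (c : E i) (M : R -> set (V' i)) : c != 0 -> nf' i M ->
  lf_act (iota c) (jt M) = lf_translate (jt M) (- nu_step (@nuE i) c).
Proof. by move=> c0 HM; exact: (lf_act_scalar (Hwe i) (Vcomp_E i) (jt_bnorm HM).2 c0). Qed.

Lemma jt_translate1 i (M : R -> set (V' i)) : nf' i M -> jt (lf_translate M (- 1)) = lf_translate (jt M) (- 1).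
Proof.
move=> HM; rewrite -(nu_piE i) -(iota_translate (pi_neq0 _) HM).
rewrite -(BL_equivariant (hjt i) (Cent_iota _) (psi_iota_gl (pi_neq0 (E i))) (iffRL (Latt'_nf _) HM)).
rewrite psi_iota (lf_act_scalar (Hw' i) (HW' i) HM (piD'_neq0 i)) /nu_step (hnuD' i).2.
by [].
Qed.

(** Equivariance under a scalar of valuation 1 handles translation by -1, hence all integers; real
    translations follow by affinity through [conv_between]. *)
Lemma jt_translate i (M : R -> set (V' i)) r : nf' i M -> jt (lf_translate M r) = lf_translate (jt M) r.
Proof.
have pos (M0 : R -> set (V' i)) n : nf' i M0 ->
    jt (lf_translate M0 (- n%:R)) = lf_translate (jt M0) (- n%:R).
  elim: n M0 => [|n IH] M0 H0; first by rewrite oppr0 !translate0.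
  by rewrite -addn1 natrD opprD -!translateD jt_translate1 ?IH //; exact: translate_normfam.
move=> HM; pose n := (Num.truncn `|r|).+1.
have rn : `|r| <= n%:R by apply: ltW; exact: truncnS_gt.
have n0 : 0 < n%:R :> R by rewrite ltr0n.
have neg : jt (lf_translate M n%:R) = lf_translate (jt M) n%:R.
  have := pos _ n (translate_normfam n%:R HM); rewrite translateD subrr translate0 => ->.
  by rewrite translateD addNr translate0.
have [b [bb Hb]] := hV' i; have [b2 [bb2 Hb2]] := basisD i.
have [c01 Hcv] := conv_between (Hw' i) (HW' i) Hb HM rn n0.
have [_ Hcv2] := conv_between Hw (Vcomp_D i) Hb2 (jt_bnorm HM).1 rn n0.
have := jt_conv c01 Hcv; rewrite pos // neg => Hcv1.
exact: (conv_uniq Hw (Vcomp_D i) c01 Hcv1 Hcv2).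
Qed.

Lemma h_idem i u v : h (idem i u) v = h u (idem (s i) v).
Proof. by rewrite (adjE hh Adiv HbV) ?adj_idem //; exact: idem_End. Qed.

Notation SDV := (SD nuD h).
Definition res i (L : R -> set V) : R -> set V := fun t => L t `&` Vcomp i.
(** The self-dual o_E-o_D-lattice functions, expressed by the scalars that lie in the square lattice
    function; see [goodP]. *)
Definition good (L : R -> set V) := SDV L /\
  forall i (c : E i), c != 0 -> in_square L (nu_step (@nuE i) c) (iota c).
Definition comp i (L : R -> set V) : R -> set (V' i) :=
  xget (fun=> setT) [set M | nf' i M /\ jt M = res i L].
Arguments comp : clear implicits.

Lemma nu_E1 i : nu_step (@nuE i) 1 = 0.
Proof. exact: (nu_one_aux (dv_val (Hwe i))). Qed.

(** * Self-dual o_E-o_D-lattice functions and their components *)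

Section Good.
Variable L : R -> set V.
Hypothesis HL : good L.
Let SL := HL.1.
Let NL := SL.1.

Lemma good_iota i (c : E i) r v : c != 0 -> L r v -> L (r + nu_step (@nuE i) c) (iota c v).
Proof. by move=> c0 Lv; apply: (HL.2 i c c0); exists v. Qed.

Lemma good_idem i r v : L r v -> L r (idem i v).
Proof. by move=> /(good_iota (oner_neq0 (E i))); rewrite nu_E1 addr0. Qed.

Lemma res_D i : normfam nuD act (Vcomp i) (res i L).
Proof.
have S := Vcomp_D i; split.
- by move=> r v [].
- by move=> r; split; [exact: (nf0 NL)|exact: (rs0 S)].
- by move=> r u v [Lu Wu] [Lv Wv]; split; [exact: (nfD NL)|exact: (rsD S)].
- by move=> r t x v [Lv Wv] tx; split; [exact: (nfZ NL)|exact: (rsZ S)].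
- move=> v Wv v0; have [al Hal] := nf_val NL (Logic.I : setT v) v0; exists al => r.
  by split=> [[/Hal]//|/Hal Lv].
- move=> lam Hl; have Hl' : lform act setT (fun v => lam (idem i v)).
    split=> [u v _ _|a u _]; rewrite ?(EndD _ _ (idem_End i)) ?(EndZ _ _ (idem_End i)).
      by apply: (lformD Hl); exact: iota_Vcomp.
    by apply: (lformZ Hl); exact: iota_Vcomp.
  have [C HC] := nf_bd NL Hl'; exists C => r v [Lv /VcompP iv].
  by have := HC r v Lv; rewrite iv.
Qed.

Lemma res_bnorm i : bnorm i (res i L).
Proof.
split; first exact: res_D.
have [M0 HM0] := nf'_ex i; have [N1 N2] := jt_bnorm HM0.
have [n [b Hb]] := basisD i; have [C HC] := nf_compare (Vcomp_D i) Hb (res_D i) N1.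
have H := res_D i; split.
- exact: (nf_sub H).
- exact: (nf0 H).
- exact: (nfD H).
- move=> r t x v [Lv Wv] tx; split; last exact: iota_Vcomp.
  have [->|x0] := eqVneq x 0; first by rewrite iota0; exact: (nf0 NL).
  have Hvi := dv_val (Hwe i); have tle : t <= nu_step (@nuE i) x by apply/(vgeE Hvi).
  have [->|v0] := eqVneq (iota x v) 0; first exact: (nf0 NL).
  apply/(nrmP NL) => //; apply: le_trans (iffLR (nrmP NL _ _ v0) (good_iota x0 Lv)) => //.
  by rewrite lerD2l.
- exact: (nf_val H).
- move=> lam Hl; have [C' HC'] := nf_bd N2 Hl; exists (C + C') => r v /HC /HC'.
  by rewrite addrA.
Qed.

Lemma compP i : nf' i (comp i L) /\ jt (comp i L) = res i L.
Proof. by have [M HM HM2] := jt_surj (res_bnorm i); rewrite /comp; case: xgetP => [N _ //|/(_ M)[]]. Qed.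

Lemma Cent_idem_l i a v : Cent i a -> idem i (a v) = a v.
Proof. by case=> [_ <- _]; rewrite /= idemK. Qed.
Lemma Cent_idem_r i a v : Cent i a -> a (idem i v) = a v.
Proof. by case=> [_ <- _]; rewrite /= idemK. Qed.

Lemma res_square i a t : Cent i a -> in_square (res i L) t a <-> in_square L t a.
Proof.
move=> Ca; split=> H r _ [v Lv <-].
  rewrite -(Cent_idem_r _ Ca); have [|Lav _ //] := H r (a (idem i v)).
  by exists (idem i v) => //; split; [exact: good_idem|exact: iota_Vcomp].
split; first by apply: H; exists v => //; exact: Lv.1.
by apply/VcompP; exact: (Cent_idem_l _ Ca).
Qed.

Lemma comp_square i a t : Cent i a -> in_square (comp i L) t (@psi i a) <-> in_square L t a.
Proof. by move=> Ca; have [H1 H2] := compP i; rewrite -jt_square // H2 res_square. Qed.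

Lemma good_dual i r v : Vcomp (s i) v ->
  L r v <-> forall t z, res i L t z -> vge nuD (r + t) (h v z).
Proof.
move=> /VcompP iv; split=> [Lv t z [Lz _]|H]; first exact: (SD_h SL).
apply: (SD_in SL) => t z Lz; rewrite -iv h_idem sK; apply: H.
by split; [exact: good_idem|exact: iota_Vcomp].
Qed.

End Good.

Lemma comp_uniq i L M : good L -> nf' i M -> jt M = res i L -> comp i L = M.
Proof. by move=> HL HM E1; have [H1 H2] := compP HL i; apply: jt_inj => //; rewrite H2. Qed.

Section Conv.
Variables (c : R) (L1 L2 L3 : R -> set V).
Hypothesis c01 : 0 <= c <= 1.
Hypotheses (H1 : good L1) (H2 : good L2) (H3 : good L3).
Hypothesis Hcv : conv nuD act setT c L1 L2 L3.

(** The splitting bases on V and on V_i need not be related. Projecting the first to V_i, and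
    viewing the second inside V, gives the two inclusions through [conv_ge]. *)
Lemma res_conv i : conv nuD act (Vcomp i) c (res i L1) (res i L2) (res i L3).
Proof.
have S := Vcomp_D i; have [n [b Hb]] := basisD i.
have [N HN] := conv_ex Hw S c Hb (res_D H1 i) (res_D H2 i).
suff -> : res i L3 = N by [].
have [n1 [b1 [a1 [a2 [Hb1 E1 E2 E3]]]]] := HN.
have [n0 [b0 [d1 [d2 [Hb0 F1 F2 F3]]]]] := Hcv.
have [_ _ NN] := conv_nf Hw S HN.
apply/funext => r; apply/seteqP; split=> v.
  move=> [L3v /VcompP iv].
  have := L3v; rewrite F3 => /(LBE nuD HW _ _ _ Hb0) [_ Hx].
  rewrite -iv -{1}(crdP HW Hb0 (v := v)) // (End_comb _ _ (idem_End i)).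
  apply: (nf_sum NN) => l _.
  have Nl : N (c * d1 l + (1 - c) * d2 l) (idem i (b0 l)).
    apply: (conv_ge Hw S c01 HN); (split; last exact: iota_Vcomp).
      by apply: (good_idem H1); rewrite F1; exact/(LB_b Hw HW _ _ _ Hb0).
    by apply: (good_idem H2); rewrite F2; exact/(LB_b Hw HW _ _ _ Hb0).
  have := nfZ NN Nl (Hx l); rewrite addrC subrK; exact.
rewrite E3 => Nv; split; last by have /(LBE nuD S _ _ _ Hb1) [] := Nv.
have NL3 := H3.1.1.
apply: (nf_LB_sub NL3 _ Nv) => l.
apply: (conv_ge Hw HW c01 Hcv).
  have : res i L1 (a1 l) (b1 l) by rewrite E1; exact/(LB_b Hw S _ _ _ Hb1).
  by case.
have : res i L2 (a2 l) (b1 l) by rewrite E2; exact/(LB_b Hw S _ _ _ Hb1).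
by case.
Qed.

Lemma comp_conv i : conv (@nuD' i) (act' i) setT c (comp i L1) (comp i L2) (comp i L3).
Proof.
have [n [b Hb]] := hV' i.
have [[M1 J1] [M2 J2] [M3 J3]] := And3 (compP H1 i) (compP H2 i) (compP H3 i).
have [N HN] := conv_ex (Hw' i) (HW' i) c Hb M1 M2.
suff -> : comp i L3 = N by [].
have [_ _ NN] := conv_nf (Hw' i) (HW' i) HN.
apply: jt_inj => //; rewrite J3.
have := jt_conv c01 HN; rewrite J1 J2 => HN2.
exact: (conv_uniq Hw (Vcomp_D i) c01 (res_conv i) HN2).
Qed.
End Conv.

Section Act.
Variable g : V -> V.
Hypothesis Hg : centralizer h beta g.
Let Eg : End g. Proof. exact: Hg.1.1. Qed.
Let gh u v : h (g u) (g v) = h u v.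
Proof. by have /(unitaryP hD hh HbV) [_] := Hg.1. Qed.
Notation g' := (adj g).
Let Eg' : End g'. Proof. exact: (adjoint_End hh Adiv HbV). Qed.
Let gK v : g' (g v) = v. Proof. by have := congr1 (@^~ v) Hg.1.2. Qed.
Lemma cent_gK' v : g (g' v) = v.
Proof.
have Hb : act_basis act setT (g \o bV).
  apply: (indep_basis Adiv HW HbV) => // x; rewrite -(End_comb _ _ Eg) => E0.
  have : comb act bV x = 0 by rewrite -(gK (comb act bV x)) E0 (End0 Eg').
  by rewrite -(comb0 HW bV) => /(comb_inj HW HbV) -> .
by rewrite -(crdP HW Hb (v := v)) // -(End_comb _ _ Eg) gK.
Qed.

Lemma cent_beta n v : g (iter n beta v) = iter n beta (g v).
Proof.
elim: n => [//|n IH] /=; rewrite -IH.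
by have := congr1 (@^~ (iter n beta v)) Hg.2.
Qed.

Lemma cent_iota i (c : E i) v : g (iota c v) = iota c (g v).
Proof.
have [p ->] := iota_poly c; rewrite /poly_end (End_sum _ _ _ Eg).
by apply: eq_bigr => n _; rewrite (EndZ _ _ Eg) cent_beta.
Qed.

Lemma cent_iota' i (c : E i) v : g' (iota c v) = iota c (g' v).
Proof. by rewrite -{1}(cent_gK' v) -cent_iota gK. Qed.

Lemma cent_idem i v : g (idem i v) = idem i (g v). Proof. exact: cent_iota. Qed.
Lemma cent_idem' i v : g' (idem i v) = idem i (g' v). Proof. exact: cent_iota'. Qed.

Lemma cent_Cent i : Cent i (g \o idem i).
Proof.
split; first exact: (End_comp Eg (idem_End i)).
  by apply/funext => v; rewrite /= -cent_idem !idemK.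
by move=> x; apply/funext => v; rewrite /= idem_iota cent_iota cent_idem iota_idem.
Qed.

Lemma cent_Cent' i : Cent i (g' \o idem i).
Proof.
split; first exact: (End_comp Eg' (idem_End i)).
  by apply/funext => v; rewrite /= -cent_idem' !idemK.
by move=> x; apply/funext => v; rewrite /= idem_iota cent_iota' cent_idem' iota_idem.
Qed.

Lemma cent_psiK i : cancel (@psi i (g \o idem i)) (@psi i (g' \o idem i)) /\
  cancel (@psi i (g' \o idem i)) (@psi i (g \o idem i)).
Proof.
split=> v.
  rewrite -[LHS]/((@psi i (g' \o idem i) \o @psi i (g \o idem i)) v).
  rewrite -(ci_mul (hpsi i) (cent_Cent' i) (cent_Cent i)) -[RHS](congr1 (@^~ v) (psi_idem i)).
  by congr (@psi i _ v); apply/funext => u; rewrite /= -cent_idem idemK gK.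
rewrite -[LHS]/((@psi i (g \o idem i) \o @psi i (g' \o idem i)) v).
rewrite -(ci_mul (hpsi i) (cent_Cent i) (cent_Cent' i)) -[RHS](congr1 (@^~ v) (psi_idem i)).
by congr (@psi i _ v); apply/funext => u; rewrite /= -cent_idem' idemK cent_gK'.
Qed.

Lemma cent_gl i : general_linear (@psi i (g \o idem i)).
Proof.
split; first exact: (psi_End (cent_Cent i)).
by have [G1 G2] := cent_psiK i; exists (@psi i (g' \o idem i)).
Qed.

Lemma good_act L : good L -> good (lf_act g L).
Proof.
move=> HL; split; first exact: (lf_act_SD Eg Eg' gK cent_gK' gh HL.1).
move=> i c c0 r _ [v /(lf_actP gK cent_gK') Lv <-].
by apply/(lf_actP gK cent_gK'); rewrite cent_iota'; exact: (good_iota HL).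
Qed.

Lemma comp_act i L : good L -> comp i (lf_act g L) = lf_act (@psi i (g \o idem i)) (comp i L).
Proof.
move=> HL; have [HM JM] := compP HL i; have GL := cent_gl i; have CC := cent_Cent i.
have JE := BL_equivariant (hjt i) CC GL (iffRL (Latt'_nf _) HM).
have EL : lf_act (g \o idem i) (res i L) = res i (lf_act g L).
  apply/funext => r; apply/seteqP; split=> v.
    move=> [u [Lu /VcompP iu] <-]; rewrite /= iu; split; first by exists u.
    by apply/VcompP; rewrite -cent_idem iu.
  move=> [[u Lu <-] /VcompP ig]; exists (idem i u); last by rewrite /= idemK cent_idem.
  by split; [exact: good_idem|exact: iota_Vcomp].
rewrite JM EL in JE;
have Hnf : nf' i (lf_act (@psi i (g \o idem i)) (comp i L)).
  by have [G1 G2] := cent_psiK i; exact: (lf_act_nf GL.1 (psi_End (cent_Cent' i)) G1 G2).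
by apply: comp_uniq => //; exact: good_act.
Qed.

End Act.

Lemma SD_rhoD L (i : I) : SDV L -> forall a, nuD (rho a) = nuD a.
Proof.
move=> SL a; have [v0 vn] := idem_neq0 i.
exact: (SD_rho Hw hh a SL vn).
Qed.

Lemma adj_iota_to i i' (c : E i) : (forall a, nuD (rho a) = nuD a) -> s i = i' ->
  exists c' : E i', adj (iota c) = iota c' /\ nuE c' = nuE c.
Proof. by move=> Hrho <-; exists (sigma c); split; [exact: sigmaP|exact: nu_sigma_of]. Qed.

Variable Iplus : {set I}.
Hypothesis hIplus : half_system s Iplus.
Variable h' : forall i, V' i -> V' i -> D' i.
Variables (rho' : forall i, D' i -> D' i) (eps' : forall i, D' i).
Hypothesis hh' : forall i, s i = i -> hermitian_form (@rho' i) (eps' i) (@h' i).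
Hypothesis hadj : forall i, s i = i -> form_compatible h iota psi h' i.
Notation B1H := (@B1H R k I E D' nuD' V' s Iplus h').
Notation pointH := (pointH R V' s Iplus).
Notation halfI := (halfI s Iplus).
Notation SD' i := (SD (@nuD' i) (@h' i)).

Lemma half_cases i : [\/ s i = i, s i != i /\ i \in Iplus | s i != i /\ s i \in Iplus].
Proof.
have [si|si] := eqVneq (s i) i; first by constructor 1.
by have := hIplus.2 i si; case: (boolP (i \in Iplus)) => Hi E0; [constructor 2|constructor 3].
Qed.

Lemma B1H_fix (x : pointH) (j : halfI) : B1H x -> s (sval j) = sval j -> SD' (sval j) (x j).
Proof.
move=> /(_ j) Hx sj; have [n [b Hb]] := hV' (sval j).
by apply/(Latt_hE (Hw' _) (hh' sj) Hb (step := nu_step (@nuD' (sval j)))) => //; move: Hx; rewrite sj eqxx.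
Qed.

Lemma B1H_nf (x : pointH) (j : halfI) : B1H x -> nf' (sval j) (x j).
Proof.
move=> Bx; have [/eqP sj|sj] := boolP (s (sval j) == sval j); first exact: (B1H_fix Bx sj).1.
by apply/Latt'_nf; have := Bx j; rewrite (negbTE sj).
Qed.

Lemma B1HP (x : pointH) : (forall j : halfI, nf' (sval j) (x j)) ->
  (forall j : halfI, s (sval j) = sval j -> SD' (sval j) (x j)) -> B1H x.
Proof.
move=> H1 H2 j; case: eqP => [sj|_]; last exact/Latt'_nf.
have [n [b Hb]] := hV' (sval j).
apply/(Latt_hE (Hw' _) (hh' sj) Hb (step := nu_step (@nuD' (sval j)))) => //.
exact: H2.
Qed.

Lemma Cent0 i : Cent i (fun=> 0).
Proof.
split; first exact: End_zero.
  by apply/funext => v; rewrite /= (End0 (idem_End i)).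
by move=> x; apply/funext => v; rewrite /= (End0 (iota_End x)).
Qed.

Lemma psi0 i : @psi i (fun=> 0) = fun=> 0.
Proof.
have -> : (fun=> 0 : V) = iota (0 : E i) by apply/funext => v; rewrite iota0.
by rewrite psi_iota; apply/funext => v; rewrite scale0r (act0r (HW' i)).
Qed.

Lemma adj0 : adj (fun=> 0) = fun=> 0.
Proof.
apply: (adjoint_uniq hh Adiv HbV); first exact: End_zero.
by move=> u v; rewrite (h0l hh) (h0r hh).
Qed.

(** * The CLF condition forces an o_E-structure *)

Section CLF.
Variables (x : pointH) (L : R -> set V).
Hypothesis Bx : B1H x.
Hypothesis SL : SDV L.
Hypothesis HCLF : forall t a, lieH_filtration h iota psi x t a -> in_square L t a.
Let NL := SL.1.

Lemma clf1 (j : halfI) a t : lieH_factor h iota j a -> in_square (@x j) t (@psi (sval j) a) ->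
  in_square L t (lieH_embed h j a).
Proof.
move=> Fa Sa; apply: HCLF; exists (fun j' => if j' == j then a else fun=> 0).
  move=> j'; case: eqP => [->//|_]; split.
    by split; [exact: Cent0|move=> _ v; rewrite adj0 oppr0].
  by rewrite psi0 => r _ [u _ <-]; exact: (nf0 (B1H_nf j' Bx)).
apply/funext => v; rewrite (bigD1 j) //= eqxx big1 ?addr0 // => j' /negbTE ->.
by rewrite /lieH_embed adj0; case: ifP; rewrite ?subrr.
Qed.

Let Hrho (i : I) := SD_rhoD i SL.
Let H2 : nu 2%:R = 0%E := local_nu2 hk hodd.

Lemma L_half r v : L r (v + v) -> L r v.
Proof.
have D2 : nuD (2%:R^-1)%:A = 0%E.
  have n2 : 2%:R != 0 :> k by apply/eqP => E0; move: H2; rewrite E0 (val0 (dv_val Hw0)).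
  rewrite hnuD.2 (w_nu (dv_val Hw0)) ?invr_eq0 // (nuV Hw0) // /nu_step H2 /=.
  by rewrite oppr0.
have h2 : vge nuD 0 (2%:R^-1)%:A by rewrite /vge D2.
move=> /(nfZ NL) /(_ h2); rewrite addr0 (actDr HW) -scD.
rewrite (_ : 2%:R^-1 + 2%:R^-1 = 1) ?sc1 //.
have n2 : 2%:R != 0 :> k by apply/eqP => E0; move: H2; rewrite E0 (val0 (dv_val Hw0)).
by field; rewrite n2.
Qed.

Lemma scal_square (j : halfI) (c : E (sval j)) t : vge (@nuE _) t c ->
  in_square (@x j) t (@psi (sval j) (iota c)).
Proof.
move=> tc r _ [v Lv <-]; rewrite psi_iota; apply: (nfZ (B1H_nf j Bx)) => //.
by rewrite /vge (hnuD' _).2.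
Qed.

(* On V_i + V_{-i} the elements [x - sigma x], [x] in E_i, lie in Lie(H). *)
Lemma square_plus (j : halfI) (c : E (sval j)) t : s (sval j) != sval j -> vge (@nuE _) t c ->
  in_square L t (fun v => iota c v - iota (sigma c) v).
Proof.
move=> sj tc; have := clf1 (j := j) (a := iota c) (t := t).
rewrite /lieH_embed (negbTE sj) sigmaP; apply; last exact: scal_square.
by split; [exact: Cent_iota|move=> E0; rewrite E0 eqxx in sj].
Qed.

(** The difference U of the two idempotents lies in Lie(H), and U applied twice is their sum; half
    the sum and half the difference of U and its square are the idempotents. *)
Lemma L_idem_plus (j : halfI) r v : s (sval j) != sval j -> L r v ->
  L r (idem (sval j) v) /\ L r (idem (s (sval j)) v).
Proof.
move=> sj Lv; set i := sval j in sj *.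
have v1 : vge (@nuE i) 0 1 by rewrite -(nu_E1 i); exact: (vge_nu (dv_val (Hwe i))).
have U u : L r u -> L r (idem i u - idem (s i) u).
  move=> Lu; have := square_plus sj v1; rewrite sigma1 => /(_ r) H.
  by have := H _ (ex_intro2 _ _ u Lu erefl); rewrite addr0.
have Lu := U v Lv; have := U _ Lu.
rewrite (EndB _ _ (idem_End i)) (EndB _ _ (idem_End (s i))) !idemK.
rewrite (idem_orth _ sj) (idem_orth v (i := i) (i' := s i)) 1?eq_sym // sub0r subr0 opprK => Lp.
split; apply: L_half.
  by have := nfD NL Lp Lu; rewrite addrACA subrr addr0.
by have := nfB Hw HW NL Lp Lu; rewrite opprB (addrC (idem i v)) addrACA subrr addr0.
Qed.

Lemma iota_plus (j : halfI) (c : E (sval j)) t : s (sval j) != sval j -> vge (@nuE _) t c ->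
  in_square L t (iota c) /\ in_square L t (iota (sigma c)).
Proof.
move=> sj tc; have H := square_plus sj tc; split=> r _ [v Lv <-]; have [L1 L2] := L_idem_plus sj Lv.
  have := H r _ (ex_intro2 _ _ _ L1 erefl); rewrite iota_idem.
  by rewrite /Defs.idem (iota_orth (sigma c)) // subr0.
have := H r _ (ex_intro2 _ _ _ L2 erefl); rewrite iota_idem.
rewrite /Defs.idem (iota_orth c) 1?eq_sym // sub0r => /(nfN Hw HW NL).
by rewrite opprK.
Qed.

Lemma iota_skew i (si : s i = i) (e : E i) t : adj (iota e) = iota (- e) -> vge (@nuE i) t e ->
  in_square L t (iota e).
Proof.
move=> Ee te; have Pi : (s i == i) || (i \in Iplus) by rewrite si eqxx.
pose j : halfI := exist _ i Pi.
have := clf1 (j := j) (a := iota e) (t := t); rewrite /lieH_embed /= si eqxx; apply.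
  by split; [exact: Cent_iota|move=> _ v; rewrite Ee iotaN].
exact: (scal_square (j := j)).
Qed.

(** With e skew and c' the conjugate of c, write 2c = (c - c') + ((c + c') e) e^-1. All three of c -
    c', (c + c') e and e^-1 are skew, and their valuations add up correctly. *)
Lemma iota_fix i (si : s i = i) (e c : E i) t : e != 0 -> adj (iota e) = iota (- e) ->
  vge (@nuE i) t c -> in_square L t (iota c).
Proof.
move=> e0 Ee tc; have Hvi := dv_val (Hwe i).
have [c' [hc' nc']] := adj_iota_to c (Hrho i) si.
have tc' : vge (@nuE i) t c' by rewrite /vge nc'.
have hc : adj (iota c') = iota c by rewrite -hc' (adjointK hh Adiv HbV) //; exact: iota_End.
have adjD (y z : E i) : adj (iota (y + z)) = fun v => adj (iota y) v + adj (iota z) v.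
  have -> : iota (y + z) = fun v => iota y v + iota z v by apply/funext => v; rewrite iotaD.
  by rewrite (adjoint_add hh Adiv HbV) //; exact: iota_End.
have adjN (y : E i) : adj (iota (- y)) = fun v => - adj (iota y) v.
  have -> : iota (- y) = fun v => - iota y v by apply/funext => v; rewrite iotaN.
  by rewrite (adjoint_opp hh Adiv HbV) //; exact: iota_End.
have adjM (y z : E i) : adj (iota (y * z)) = adj (iota z) \o adj (iota y).
  by rewrite (pf_mul hE) (adjoint_comp hh Adiv HbV) //; exact: iota_End.
have adj1 : adj (idem i) = idem i by rewrite adj_idem si.
have Eei : adj (iota e^-1) = iota (- e^-1).
  have [e2 [he2 _]] := adj_iota_to e^-1 (Hrho i) si.
  have := adjM e e^-1; rewrite mulfV // -[iota 1]/(idem i) adj1 he2 Ee -(pf_mul hE) => /iota_inj E1.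
  by congr iota; apply: (mulIf e0); rewrite mulNr mulVf // E1 mulrN opprK.
have q1 : in_square L t (iota (c - c')).
  apply: (iota_skew si); last exact: (vgeB Hvi).
  by rewrite adjD adjN hc' hc; apply/funext => v; rewrite -iotaN -iotaD opprB.
have q2 : in_square L (t + nu_step (@nuE i) e) (iota ((c + c') * e)).
  apply: (iota_skew si); last by apply: (vgeM Hvi); [exact: (vgeD Hvi)|exact: (vge_nu Hvi)].
  by rewrite adjM adjD hc' hc Ee; apply/funext => v; rewrite /= -iotaD -iotaM addrC mulNr mulrC.
have q3 : in_square L (- nu_step (@nuE i) e) (iota e^-1).
  by apply: (iota_skew si) => //; rewrite -(nuV (Hwe i) e0); exact: (vge_nu Hvi).
move=> r _ [v Lv <-]; apply: L_half; rewrite -iotaD.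
have -> : c + c = (c - c') + (c + c') * e * e^-1 by rewrite mulfK //; ring.
rewrite iotaD; apply: (nfD NL); first by apply: q1; exists v.
rewrite iotaM; have L1 : L (r - nu_step (@nuE i) e) (iota e^-1 v) by apply: q3; exists v.
have := q2 _ _ (ex_intro2 _ _ _ L1 erefl).
by rewrite (_ : r - _ + _ = r + t) //; ring.
Qed.

Let skewable i := exists e : E i, e != 0 /\ adj (iota e) = iota (- e).

Lemma iota_good i (c : E i) t : s i != i \/ skewable i -> vge (@nuE i) t c -> in_square L t (iota c).
Proof.
have [si|[si Pi]|[si Pi]] := half_cases i.
- by move=> [|[e [e0 Ee]]]; [rewrite si eqxx|exact: (iota_fix si e0 Ee)].
- move=> _ tc; have Pj : (s i == i) || (i \in Iplus) by rewrite Pi orbT.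
  exact: (iota_plus (j := exist _ i Pj) si tc).1.
- move=> _ tc; have Pj : (s (s i) == s i) || (s i \in Iplus) by rewrite Pi orbT.
  have sj : s (s i) != s i by rewrite s_inj.
  have H (i' : I) : s (s i) = i' -> forall c' : E i', vge (@nuE i') t c' -> in_square L t (iota c').
    move=> <- c' tc'; have [c0 E0] := sigma_surj c'; rewrite -E0.
    apply: (iota_plus (j := exist _ (s i) Pj) sj _).2.
    by move: tc'; rewrite -E0 /vge (nu_sigma_of (Hrho i)).
  exact: (H i (sK i)).
Qed.

(** Only an index i fixed by s with no nonzero skew scalar remains after [iota_good]. There beta
    acts as 0, which happens for one index only; so the idempotent of V_i is 1 minus the others, and
    every scalar of E_i comes from k. *)
Lemma good_of_CLF : good L.
Proof.
split=> // i c c0; have Hvi := dv_val (Hwe i).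
have [H|H] := pselect (s i != i \/ skewable i).
  by apply: iota_good => //; exact: (vge_nu Hvi).
have si : s i = i by apply/eqP/negPn/negP => si; apply: H; left.
have nsk : ~ skewable i by move=> sk; apply: H; right.
have [be Hbe] := beta_iota.
have bi v : iota (be i) v = beta (idem i v) by rewrite Hbe sum_iota_comp.
have bi' v : iota (be i) v = idem i (beta v) by rewrite Hbe iota_sum_comp.
(* The component of beta in E_i is itself skew. *)
have be0 : be i = 0.
  apply/eqP/negPn/negP => b0; apply: nsk; exists (be i); split=> //.
  apply: (adjoint_uniq hh Adiv HbV); first exact: iota_End.
  move=> u v; rewrite bi' h_idem si iotaN bi (adjE hh Adiv HbV); last exact: beta_End.
  by rewrite hbeta.2.
have poly0 i' p v : be i' = 0 -> poly_end beta p (idem i' v) = act (p`_0)%:A (idem i' v).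
  move=> b0; have bz u : beta (idem i' u) = 0.
    by rewrite Hbe sum_iota_comp b0 iota0.
  rewrite /poly_end; case E0: (size p) => [|n].
    by rewrite big_ord0 nth_default ?E0 // sc0.
  rewrite big_ord_recl big1 ?addr0 // => l _ /=.
  have bzn n' : iter n' beta 0 = 0 by elim: n' => //= n' ->; exact: (End0 beta_End).
  by rewrite -iterS iterSr bz bzn (actr0 HW).
(* A polynomial in beta acts on each component killed by beta through its constant term. The one
   representing the idempotent of V_i would need constant term 1 and 0 at once. *)
have uniq i' : i' != i -> be i' <> 0.
  move=> ne b0; have [p Hp] := iota_poly (1 : E i).
  have [u un] := idem_neq0 i; have [u' un'] := idem_neq0 i'.
  have p1 : (p`_0)%:A - 1 = 0 :> D.
    apply/eqP/negPn/negP => pn.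
    have := act_neq0 HW Adiv pn (Logic.I : setT (idem i u)) un.
    rewrite (actDl HW) -(poly0 _ _ _ be0) -Hp iota_idem (actNr HW) (act1 HW) //.
    by rewrite /Defs.idem subrr eqxx.
  have := poly0 _ p u' b0; rewrite -Hp (iota_orth _ _ _ (i := i) (i' := i')) 1?eq_sym //.
  by move/eqP: p1; rewrite subr_eq0 => /eqP ->; rewrite (act1 HW) // => /esym/eqP; rewrite (negbTE un').
have others i' : i' != i -> s i' != i' \/ skewable i'.
  move=> ne; have [si'|si'] := eqVneq (s i') i'; [right|by left].
  exists (be i'); split; first by apply/eqP; exact: uniq.
  apply: (adjoint_uniq hh Adiv HbV); first exact: iota_End.
  have b1 v : iota (be i') v = beta (idem i' v) by rewrite Hbe sum_iota_comp.
  have b2 v : iota (be i') v = idem i' (beta v) by rewrite Hbe iota_sum_comp.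
  move=> u v; rewrite b2 h_idem si' iotaN b1 (adjE hh Adiv HbV); last exact: beta_End.
  by rewrite hbeta.2.
have Lid r v : L r v -> L r (idem i v).
  move=> Lv; have -> : idem i v = v - \sum_(i' | i' != i) idem i' v.
    by rewrite -[X in _ = X - _](sum_idem v) (bigD1 i) //= addrK.
  apply: (nfB Hw HW NL) => //.
  elim/big_ind: _ => [|u1 u2|i' ne]; [exact: (nf0 NL)|exact: (nfD NL)|].
  have Hvi' := dv_val (Hwe i').
  have v1 : vge (@nuE i') 0 1 by rewrite -(nu_E1 i'); exact: (vge_nu Hvi').
  by have := iota_good (others _ ne) v1 (ex_intro2 _ _ v Lv erefl); rewrite addr0.
have [p Hp] := iota_poly c.
have cE v : iota c v = act (p`_0)%:A (idem i v) by rewrite -iota_idem Hp poly0.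
have ck : c = (p`_0)%:A by apply: iota_inj; apply/funext => v; rewrite cE iota_scal.
move=> r _ [v Lv <-]; rewrite cE; apply: (nfZ NL); first exact: Lid.
have := vge_nu Hvi c; rewrite /vge [in X in _ -> X]hnuD.2 {2}ck (hnuE i).2; exact.
Qed.

End CLF.

(** * The inverse of j *)

Lemma rho'_scalar i (c c' : E i) : s i = i -> adj (iota c) = iota c' -> @rho' i c%:A = c'%:A.
Proof.
move=> si hc; have Hh' := hh' si; have [v v0] := V'_neq0 i.
have [n [b Hb]] := hV' i; have D'div := cda_division (hD' i).
have [u hu] : exists u, @h' i u v != 0.
  have [//|H] := pselect (exists u, @h' i u v != 0).
  case/eqP: v0; apply: (h_nondegr Hh') => u; apply/eqP/negPn/negP => hu.
  by apply: H; exists u.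
have Esc : End (act' i c%:A) := End_sc c (@End_id _ (V' i)).
have := hadj si (Cent_iota c); rewrite hc !psi_iota => H.
have := adjE Hh' D'div Hb u v Esc; rewrite -H (hZl Hh') (hZr Hh') -alg_comm.
exact: (mulIr (D'div _ hu)).
Qed.

Lemma rho'_nu i : s i = i -> (forall a, nuD (rho a) = nuD a) -> forall a, nuD' (@rho' i a) = nuD' a.
Proof.
move=> si Hrho a; have Hh' := hh' si; have Hr := hermitian_involution Hh'; have [Hv' He'] := hnuD' i.
have ext : extends_valuation (@nuE i) (fun x => nuD' (@rho' i x)).
  split; first split.
  - move=> x; rewrite (valuation_eqy Hv'); split=> [/eqP|->]; last exact: (rho0 Hh').
    by rewrite (rho_eq0 Hh') => /eqP.
  - by move=> x; exact: (valuation_neqNy Hv').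
  - by move=> x y; rewrite (rhoM Hh') (valuationM Hv') addeC.
  - by move=> x y; rewrite (rhoD Hh'); exact: (valuationD Hv').
  move=> c; have [c' [hc nc]] := adj_iota_to c Hrho si.
  by rewrite (rho'_scalar si hc) He' nc.
by rewrite -[RHS](congr1 (@^~ a) (ext_unique (Hwe i) (@Hce i) ext (hnuD' i))).
Qed.

Lemma Cent_adj i a : s i = i -> Cent i a -> Cent i (adj a).
Proof.
move=> si [Ea ia ca]; have Ei := idem_End i; split; first exact: (adjoint_End hh Adiv HbV).
  by rewrite -{2}ia (adjoint_comp hh Adiv HbV (End_comp Ei Ea) Ei) (adjoint_comp hh Adiv HbV Ei Ea) adj_idem si.
have H i' : s i = i' -> forall x : E i', adj a \o iota x = iota x \o adj a.
  move=> <- x; have [x0 <-] := sigma_surj x.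
  rewrite -sigmaP -(adjoint_comp hh Adiv HbV (iota_End x0) Ea).
  by rewrite -(adjoint_comp hh Adiv HbV Ea (iota_End x0)) ca.
exact: (H i si).
Qed.

Lemma adj_square L a t : SDV L -> End a -> in_square L t a -> in_square L t (adj a).
Proof. by move=> SL Ea; exact: (in_square_adj Hw hh HbV SL Ea). Qed.

(** The square lattice function of the component is stable under the adjoint, so the component and
    its dual have the same one and differ by a translation kap; shifting by kap / 2 makes it
    self-dual. *)
Lemma comp_SD i L : good L -> s i = i ->
  exists y, SD' i y /\ exists r, y = lf_translate (comp i L) r.
Proof.
move=> HL si; have Hh' := hh' si; have [n [b Hb]] := hV' i; have D'div := cda_division (hD' i).
have Hrho' := rho'_nu si (SD_rhoD i HL.1); have [HM JM] := compP HL i.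
have HDM := Dual_nf (Hw' i) Hh' Hb Hrho' HM.
have [|kap Hk] := square_translate (Hw' i) Hb HM HDM.
  move=> t g /psi_surj [a Ca <-] /(comp_square HL _ Ca) Sa; have [Ea _ _] := Ca.
  have Sa' := adj_square HL.1 Ea Sa.
  have Ca' := Cent_adj si Ca.
  have := iffRL (comp_square HL t Ca') Sa'; rewrite (hadj si Ca) => S1.
  have EP := psi_End Ca.
  have := in_square_Dual (Hw' i) Hh' Hb (adjoint_End Hh' D'div Hb EP) S1.
  by rewrite (adjointK Hh' D'div Hb EP).
exists (lf_translate (comp i L) (kap / 2)); split; last by exists (kap / 2).
split; first exact: translate_normfam.
rewrite Dual_translate Hk translateD; congr lf_translate; lra.
Qed.

(** The inverse of [j]: the components of L, normalized to be self-dual on the fixed indices. *)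
Definition ycoord (L : R -> set V) : pointH := fun j =>
  if s (sval j) == sval j
  then xget (comp (sval j) L) [set y | SD' (sval j) y /\ exists r, y = lf_translate (comp (sval j) L) r]
  else comp (sval j) L.

Arguments ycoord : clear implicits.

Lemma ycoord_fix L (j : halfI) : good L -> s (sval j) = sval j ->
  SD' (sval j) (ycoord L j) /\ exists r, ycoord L j = lf_translate (comp (sval j) L) r.
Proof.
move=> HL sj; rewrite /ycoord sj eqxx; case: xgetP => [y _ //|H].
by have [y /H] := comp_SD HL sj.
Qed.

Lemma ycoord_plus L (j : halfI) : s (sval j) != sval j -> ycoord L j = comp (sval j) L.
Proof. by rewrite /ycoord => /negbTE ->. Qed.

Lemma SD'_translate_eq i y y' r : SD' i y -> SD' i y' -> y = lf_translate y' r -> y = y'.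
Proof.
move=> Sy Sy' E0; have [v v0] := V'_neq0 i.
by rewrite E0 in Sy *; rewrite (SD_translate Sy' Sy v0) translate0.
Qed.

Lemma ycoord_uniq L (j : halfI) y r : good L -> s (sval j) = sval j ->
  SD' (sval j) y -> y = lf_translate (comp (sval j) L) r -> y = ycoord L j.
Proof.
move=> HL sj Sy Ey; have [S0 [r0 E0]] := ycoord_fix HL sj.
apply: (SD'_translate_eq (r := r - r0) Sy S0); rewrite E0 translateD Ey; congr lf_translate; ring.
Qed.

Lemma ycoord_B1H L : good L -> B1H (ycoord L).
Proof.
move=> HL; apply: B1HP => j; last by move=> sj; exact: (ycoord_fix HL sj).1.
have [/eqP sj|sj] := boolP (s (sval j) == sval j); first exact: (ycoord_fix HL sj).1.1.
by rewrite ycoord_plus //; exact: (compP HL _).1.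
Qed.

Notation jf := (@j_factor R k D nuD V h I E iota D' V' s Iplus jt).
Notation jmap := (@j_map R k D nuD V h I E iota D' V' s Iplus jt).

Lemma dualV L i t v : (exists W, normfam nuD act W L) -> lf_dual h nuD (Vcomp i) L t v <->
  Vcomp i v /\ Dual nuD h L t v.
Proof.
move=> [W HL]; apply: (lf_dualE Hw hh) => r c u Lu c0.
by apply: (nfZ HL) => //; exact: (vge_nu Hv).
Qed.

(** Self-duality of L makes its restriction to V_i self-dual, and a nonzero translation destroys
    this; so the normalization in [j_factor] returns the restriction, whatever the translation r. *)
Lemma jf_fix L (j : halfI) (y : R -> set (V' (sval j))) r : good L -> s (sval j) = sval j ->
  y = lf_translate (comp (sval j) L) r -> jf y = res (sval j) L.
Proof.
move=> HL; set i := sval j => sj Ey; have [HM JM] := compP HL i; have HD := res_D HL i.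
have Jy : jt y = lf_translate (res i L) r by rewrite Ey jt_translate // JM.
have dual_res : lf_dual h nuD (Vcomp i) (res i L) = res i L.
  apply/funext => t; apply/seteqP; split=> v.
    move=> /(dualV _ _ _ (ex_intro _ _ HD)) [Wv Dv]; split=> //.
    have Wv' : Vcomp (s i) v by rewrite sj.
    by apply: (iffRL (good_dual HL t Wv')).
  move=> [Lv Wv]; apply/(dualV _ _ _ (ex_intro _ _ HD)); split=> // t' z Lz.
  have Wv' : Vcomp (s i) v by rewrite sj.
  by apply: (iffLR (good_dual HL t Wv')).
rewrite /j_factor -/i sj eqxx Jy; case: xgetP => [N _ [[r2 E2] D2]|H].
  have E3 : N = lf_translate (res i L) (r + r2) by rewrite E2 translateD.
  have := D2; rewrite {1}E3; set q := r + r2.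
  have -> : lf_dual h nuD (Vcomp i) (lf_translate (res i L) q) = lf_translate (res i L) (- q).
    apply/funext => t; apply/seteqP; split=> v.
      move=> /(dualV _ _ _ (ex_intro _ _ (translate_normfam q HD))) [Wv].
      rewrite Dual_translate => Dv; rewrite /lf_translate -dual_res.
      by apply/(dualV _ _ _ (ex_intro _ _ HD)).
    rewrite /lf_translate -{1}dual_res => /(dualV _ _ _ (ex_intro _ _ HD)) [Wv Dv].
    apply/(dualV _ _ _ (ex_intro _ _ (translate_normfam q HD))); split=> //.
    by rewrite Dual_translate.
  rewrite E3 => Eq; have [v0 vn] := idem_neq0 i.
  have := translate_inj HD (iota_Vcomp _ _) vn Eq => qq.
  have -> : r + r2 = 0 by move: qq; rewrite /q => qq; lra.
  exact: translate0.
case: (H (res i L)); split; last exact: dual_res.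
by exists (- r); rewrite translateD subrr translate0.
Qed.

Lemma jf_translate (j : halfI) (y : R -> set (V' (sval j))) : s (sval j) = sval j ->
  exists r, jf y = lf_translate (jt y) r.
Proof.
move=> sj; rewrite /j_factor sj eqxx; case: xgetP => [N _ [//]|_].
by exists 0; rewrite translate0.
Qed.

Lemma jf_plus (j : halfI) (y : R -> set (V' (sval j))) : s (sval j) != sval j ->
  jf y = fun t => [set u + v | u in jt y t & v in lf_dual h nuD (Vcomp (s (sval j))) (jt y) t].
Proof. by rewrite /j_factor => /negbTE ->. Qed.

Lemma jf_Vcomp (j : halfI) (y : R -> set (V' (sval j))) t v i : nf' (sval j) y -> jf y t v ->
  i != sval j -> i != s (sval j) -> idem i v = 0.
Proof.
move=> Ny; have [N1 _] := jt_bnorm Ny; have [sj|sj] := eqVneq (s (sval j)) (sval j).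
  have [r ->] := jf_translate y sj; rewrite /lf_translate => /(nf_sub N1) /VcompP <- ne _.
  exact: idem_orth.
rewrite jf_plus // => -[u /(nf_sub N1) /VcompP <- [z [/VcompP <- _] <-]] ne1 ne2.
by rewrite (EndD _ _ (idem_End i)) !idem_orth // addr0.
Qed.

Lemma half_rep i : exists j : halfI, sval j = i \/ s (sval j) = i.
Proof.
have [si|[_ Pi]|[_ Pi]] := half_cases i.
- have P : (s i == i) || (i \in Iplus) by rewrite si eqxx.
  by exists (exist _ i P); left.
- have P : (s i == i) || (i \in Iplus) by rewrite Pi orbT.
  by exists (exist _ i P); left.
- have P : (s (s i) == s i) || (s i \in Iplus) by rewrite Pi orbT.
  by exists (exist _ (s i) P); right; exact: sK.
Qed.

Lemma half_uniq (j j' : halfI) i : sval j = i \/ s (sval j) = i -> sval j' = i \/ s (sval j') = i -> j = j'.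
Proof.
have pl (a b : halfI) : s (sval a) = sval b -> a = b.
  move=> E0; apply: val_inj => /=; have [si|si] := eqVneq (s (sval a)) (sval a); first by rewrite -E0 si.
  have sib : s (sval b) != sval b by rewrite -E0 s_inj.
  have := valP a; have := valP b; rewrite /= (negbTE si) (negbTE sib) /= => Pb Pa.
  by have := hIplus.2 _ si; rewrite E0 Pb Pa.
move=> [<-|E1] [E2|E2].
- exact/esym/val_inj.
- by apply/esym; exact: pl.
- by apply: pl; rewrite E1 E2.
- by apply: val_inj; apply/eqP; rewrite -s_inj /= E1 E2.
Qed.

Lemma jmap_comp (y : pointH) t (v : halfI -> V) (j : halfI) i : (forall j, nf' (sval j) (y j)) ->
  (forall j, jf (y j) t (v j)) -> sval j = i \/ s (sval j) = i ->
  idem i (\sum_j' v j') = idem i (v j).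
Proof.
move=> Ny Hy Hj; rewrite (End_sum _ _ _ (idem_End i)) (bigD1 j) //= big1 ?addr0 // => j' ne.
apply: (jf_Vcomp (Ny j') (Hy j')); apply: contra ne => /eqP E0.
  by apply/eqP; apply: (half_uniq (i := i)) => //; left.
by apply/eqP; apply: (half_uniq (i := i)) => //; right.
Qed.

Lemma j_factor0 (j : halfI) (y : pointH) t : (forall j, nf' (sval j) (y j)) -> jf (y j) t 0.
Proof.
move=> Ny; have [N1 _] := jt_bnorm (Ny j); have [sj|sj] := eqVneq (s (sval j)) (sval j).
  by have [r ->] := jf_translate (y j) sj; exact: (nf0 N1).
rewrite jf_plus //; exists 0; first exact: (nf0 N1).
exists 0; last exact: addr0.
apply/(dualV _ _ _ (ex_intro _ _ N1)); split; first exact: (rs0 (Vcomp_D _)).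
by move=> t' z _; rewrite (h0l hh); exact: (vge0 Hv).
Qed.

Lemma jmap_ycoord L : good L -> jmap (ycoord L) = L.
Proof.
move=> HL; have NL := HL.1.1; have Ny j := B1H_nf j (ycoord_B1H HL).
apply/funext => t; apply/seteqP; split=> [_ [v Hy <-]|v Lv].
  apply: (nf_sum NL) => j _; have := Hy j; have [sj|sj] := eqVneq (s (sval j)) (sval j).
    have [_ [r E0]] := ycoord_fix HL sj.
    by rewrite (jf_fix HL sj E0) => -[].
  rewrite jf_plus // ycoord_plus // (compP HL _).2 => -[u [Lu _] [z Dz <-]].
  apply: (nfD NL) => //; have [Wz Dz'] := iffLR (dualV _ _ _ (ex_intro _ _ (res_D HL _))) Dz.
  by apply: (iffRL (good_dual HL t Wz)).
exists (fun j : halfI => if s (sval j) == sval j then idem (sval j) v else idem (sval j) v + idem (s (sval j)) v).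
  move=> j; have [sj|sj] := eqVneq (s (sval j)) (sval j).
    have [_ [r E0]] := ycoord_fix HL sj; rewrite (jf_fix HL sj E0).
    by split; [exact: good_idem|exact: iota_Vcomp].
  rewrite jf_plus // ycoord_plus // (compP HL _).2; exists (idem (sval j) v).
    by split; [exact: good_idem|exact: iota_Vcomp].
  exists (idem (s (sval j)) v) => //; apply/(dualV _ _ _ (ex_intro _ _ (res_D HL _))).
  have W := iota_Vcomp (1 : E (s (sval j))) v; split=> //.
  by apply: (iffLR (good_dual HL t W)); exact: good_idem.
set f := fun j : halfI => _.
rewrite -[RHS](sum_idem v) -[LHS](sum_idem); apply: eq_bigr => i _.
have [j Hj] := half_rep i.
rewrite (End_sum _ _ _ (idem_End i)) (bigD1 j) //= big1 ?addr0 /f => [|j' ne].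
  have [sj|sj] := eqVneq (s (sval j)) (sval j).
    by case: Hj => [<-|<-]; rewrite ?sj idemK.
  case: Hj => <-; rewrite (EndD _ _ (idem_End _)) idemK idem_orth ?addr0 ?add0r //.
  by rewrite eq_sym.
have ne1 : i != sval j'.
  by apply: contra ne => /eqP E0; apply/eqP; apply: (half_uniq (i := i)) => //; left.
have ne2 : i != s (sval j').
  by apply: contra ne => /eqP E0; apply/eqP; apply: (half_uniq (i := i)) => //; right.
by case: ifP => _; rewrite ?(EndD _ _ (idem_End i)) !idem_orth // addr0.
Qed.

(** Restricting [jmap y] to V_i recovers the factor of y there up to translation, and bijectivity of
    [jt], together with self-dual normalization, recovers the coordinate itself. *)
Lemma jmap_inv L (y : pointH) : good L -> B1H y -> jmap y = L -> y = ycoord L.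
Proof.
move=> HL By Ey; have Ny j := B1H_nf j By; apply: functional_extensionality_dep => j.
have [N1 _] := jt_bnorm (Ny j); have [sj|sj] := eqVneq (s (sval j)) (sval j).
  have [r E0] := jf_translate (y j) sj.
  have Er : res (sval j) L = jf (y j).
    apply/funext => t; apply/seteqP; split=> v.
      rewrite -Ey => -[[u Hu <-] /VcompP <-].
      rewrite (jmap_comp Ny Hu (or_introl erefl)); have := Hu j; rewrite E0 /lf_translate => Hj.
      by have /VcompP -> := nf_sub N1 Hj.
    move=> Hv0; have Wv : Vcomp (sval j) v by move: Hv0; rewrite E0 => /(nf_sub N1).
    split=> //; rewrite -Ey; exists (dfwith (fun=> 0 : V) j v).
      move=> j'; have [<-|ne] := eqVneq j j'; first by rewrite dfwithin.
      by rewrite dfwithout //; exact: j_factor0.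
    rewrite (bigD1 j) //= dfwithin big1 ?addr0 // => j' ne.
    by rewrite dfwithout // eq_sym.
  apply: (ycoord_uniq (r := - r) HL sj (B1H_fix By sj)).
  have [HM JM] := compP HL (sval j).
  have <- : lf_translate (y j) r = comp (sval j) L.
    apply: jt_inj => //; first exact: translate_normfam.
    by rewrite jt_translate // JM Er E0.
  by rewrite translateD subrr translate0.
rewrite ycoord_plus //; apply/esym/comp_uniq => //.
apply/funext => t; apply/seteqP; split=> v.
  move=> Jv; have Wv := nf_sub N1 Jv; split=> //; rewrite -Ey; exists (dfwith (fun=> 0 : V) j v).
    move=> j'; have [<-|ne] := eqVneq j j'; last by rewrite dfwithout //; exact: j_factor0.
    rewrite dfwithin jf_plus //; exists v => //; exists 0; last exact: addr0.
    apply/(dualV _ _ _ (ex_intro _ _ N1)); split; first exact: (rs0 (Vcomp_D _)).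
    by move=> t' z _; rewrite (h0l hh); exact: (vge0 Hv).
  rewrite (bigD1 j) //= dfwithin big1 ?addr0 // => j' ne.
  by rewrite dfwithout // eq_sym.
rewrite -Ey => -[[u Hu <-] /VcompP <-]; rewrite (jmap_comp Ny Hu (or_introl erefl)).
have := Hu j; rewrite jf_plus // => -[z Jz [z' [/VcompP iz' _] <-]].
have /VcompP iz := nf_sub N1 Jz.
by rewrite (EndD _ _ (idem_End _)) iz -iz' idem_orth ?addr0 // eq_sym.
Qed.

Lemma ycoord_act g L (j : halfI) : centralizer h beta g -> good L ->
  ycoord (lf_act g L) j = lf_act (@psi (sval j) (g \o idem (sval j))) (ycoord L j).
Proof.
move=> Hg HL; have HgL := good_act Hg HL; set i := sval j.
have [sj|sj] := eqVneq (s i) i; last by rewrite !ycoord_plus // comp_act.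
have [Sy [r Ey]] := ycoord_fix HL sj; have [G1 G2] := cent_psiK Hg i.
have [n [b Hb]] := hV' i; have D'div := cda_division (hD' i); have Hh' := hh' sj.
have CC := cent_Cent Hg i; have EP := psi_End CC; have EP' := psi_End (cent_Cent' Hg i).
have Eg := Hg.1.1.
have adjP : adjoint (@h' i) (@psi i (g \o idem i)) = @psi i (adj g \o idem i).
  rewrite -(hadj sj CC); congr (@psi i _).
  rewrite (adjoint_comp hh Adiv HbV Eg (idem_End i)) adj_idem sj.
  by apply/funext => v; rewrite /= (cent_idem' Hg).
apply/esym; apply: (ycoord_uniq (r := r) HgL sj).
  apply: (lf_act_SD EP EP' G1 G2 _ Sy) => u v.
  by rewrite (adjE Hh' D'div Hb u _ EP) adjP G1.
by rewrite comp_act // Ey.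
Qed.

(** Builds elements of the centralizer block by block. The isometry condition only couples the
    blocks at i and s i. *)
Lemma block_cent (a : I -> V -> V) : (forall i, Cent i (a i)) ->
  (forall i v, adj (a i) (a (s i) v) = idem (s i) v) ->
  let g := fun v => \sum_i a i v in
  centralizer h beta g /\ forall i, g \o idem i = a i.
Proof.
move=> Ca aa g; have Ea i : End (a i) by have [] := Ca i.
have al i v : idem i (a i v) = a i v by exact: (Cent_idem_l v (Ca i)).
have ar i v : a i (idem i v) = a i v by exact: (Cent_idem_r v (Ca i)).
have ig i v : idem i (g v) = a i v.
  rewrite (End_sum _ _ _ (idem_End i)) (bigD1 i) //= al big1 ?addr0 // => i' ne.
  by rewrite -al idem_orth // eq_sym.
have gi i v : g (idem i v) = a i v.
  rewrite /g (bigD1 i) //= ar big1 ?addr0 // => i' ne.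
  by rewrite -ar idem_orth // (End0 (Ea i')).
split; last by move=> i; apply/funext => v; exact: gi.
have Eg : End g by apply: End_bigsum => i _.
split.
  apply/(unitaryP hD hh HbV); split=> // u v.
  have -> : h (g u) (g v) = \sum_i h u (idem (s i) v).
    rewrite {1}/g (h_suml hh); apply: eq_bigr => i _.
    by rewrite -al h_idem ig (adjE hh Adiv HbV) // aa.
  rewrite -(lform_sum HW (h_lform hh u)) // -(sum_idem v) -[in RHS](sum_idem v).
  congr (h u _); rewrite (reindex_inj (inv_inj sK)) /=.
  by apply: eq_bigr => i _; rewrite sum_idem sK.
have [be Hbe] := beta_iota; move: g ig gi Eg => g ig gi Eg.
apply/funext => v; rewrite -[LHS]/(g (beta v)) -[RHS]/(beta (g v)).
rewrite [RHS]Hbe -[LHS]sum_idem; apply: eq_bigr => i _.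
rewrite ig -ar Hbe iota_sum_comp -[RHS]iota_idem ig.
by have [_ _ H] := Ca i; have := congr1 (@^~ v) (H (be i)).
Qed.

Lemma infinite_E (i : I) : infinite_set [set: E i].
Proof.
have inj : injective (fun n : nat => (pi%:A : E i) ^+ n).
  move=> a b E0; have := congr1 (nu_step (@nuE i)) E0.
  have X n : nu_step (@nuE i) ((pi%:A : E i) ^+ n) = n%:R.
    by rewrite (nuX (dv_val (Hwe i)) _ (pi_neq0 _)) nu_piE.
  by rewrite !X => /eqP; rewrite eqr_nat => /eqP.
move=> Hf; apply: infinite_nat.
exact: (finite_preimage (f := fun n : nat => (pi%:A : E i) ^+ n) (fun a b _ _ => @inj a b) Hf).
Qed.

Variables (kbar : closedFieldType) (tau : forall i, {rmorphism E i -> kbar}).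
Variable phi : pointH -> (R -> set V).
Hypothesis hphi : forall x, B1H x -> B1G d nuD h (phi x).
Hypothesis hphi_affine : affine_map nuD' h' phi.
Hypothesis hphi_CLF : CLF_map h iota nuD' psi h' phi.
Hypothesis hphi_centre : equivariant h beta iota nuD' psi h'
  (@centre_neutralH _ _ _ h _ _ iota _ _ s Iplus h' kbar tau) phi.
(** Without indices V is zero, and every lattice function is constant. *)
Lemma main_empty : (I -> False) ->
  [/\ exists2 t : pointH -> pointH, translationH h iota nuD' h' (fun i => tau i) t
        & forall x, B1H x -> [set y | B1H y /\ jmap y = phi x] = [set t x],
      phi @` [set x | B1H x] =
        [set L | B1G d nuD h L /\ oE_oD_lattice_function d nuD nuE iota L]
    & equivariant h beta iota nuD' psi h'
        (@neutralH _ _ _ h _ _ iota _ _ s Iplus h' kbar tau) phi].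
Proof.
move=> noI; have V0 (v : V) : v = 0.
  by rewrite -(sum_idem v) big1 // => i; case: (noI i).
have full (L : R -> set V) : (forall t, exists v, L t v) -> L = fun=> setT.
  move=> H; apply/funext => t; apply/seteqP; split=> // v _.
  have [u Lu] := H t; by rewrite (V0 v) -(V0 u).
have lat (L : R -> set V) : lattice_function_D d nuD setT L -> L = fun=> setT.
  move=> [H _ _ _]; apply: full => t; have [n [g [_ ->]]] := H t.
  exists (\sum_l act 0 (g l)); exists (fun=> 0) => // l.
  by rewrite /valring /= (val0 Hv) leey.
have BT (x : pointH) : B1H x by move=> j; case: (noI (sval j)).
have pE (x y : pointH) : x = y.
  by apply: functional_extensionality_dep => j; case: (noI (sval j)).
have jE y : jmap y = fun=> setT.
  apply: full => t; exists (\sum_(j : halfI) 0); exists (fun=> 0) => // j.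
  by case: (noI (sval j)).
have phE x : phi x = fun=> setT by apply: lat; have [] := hphi (BT x).
split.
- exists id; last first.
    move=> x _; apply/seteqP; split=> y /=; first by move=> _; exact: pE.
    by move=> _; split; [exact: BT|rewrite jE phE].
  by exists (fun j => id); split=> // j; case: (noI (sval j)).
- apply/seteqP; split=> [_ [x _ <-]|L [[BL _] _]].
    split; first exact: hphi.
    split=> [|t|i]; [by have [] := hphi (BT x)| |by case: (noI i)].
    rewrite phE; apply/seteqP; split=> // v _; exists (fun=> 0); last exact: (etrans (V0 _) (esym (V0 _))).
    by move=> i; case: (noI i).
  exists (fun j => match noI (sval j) with end); first exact: BT.
  by rewrite phE (lat _ BL).
- move=> g _ _ x _; rewrite !phE; apply/esym/full => t.
  by exists (g 0); exists 0.
Qed.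

(** * Comparison of phi with j in each factor *)

Variable i0 : I.
Notation conv' i c := (conv (@nuD' i) (act' i) setT c).

Lemma B1G_SD L : B1G d nuD h L <-> SDV L.
Proof. by apply: (Latt_hE Hw hh HbV) => p; exact: (hstep i0). Qed.

Lemma phi_SD x : B1H x -> SDV (phi x). Proof. by move=> /hphi /B1G_SD. Qed.

Lemma phi_CLF x t a : B1H x -> lieH_filtration h iota psi x t a -> in_square (phi x) t a.
Proof. by move=> Bx; rewrite (hphi_CLF t Bx) => -[_ []]. Qed.

Lemma phi_good x : B1H x -> good (phi x).
Proof. by move=> Bx; apply: (good_of_CLF Bx (phi_SD Bx)) => t a; exact: phi_CLF. Qed.

(** The composite of phi with the inverse of j. *)
Definition Y x := ycoord (phi x).
Arguments Y : clear implicits.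

Lemma Y_nf x (j : halfI) : B1H x -> nf' (sval j) (Y x j).
Proof. by move=> Bx; exact: (B1H_nf j (ycoord_B1H (phi_good Bx))). Qed.

(** Components of an affine combination combine affinely by [comp_conv]. On a fixed index the
    combination of the self-dual normalizations is self-dual, so it is the normalization of the
    combined component. *)
Lemma Y_conv c (x1 x2 x3 : pointH) : 0 <= c <= 1 -> B1H x1 -> B1H x2 -> B1H x3 ->
  (forall j : halfI, conv' (sval j) c (x1 j) (x2 j) (x3 j)) ->
  forall j : halfI, conv' (sval j) c (Y x1 j) (Y x2 j) (Y x3 j).
Proof.
move=> c01 B1 B2 B3 Hcv j.
have [G1 G2 G3] := And3 (phi_good B1) (phi_good B2) (phi_good B3).
have Hph : conv nuD act setT c (phi x1) (phi x2) (phi x3).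
  apply/(convex_combP Hw HW); [exact: G1.1.1|exact: G2.1.1|exact: G3.1.1|].
  apply: (hphi_affine c01 B1 B2 B3) => j'.
  by apply/(convex_combP (Hw' _) (HW' _)) => //; exact: B1H_nf.
have Hc0' := comp_conv c01 G1 G2 G3 Hph (sval j).
have [sj|sj] := eqVneq (s (sval j)) (sval j); last by rewrite /Y !ycoord_plus.
have [n [b Hb]] := hV' (sval j).
have [S1 [r1 E1]] := ycoord_fix G1 sj; have [S2 [r2 E2]] := ycoord_fix G2 sj.
have := conv_translate r1 r2 Hc0'; rewrite -E1 -E2 => Hcv'.
have Hr' := rho'_nu sj (SD_rhoD (sval j) G1.1).
have S3 := conv_SD (Hw' _) (hh' sj) Hr' c01 Hcv' S1 S2.
by rewrite {3}/Y -(ycoord_uniq G3 sj S3 erefl).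
Qed.

Lemma Cent_add i a b : Cent i a -> Cent i b -> Cent i (fun v => a v + b v).
Proof.
move=> Ca Cb; have [Ea _ ca] := Ca; have [Eb _ cb] := Cb; split; first exact: End_add.
  apply/funext => v; rewrite /= (EndD _ _ (idem_End i)).
  by rewrite !(Cent_idem_r _ Ca) !(Cent_idem_r _ Cb) !(Cent_idem_l _ Ca) !(Cent_idem_l _ Cb).
move=> x; apply/funext => v; rewrite /= (EndD _ _ (iota_End x)).
have /= -> := congr1 (@^~ v) (ca x); by have /= -> := congr1 (@^~ v) (cb x).
Qed.

Lemma nu2D' i : nuD' (2%:R : D' i) = 0%E.
Proof.
have -> : (2%:R : D' i) = ((2%:R : k)%:A : E i)%:A by rewrite !scaler_nat.
by rewrite (hnuD' i).2 (hnuE i).2 (local_nu2 hk hodd).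
Qed.

(** Every endomorphism of V'_i, cut down to the block V_i, comes from Lie(H), so both norms have
    comparable square lattice functions and [square_translate] applies. *)
Lemma Y_plus x (j : halfI) : B1H x -> s (sval j) != sval j -> exists r, Y x j = lf_translate (x j) r.
Proof.
move=> Bx sj; set i := sval j in sj *; have [n [b Hb]] := hV' i; have G := phi_good Bx.
rewrite /Y ycoord_plus //; apply: (square_translate (Hw' i) Hb (B1H_nf j Bx) (compP G i).1).
move=> t g Eg Sg; have [a Ca pa] := psi_surj Eg; rewrite -pa in Sg *; apply/(comp_square G t Ca).
have := clf1 Bx (fun t a => @phi_CLF x t a Bx) (j := j) (a := a) (t := t).
rewrite /lieH_embed -/i (negbTE sj) => H r _ [v Lv <-].
have Fa : lieH_factor h iota j a by split=> // E0; rewrite -/i E0 eqxx in sj.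
have := good_idem G i (H Fa Sg r _ (ex_intro2 _ _ v Lv erefl)).
rewrite (EndB _ _ (idem_End i)) (Cent_idem_l _ Ca).
have [Ea ia _] := Ca; have Ei := idem_End i.
have -> : idem i (adj a v) = 0; last by rewrite subr0.
rewrite -ia (adjoint_comp hh Adiv HbV (End_comp Ei Ea) Ei) adj_idem /=.
by rewrite idem_orth // eq_sym.
Qed.

Definition is_split (i : I) := exists e f : V' i, splane (@rho' i) (eps' i) (@h' i) e f.

(** Here Lie(H) supplies only the skew endomorphisms of V'_i, which suffice by [skew_square_eq] as
    the space is not a split plane. *)
Lemma Y_fix x (j : halfI) : B1H x -> s (sval j) = sval j -> ~ is_split (sval j) -> Y x j = x j.
Proof.
move=> Bx sj ns; set i := sval j in sj ns *; have [n [b Hb]] := hV' i; have G := phi_good Bx.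
have [SY [r EY]] := ycoord_fix G sj; have Hh' := hh' sj.
have Hrho' := rho'_nu sj (SD_rhoD i (phi_SD Bx)).
apply/esym; apply: (skew_square_eq (Hw' i) Hh' Hrho' Hb (nu2D' i) (@Hc' i) ns (B1H_fix Bx sj) SY).
move=> t g Eg skg Sg; rewrite EY; apply/translate_square.
have [a Ca pa] := psi_surj Eg; rewrite -pa in Sg skg *; apply/(comp_square G t Ca).
have := clf1 Bx (fun t a => @phi_CLF x t a Bx) (j := j) (a := a) (t := t).
rewrite /lieH_embed -/i sj eqxx; apply=> //; split=> // _ v.
have Caa := Cent_adj sj Ca.
have H : (fun u => adj a u + a u) = fun=> 0.
  apply: (psi_inj (Cent_add Caa Ca) (Cent0 i)); rewrite psi0; apply/funext => u.
  by rewrite (ci_add (hpsi i)) // (hadj sj Ca) skg addNr.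
by apply/eqP; rewrite -addr_eq0; apply/eqP; exact: (congr1 (@^~ v) H).
Qed.

Definition ppair i : V' i * V' i := xget (0, 0) [set p | splane (@rho' i) (eps' i) (@h' i) p.1 p.2].
Notation pe i := (ppair i).1.
Notation pf i := (ppair i).2.
Notation pl' i := (pl (@nuD' i) (@h' i) (pe i) (pf i)).

Lemma ppairP i : is_split i -> splane (@rho' i) (eps' i) (@h' i) (pe i) (pf i).
Proof. by move=> [e [f H]]; rewrite /ppair; case: xgetP => [[a b] _ //|/(_ (e, f))]. Qed.

Lemma SD_pl' i L : s i = i -> is_split i -> SD' i L -> L = pl' i (nrm L (pe i)).
Proof.
move=> si Hi SL; have [n [b Hb]] := hV' i.
have [a ->] := SD_pl (Hw' i) (hh' si) Hb (nu2D' i) (@Hc' i) (ppairP Hi) SL.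
by rewrite (nrm_pl (Hw' i) (hh' si) (ppairP Hi)).
Qed.

Lemma upd_conv c (x : pointH) (j : halfI) L1 L2 L3 : B1H x -> conv' (sval j) c L1 L2 L3 ->
  forall j' : halfI, conv' (sval j') c (dfwith x j L1 j') (dfwith x j L2 j') (dfwith x j L3 j').
Proof.
move=> Bx Hcv j'; have [<-|ne] := eqVneq j j'; first by rewrite !dfwithin.
have [n [b Hb]] := hV' (sval j').
by rewrite !dfwithout //; exact: (conv_refl (Hw' _) (HW' _) c Hb (B1H_nf j' Bx)).
Qed.

Lemma upd_B1H (x : pointH) (j : halfI) L : B1H x -> nf' (sval j) L ->
  (s (sval j) = sval j -> SD' (sval j) L) -> B1H (dfwith x j L).
Proof.
move=> Bx HL1 HL2; apply: B1HP => j'; have [<-|ne] := eqVneq j j'; rewrite ?dfwithin ?dfwithout //.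
  exact: (B1H_nf j' Bx).
exact: (B1H_fix Bx).
Qed.

Lemma upd_id (x : pointH) (j : halfI) : dfwith x j (x j) = x.
Proof.
apply: functional_extensionality_dep => j'.
by have [<-|ne] := eqVneq j j'; rewrite ?dfwithin ?dfwithout.
Qed.

(** * Affine functions on the building of H with central periods *)

Section Constant.
Variable G : pointH -> R.
Hypothesis Gaff : forall c x1 x2 x3, 0 <= c <= 1 -> B1H x1 -> B1H x2 -> B1H x3 ->
  (forall j : halfI, conv' (sval j) c (x1 j) (x2 j) (x3 j)) -> G x3 = c * G x1 + (1 - c) * G x2.
Hypothesis Gplus : forall x (j : halfI), B1H x -> s (sval j) != sval j ->
  G (dfwith x j (lf_translate (x j) (- 1))) = G x.
Hypothesis Gpl : forall x (j : halfI) a, B1H x -> s (sval j) = sval j -> is_split (sval j) ->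
  x j = pl' (sval j) a -> G (dfwith x j (pl' (sval j) (a - 1))) = G x.

(** Only the coordinate at j moves. The function of this coordinate is constant by
    [gl_affine_const], by [plane_affine_const] or by [SD_affine_const], according to the type of the
    factor; the first two use the periods. *)
Lemma const_upd x (j : halfI) L : B1H x -> B1H (dfwith x j L) -> G (dfwith x j L) = G x.
Proof.
move=> Bx BL; rewrite -[in RHS](upd_id x j); set i := sval j.
have [n [b Hb]] := hV' i; have NL := B1H_nf j BL; rewrite dfwithin in NL; have Nx := B1H_nf j Bx.
pose F L0 := G (dfwith x j L0); rewrite -/(F L) -/(F (x j)).
have Faff c L1 L2 L3 : 0 <= c <= 1 -> B1H (dfwith x j L1) -> B1H (dfwith x j L2) ->
    B1H (dfwith x j L3) -> conv' i c L1 L2 L3 -> F L3 = c * F L1 + (1 - c) * F L2.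
  by move=> c01 b1 b2 b3 Hcv; apply: (Gaff c01 b1 b2 b3); exact: upd_conv.
have [sj|sj] := eqVneq (s i) i; last first.
  have BN L0 : nf' i L0 -> B1H (dfwith x j L0).
    by move=> N0; apply: upd_B1H => // E0; rewrite -/i E0 eqxx in sj.
  apply: (@gl_affine_const _ _ _ (Hw' i) _ _ _ (HW' i) _ _ Hb F _ (- 1)) => //.
  - move=> c L1 L2 L3 c01 Hcv; have [N1 N2 N3] := conv_nf (Hw' i) (HW' i) Hcv.
    by apply: Faff => //; exact: BN.
  - move=> L0 N0; have := Gplus (BN L0 N0) sj; rewrite dfwithin /F => <-.
    congr G; apply: functional_extensionality_dep => j'.
    by have [<-|ne] := eqVneq j j'; rewrite ?dfwithin ?dfwithout // dfwithout.
have BS L0 : SD' i L0 -> B1H (dfwith x j L0) by move=> S0; apply: upd_B1H => //; exact: S0.1.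
have SL := B1H_fix BL sj; rewrite dfwithin in SL; have Sx := B1H_fix Bx sj.
have [Hi|Hi] := pselect (is_split i).
  apply: (plane_affine_const (Hw' i) (hh' sj) Hb (nu2D' i) (@Hc' i) (ppairP Hi) (F := F) (p := - 1)) => //.
  - by move=> c L1 L2 L3 c01 S1 S2 S3 Hcv; apply: Faff => //; exact: BS.
  - move=> a; have Sa := pl_SD (Hw' i) (hh' sj) (ppairP Hi) a.
    have := Gpl (a := a) (BS _ Sa) sj Hi; rewrite dfwithin /F => <- //.
    congr G; apply: functional_extensionality_dep => j'.
    by have [<-|ne] := eqVneq j j'; rewrite ?dfwithin ?dfwithout // dfwithout.
have Hrho' := rho'_nu sj (SD_rhoD i (phi_SD Bx)).
apply: (SD_affine_const (Hw' i) (hh' sj) Hrho' Hb (nu2D' i) (@Hc' i) _ Hi SL Sx) => L1 L2 L3 S1 S2 S3 Hcv.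
have h01 : 0 <= (1 / 2 : R) <= 1 by apply/andP; split; lra.
by rewrite (Faff _ _ _ _ h01 (BS _ S1) (BS _ S2) (BS _ S3) Hcv); lra.
Qed.

Lemma const_G x x' : B1H x -> B1H x' -> G x = G x'.
Proof.
move=> Bx Bx'; have : forall j : halfI, j \notin enum halfI -> x j = x' j.
  by move=> j; rewrite mem_enum.
elim: (enum halfI) x Bx => [|j l IH] x Bx H.
  by congr G; apply: functional_extensionality_dep => j; exact: H.
have B1 : B1H (dfwith x j (x' j)).
  by apply: upd_B1H => //; [exact: (B1H_nf j Bx')|exact: (B1H_fix Bx')].
rewrite -(const_upd Bx B1); apply: IH => // j' nl.
have [<-|ne] := eqVneq j j'; first by rewrite dfwithin.
by rewrite dfwithout //; apply: H; rewrite inE negb_or eq_sym ne.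
Qed.

End Constant.

(** * Central elements and their action *)

Notation FE i := (@E0 k D V h I E iota s i).

Lemma E0_plus i : s i != i -> FE i = setT.
Proof. by move=> si; apply/seteqP; split=> // x _ E1; rewrite E1 eqxx in si. Qed.

Lemma E0_fix i : s i = i -> FE i = [set c | @rho' i c%:A = c%:A].
Proof.
move=> si; have H i' : s i = i' -> forall c : E i, exists c' : E i', adj (iota c) = iota c'.
  by move=> <-; exact: adj_iota.
apply/seteqP; split=> c; have [c' hc'] := H i si c; have rc := rho'_scalar si hc'.
  by move=> /(_ si); rewrite hc' /= rc => /iota_inj ->.
by rewrite /= rc => /alg_inj E1 _; rewrite hc' E1.
Qed.

Let D2 i : 2%:R != 0 :> D' i := two_neq0 (Hw' i) (nu2D' i).

Definition neutral_at i (g : V' i -> V' i) : Prop :=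
  if s i == i then unitary_neutral (FE i) (tau i) (@h' i) g else gl_neutral (FE i) (tau i) g.

Lemma neutral_at_id i : @neutral_at i id.
Proof.
have [n [b Hb]] := hV' i; rewrite /neutral_at; case: eqP => [si|/eqP si].
  by rewrite E0_fix //; exact: (unitary_neutral_id (hD' i) (hh' si) (D2 i) Hb).
rewrite E0_plus //; have -> : id = fun v : V' i => act' i (1 : E i)%:A v.
  by apply/funext => v; rewrite scale1r (act1 (HW' i)).
exact: (gl_neutral_scalar Hb _ (oner_neq0 _)).
Qed.

Lemma neutral_at_End i g : @neutral_at i g -> End g.
Proof. by rewrite /neutral_at; case: eqP => _ [[]]. Qed.

Lemma lf_act_id (W : Type) (L : R -> set W) : lf_act id L = L.
Proof. by apply/funext => r; exact: image_id. Qed.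

Lemma Y_centre (j0 : halfI) (T : V' (sval j0) -> V' (sval j0)) g (x : pointH) : B1H x ->
  centralizer h beta g -> @psi (sval j0) (g \o idem (sval j0)) = T ->
  (forall j : halfI, j != j0 -> g \o idem (sval j) = idem (sval j)) ->
  @neutral_at (sval j0) T -> (forall g0, @neutral_at (sval j0) g0 -> T \o g0 = g0 \o T) ->
  Y (dfwith x j0 (lf_act T (x j0))) = dfwith (Y x) j0 (lf_act T (Y x j0)).
Proof.
move=> Bx Hg HT Hid NT CT.
have Hpsi (j : halfI) : j != j0 -> @psi (sval j) (g \o idem (sval j)) = id.
  by move=> ne; rewrite Hid // psi_idem.
have cen : centre_neutralH h iota h' (fun i => tau i) (fun j : halfI => @psi (sval j) (g \o idem (sval j))).
  split=> [j|g0 Hg0 j]; have [->|ne] := eqVneq j j0.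
  - by rewrite HT; exact: NT.
  - by rewrite Hpsi //; exact: neutral_at_id.
  - by rewrite HT; apply: CT; exact: Hg0.
  - by rewrite Hpsi.
have := hphi_centre Hg cen Bx.
have -> : (fun j : halfI => lf_act (@psi (sval j) (g \o idem (sval j))) (x j)) =
    dfwith x j0 (lf_act T (x j0)).
  apply: functional_extensionality_dep => j; have [<-|ne] := eqVneq j0 j; first by rewrite dfwithin HT.
  by rewrite dfwithout // Hpsi 1?eq_sym // lf_act_id.
move=> Ephi; apply: functional_extensionality_dep => j.
rewrite {1}/Y Ephi ycoord_act //; last exact: phi_good.
have [<-|ne] := eqVneq j0 j; first by rewrite dfwithin HT.
by rewrite dfwithout // Hpsi 1?eq_sym // lf_act_id.
Qed.

(** To be an isometry, multiplication by pi on V_i must be matched by the inverse of its conjugate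
    on V_{-i}. *)
Lemma centre_plus (j0 : halfI) : s (sval j0) != sval j0 -> exists g,
  [/\ centralizer h beta g, @psi (sval j0) (g \o idem (sval j0)) = act' (sval j0) (pi%:A : E (sval j0))%:A
    & forall j : halfI, j != j0 -> g \o idem (sval j) = idem (sval j)].
Proof.
set i := sval j0 => si; pose p : E i := pi%:A; have p0 : p != 0 by exact: pi_neq0.
pose a i' := if i' == i then iota p else if i' == s i then iota (sigma p^-1) else idem i'.
have sii : (i == s i) = false by rewrite eq_sym (negbTE si).
have Ca i' : Cent i' (a i').
  rewrite /a; case: eqP => [->|_]; first exact: Cent_iota.
  by case: eqP => [->|_]; [exact: Cent_iota|exact: Cent_idem].
have [|Hg Hgi] := block_cent Ca.
  move=> i' v; rewrite /a; have [->|ne] := eqVneq i' i.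
    by rewrite (negbTE si) eqxx sigmaP -iotaM -sigmaM mulfV // sigma1.
  have -> : (s i' == s i) = false by rewrite s_inj (negbTE ne).
  have [->|ne'] := eqVneq i' (s i).
    rewrite !sK eqxx -sigmaP (adjointK hh Adiv HbV); last exact: iota_End.
    by rewrite -iotaM mulVf.
  have -> : (s i' == i) = false by rewrite -(s_inj (s i')) sK (negbTE ne').
  by rewrite adj_idem idemK.
exists (fun v => \sum_i a i v); split=> //.
  by rewrite Hgi /a eqxx psi_iota.
move=> j ne; rewrite Hgi /a.
have -> : (sval j == i) = false.
  by apply/negbTE; apply: contra ne => /eqP E1; apply/eqP/val_inj.
case: eqP => // E1; case/eqP: ne; apply: (half_uniq (i := s i)); [by left|by right].
Qed.

Lemma centre_fix (j0 : halfI) T : s (sval j0) = sval j0 -> unitary_group (@h' (sval j0)) T -> exists g,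
  [/\ centralizer h beta g, @psi (sval j0) (g \o idem (sval j0)) = T
    & forall j : halfI, j != j0 -> g \o idem (sval j) = idem (sval j)].
Proof.
set i := sval j0 => si UT; have [u Cu pu] := psi_surj UT.1.
have uu : adj u \o u = idem i.
  have Cau := Cent_adj si Cu; have [Eu iu cu] := Cu; have [Eau iau cau] := Cau.
  apply: (@psi_inj i); last first.
  - by rewrite (ci_mul (hpsi i) Cau Cu) (hadj si Cu) pu UT.2 psi_idem.
  - exact: Cent_idem.
  - split; first exact: End_comp.
      apply/funext => v; rewrite /= (Cent_idem_r _ Cu).
      exact: (Cent_idem_l _ Cau).
    by move=> x; apply/funext => v; have /= -> := congr1 (@^~ v) (cu x);
      have /= -> := congr1 (@^~ (u v)) (cau x).
pose a i' := if i' == i then u else idem i'.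
have Ca i' : Cent i' (a i').
  by rewrite /a; case: eqP => [->//|_]; exact: Cent_idem.
have [|Hg Hgi] := block_cent Ca.
  move=> i' v; rewrite /a; have [->|ne] := eqVneq i' i.
    by rewrite si eqxx -[LHS]/((adj u \o u) v) uu.
  have -> : (s i' == i) = false by rewrite -{1}si s_inj (negbTE ne).
  by rewrite adj_idem idemK.
exists (fun v => \sum_i a i v); split=> //.
  by rewrite Hgi /a eqxx.
move=> j ne; rewrite Hgi /a.
have -> // : (sval j == i) = false.
by apply/negbTE; apply: contra ne => /eqP E1; apply/eqP/val_inj.
Qed.

Lemma Y_scalar x (j : halfI) : B1H x -> s (sval j) != sval j ->
  Y (dfwith x j (lf_translate (x j) (- 1))) = dfwith (Y x) j (lf_translate (Y x j) (- 1)).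
Proof.
move=> Bx sj; set i := sval j in sj *; have [g [Hg Hp Hid]] := centre_plus sj.
have [n [b Hb]] := hV' i; set c : D' i := _%:A in Hp.
have tr L : nf' i L -> lf_act (act' i c) L = lf_translate L (- 1).
  by move=> HL; rewrite (lf_act_scalar (Hw' i) (HW' i) HL (piD'_neq0 i)) nu_piD'.
rewrite -(tr _ (B1H_nf j Bx)) -(tr _ (Y_nf j Bx)); apply: (Y_centre Bx Hg Hp Hid).
  rewrite /neutral_at -/i (negbTE sj) E0_plus //; exact: (gl_neutral_scalar Hb _ (pi_neq0 (E i))).
move=> g0 /neutral_at_End Eg0; apply/funext => v; exact: esym (EndZ _ _ Eg0).
Qed.

Lemma neutral_lines_at i g : s i = i -> is_split i -> @neutral_at i g ->
  [/\ End g, forall u v, @h' i (g u) (g v) = @h' i u v, g (pe i) = act' i (@h' i (pf i) (g (pe i))) (pe i)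
    & g (pf i) = act' i (@h' i (pe i) (g (pf i))) (pf i)].
Proof.
move=> si Hi; rewrite /neutral_at si eqxx E0_fix // => Ng; have [n [b Hb]] := hV' i.
have [Eg [ge gf]] := neutral_lines (hD' i) (hh' si) (D2 i) Hb (ppairP Hi) Ng.
by have /(unitaryP (hD' i) (hh' si) Hb) [_ gh] := Ng.1; split.
Qed.

(** The torus element with parameter pi moves [pl a] to [pl (a - 1)]. It is central in the neutral
    component because neutral elements preserve both isotropic lines. *)
Lemma Y_torus x (j : halfI) a : B1H x -> s (sval j) = sval j -> is_split (sval j) ->
  x j = pl' (sval j) a ->
  Y (dfwith x j (pl' (sval j) (a - 1))) = dfwith (Y x) j (pl' (sval j) (nrm (Y x j) (pe (sval j)) - 1)).
Proof.
move=> Bx; set i := sval j => sj Hi xa; have Hs := ppairP Hi; have Hh' := hh' sj.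
have [n [b Hb]] := hV' i; set p : E i := pi%:A; have p0 : p != 0 by exact: pi_neq0.
set T := torus (@h' i) (pe i) (pf i) p.
have NT : @neutral_at i T.
  by rewrite /neutral_at sj eqxx E0_fix //; exact: (torus_neutral (hD' i) Hh' Hb (tau i) Hs p0).
have UT : unitary_group (@h' i) T by move: NT; rewrite /neutral_at sj eqxx => -[].
have [ee ff fe] := spl_pair Hs; have ef := splane_ef Hh' Hs.
have Te : T (pe i) = act' i p%:A (pe i).
  by rewrite /T /torus fe ee mulr1 mulr0 (act0r (HW' i)) addr0.
have Tf : T (pf i) = act' i (p^-1)%:A (pf i).
  by rewrite /T /torus ff ef mulr1 mulr0 (act0r (HW' i)) add0r.
clearbody T; have /(unitaryP (hD' i) Hh' Hb) [ET Th] := UT.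
have Ta a' : lf_act T (pl' i a') = pl' i (a' - 1).
  rewrite (plane_act (Hw' i) Hh' Hs a' ET Th Te Tf); congr pl.
  by rewrite algV (nuV (Hw' i) (piD'_neq0 i)) nu_piD'.
have [g [Hg Hp Hid]] := centre_fix sj UT.
have SY : SD' i (Y x j) := B1H_fix (ycoord_B1H (phi_good Bx)) sj.
rewrite -!Ta -xa -(SD_pl' sj Hi SY); apply: (Y_centre Bx Hg Hp Hid NT) => g0 N0.
have [Eg0 _ ge gf] := neutral_lines_at sj Hi N0; apply/funext => v /=.
have Cm := sym_comm Hh' (spl_rho Hs).
set x' := @h' i _ _ in ge; set y' := @h' i _ _ in gf; clearbody x' y'.
rewrite (splane_decomp Hs v) (EndD _ _ Eg0) !(EndD _ _ ET) !(EndZ _ _ Eg0) !(EndZ _ _ ET) ge gf.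
rewrite !(EndZ _ _ ET) Te Tf (EndD _ _ Eg0) !(EndZ _ _ Eg0) ge gf -!(actM (HW' i)).
by rewrite !mulrA (Cm p%:A x') (Cm (p^-1)%:A y').
Qed.

(** * The translation and the conclusion *)

Definition valid (j : halfI) L := nf' (sval j) L /\ (s (sval j) = sval j -> SD' (sval j) L).

Arguments valid : clear implicits.

Lemma B1H_valid x (j : halfI) : B1H x -> valid j (x j).
Proof. by move=> Bx; split; [exact: B1H_nf|exact: B1H_fix]. Qed.

(** The shift G x is read off as a difference of norms of one fixed vector. It is affine because
    translations of a norm are distinct, and a central scalar moves x and Y x alike, so [const_G]
    applies. *)
Lemma factor_plus (j : halfI) : s (sval j) != sval j -> exists r, forall x, B1H x ->
  Y x j = lf_translate (x j) r.
Proof.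
move=> sj; have [[x0 B0]|Hno] := pselect (exists x, B1H x); last first.
  by exists 0 => x Bx; case: Hno; exists x.
have [v vn] := V'_neq0 (sval j); pose G x := nrm (Y x j) v - nrm (x j) v.
have YG x : B1H x -> Y x j = lf_translate (x j) (G x).
  move=> Bx; have [r Er] := Y_plus Bx sj; rewrite /G Er.
  by rewrite (nrm_translate r (B1H_nf j Bx) (Logic.I : setT v) vn) addrAC subrr add0r.
have Gc x x' : B1H x -> B1H x' -> G x = G x'.
  apply: const_G => [c x1 x2 x3 c01 B1 B2 B3 Hcv|y j' By sj'|y j' a By sj' Hi Ey].
  - have := Y_conv c01 B1 B2 B3 Hcv j; rewrite !YG // => H1.
    have H2 := conv_translate (G x1) (G x2) (Hcv j).
    have := conv_uniq (Hw' _) (HW' _) c01 H1 H2.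
    exact: (translate_inj (B1H_nf j B3) (Logic.I : setT v) vn).
  - rewrite /G (Y_scalar By sj'); have [E1|ne] := eqVneq j' j; last by rewrite !dfwithout.
    subst j'; rewrite !dfwithin.
    rewrite (nrm_translate _ (Y_nf j By) (Logic.I : setT v) vn).
    by rewrite (nrm_translate _ (B1H_nf j By) (Logic.I : setT v) vn); ring.
  - have ne : j' != j by apply: contra sj => /eqP <-; apply/eqP.
    by rewrite /G (Y_torus By sj' Hi Ey) !dfwithout.
by exists (G x0) => x Bx; rewrite -(Gc x x0 Bx B0); exact: YG.
Qed.

(** On a split plane the norm of e is an affine coordinate on the line of self-dual norms; G is the
    difference of the coordinates of Y x and x. *)
Lemma factor_split (j : halfI) : s (sval j) = sval j -> is_split (sval j) -> exists r, forall x, B1H x ->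
  Y x j = plane_shift (pe (sval j)) (pf (sval j)) r (x j).
Proof.
move=> sj Hi; have [[x0 B0]|Hno] := pselect (exists x, B1H x); last first.
  by exists 0 => x Bx; case: Hno; exists x.
set i := sval j in sj Hi *; have Hs := ppairP Hi; have Hh' := hh' sj.
pose G x := nrm (Y x j) (pe i) - nrm (x j) (pe i).
have SY x : B1H x -> SD' i (Y x j) by move=> Bx; exact: (B1H_fix (ycoord_B1H (phi_good Bx)) sj).
have Sx x : B1H x -> SD' i (x j) by move=> Bx; exact: (B1H_fix Bx sj).
have nc c L1 L2 L3 : 0 <= c <= 1 -> SD' i L1 -> SD' i L2 -> SD' i L3 -> conv' i c L1 L2 L3 ->
    nrm L3 (pe i) = c * nrm L1 (pe i) + (1 - c) * nrm L2 (pe i).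
  move=> c01 S1 S2 S3; rewrite {1}(SD_pl' sj Hi S1) {1}(SD_pl' sj Hi S2) {1}(SD_pl' sj Hi S3) => Hcv.
  have Hcv2 := pl_conv (Hw' i) Hh' Hs c (nrm L1 (pe i)) (nrm L2 (pe i)).
  exact: (pl_inj (Hw' i) Hh' Hs (conv_uniq (Hw' i) (HW' i) c01 Hcv Hcv2)).
have Gc x x' : B1H x -> B1H x' -> G x = G x'.
  apply: const_G => [c x1 x2 x3 c01 B1 B2 B3 Hcv|y j' By sj'|y j' a By sj' Hi' Ey].
  - rewrite /G (nc c _ _ _ c01 (Sx _ B1) (Sx _ B2) (Sx _ B3) (Hcv j)).
    rewrite (nc c _ _ _ c01 (SY _ B1) (SY _ B2) (SY _ B3) (Y_conv c01 B1 B2 B3 Hcv j)); ring.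
  - have ne : j' != j by apply: contra sj' => /eqP ->; apply/eqP.
    by rewrite /G (Y_scalar By sj') !dfwithout.
  - rewrite /G (Y_torus By sj' Hi' Ey); have [E1|ne] := eqVneq j' j; last by rewrite !dfwithout.
    subst j'; rewrite !dfwithin !(nrm_pl (Hw' i) Hh' Hs) Ey (nrm_pl (Hw' i) Hh' Hs); ring.
exists (G x0) => x Bx; rewrite -(Gc x x0 Bx B0) (SD_pl' sj Hi (Sx x Bx)).
rewrite (plane_shiftE (Hw' i) Hh' Hs) {1}(SD_pl' sj Hi (SY x Bx)) /G; congr pl; ring.
Qed.

(** Besides being a translation, the map must be onto, for the image of phi, and commute with the
    neutral component, for its equivariance. On a split plane both hold because everything acts by
    shifts of one line. *)
Lemma factor (j : halfI) : exists F : (R -> set (V' (sval j))) -> (R -> set (V' (sval j))),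
  [/\ if s (sval j) == sval j
      then unitary_translation (FE (sval j)) (tau (sval j)) (@h' (sval j)) (@nuD' (sval j)) F
      else gl_translation (@nuD' (sval j)) F,
      forall x, B1H x -> Y x j = F (x j),
      forall L, valid j L -> exists2 L', valid j L' & F L' = L
    & forall g L, @neutral_at (sval j) g -> valid j L -> F (lf_act g L) = lf_act g (F L)].
Proof.
set i := sval j; have [n [b Hb]] := hV' i.
have [sj|sj] := eqVneq (s i) i; last first.
  have [r Hr] := factor_plus sj; exists (fun L => lf_translate L r); split=> //.
  - by exists r.
  - move=> L [NL _]; exists (lf_translate L (- r)); last by rewrite translateD addNr translate0.
    by split; [exact: translate_normfam|move=> E1; rewrite -/i E1 eqxx in sj].
have Hh' := hh' sj; have E1 := E0_fix sj.
have LSD L : Latt_h (@h' i) (@nuD' i) (nu_step (@nuD' i)) L -> SD' i L.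
  by move=> /(Latt_hE (Hw' i) Hh' Hb); apply.
have [Hi|Hi] := pselect (is_split i); last first.
  exists id; split=> //.
  - split=> // Ho; case: Hi; rewrite E1 in Ho.
    exact: (is_O2is_splane (hD' i) Hh' (D2 i) (@infinite_E i) Hb Ho).
  - by move=> x Bx; exact: Y_fix.
  - by move=> L HL; exists L.
have Hs := ppairP Hi; have [r Hr] := factor_split sj Hi.
exists (plane_shift (pe i) (pf i) r).
have PE L : SD' i L -> exists a, L = pl' i a by move=> SL; exists (nrm L (pe i)); exact: SD_pl'.
have [ee ff fe] := spl_pair Hs; split=> //.
- split=> [nO|_].
    by case: nO; rewrite E1; exact: (splane_is_O2is (hD' i) Hh' (D2 i) Hb (tau i) Hs).
  exists (pe i), (pf i); split=> //; first exact: (plane_basis2 Hh' Hs).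
  by exists r.
- move=> L [_ /(_ sj) /PE [a ->]]; exists (pl' i (a - r)); last first.
    by rewrite (plane_shiftE (Hw' i) Hh' Hs) subrK.
  have S := pl_SD (Hw' i) Hh' Hs (a - r).
  by split=> //; exact: S.1.
- move=> g L Ng [_ /(_ sj) /PE [a ->]].
  have [Eg gh ge gf] := neutral_lines_at sj Hi Ng.
  rewrite (plane_act (Hw' i) Hh' Hs a Eg gh ge gf) !(plane_shiftE (Hw' i) Hh' Hs).
  rewrite (plane_act (Hw' i) Hh' Hs (a + r) Eg gh ge gf); congr pl; ring.
Qed.

Definition tr (j : halfI) := projT1 (cid (factor j)).
Arguments tr : clear implicits.
Definition trans (x : pointH) : pointH := fun j => tr j (x j).

Lemma Y_trans x : B1H x -> Y x = trans x.
Proof.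
move=> Bx; apply: functional_extensionality_dep => j; rewrite /trans /tr.
by case: (cid (factor j)) => F /= [_ H _ _]; exact: H.
Qed.

Lemma trans_translation : translationH h iota nuD' h' (fun i => tau i) trans.
Proof.
exists (fun j => tr j); split=> // j; rewrite /tr.
by case: (cid (factor j)) => F /= [H _ _ _]; exact: H.
Qed.

Lemma translation_unique x : B1H x -> [set y | B1H y /\ jmap y = phi x] = [set trans x].
Proof.
move=> Bx; have G := phi_good Bx; rewrite -Y_trans //; apply/seteqP; split=> y /=.
  by move=> [By Ey]; exact: jmap_inv.
by move=> ->; split; [exact: ycoord_B1H|exact: jmap_ycoord].
Qed.

Lemma phi_jmap x : B1H x -> phi x = jmap (trans x).
Proof. by move=> Bx; rewrite -Y_trans // jmap_ycoord //; exact: phi_good. Qed.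

Lemma goodP L : good L <-> B1G d nuD h L /\ oE_oD_lattice_function d nuD nuE iota L.
Proof.
rewrite B1G_SD; split=> [HL|[SL [_ sp LE]]].
  have SL := HL.1; split=> //; split.
  - by have /B1G_SD [] := SL.
  - move=> t; apply/seteqP; split=> v.
      move=> Lv; exists (fun i => idem i v); last exact: sum_idem.
      by move=> i; split; [exact: iota_Vcomp|exact: good_idem].
    by move=> [u Hu <-]; apply: (nf_sum SL.1) => i _; exact: (Hu i).2.
  - by move=> i; apply/LF_E_nf; exact: (res_bnorm HL i).2.
split=> // i c c0 r _ [v Lv <-].
have Li : L r (idem i v).
  have := Lv; rewrite {1}sp => -[u Hu <-].
  rewrite (End_sum _ _ _ (idem_End i)) (bigD1 i) //= big1 ?addr0.
    by have [/VcompP -> Lu] := Hu i.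
  by move=> i' ne; have [/VcompP <- _] := Hu i'; rewrite idem_orth // eq_sym.
have /LF_E_nf N := LE i; rewrite -iota_idem.
have : (L r `&` Vcomp i) (idem i v) by split=> //; exact: iota_Vcomp.
by move=> /(nfZ N) /(_ (vge_nu (dv_val (Hwe i)) c)) [].
Qed.

Lemma phi_image : phi @` [set x | B1H x] =
  [set L | B1G d nuD h L /\ oE_oD_lattice_function d nuD nuE iota L].
Proof.
apply/seteqP; split=> [_ [x Bx <-]|L /goodP HL]; first by apply/goodP; exact: phi_good.
have BY := ycoord_B1H HL.
have H j : exists L', valid j L' /\ tr j L' = ycoord L j.
  rewrite /tr; case: (cid (factor j)) => F /= [_ _ H _].
  by have [L' ? ?] := H _ (B1H_valid j BY); exists L'.
pose x : pointH := fun j => projT1 (cid (H j)).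
have Hx j : valid j (x j) /\ tr j (x j) = ycoord L j.
  by rewrite /x; case: (cid (H j)).
have Bx : B1H x by apply: B1HP => j; [exact: (Hx j).1.1|exact: (Hx j).1.2].
exists x => //; rewrite phi_jmap // -[RHS](jmap_ycoord HL); congr jmap.
by apply: functional_extensionality_dep => j; exact: (Hx j).2.
Qed.

Lemma phi_equivariant : equivariant h beta iota nuD' psi h'
  (@neutralH _ _ _ h _ _ iota _ _ s Iplus h' kbar tau) phi.
Proof.
move=> g Hg Sg x Bx; have Gx := phi_good Bx; have Ggx := good_act Hg Gx.
have Bgx : B1H (fun j : halfI => lf_act (@psi (sval j) (g \o idem (sval j))) (x j)).
  apply: B1HP => j.
    have [G1 G2] := cent_psiK Hg (sval j).
    exact: (lf_act_nf (cent_gl Hg _).1 (psi_End (cent_Cent' Hg _)) G1 G2 (B1H_nf j Bx)).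
  move=> sj; have := Sg j; rewrite /= sj eqxx => -[Ug _].
  have [n [b Hb]] := hV' (sval j); have /(unitaryP (hD' _) (hh' sj) Hb) [Eg gh] := Ug.
  have [G1 G2] := cent_psiK Hg (sval j).
  exact: (lf_act_SD Eg (psi_End (cent_Cent' Hg _)) G1 G2 gh (B1H_fix Bx sj)).
rewrite phi_jmap // -[RHS](jmap_ycoord Ggx); congr jmap.
apply: functional_extensionality_dep => j; rewrite ycoord_act //.
rewrite -[ycoord (phi x)]/(Y x) Y_trans // /trans /tr.
case: (cid (factor j)) => F /= [_ _ _ H]; apply: H; first exact: Sg.
exact: B1H_valid.
Qed.

Lemma main_inhabited :
  [/\ exists2 t : pointH -> pointH, translationH h iota nuD' h' (fun i => tau i) t
        & forall x, B1H x -> [set y | B1H y /\ jmap y = phi x] = [set t x],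
      phi @` [set x | B1H x] =
        [set L | B1G d nuD h L /\ oE_oD_lattice_function d nuD nuE iota L]
    & equivariant h beta iota nuD' psi h'
        (@neutralH _ _ _ h _ _ iota _ _ s Iplus h' kbar tau) phi].
Proof.
split; [|exact: phi_image|exact: phi_equivariant].
by exists trans; [exact: trans_translation|exact: translation_unique].
Qed.

End Main.

Theorem theorem11p3 (R : realType)
  (k : fieldType) (nu : k -> \bar R)
  (hk : local_field nu) (hodd : odd_residue_char nu)
  (D : falgType k) (d : nat) (nuD : D -> \bar R)
  (hD : central_division_algebra D) (hd : \dim {:D} = (d ^ 2)%N)
  (hnuD : extends_valuation nu nuD)
  (V : lmodType D^c) (m : nat)
  (hV : exists b : 'I_m -> V, act_basis (@ract D V) setT b)
  (rho : D -> D) (eps : D) (h : V -> V -> D)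
  (hh : hermitian_form rho eps h)
  (beta : V -> V) (hbeta : unitary_lie h beta)
  (I : finType) (E : I -> fieldExtType k) (nuE : forall i, E i -> \bar R)
  (hnuE : forall i, extends_valuation nu (@nuE i))
  (iota : forall i, E i -> V -> V) (hE : product_of_fields beta iota)
  (s : I -> I) (hs : sigma_on_index h iota s)
  (Iplus : {set I}) (hIplus : half_system s Iplus)
  (D' : forall i, falgType (E i)) (nuD' : forall i, D' i -> \bar R)
  (hD' : forall i, central_division_algebra (D' i))
  (hnuD' : forall i, extends_valuation (@nuE i) (@nuD' i))
  (V' : forall i, lmodType (D' i)^c)
  (hV' : forall i, exists n (b : 'I_n -> V' i), act_basis (@ract (D' i) (V' i)) setT b)
  (psi : forall i, (V -> V) -> (V' i -> V' i))
  (hpsi : forall i, centralizer_iso iota psi i)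
  (rho' : forall i, D' i -> D' i) (eps' : forall i, D' i)
  (h' : forall i, V' i -> V' i -> D' i)
  (hh' : forall i, s i = i -> hermitian_form (@rho' i) (eps' i) (@h' i))
  (hadj : forall i, s i = i -> form_compatible h iota psi h' i)
  (kbar : closedFieldType) (emb : {rmorphism k -> kbar})
  (hkbar : forall x : kbar, algebraicOver emb x)
  (tau : forall i, {rmorphism E i -> kbar})
  (htau : forall i c, tau i c%:A = emb c)
  (jt : forall i, (R -> set (V' i)) -> (R -> set V))
  (hjt : forall i, BL_map d nuD nuE iota nuD' psi (@jt i))
  (phi : pointH R V' s Iplus -> (R -> set V))
  (hphi : forall x, B1H nuD' h' x -> B1G d nuD h (phi x))
  (hphi_affine : affine_map nuD' h' phi)
  (hphi_CLF : CLF_map h iota nuD' psi h' phi)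
  (hphi_centre : equivariant h beta iota nuD' psi h'
                   (@centre_neutralH _ _ _ h _ _ iota _ _ s Iplus h' kbar tau) phi) :
  let j := @j_map R k D nuD V h I E iota D' V' s Iplus jt in
  [/\ exists2 t : pointH R V' s Iplus -> pointH R V' s Iplus,
        @translationH R k D V h I E iota D' nuD' V' s Iplus h' kbar tau t
        & forall x, B1H nuD' h' x ->
            [set y | B1H nuD' h' y /\ j y = phi x] = [set t x],
      phi @` [set x | B1H nuD' h' x] =
        [set L | B1G d nuD h L /\ oE_oD_lattice_function d nuD nuE iota L]
    & equivariant h beta iota nuD' psi h'
        (@neutralH _ _ _ h _ _ iota _ _ s Iplus h' kbar tau) phi].
Proof.
have [bV HbV] := hV; have [[i0 _]|noI] := pselect (exists i : I, True).
  exact: (main_inhabited hk hodd hD hnuD HbV hh hbeta hnuE hE hs hD' hnuD' hV' hpsi hjt hd hIplus hh' hadj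
    hphi hphi_affine hphi_CLF hphi_centre i0).
exact: (main_empty hk hD hnuD nuE hE psi jt tau hphi (fun i => noI (ex_intro _ i Logic.I))).
Qed.
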